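(* Let $1<p\le\infty$. Then there is a constant $C=C(p)$ such that $$\|f\|_{W^1_p}\le C\,\|f\|_{B^{1,\mathrm{dyad}}_{p,\infty}}\qquad\text{for every } f\in W^1_p(\mathbb R).$$ In particular, $W^1_p(\mathbb R)$ is a proper closed subspace of $B^{1,\mathrm{dyad}}_{p,\infty}(\mathbb R)$, and, when $1<p<\infty$, $$\|f\|_{W^1_p}\approx\|f\|_{B^{1,\mathrm{dyad}}_{p,\infty}}\approx\|f\|_{F^{1,\mathrm{dyad}}_{p,\infty}}\qquad\text{for all } f\in W^1_p(\mathbb R).$$
   Context: $W^1_p(\mathbb R)$ is the Sobolev space with norm $\|f\|_{W^1_p}=\|f\|_p+\|f'\|_p$. Let $\eta_0\in C_c^\infty(\mathbb R)$ be supported in $\{|\xi|<3/4\}$ with $\eta_0(\xi)=1$ for $|\xi|\le 1/2$. For $f\in\mathcal S'(\mathbb R)$ let $\widehat{\Delta_0f}=\eta_0\widehat f$ and $\widehat{\Delta_kf}(\xi)=(\eta_0(2^{-k}\xi)-\eta_0(2^{-k+1}\xi))\widehat f(\xi)$, $k\ge1$. The reference space of distributions is the Besov space $\mathscr B:=B^{-1}_{\infty,1}(\mathbb R)$, with norm $\sum_{k\ge0}2^{-k}\|\Delta_kf\|_\infty$. For a bounded interval $I$ and $f\in\mathscr B$ set $\langle f,\mathbf 1_I\rangle:=\sum_{k\ge0}\int_I\Delta_kf(x)\,dx$ (this series converges absolutely and defines a bounded linear functional on $\mathscr B$, extending $f\mapsto\int_If$); extend by linearity to finite linear combinations of indicator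 functions of bounded intervals. Haar system: $h=\mathbf 1_{[0,1/2)}-\mathbf 1_{[1/2,1)}$, $h_{j,\mu}(x)=h(2^jx-\mu)$ for $j\ge0$, $\mu\in\mathbb Z$, and $h_{-1,\mu}=\mathbf 1_{[\mu,\mu+1)}$. Also $I_{j,\mu}=[2^{-j}\mu,2^{-j}(\mu+1))$ for $j\ge0$ and, by convention, $I_{-1,\mu}=[\mu,\mu+1)$. Dyadic spaces: $B^{1,\mathrm{dyad}}_{p,\infty}$ is the set of $f\in\mathscr B$ with finite norm $$\|f\|_{B^{1,\mathrm{dyad}}_{p,\infty}}=\sup_{j\ge-1}2^{j(1-1/p)}\Big(\sum_{\mu\in\mathbb Z}|2^j\langle f,h_{j,\mu}\rangle|^p\Big)^{1/p}$$ (supremum over $\mu$ if $p=\infty$), and, for $p<\infty$, $F^{1,\mathrm{dyad}}_{p,\infty}$ is the set of $f\in\mathscr B$ with finite norm $$\|f\|_{F^{1,\mathrm{dyad}}_{p,\infty}}=\Big\|\sup_{j\ge-1}2^{j}\Big|\sum_{\mu\in\mathbb Z}2^j\langle f,h_{j,\mu}\rangle\mathbf 1_{I_{j,\mu}}\Big|\,\Big\|_p .$$ *)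

(* Defs.v *)
From HB Require Import structures.
From mathcomp Require Import all_boot all_order all_algebra.
From mathcomp Require Import all_classical all_reals all_analysis.
From mathcomp Require Import complex.
From mathcomp Require Import lra.

Set Implicit Arguments.
Unset Strict Implicit.
Unset Printing Implicit Defensive.

Import Order.TTheory GRing.Theory Num.Theory.
Import numFieldTopology.Exports numFieldNormedType.Exports.

Local Open Scope classical_set_scope.
Local Open Scope ring_scope.
Local Open Scope complex_scope.

Section ComplexFunctions.
Context {R : realType}.
Implicit Types (g phi : R -> R[i]) (D : set R) (p : \bar R).

Definition cmod (z : R[i]) : R := Normc.normc z.

Definition reF g : R -> R := fun x => complex.Re (g x).
Definition imF g : R -> R := fun x => complex.Im (g x).

Definition cmeasurable g : Prop :=
  measurable_fun setT (reF g) /\ measurable_fun setT (imF g).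

Definition cintegral D g : R[i] :=
  Rintegral lebesgue_measure D (reF g) +i* Rintegral lebesgue_measure D (imF g).

Definition cderiv (n : nat) phi : R -> R[i] :=
  fun x => derive1n n (reF phi) x +i* derive1n n (imF phi) x.

Definition csmooth phi : Prop :=
  forall n x, derivable (derive1n n (reF phi)) x 1 /\
              derivable (derive1n n (imF phi)) x 1.

Definition cseries_sum (u : nat -> R[i]) : R[i] :=
  limn (series (fun k => complex.Re (u k))) +i*
  limn (series (fun k => complex.Im (u k))).

Definition Lpnorm p g : \bar R := Lnorm lebesgue_measure p (fun x => (cmod (g x))%:E).

(** The Fourier transform is normalised as [int phi(x) e^{-2 pi i x xi} dx]. *)
Definition cexpi (t : R) : R[i] := cos t +i* sin t.

Definition fourier phi : R -> R[i] :=
  fun xi => cintegral setT (fun x => phi x * cexpi (- (2 * pi * x * xi))).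

Definition ifourier phi : R -> R[i] :=
  fun x => cintegral setT (fun xi => phi xi * cexpi (2 * pi * x * xi)).

End ComplexFunctions.

Section Distributions.
Context {R : realType}.
Implicit Types (g phi psi m : R -> R[i]) (p : \bar R).

Definition schwartz_seminorm (a b : nat) phi : \bar R :=
  ereal_sup (range (fun x : R => (`|x| ^+ a * cmod (cderiv b phi x))%:E)).

Definition schwartz phi : Prop :=
  csmooth phi /\ forall a b, (schwartz_seminorm a b phi < +oo)%E.

(** A distribution is represented by a functional on all functions which is
    set to 0 outside the Schwartz space, so that Leibniz equality is equality
    in the space of tempered distributions. *)
Definition functional : Type := (R -> R[i]) -> R[i].
Implicit Types T : functional.

Definition on_schwartz T : functional :=
  fun phi => if `[< schwartz phi >] then T phi else 0.

Definition tempered : set functional := [set T |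
  [/\ on_schwartz T = T,
      forall (a : R[i]) phi psi, schwartz phi -> schwartz psi ->
        T (fun x => a * phi x + psi x) = a * T phi + T psi &
      exists (M : R) (N : nat), forall phi, schwartz phi ->
        ((cmod (T phi))%:E <=
         M%:E * \sum_(a < N) \sum_(b < N) schwartz_seminorm a b phi)%E]].

Definition dist_of_fun g : functional :=
  on_schwartz (fun phi => cintegral setT (fun x => g x * phi x)).

Definition dist_deriv T : functional :=
  on_schwartz (fun phi => - T (cderiv 1 phi)).

Definition dist_fourier T : functional :=
  on_schwartz (fun phi => T (fourier phi)).

Definition dist_ifourier T : functional :=
  on_schwartz (fun phi => T (ifourier phi)).

Definition dist_mul m T : functional :=
  on_schwartz (fun phi => T (fun x => m x * phi x)).

(** All the functions representing [T] agree almost everywhere; the value is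
    [+oo] when [T] is not given by an L^p function. *)
Definition dist_Lpnorm p T : \bar R :=
  ereal_inf [set Lpnorm p g | g in [set g | cmeasurable g /\ T = dist_of_fun g]].

(** A bounded function representing [T], if there is one. *)
Definition bounded_density T : R -> R[i] :=
  xget (fun=> 0) [set g | [/\ cmeasurable g, (Lpnorm +oo g < +oo)%E & T = dist_of_fun g]].

(** The weak derivative is the distributional one. *)
Definition W1norm p T : \bar R := (dist_Lpnorm p T + dist_Lpnorm p (dist_deriv T))%E.

Definition W1 p : set functional := [set T | tempered T /\
  (dist_Lpnorm p T < +oo)%E /\ (dist_Lpnorm p (dist_deriv T) < +oo)%E].

End Distributions.
Arguments functional : clear implicits.

Section ReferenceSpace.
Context {R : realType}.
Implicit Types (eta : R -> R[i]) (f : functional R).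

Definition lp_cutoff eta : Prop :=
  [/\ csmooth eta,
      closure [set xi | eta xi != 0] `<=` [set xi | `|xi| < 3 / 4] &
      forall xi, `|xi| <= 1 / 2 -> eta xi = 1].

Definition lp_multiplier eta (k : nat) : R -> R[i] :=
  match k with
  | 0%N => eta
  | k'.+1 => fun xi => eta (2 ^- k'.+1 * xi) - eta (2 ^- k' * xi)
  end.

Definition lp_block eta (k : nat) f : functional R :=
  dist_ifourier (dist_mul (lp_multiplier eta k) (dist_fourier f)).

(** [lp_block eta k] is the k-th Littlewood-Paley operator; [refBnorm] is the
    norm of the Besov space [B^{-1}_{oo,1}]. *)
Definition refBnorm eta f : \bar R :=
  (\sum_(0 <= k <oo) (2 ^- k)%:E * dist_Lpnorm +oo (lp_block eta k f))%E.

Definition refB eta : set (functional R) :=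
  [set f | tempered f /\ (refBnorm eta f < +oo)%E].

Definition pair_indic eta f (I : set R) : R[i] :=
  cseries_sum (fun k => cintegral I (bounded_density (lp_block eta k f))).

End ReferenceSpace.

Section Haar.
Context {R : realType}.
Implicit Types (eta : R -> R[i]) (f : functional R) (j mu : int).

(** Haar levels are the integers [j >= -1]: a negative [j] always stands for -1. *)
Definition dyadic_interval j mu : set R :=
  if 0 <= j then [set` `[2 ^ (- j) * mu%:~R, 2 ^ (- j) * (mu%:~R + 1)[%R]
  else [set` `[mu%:~R, mu%:~R + 1[%R].

Definition haar_mother (x : R) : R :=
  \1_(`[0, 1 / 2[) x - \1_(`[1 / 2, 1[) x.

Definition haar j mu (x : R) : R :=
  if 0 <= j then haar_mother (2 ^ j * x - mu%:~R)
  else \1_(`[mu%:~R, mu%:~R + 1[) x.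

Lemma haar_ge0E j mu x : 0 <= j ->
  haar j mu x = \1_(dyadic_interval (j + 1) (2 * mu)) x
              - \1_(dyadic_interval (j + 1) (2 * mu + 1)) x.
Proof.
move=> j0; have j10 : 0 <= j + 1 by rewrite addr_ge0.
rewrite /haar /haar_mother /dyadic_interval j0 j10 !indicE.
have c0 : 0 < (2 : R) ^ j by rewrite exprz_gt0.
have -> : (2 : R) ^ (- (j + 1)) = (2 ^ j)^-1 / 2.
  by rewrite -invr_expz expfzDr ?pnatr_eq0// invfM.
have cE (t : R) : ((2 ^ j)^-1 / 2 * t <= x) = (t / 2 <= 2 ^ j * x).
  by rewrite -mulrA -ler_pdivlMl ?invr_gt0// invrK [_ / 2]mulrC.
have cE' (t : R) : (x < (2 ^ j)^-1 / 2 * t) = (2 ^ j * x < t / 2).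
  by rewrite !ltNge cE.
rewrite !mem_setE !in_itv /= !cE !cE' !intrD !intrM.
have -> : (2 : int)%:~R = 2 :> R by [].
have -> : (1 : int)%:~R = 1 :> R by [].
set y := 2 ^ j * x; set m := mu%:~R.
have E1 : (0 <= y - m) = (2 * m / 2 <= y) by apply/idP/idP; lra.
have E2 : (y - m < 1 / 2) = (y < (2 * m + 1) / 2) by apply/idP/idP; lra.
have E3 : (1 / 2 <= y - m) = ((2 * m + 1) / 2 <= y) by apply/idP/idP; lra.
have E4 : (y - m < 1) = (y < (2 * m + 1 + 1) / 2) by apply/idP/idP; lra.
by rewrite E1 E2 E3 E4.
Qed.

Lemma haar_lt0E j mu x : j < 0 -> haar j mu x = \1_(dyadic_interval j mu) x.
Proof. by rewrite /haar /dyadic_interval ltNge => /negbTE ->. Qed.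

(** The linear extension of [pair_indic] evaluated on [haar j mu], using the
    decompositions [haar_ge0E] and [haar_lt0E]. *)
Definition haar_coef eta f j mu : R[i] :=
  if 0 <= j then pair_indic eta f (dyadic_interval (j + 1) (2 * mu))
               - pair_indic eta f (dyadic_interval (j + 1) (2 * mu + 1))
  else pair_indic eta f (dyadic_interval j mu).

End Haar.

Section DyadicSpaces.
Context {R : realType}.
Implicit Types (eta : R -> R[i]) (f : functional R) (p : \bar R).

Definition ellp p (a : int -> R) : \bar R :=
  match p with
  | q%:E => (poweR (\esum_(mu in [set: int]) (`|a mu| `^ q)%:E) q^-1)%E
  | _ => ereal_sup (range (fun mu => `|a mu|%:E))
  end.

(** [(fine p)^-1] is [1/p], including [1/oo = 0]. *)
Definition Bdyad_norm eta p f : \bar R :=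
  ereal_sup [set ((2 `^ (j%:~R * (1 - (fine p)^-1)))%:E *
                  ellp p (fun mu => cmod ((2 ^ j)%:C * haar_coef eta f j mu)%R))%E
            | j in [set j : int | -1 <= j]].

Definition Bdyad eta p : set (functional R) :=
  [set f | refB eta f /\ (Bdyad_norm eta p f < +oo)%E].

Definition Fdyad_norm eta p f : \bar R :=
  Lnorm lebesgue_measure p (fun x => ereal_sup
    [set (2 ^ j * cmod (\sum_(mu \in [set: int])
            (2 ^ j)%:C * haar_coef eta f j mu * (\1_(dyadic_interval j mu) x)%:C))%:E
    | j in [set j : int | -1 <= j]]).

End DyadicSpaces.

Section Subspaces.
Context {R : realType}.
Implicit Types (A B : set (functional R)) (N : functional R -> \bar R).

Definition linear_subspace A : Prop :=
  A (fun=> 0) /\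
  forall (a : R[i]) f g, A f -> A g -> A (fun phi => a * f phi + g phi).

Definition closed_wrt N B A : Prop :=
  forall f, B f ->
    (forall e : R, 0 < e -> exists2 g, A g & (N (g \- f)%R < e%:E)%E) -> A f.

Definition proper_closed_subspace N B A : Prop :=
  [/\ linear_subspace A, A `<` B & closed_wrt N B A].

End Subspaces.

Definition comparable_upto {R : realType} (C : R) (a b : \bar R) : Prop :=
  (a <= C%:E * b)%E /\ (b <= C%:E * a)%E.

(* Main.v *)
Require Import Defs.
From HB Require Import structures.
From mathcomp Require Import all_boot all_order all_algebra.
From mathcomp Require Import all_classical all_reals all_analysis.
From mathcomp Require Import measurable_realfun ess_sup_inf lebesgue_integral_under.
From mathcomp Require Import complex.
From mathcomp Require Import ring lra.

Set Implicit Arguments.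
Unset Strict Implicit.
Unset Printing Implicit Defensive.

Import Order.TTheory GRing.Theory Num.Theory.
Import numFieldTopology.Exports numFieldNormedType.Exports.

Local Open Scope classical_set_scope.
Local Open Scope ring_scope.

Local Open Scope complex_scope.

(** Throughout, a distribution of the reference space is compared with functions
    through its pairings with indicator functions.  A fixed smooth bump [rho] and
    its primitive [rstep] give Schwartz functions [sindr a b n] that converge to
    the indicator of [[a, b[] with total variation at most 2.  A Littlewood-Paley
    block at frequency 2^k kills everything of frequency below a fixed multiple of
    2^k, so its value on a function of bounded variation gains a factor 2^-k
    ([block_bv]), and the blocks of an element of B^{-1}_{oo,1} are summable with
    exactly this weight.  Dominated convergence for series ([tannery]) then identifies the
    pairing of F with the indicator of [[a, b[] with the limit of
    F (sindr a b n) ([pair_indic_cvg]).  There are two consequences: for a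
    function the pairing is the integral ([pair_indic_fun]), and a distribution of
    the reference space whose Haar coefficients all vanish is zero
    ([haar_unique]).

    An element of W^1_p has a representative u with u b - u a = int_a^b g, where g
    is the derivative ([du_Bois_Reymond], [W1_rep]).  Its Haar coefficient of level
    j on a dyadic interval is a difference of the integrals of u over the two
    halves, hence an average of g: after multiplication by 4^j it is bounded by the
    Hardy-Littlewood maximal function of g, and at a Lebesgue point x of g the
    coefficients of the intervals shrinking to x converge to - g x / 4
    ([Dif_formula], [Ph_cvg]).  The functions x |-> 2^j |2^j <F, h_{j,mu}>|, with mu
    the index of the interval containing x, have L^p norms whose supremum is
    equivalent to the norm of B ([nrm_val_le_B], [B_le]).

    - The lower bound ([W1_le_B]): Fatou's lemma along the convergence to - g / 4
      bounds the norm of g; then u differs from its means over unit intervals,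
      which are the coefficients of level -1, by at most twice the maximal function
      of g.
    - The upper bounds ([F_le_W1], [B_le_W1]): the strong maximal inequality, which
      is derived from the weak type inequality by a dyadic layer cake and needs
      p > 1.  The bound of B by F ([B_le_F]) compares a supremum of norms with the
      norm of a supremum.
    - Closedness ([W1_closed]): by the lower bound, a fast sequence of W^1_p
      converging in the norm of B is Cauchy in W^1_p; its limit has the same Haar
      coefficients as the limit in B, hence equals it by [haar_unique].
    - Properness: the only nonzero Haar coefficient of the indicator of [[0, 1[] has
      level -1, so its norm in B is finite; if it were in W^1_p, its derivative
      would be the limit of zero coefficients, so it would be constant. *)

(** * Schwartz functions *)

Section RealSchwartz.
Context {R : realType}.
Implicit Types (u v : R -> R) (P : (R -> R) -> Prop).

Definition derives (u v : R -> R) := forall x : R, is_derive x (1 : R) u (v x).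

Definition smoothR u := forall n x, derivable (derive1n n u) x 1.

Definition rschwartz u := smoothR u /\
  forall a b, exists M : R, forall x, `|x| ^+ a * `|derive1n b u x| <= M.

Lemma derive1Sn u n : derive1n n.+1 u = derive1n n (derive1 u).
Proof. by elim: n => [|n IH]; rewrite derive1nS ?derive1n0// IH -derive1nS. Qed.

Lemma is_derive_derive1 u u' : derives u u' -> derive1 u = u'.
Proof. by move=> h; apply/funext => x; rewrite derive1E (@derive_val _ _ _ _ _ _ _ (h x)). Qed.

(** Coinduction: a family of functions stable under differentiation consists
    of smooth functions.  It replaces explicit formulas for iterated derivatives. *)
Lemma smoothR_coind P :
  (forall u, P u -> exists u', P u' /\ derives u u') ->
  forall u, P u -> smoothR u.
Proof.
move=> H u Pu n; have : P (derive1n n u).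
  elim: n => [|n IH]; first by rewrite derive1n0.
  rewrite derive1nS; have [u' [Pu' /is_derive_derive1 ->]] := H _ IH; exact: Pu'.
by move=> /H[u' [_ h]] x; exact: (@ex_derive _ _ _ _ _ _ _ (h x)).
Qed.

Lemma smoothR_derive u : smoothR u -> smoothR (derive1 u).
Proof. by move=> su n x; rewrite -derive1Sn; exact: su. Qed.

Lemma smoothR_is_derive u : smoothR u -> derives u (derive1 u).
Proof.
move=> su x; have := su 0%N x; rewrite derive1n0 => d.
by apply: DeriveDef => //; rewrite derive1E.
Qed.

(** A family of bounded functions stable under differentiation and under
    multiplication by the variable consists of Schwartz functions, because every
    [x ^ a * u^(b)] is again in the family.  This is how transforms are shown to
    be Schwartz. *)
Lemma rschwartz_coind P :
  (forall u, P u -> [/\ exists M, forall x, `|u x| <= M,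
     exists u', P u' /\ derives u u' &
     P (fun x => x * u x)]) ->
  forall u, P u -> rschwartz u.
Proof.
move=> H u Pu; split.
  by apply: (@smoothR_coind P) => // v /H[].
move=> a b.
(* First stability under b derivatives, then under a multiplications. *)
have : P (derive1n b u).
  elim: b => [|b IH]; first by rewrite derive1n0.
  by rewrite derive1nS; have [_ [u' [Pu' /is_derive_derive1 ->]] _] := H _ IH.
set v := derive1n b u => Pv; clearbody v.
have : P (fun x => x ^+ a * v x).
  elim: a => [|a IH].
    by rewrite (_ : (fun _ => _) = v)//; apply/funext => x; rewrite expr0 mul1r.
  have [_ _] := H _ IH; congr (P _); apply/funext => x.
  by rewrite exprS mulrA.
move=> /H[[M hM] _ _]; exists M => x.
by rewrite -normrX -normrM.
Qed.

Lemma rschwartz_smooth u : rschwartz u -> smoothR u. Proof. by case. Qed.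

Lemma rschwartz_derive u : rschwartz u -> rschwartz (derive1 u).
Proof.
move=> [su h]; split; first exact: smoothR_derive.
by move=> a b; have [M hM] := h a b.+1; exists M => x; rewrite -derive1Sn.
Qed.

Lemma rschwartz_bnd u a : rschwartz u -> exists M : R, forall x, `|x| ^+ a * `|u x| <= M.
Proof. by move=> [_ /(_ a 0%N)]; rewrite derive1n0. Qed.

Lemma rschwartz_bounded u : rschwartz u -> exists M : R, forall x, `|u x| <= M.
Proof.
by move=> /(rschwartz_bnd 0)[M hM]; exists M => x; have := hM x; rewrite expr0 mul1r.
Qed.

Lemma derives_id : derives id (fun=> 1).
Proof. by move=> x; exact: is_derive_id. Qed.

Lemma derives_cst c : derives (fun=> c) (fun=> 0).
Proof. by move=> x; exact: is_derive_cst. Qed.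

Lemma derives_eq u u1 u2 : derives u u1 -> u1 =1 u2 -> derives u u2.
Proof. by move=> d /funext <-. Qed.

Lemma derivesD u v u' v' : derives u u' -> derives v v' ->
  derives (fun x => u x + v x) (fun x => u' x + v' x).
Proof. by move=> du dv x; apply: is_deriveD. Qed.

Lemma derivesM u v u' v' : derives u u' -> derives v v' ->
  derives (fun x => u x * v x) (fun x => u' x * v x + u x * v' x).
Proof.
move=> du dv x; have d := du x; have e := dv x.
have -> : (fun x => u x * v x) = (u * v) by [].
by apply: is_derive_eq; rewrite /GRing.scale/= addrC mulrC.
Qed.

Lemma derivesZ c u u' : derives u u' -> derives (fun x => c * u x) (fun x => c * u' x).
Proof.
move=> du; apply: derives_eq (derivesM (derives_cst c) du) _ => x.
by rewrite mul0r add0r.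
Qed.

Lemma derives_derive1n u n : smoothR u -> derives (derive1n n u) (derive1n n.+1 u).
Proof.
by move=> su x; apply: DeriveDef; [exact: su|rewrite derive1nS derive1E].
Qed.

Lemma derive1n_mulx u n : smoothR u ->
  derive1n n (fun x => x * u x) =
  (fun x => x * derive1n n u x + n%:R * derive1n n.-1 u x).
Proof.
move=> su; elim: n => [|n IH].
  by rewrite !derive1n0; apply/funext => x; rewrite mul0r addr0.
rewrite derive1nS IH; apply: is_derive_derive1.
apply: derives_eq.
  apply: derivesD.
    by apply: derivesM; [exact: derives_id|exact: derives_derive1n].
  by apply: derivesZ; exact: derives_derive1n.
move=> x /=; rewrite mul1r; case: n IH => [|n] IH /=.
  by rewrite mul0r addr0 mul1r addrC.
by rewrite addrC addrA [in RHS]addrC -[n.+2%:R]natr1 mulrDl mul1r.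
Qed.

Lemma rschwartz_mulx u : rschwartz u -> rschwartz (fun x => x * u x).
Proof.
move=> [su h]; split.
  move=> n x; rewrite derive1n_mulx//.
  by apply: derivableD; apply: derivableM => //; exact: su.
move=> a b; have [M hM] := h a.+1 b; have [N hN] := h a b.-1.
exists (M + b%:R * N) => x; rewrite derive1n_mulx//.
apply: (@le_trans _ _ (`|x| ^+ a * (`|x| * `|derive1n b u x| + b%:R * `|derive1n b.-1 u x|))).
  rewrite ler_wpM2l ?exprn_ge0// (le_trans (ler_normD _ _))// !normrM.
  by rewrite [`|b%:R|]ger0_norm.
rewrite mulrDr mulrA -exprSr lerD// mulrCA ler_wpM2l//.
Qed.

Lemma rschwartz0 : rschwartz (cst 0).
Proof.
apply: (@rschwartz_coind (fun w => w = cst 0)) => // w ->; split.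
- by exists 0 => x; rewrite normr0.
- by exists (cst 0); split => // x; exact: is_derive_cst.
- by apply/funext => x; rewrite /= mulr0.
Qed.

Lemma rschwartzD u v : rschwartz u -> rschwartz v -> rschwartz (fun x => u x + v x).
Proof.
move=> su sv.
apply: (@rschwartz_coind (fun w => exists u v, [/\ rschwartz u, rschwartz v & w = (fun x => u x + v x)])); last by exists u, v.
move=> _ [{su sv}u [{}v [su sv ->]]]; split.
- have [M hM] := rschwartz_bounded su; have [N hN] := rschwartz_bounded sv.
  by exists (M + N) => x; rewrite (le_trans (ler_normD _ _))// lerD.
- exists (fun x => derive1 u x + derive1 v x); split.
    by exists (derive1 u), (derive1 v); split => //; exact: rschwartz_derive.
  move=> x; apply: is_deriveD; apply: smoothR_is_derive; exact: rschwartz_smooth.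
- exists (fun x => x * u x), (fun x => x * v x); split; [exact: rschwartz_mulx|exact: rschwartz_mulx|].
  by apply/funext => x; rewrite mulrDr.
Qed.

Lemma rschwartzZ c u : rschwartz u -> rschwartz (fun x => c * u x).
Proof.
move=> su.
apply: (@rschwartz_coind (fun w => exists u, rschwartz u /\ w = (fun x => c * u x))); last by exists u.
move=> _ [{su}u [su ->]]; split.
- have [M hM] := rschwartz_bounded su.
  by exists (`|c| * M) => x; rewrite normrM ler_wpM2l.
- exists (fun x => c * derive1 u x); split.
    by exists (derive1 u); split => //; exact: rschwartz_derive.
  move=> x; have d := smoothR_is_derive (rschwartz_smooth su) x.
  have -> : (fun x => c * u x) = (c *: u) by [].
  exact: is_deriveZ.
- exists (fun x => x * u x); split; first exact: rschwartz_mulx.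
  by apply/funext => x; rewrite mulrCA.
Qed.

Lemma rschwartzB u v : rschwartz u -> rschwartz v -> rschwartz (fun x => u x - v x).
Proof.
move=> su sv; have := rschwartzD su (rschwartzZ (-1) sv); congr rschwartz.
by apply/funext => x; rewrite mulN1r.
Qed.

Inductive prodsum : (R -> R) -> Prop :=
| Prodsum_prod u v of rschwartz u & rschwartz v : prodsum (fun x => u x * v x)
| Prodsum_add u v of prodsum u & prodsum v : prodsum (fun x => u x + v x).

Lemma rschwartzM u v : rschwartz u -> rschwartz v -> rschwartz (fun x => u x * v x).
Proof.
move=> su sv; apply: (@rschwartz_coind prodsum); last exact: Prodsum_prod.
move=> w; elim => [{su sv}u {}v su sv|{su sv}u {}v _ [[M hM] [u' [pu' du]] pu] _ [[N hN] [v' [pv' dv]] pv]]; split.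
- have [M hM] := rschwartz_bounded su; have [N hN] := rschwartz_bounded sv.
  by exists (M * N) => x; rewrite normrM ler_pM.
- exists (fun x => derive1 u x * v x + u x * derive1 v x); split.
    by apply: Prodsum_add; apply: Prodsum_prod => //; exact: rschwartz_derive.
  move=> x; have d := smoothR_is_derive (rschwartz_smooth su) x.
  have e := smoothR_is_derive (rschwartz_smooth sv) x.
  have -> : (fun x => u x * v x) = (u * v) by [].
  by apply: is_derive_eq; rewrite /GRing.scale/= addrC mulrC.
- have := Prodsum_prod (rschwartz_mulx su) sv; congr prodsum.
  by apply/funext => x; rewrite mulrA.
- by exists (M + N) => x; rewrite (le_trans (ler_normD _ _))// lerD.
- exists (fun x => u' x + v' x); split; first exact: Prodsum_add.
  by move=> x; apply: is_deriveD.
- have := Prodsum_add pu pv; congr prodsum.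
  by apply/funext => x; rewrite mulrDr.
Qed.

Lemma is_derive_affine u u' (a c : R) : derives u u' ->
  derives (fun x => u (a * x + c)) (fun x => a * u' (a * x + c)).
Proof.
move=> du x.
have d := du (a * x + c).
have d1 : is_derive x 1 (fun x : R => a * x + c) a.
  have -> : (fun x : R => a * x + c) = (a *: (id : R -> R) + cst c) by [].
  by apply: is_derive_eq; rewrite addr0 /GRing.scale/= mulr1.
by have := @is_derive1_comp _ u (fun x : R => a * x + c) _ _ _ d d1; rewrite mulrC.
Qed.

Lemma rschwartz_affine u (a c : R) : a != 0 -> rschwartz u -> rschwartz (fun x => u (a * x + c)).
Proof.
move=> a0 su.
apply: (@rschwartz_coind (fun w => exists u, rschwartz u /\ w = (fun x => u (a * x + c)))); last by exists u.
move=> _ [{su}u [su ->]]; split.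
- by have [M hM] := rschwartz_bounded su; exists M.
- exists (fun x => a * derive1 u (a * x + c)); split.
    exists (fun x => a * derive1 u x); split => //; apply: rschwartzZ; exact: rschwartz_derive.
  by apply: is_derive_affine; apply: smoothR_is_derive; exact: rschwartz_smooth.
- exists (fun x => a^-1 * (x * u x - c * u x)); split.
    by apply: rschwartzZ; apply: rschwartzB; [exact: rschwartz_mulx|exact: rschwartzZ].
  apply/funext => x; rewrite -mulrBl addrK mulrA; congr (_ * _).
  by rewrite mulrA mulVf// mul1r.
Qed.

(** Differentiation does not enlarge the support: the complement is open. *)
Lemma derive1_out u u' (A : R) : derives u u' ->
  (forall x, A < `|x| -> u x = 0) -> forall x, A < `|x| -> u' x = 0.
Proof.
move=> du h x Ax.
have d := du x.
rewrite -(@derive_val _ _ _ _ _ _ _ d).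
have <- : 'D_(1 : R) (cst (0 : R)) x = 0 by rewrite derive_cst.
apply: near_eq_derive.
have : \forall y \near x, A < `|y|.
  have c : {for x, continuous (fun y : R => `|y|)} by exact: norm_continuous.
  exact: (cvgr_gt _ c).
by apply: filterS => y /h ->.
Qed.

Lemma is_derive_continuous u u' : derives u u' -> continuous u.
Proof.
move=> du x; apply/differentiable_continuous/derivable1_diffP.
exact: (@ex_derive _ _ _ _ _ _ _ (du x)).
Qed.

Lemma smoothR_continuous u : smoothR u -> continuous u.
Proof. by move=> su; exact: (is_derive_continuous (smoothR_is_derive su)). Qed.

Lemma rschwartz_continuous u : rschwartz u -> continuous u.
Proof. by move=> [su _]; exact: smoothR_continuous. Qed.

Lemma continuous_supp_bounded u (A : R) : continuous u ->
  (forall x, A < `|x| -> u x = 0) -> exists M, forall x, `|u x| <= M.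
Proof.
move=> cu h.
have [A0|A0] := ltP A 0.
  by exists 0 => x; rewrite h ?normr0// (lt_le_trans A0).
have : compact (u @` `[-A, A]).
  apply: continuous_compact; last exact: segment_compact.
  exact: continuous_subspaceT.
move=> /compact_bounded[M [_ /(_ (M + 1))]].
rewrite ltrDl ltr01 => /(_ isT) hM.
exists (Num.max (M + 1) 0) => x.
have [Ax|Ax] := ltP A `|x|; first by rewrite h// normr0 le_max lexx orbT.
rewrite le_max (hM (u x))//; exists x => //=.
by rewrite in_itv/= -ler_norml.
Qed.

(** Such a function and its derivatives are continuous with compact support,
    and so is any product with the variable: the coinduction principle applies. *)
Lemma smooth_supp_rschwartz u (A : R) : smoothR u ->
  (forall x, A < `|x| -> u x = 0) -> rschwartz u.
Proof.
move=> su h.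
split=> // a b.
have cs : forall x, A < `|x| -> derive1n b u x = 0.
  elim: b => [|b IH]; first by rewrite derive1n0.
  rewrite derive1nS; apply: derive1_out IH => x.
  by apply: DeriveDef; [exact: su|rewrite derive1E].
have c : continuous (fun x : R => x ^+ a * derive1n b u x).
  move=> x; apply: (@continuousM R R (fun x => x ^+ a) (derive1n b u)).
    exact: exprn_continuous.
  by apply: is_derive_continuous; exact: derives_derive1n.
have [|M hM] := continuous_supp_bounded (A := A) c.
  by move=> x /cs ->; rewrite mulr0.
by exists M => x; rewrite -normrX -normrM.
Qed.

End RealSchwartz.

Section ComplexSchwartz.
Context {R : realType}.
Implicit Types (phi psi : R -> R[i]).

Lemma cmod_le (z : R[i]) : cmod z <= `|complex.Re z| + `|complex.Im z|.
Proof.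
case: z => a b; rewrite /cmod/= -[leRHS]ger0_norm; last by rewrite addr_ge0.
rewrite -sqrtr_sqr ler_wsqrtr// sqrrD !real_normK ?num_real//.
by rewrite lerD2r lerDl mulrn_wge0// mulr_ge0.
Qed.

Lemma Re_le_cmod (z : R[i]) : `|complex.Re z| <= cmod z.
Proof.
by case: z => a b; rewrite /cmod/= -sqrtr_sqr ler_wsqrtr// lerDl sqr_ge0.
Qed.

Lemma Im_le_cmod (z : R[i]) : `|complex.Im z| <= cmod z.
Proof.
by case: z => a b; rewrite /cmod/= -sqrtr_sqr ler_wsqrtr// lerDr sqr_ge0.
Qed.

(** The seminorms of a complex function are equivalent to those of its real and
    imaginary parts, so all analysis can be done on real functions. *)
Lemma schwartzP phi : schwartz phi <-> rschwartz (reF phi) /\ rschwartz (imF phi).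
Proof.
split.
  move=> [cs h].
  have g a b : exists M, forall x : R, `|x| ^+ a * cmod (cderiv b phi x) <= M.
    have h' := h a b.
    have gx (x : R) : ((`|x| ^+ a * cmod (cderiv b phi x))%:E <= schwartz_seminorm a b phi)%E.
      by apply: ereal_sup_ubound; exists x.
    have fs : schwartz_seminorm a b phi \is a fin_num.
      rewrite fin_numE (lt_eqF h') andbT; apply/negP => /eqP e.
      by have := gx 0; rewrite e leeNy_eq.
    by exists (fine (schwartz_seminorm a b phi)) => x; rewrite -lee_fin fineK.
  split; split; try (by move=> n x; have [] := cs n x); move=> a b;
    have [M hM] := g a b; exists M => x; apply: le_trans (hM x);
    rewrite ler_wpM2l ?exprn_ge0//.
  - exact: (Re_le_cmod (cderiv b phi x)).
  - exact: (Im_le_cmod (cderiv b phi x)).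
move=> [[s1 h1] [s2 h2]]; split; first by move=> n x.
move=> a b; have [M hM] := h1 a b; have [N hN] := h2 a b.
apply: (@le_lt_trans _ _ (M + N)%:E); last exact: ltry.
apply: ge_ereal_sup => _ [x _ <-]; rewrite lee_fin.
apply: le_trans (lerD (hM x) (hN x)); rewrite -mulrDr ler_wpM2l ?exprn_ge0//.
exact: (cmod_le (cderiv b phi x)).
Qed.

End ComplexSchwartz.

(** * Integration on the line *)

Section Affine.
Context {R : realType}.
Notation mu := (@lebesgue_measure R).

Variables (a b : R).
Hypothesis a0 : a != 0.
Variable phi : measurableTypeR R -> measurableTypeR R.
Hypothesis mphi : measurable_fun setT phi.
Hypothesis phiE : phi = (fun x => a * x + b).

Let nu : {measure set (measurableTypeR R) -> \bar R} :=
  @measure_function_pushforward__canonical__measure_function_Measure _ _ _ _ _ mu _ mphi.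

Let affine_measure : forall A, measurable A -> mu A = mscale (NngNum (normr_ge0 a)) nu A.
Proof.
apply: lebesgue_measure_unique => X /ocitvP[->|[[c d]/= cd ->]].
  by rewrite !measure0.
rewrite lebesgue_measure_itv/= lte_fin cd -EFinD.
rewrite -[RHS]/(`|a|%:E * mu (phi @^-1` `]c, d]))%E.
have [a_gt0|a_lt0|] := ltgtP a 0; last by move/eqP; rewrite (negbTE a0).
- have -> : (phi @^-1` `]c, d])%classic = `[(d - b) / a, (c - b) / a[%classic.
    apply/seteqP; split=> x /=; rewrite !in_itv/= phiE => /andP[h1 h2].
      by rewrite ler_ndivrMr// ltr_ndivlMr// (mulrC x) lerBrDr h2 ltrBlDr.
    move: h1 h2; rewrite ler_ndivrMr// ltr_ndivlMr// (mulrC x) lerBrDr ltrBlDr => -> ->//.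
  have -> : mu `[(d - b) / a, (c - b) / a[ = ((c - b) / a - (d - b) / a)%:E.
    by rewrite lebesgue_measure_itv/= lte_fin ltr_ndivrMr// divfK ?lt_eqF// ltrD2r cd.
  rewrite -EFinM -mulrBl ltr0_norm//; congr (_%:E).
  by field.
- have -> : (phi @^-1` `]c, d])%classic = `](c - b) / a, (d - b) / a]%classic.
    apply/seteqP; split=> x /=; rewrite !in_itv/= phiE => /andP[h1 h2].
      by rewrite ltr_pdivrMr// ler_pdivlMr// (mulrC x) ltrBlDr h1 lerBrDr.
    move: h1 h2; rewrite ltr_pdivrMr// ler_pdivlMr// (mulrC x) ltrBlDr lerBrDr => -> ->//.
  have -> : mu `](c - b) / a, (d - b) / a] = ((d - b) / a - (c - b) / a)%:E.
    by rewrite lebesgue_measure_itv/= lte_fin ltr_pdivrMr// divfK ?gt_eqF// ltrD2r cd.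
  rewrite -EFinM -mulrBl gtr0_norm//; congr (_%:E).
  by field.
Qed.

Lemma ge0_integral_affine_subproof (f : R -> \bar R) :
  measurable_fun setT f -> (forall x, 0 <= f x)%E ->
  (\int[mu]_x f (a * x + b)%R = (`|a|^-1)%:E * \int[mu]_x f x)%E.
Proof.
move=> mf f0.
have e : (\int[mu]_x f x = `|a|%:E * \int[mu]_x f (a * x + b)%R)%E.
  rewrite (eq_measure_integral (mscale (NngNum (normr_ge0 a)) nu)); last first.
    by move=> A mA _; exact: affine_measure.
  rewrite ge0_integral_mscale//; congr (_ * _)%E.
  by rewrite ge0_integral_pushforward//=; apply: eq_integral => x _; rewrite /= phiE.
by rewrite e muleA -EFinM mulVf ?normr_eq0// mul1e.
Qed.

End Affine.

(** Lebesgue measure and its rescaled image under an affine map agree on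
    intervals, hence everywhere. *)
Lemma ge0_integral_affine {R : realType} (a b : R) (f : R -> \bar R) : a != 0 ->
  measurable_fun setT f -> (forall x, 0 <= f x)%E ->
  (\int[lebesgue_measure]_x f (a * x + b)%R = (`|a|^-1)%:E * \int[lebesgue_measure]_x f x)%E.
Proof.
move=> a0; apply: (@ge0_integral_affine_subproof _ a b a0 (fun x => a * x + b)) => //.
by apply: measurable_funD => //; apply: measurable_funM.
Qed.

Section RealIntegral.
Context {R : realType}.
Notation mu := (@lebesgue_measure R).
Implicit Types (f g u v : R -> R).

Definition meas f := measurable_fun (setT : set R) f.
Definition integ f := mu.-integrable setT (EFin \o f).
Definition intR f : R := Rintegral mu setT f.

Lemma integ_meas f : integ f -> meas f.
Proof. by move=> /integrableP[/measurable_EFinP]. Qed.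

Lemma intRE f : integ f -> (\int[mu]_x (f x)%:E = (intR f)%:E)%E.
Proof. by move=> If; rewrite /intR /Rintegral fineK//; exact: integrable_fin_num. Qed.

Lemma integP f : meas f -> (\int[mu]_x `|f x|%:E < +oo)%E -> integ f.
Proof.
move=> mf h; apply/integrableP; split; first exact/measurable_EFinP.
by [].
Qed.

Lemma integ_lty f : integ f -> (\int[mu]_x `|f x|%:E < +oo)%E.
Proof. by move=> /integrableP[]. Qed.

Lemma integ_dom f g : meas f -> integ g -> (forall x, `|f x| <= g x) -> integ f.
Proof.
move=> mf Ig h; apply: le_integrable Ig => //; first exact/measurable_EFinP.
by move=> x _ /=; rewrite lee_fin (le_trans (h x))// ler_norm.
Qed.

Lemma integD f g : integ f -> integ g -> integ (fun x => f x + g x).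
Proof. by move=> If Ig; have := integrableD (@measurableT _ (measurableTypeR R)) If Ig. Qed.

Lemma integZ c f : integ f -> integ (fun x => c * f x).
Proof. by move=> If; have := integrableZl (@measurableT _ (measurableTypeR R)) c If. Qed.

Lemma integB f g : integ f -> integ g -> integ (fun x => f x - g x).
Proof. by move=> If Ig; have := integrableB (@measurableT _ (measurableTypeR R)) If Ig. Qed.

Lemma integ0 : integ (fun=> 0).
Proof. exact: integrable0. Qed.

Lemma integ_norm f : integ f -> integ (fun x => `|f x|).
Proof. by move=> If; exact: (integrable_norm If). Qed.

Lemma intRD f g : integ f -> integ g -> intR (fun x => f x + g x) = intR f + intR g.
Proof. by move=> If Ig; rewrite /intR RintegralD. Qed.

Lemma intRB f g : integ f -> integ g -> intR (fun x => f x - g x) = intR f - intR g.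
Proof. by move=> If Ig; rewrite /intR RintegralB. Qed.

Lemma intRZ c f : integ f -> intR (fun x => c * f x) = c * intR f.
Proof. by move=> If; rewrite /intR RintegralZl. Qed.

Lemma intRN f : integ f -> intR (fun x => - f x) = - intR f.
Proof.
move=> If; rewrite -mulN1r -intRZ//; congr intR.
by apply/funext => x; rewrite mulN1r.
Qed.

Lemma intR_cst0 : intR (fun=> 0) = 0.
Proof. by rewrite /intR /Rintegral integral0. Qed.

Lemma le_intR f g : integ f -> integ g -> (forall x, f x <= g x) -> intR f <= intR g.
Proof. by move=> If Ig h; apply: le_Rintegral. Qed.

Lemma intR_ge0 f : (forall x, 0 <= f x) -> 0 <= intR f.
Proof. by move=> h; apply: Rintegral_ge0. Qed.

Lemma le_norm_intR f : integ f -> `|intR f| <= intR (fun x => `|f x|).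
Proof. by move=> If; apply: le_normr_Rintegral. Qed.

Lemma norm_intR_le f g : integ f -> integ g -> (forall x, `|f x| <= g x) -> `|intR f| <= intR g.
Proof.
move=> If Ig h; apply: le_trans (le_norm_intR If) _.
by apply: le_intR => //; exact: integ_norm.
Qed.

Lemma meas_continuous f : continuous f -> meas f.
Proof. exact: continuous_measurable_fun. Qed.

Lemma meas_affine (a b : R) : meas (fun x => a * x + b).
Proof. by apply: measurable_funD => //; apply: measurable_funM. Qed.

Lemma meas_comp_affine f (a b : R) : meas f -> meas (fun x => f (a * x + b)).
Proof. by move=> mf; apply: (measurableT_comp mf); exact: meas_affine. Qed.

Lemma integ_affine f (a b : R) : a != 0 -> integ f -> integ (fun x => f (a * x + b)).
Proof.
move=> a0 If; have mf := integ_meas If; apply: integP.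
  exact: meas_comp_affine.
rewrite (@ge0_integral_affine _ a b (fun x => `|f x|%:E))//; last first.
  apply/measurable_EFinP; exact: (measurableT_comp (@normr_measurable R setT) mf).
by rewrite lte_mul_pinfty//; exact: integ_lty.
Qed.

Lemma intR_affine f (a b : R) : a != 0 -> integ f ->
  intR (fun x => f (a * x + b)) = `|a|^-1 * intR f.
Proof.
move=> a0 If.
have ge0 g : integ g -> (forall x, 0 <= g x) ->
    intR (fun x => g (a * x + b)) = `|a|^-1 * intR g.
  move=> Ig g0; apply: EFin_inj; rewrite -intRE; last exact: integ_affine.
  rewrite (@ge0_integral_affine _ a b (fun x => (g x)%:E))//; last first.
    by apply/measurable_EFinP; exact: (integ_meas Ig).
  by rewrite intRE// EFinM.
pose p x := (`|f x| + f x) / 2; pose n x := (`|f x| - f x) / 2.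
have Ip : integ p.
  have := integZ 2^-1 (integD (integ_norm If) If); congr integ.
  by apply/funext => x; rewrite mulrC.
have In : integ n.
  have := integZ 2^-1 (integB (integ_norm If) If); congr integ.
  by apply/funext => x; rewrite mulrC.
have p0 x : 0 <= p x by rewrite divr_ge0// -lerBlDr sub0r -normrN ler_norm.
have n0 x : 0 <= n x by rewrite divr_ge0// subr_ge0 ler_norm.
have -> : f = (fun x => p x - n x).
  by apply/funext => x; rewrite /p /n; field.
rewrite (intRB Ip In) mulrBr -!ge0//.
by rewrite -intRB//; exact: integ_affine.
Qed.

Lemma integ_shift f b : integ f -> integ (fun x => f (x + b)).
Proof.
move=> If; have := @integ_affine f 1 b (oner_neq0 _) If; congr integ.
by apply/funext => x; rewrite mul1r.
Qed.

Lemma intR_shift f b : integ f -> intR (fun x => f (x + b)) = intR f.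
Proof.
move=> If; have := @intR_affine f 1 b (oner_neq0 _) If.
rewrite normr1 invr1 mul1r => <-; congr intR.
by apply/funext => x; rewrite mul1r.
Qed.

Lemma intR_reflect f b : integ f -> intR (fun x => f (b - x)) = intR f.
Proof.
move=> If; have m1 : (-1 : R) != 0 by rewrite oppr_eq0 oner_eq0.
have := @intR_affine f (-1) b m1 If.
rewrite normrN normr1 invr1 mul1r => <-; congr intR.
by apply/funext => x; rewrite mulN1r addrC.
Qed.

Lemma intR_odd f : integ f -> (forall x, f (- x) = - f x) -> intR f = 0.
Proof.
move=> If h; have := intR_reflect 0 If.
have -> : (fun x => f (0 - x)) = (fun x => - f x).
  by apply/funext => x; rewrite sub0r h.
rewrite intRN// => /eqP; rewrite -subr_eq0 -opprD oppr_eq0 -mulr2n.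
by rewrite -mulr_natl mulf_eq0 pnatr_eq0/= => /eqP.
Qed.

Lemma aeS (P Q : R -> Prop) : (forall x, P x -> Q x) ->
  {ae mu, forall x, P x} -> {ae mu, forall x, Q x}.
Proof. by move=> h; apply: filterS; first exact: (ae_filter_ringOfSetsType mu). Qed.

Lemma aeI (P Q : R -> Prop) : {ae mu, forall x, P x} -> {ae mu, forall x, Q x} ->
  {ae mu, forall x, P x /\ Q x}.
Proof. by move=> h k; apply: filterI; first exact: (ae_filter_ringOfSetsType mu). Qed.

Lemma dct (f_ : nat -> R -> R) f g : (forall n, meas (f_ n)) -> meas f -> integ g ->
  {ae mu, forall x, f_ n x @[n --> \oo] --> f x} ->
  (forall n x, `|f_ n x| <= g x) ->
  integ f /\ (intR (f_ n) @[n --> \oo] --> intR f).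
Proof.
move=> mf_ mf Ig cv h.
have [||||If _ c] := @dominated_convergence _ _ _ mu setT measurableT
   (fun n x => (f_ n x)%:E) (EFin \o f) (EFin \o g) _ _ _ Ig _.
- by move=> n; apply/measurable_EFinP; exact: (mf_ n).
- by apply/measurable_EFinP; exact: mf.
- move: cv; apply: aeS => x cv _.
  by apply: cvg_EFin => //; exact: nearW.
- by apply/aeW => x n _; rewrite lee_fin.
split => //.
apply: fine_cvg.
have -> : (fine (\int[mu]_x (EFin \o f) x))%:E = (\int[mu]_x (f x)%:E)%E.
  by rewrite fineK//; exact: integrable_fin_num.
exact: c.
Qed.

Lemma dct_all (f_ : nat -> R -> R) f g : (forall n, meas (f_ n)) -> integ g ->
  (forall x, f_ n x @[n --> \oo] --> f x) ->
  (forall n x, `|f_ n x| <= g x) ->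
  integ f /\ (intR (f_ n) @[n --> \oo] --> intR f).
Proof.
move=> mf_ Ig cv h; apply: (dct mf_ _ Ig _ h); last exact: aeW.
by apply: (@measurable_fun_cvg _ _ _ setT f_) => // x _; exact: cv.
Qed.

Lemma measM f g : meas f -> meas g -> meas (fun x => f x * g x).
Proof. exact: measurable_funM. Qed.

Lemma measD f g : meas f -> meas g -> meas (fun x => f x + g x).
Proof. exact: measurable_funD. Qed.

Lemma measB f g : meas f -> meas g -> meas (fun x => f x - g x).
Proof. exact: measurable_funB. Qed.

Lemma meas_cst c : meas (fun=> c).
Proof. exact: measurable_cst. Qed.

Lemma measZ c f : meas f -> meas (fun x => c * f x).
Proof. exact: measM (meas_cst c). Qed.

Lemma meas_norm f : meas f -> meas (fun x => `|f x|).
Proof. exact: (measurableT_comp (@normr_measurable R setT)). Qed.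

Lemma integM_bounded f g M : integ f -> meas g -> (forall x, `|g x| <= M) ->
  integ (fun x => g x * f x).
Proof.
move=> If mg h; apply: (integ_dom (g := fun x => M * `|f x|)).
- by apply: measM => //; exact: integ_meas.
- exact: integZ (integ_norm If).
- by move=> x; rewrite normrM ler_wpM2r.
Qed.

Definition meas2 (F : R -> R -> R) := measurable_fun (setT : set (R * R)) (fun z => F z.1 z.2).

Lemma meas2_1 f : meas f -> meas2 (fun x _ => f x).
Proof. by move=> mf; apply: (measurableT_comp mf); exact: measurable_fst. Qed.

Lemma meas2_2 f : meas f -> meas2 (fun _ y => f y).
Proof. by move=> mf; apply: (measurableT_comp mf); exact: measurable_snd. Qed.

Lemma meas2M F G : meas2 F -> meas2 G -> meas2 (fun x y => F x y * G x y).
Proof. exact: measurable_funM. Qed.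

Lemma meas2D F G : meas2 F -> meas2 G -> meas2 (fun x y => F x y + G x y).
Proof. exact: measurable_funD. Qed.

Lemma meas2N F : meas2 F -> meas2 (fun x y => - F x y).
Proof. exact: (measurableT_comp (@oppr_measurable R setT)). Qed.

Lemma meas2_comp f F : meas f -> meas2 F -> meas2 (fun x y => f (F x y)).
Proof. by move=> mf mF; exact: (measurableT_comp mf mF). Qed.

Lemma meas2_section F x : meas2 F -> meas (F x).
Proof. by move=> mF; apply: (measurableT_comp mF (pair1_measurable x)). Qed.

Lemma meas2_swap F : meas2 F -> meas2 (fun x y => F y x).
Proof.
move=> mF; have := measurableT_comp mF (@measurable_swap _ _ R R).
by [].
Qed.

End RealIntegral.

Section Fubini.
Context {R : realType}.
Notation mu := (@lebesgue_measure R).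
Implicit Types (f g u v : R -> R).

(** Integrability on the product is obtained from a dominating function for the
    inner norms in one variable only; this is what the L^1 estimate of a
    translated function provides. *)
Lemma fubini (F : R -> R -> R) c : meas2 F -> (forall x, integ (F x)) ->
  (forall y, integ (fun x => F x y)) -> integ c ->
  (forall y, intR (fun x => `|F x y|) <= c y) ->
  [/\ integ (fun x => intR (F x)), integ (fun y => intR (fun x => F x y)) &
      intR (fun x => intR (F x)) = intR (fun y => intR (fun x => F x y))].
Proof.
move=> mF I1 I2 Ic h.
have mFE : measurable_fun setT (fun z : R * R => (F z.1 z.2)%:E).
  by apply/measurable_EFinP; exact: mF.
have IF : (mu \x mu)%E.-integrable setT (fun z : R * R => (F z.1 z.2)%:E).
  apply/(@integrable21ltyP _ _ _ _ _ mu mu _ mFE).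
  apply: (@le_lt_trans _ _ (\int[mu]_y (c y)%:E)%E); last first.
    by rewrite intRE// ltry.
  apply: ge0_le_integral => //.
  - by move=> y ?; apply: integral_ge0.
  - apply: (measurable_fun_fubini_tonelli_G (m1 := mu) (fun z : R * R => `|(F z.1 z.2)%:E|%E)) => //.
    exact: measurableT_comp.
  - by apply/measurable_EFinP; exact: (integ_meas Ic).
  - move=> y ? /=.
    rewrite (_ : (fun x => `|(F x y)%:E|%E) = (fun x => (`|F x y|)%:E))//.
    by rewrite (intRE (integ_norm (I2 y))) lee_fin.
have E1 : fubini_F mu (fun z : R * R => (F z.1 z.2)%:E) = EFin \o (fun x => intR (F x)).
  by apply/funext => x; rewrite /fubini_F/= intRE.
have E2 : fubini_G mu (fun z : R * R => (F z.1 z.2)%:E) = EFin \o (fun y => intR (fun x => F x y)).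
  by apply/funext => y; rewrite /fubini_G/= (intRE (I2 y)).
have J1 : integ (fun x => intR (F x)).
  by rewrite /integ -E1; exact: (integrable_fubini_F IF).
have J2 : integ (fun y => intR (fun x => F x y)).
  apply: (integ_dom _ Ic); last first.
    by move=> y; apply: le_trans (le_norm_intR (I2 y)) (h y).
  by apply/measurable_EFinP; rewrite -E2; exact: (measurable_fubini_G IF).
split => //; apply: EFin_inj; rewrite -!intRE//.
rewrite -[LHS]/(\int[mu]_x ((EFin \o (fun x => intR (F x))) x))%E -E1.
rewrite -[RHS]/(\int[mu]_y ((EFin \o (fun y => intR (fun x => F x y))) y))%E -E2.
exact: (Fubini IF).
Qed.

Lemma fubini_dom (F : R -> R -> R) u v : meas2 F -> integ u -> integ v ->
  (forall x y, `|F x y| <= u x * v y) ->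
  [/\ integ (fun x => intR (F x)), integ (fun y => intR (fun x => F x y)) &
      intR (fun x => intR (F x)) = intR (fun y => intR (fun x => F x y))].
Proof.
move=> mF Iu Iv h.
have I1 x : integ (F x).
  apply: (integ_dom (g := fun y => u x * v y)) => //; first exact: meas2_section.
  exact: integZ.
have I2 y : integ (fun x => F x y).
  apply: (integ_dom (g := fun x => v y * u x)).
  - exact: (meas2_section y (meas2_swap mF)).
  - exact: integZ.
  - by move=> x; rewrite mulrC.
apply: (@fubini F (fun y => intR u * v y)) => //; first exact: integZ.
move=> y; rewrite mulrC -intRZ//; apply: le_intR => //; first exact: integ_norm.
  exact: integZ.
by move=> x; rewrite mulrC.
Qed.

Lemma derives_intR (f f' : R -> R -> R) G : (forall x, integ (f x)) ->
  (forall y, derives (fun x => f x y) (fun x => f' x y)) ->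
  (forall x y, `|f' x y| <= G y) -> integ G ->
  derives (fun x => intR (f x)) (fun x => intR (f' x)).
Proof.
move=> If df hG IG x.
have E y : (partial1of2 f) y = f' y.
  by apply/funext => z; rewrite partial1of2E (@derive_val _ _ _ _ _ _ _ (df z y)).
have xI : `](x - 1), (x + 1)[%classic x by rewrite /= in_itv/= ltrBlDr ltrDl ltr01.
have der : forall (x0 : R) (y : R), `](x - 1), (x + 1)[%classic x0 -> setT y ->
    derivable (f ^~ y) x0 1.
  by move=> x0 y _ _; exact: (@ex_derive _ _ _ _ _ _ _ (df y x0)).
have Gb : forall (x0 : R) (y : R), `](x - 1), (x + 1)[%classic x0 -> setT y ->
    `|(partial1of2 f) x0 y| <= G y.
  by move=> x0 y _ _; rewrite E.
have G0 y : 0 <= G y by apply: le_trans (hG 0 y).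
have If' : forall x0, `](x - 1), (x + 1)[%classic x0 -> mu.-integrable setT (EFin \o f x0).
  by move=> x0 _; exact: If.
have d1 := @derivable_under_integral R _ _ mu f setT measurableT x (x - 1) (x + 1) xI If' der G G0 IG Gb.
have d2 := @differentiation_under_integral R _ _ mu f setT measurableT x (x - 1) (x + 1) xI If' der G G0 IG Gb.
apply: DeriveDef; first exact: d1.
by rewrite -derive1E d2 /intR; congr (Rintegral mu setT _); apply/funext => y; rewrite E.
Qed.

End Fubini.

Section Weight.
Context {R : realType}.
Notation mu := (@lebesgue_measure R).
Implicit Types (f g u v : R -> R).

(** The weight is a common majorant of Schwartz functions that is still
    integrable, with total mass [pi]. *)
Definition wt (x : R) : R := (1 + x ^+ 2)^-1.

Lemma oneDsqr_ge1' (x : R) : 1 <= 1 + x ^+ 2.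
Proof. by rewrite lerDl sqr_ge0. Qed.

Lemma oneDsqr_gt0' (x : R) : 0 < 1 + x ^+ 2.
Proof. by rewrite (lt_le_trans ltr01)// oneDsqr_ge1'. Qed.

Lemma wt_gt0 x : 0 < wt x.
Proof. by rewrite invr_gt0 oneDsqr_gt0'. Qed.

Lemma wt_ge0 x : 0 <= wt x. Proof. exact: ltW (wt_gt0 x). Qed.

Lemma wt_le1 x : wt x <= 1.
Proof. by rewrite invf_le1 ?oneDsqr_ge1' ?oneDsqr_gt0'. Qed.

Lemma continuous_wt : continuous wt.
Proof. exact: (@continuous_oneDsqrV R). Qed.

Lemma meas_wt : meas wt.
Proof. exact: (meas_continuous continuous_wt). Qed.

Lemma integral_wt : (\int[mu]_x (wt x)%:E = pi%:E)%E.
Proof.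
rewrite ge0_symfun_integralT//; last first.
- by move=> x; rewrite /wt /= sqrrN.
- exact: continuous_wt.
- exact: wt_ge0.
rewrite -set_itvcy.
have -> : (\int[mu]_(x in `[0%R, +oo[) (wt x)%:E = (pi / 2)%:E)%E := @integral0y_oneDsqr R.
by rewrite -EFinM; congr (_%:E); field.
Qed.

Lemma integ_wt : integ wt.
Proof.
apply: integP; first exact: meas_wt.
rewrite (_ : (fun x => `|wt x|%:E) = (fun x => (wt x)%:E)); last first.
  by apply/funext => x; rewrite ger0_norm// wt_ge0.
by rewrite integral_wt ltry.
Qed.

Lemma intR_wt : intR wt = pi.
Proof. by apply: EFin_inj; rewrite -intRE ?integral_wt//; exact: integ_wt. Qed.

(** Functions integrable against the weight.  Every L^p function with
    1 <= p <= oo is of this kind, and every such function is locally integrable and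
    defines a tempered distribution: it is the common setting for all p. *)
Definition Lw f := meas f /\ integ (fun x => wt x * f x).

Lemma rschwartz_meas u : rschwartz u -> meas u.
Proof. by move=> su; apply: meas_continuous; exact: rschwartz_continuous. Qed.

Lemma rschwartz_wt u : rschwartz u -> exists2 M, 0 <= M & forall x, `|u x| <= M * wt x.
Proof.
move=> su; have [M hM] := rschwartz_bnd 2 su; have [N hN] := rschwartz_bounded su.
exists (N + M).
  by apply: addr_ge0; [exact: le_trans (hN 0)|apply: le_trans (hM 0); rewrite mulr_ge0].
move=> x; rewrite -ler_pdivrMr ?wt_gt0// /wt invrK mulrDr mulr1 lerD// mulrC.
by have := hM x; rewrite real_normK ?num_real.
Qed.

Lemma rschwartz_integ u : rschwartz u -> integ u.
Proof.
move=> su; have [M M0 hM] := rschwartz_wt su.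
apply: (integ_dom (g := fun x => M * wt x)) => //; first exact: rschwartz_meas.
exact: integZ integ_wt.
Qed.

Lemma Lw_mul_dom f g M : Lw f -> meas g -> (forall x, `|g x| <= M * wt x) ->
  integ (fun x => f x * g x).
Proof.
move=> [mf If] mg h.
apply: (integ_dom (g := fun x => M * `|wt x * f x|)).
- exact: measM.
- by apply: integZ; exact: integ_norm.
- move=> x; rewrite !normrM mulrC mulrA ler_wpM2r//.
  by rewrite [`|wt x|]ger0_norm ?wt_ge0.
Qed.

Lemma Lw_rschwartz f u : Lw f -> rschwartz u -> integ (fun x => f x * u x).
Proof.
move=> Lf su; have [M M0 hM] := rschwartz_wt su.
by apply: Lw_mul_dom hM => //; exact: rschwartz_meas.
Qed.

Lemma LwD f g : Lw f -> Lw g -> Lw (fun x => f x + g x).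
Proof.
move=> [mf If] [mg Ig]; split; first exact: measD.
have := integD If Ig; congr integ; apply/funext => x; ring.
Qed.

Lemma LwZ c f : Lw f -> Lw (fun x => c * f x).
Proof.
move=> [mf If]; split; first exact: measZ.
have := integZ c If; congr integ; apply/funext => x; ring.
Qed.

Lemma Lw_dom f g : meas f -> Lw g -> (forall x, `|f x| <= g x) -> Lw f.
Proof.
move=> mf [mg Ig] h; split => //.
apply: (integ_dom _ Ig); first by apply: measM => //; exact: meas_wt.
by move=> x; rewrite normrM ger0_norm ?wt_ge0// ler_wpM2l// wt_ge0.
Qed.

Lemma Lw_norm f : Lw f -> Lw (fun x => `|f x|).
Proof.
move=> [mf If]; split; first exact: meas_norm.
have := integ_norm If; congr integ; apply/funext => x.
by rewrite normrM ger0_norm// wt_ge0.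
Qed.

Lemma Lw_bounded f M : meas f -> (forall x, `|f x| <= M) -> Lw f.
Proof.
move=> mf h; split => //; have := integM_bounded integ_wt mf h.
by congr integ; apply/funext => x; rewrite mulrC.
Qed.

Lemma meas_indic (A : set R) : measurable A -> meas (\1_A : R -> R).
Proof. by move=> mA; exact: measurable_indic. Qed.

Lemma indic_bnd (A : set R) x : `|(\1_A x : R)| <= 1.
Proof. by rewrite indicE; case: (_ \in _); rewrite ?normr1// normr0. Qed.

Lemma bounded_supp_wt g (A M : R) : 0 <= M -> (forall x, `|g x| <= M) ->
  (forall x, A < `|x| -> g x = 0) -> exists N, forall x, `|g x| <= N * wt x.
Proof.
move=> M0 h s; exists (M * (1 + A ^+ 2)) => x.
have [Ax|xA] := ltP A `|x|.
  by rewrite s// normr0; apply: mulr_ge0; rewrite ?wt_ge0//; apply: mulr_ge0 => //; exact: ltW (oneDsqr_gt0' _).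
rewrite -mulrA -[leLHS]mulr1; apply: ler_pM => //.
rewrite /wt ler_pdivlMr; last exact: oneDsqr_gt0'.
rewrite mul1r.
by rewrite lerD2l -[leLHS]real_normK ?num_real// lerXn2r// nnegrE; exact: le_trans xA.
Qed.

Lemma Lw_mul_supp f g (A M : R) : Lw f -> meas g -> 0 <= M -> (forall x, `|g x| <= M) ->
  (forall x, A < `|x| -> g x = 0) -> integ (fun x => f x * g x).
Proof.
move=> Lf mg M0 h s; have [N hN] := bounded_supp_wt M0 h s.
exact: Lw_mul_dom hN.
Qed.

Lemma Lw_itv f (i : interval R) (A : R) : Lw f -> (forall x, x \in i -> `|x| <= A) ->
  integ (fun x => f x * \1_([set` i]) x).
Proof.
move=> Lf h; apply: (@Lw_mul_supp f _ A 1) => //.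
- by apply: meas_indic; exact: measurable_itv.
- by move=> x; exact: indic_bnd.
- move=> x Ax; rewrite indicE mem_setE; case: (boolP (x \in i)) => // /h.
  by rewrite leNgt Ax.
Qed.

Lemma Lw_locally_integrable f : Lw f -> locally_integrable setT f.
Proof.
move=> Lf; split; [exact: Lf.1|exact: openT|].
move=> K _ cK.
have [M [_ /(_ (M + 1))]] := compact_bounded cK.
rewrite ltrDl ltr01 => /(_ isT) hM.
have mK := compact_measurable cK.
have I : integ (fun x => f x * \1_K x).
  apply: (@Lw_mul_supp f _ (M + 1) 1) => //; first exact: meas_indic.
    by move=> x; exact: indic_bnd.
  move=> x Ax; rewrite indicE; case: (boolP (x \in K)) => // /set_mem /hM.
  by rewrite /= leNgt Ax.
have := integ_lty I; congr (_ < _)%E.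
rewrite [RHS]integral_mkcond; apply: eq_integral => x _.
rewrite patchE indicE; case: (x \in K); rewrite ?mulr1//.
by rewrite mulr0 normr0.
Qed.

Lemma RintegralE (D : set R) f : measurable D ->
  Rintegral mu D f = intR (fun x => f x * \1_D x).
Proof.
move=> mD; rewrite Rintegral_mkcond /intR; congr (Rintegral mu setT _).
apply/funext => x; rewrite patchE indicE; case: (x \in D); first by rewrite mulr1.
by rewrite mulr0.
Qed.

End Weight.

(** * Cosine and sine transforms *)

Section TrigTransforms.
Context {R : realType}.
Notation mu := (@lebesgue_measure R).
Implicit Types (f g u v : R -> R).

Lemma derives_continuous u v : derives u v -> continuous u.
Proof. exact: is_derive_continuous. Qed.

Lemma FTC_derives u v a b : a < b -> derives u v -> continuous v ->
  Rintegral mu `[a, b]%classic v = u b - u a.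
Proof.
move=> ab duv cv; have cu := derives_continuous duv.
rewrite /Rintegral (@continuous_FTC2 _ v u)//.
- exact: continuous_subspaceT.
- split.
  + by move=> x _; exact: (@ex_derive _ _ _ _ _ _ _ (duv x)).
  + by apply: cvg_at_right_filter; exact: cu.
  + by apply: cvg_at_left_filter; exact: cu.
- by move=> x _; rewrite (is_derive_derive1 duv).
Qed.

Lemma indic_itv_large (x : R) :
  (\1_(`[- n.+1%:R, n.+1%:R]%classic) x : R) @[n --> \oo] --> (1 : R).
Proof.
apply: cvg_near_cst.
near=> n; rewrite indicE mem_set//= in_itv/= -ler_norml.
rewrite (@le_trans _ _ n%:R)//; last by rewrite ler_nat.
near: n; exact: nbhs_infty_ger.
Unshelve. all: by end_near. Qed.

Lemma cvg_harmonic_sqr_wt M : M * wt (n.+1%:R : R) @[n --> \oo] --> (0 : R).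
Proof.
rewrite -(mulr0 M); apply: cvgMr.
apply: (@squeeze_cvgr _ _ _ _ (cst 0) (fun n => harmonic n)).
- apply: nearW => n; rewrite wt_ge0 /harmonic/= lef_pV2 ?posrE ?oneDsqr_gt0'//.
  have : (1 : R) <= n.+1%:R by rewrite ler1n.
  by move: (n.+1%:R : R) => t t1; nra.
- exact: cvg_cst.
- exact: cvg_harmonic.
Qed.

(** By the fundamental theorem on [[-n, n]] and the decay of [v] at the two
    ends. *)
Lemma intR_derives v v' M : derives v v' -> continuous v' -> integ v' ->
  (forall x, `|v x| <= M * wt x) -> intR v' = 0.
Proof.
move=> dv cv' Iv' h.
have [_ c1] : integ v' /\ (intR (fun x => v' x * \1_(`[- n.+1%:R, n.+1%:R]%classic) x) @[n --> \oo] --> intR v').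
  apply: (dct_all _ (integ_norm Iv')).
  - by move=> n; apply: measM; [exact: integ_meas|apply: meas_indic; exact: measurable_itv].
  - by move=> x; rewrite -[X in _ --> X]mulr1; apply: cvgMr; exact: indic_itv_large.
  - by move=> n x; rewrite normrM ler_piMr// indic_bnd.
have E n : intR (fun x => v' x * \1_(`[- n.+1%:R, n.+1%:R]%classic) x) = v n.+1%:R - v (- n.+1%:R).
  rewrite -RintegralE; last exact: measurable_itv.
  by apply: FTC_derives => //; rewrite gtrN.
have c2 : (v n.+1%:R - v (- n.+1%:R)) @[n --> \oo] --> (0 : R).
  apply: norm_cvg0.
  apply: (@squeeze_cvgr _ _ _ _ (cst 0) (fun n => 2 * M * wt (n.+1%:R : R))).
  - apply: nearW => n; rewrite normr_ge0/= (le_trans (ler_normB _ _))//.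
    rewrite -mulrA mulr_natl mulr2n lerD// (le_trans (h _))//.
    by rewrite /wt sqrrN.
  - exact: cvg_cst.
  - exact: cvg_harmonic_sqr_wt.
apply: (cvg_unique _ c1).
  exact: Rhausdorff.
by rewrite (funext E : (fun n => _) = _).
Qed.

(** The cosine and sine transforms are the real and imaginary parts of the
    Fourier transform of a real function. *)
Definition ct u (xi : R) : R := intR (fun x => u x * cos (2 * pi * x * xi)).
Definition st u (xi : R) : R := intR (fun x => u x * sin (2 * pi * x * xi)).

Lemma meas_cos (a : R) : meas (fun x => cos (2 * pi * x * a)).
Proof.
have := meas_comp_affine (2 * pi * a) 0 (meas_continuous (@continuous_cos R)).
by congr meas; apply/funext => x; rewrite addr0 mulrAC.
Qed.

Lemma meas_sin (a : R) : meas (fun x => sin (2 * pi * x * a)).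
Proof.
have := meas_comp_affine (2 * pi * a) 0 (meas_continuous (@continuous_sin R)).
by congr meas; apply/funext => x; rewrite addr0 mulrAC.
Qed.

Lemma integ_cos u xi : integ u -> integ (fun x => u x * cos (2 * pi * x * xi)).
Proof.
move=> Iu; have := integM_bounded Iu (meas_cos xi) (fun x => cos_max _).
by congr integ; apply/funext => x; rewrite mulrC.
Qed.

Lemma integ_sin u xi : integ u -> integ (fun x => u x * sin (2 * pi * x * xi)).
Proof.
move=> Iu; have := integM_bounded Iu (meas_sin xi) (fun x => sin_max _).
by congr integ; apply/funext => x; rewrite mulrC.
Qed.

Lemma derives_cos (a : R) : derives (fun x => cos (a * x)) (fun x => - (a * sin (a * x))).
Proof.
have d : derives (@cos R) (fun x => - sin x) by move=> x; exact: is_derive_cos.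
have := is_derive_affine a 0 d; rewrite -[X in X -> _]/(derives _ _) => {}d.
have -> : (fun x => cos (a * x)) = (fun x => cos (a * x + 0)) by apply/funext => x; rewrite addr0.
by apply: derives_eq d _ => x; rewrite addr0 mulrN.
Qed.

Lemma derives_sin (a : R) : derives (fun x => sin (a * x)) (fun x => a * cos (a * x)).
Proof.
have d : derives (@sin R) cos by move=> x; exact: is_derive_sin.
have := is_derive_affine a 0 d; rewrite -[X in X -> _]/(derives _ _) => {}d.
have -> : (fun x => sin (a * x)) = (fun x => sin (a * x + 0)) by apply/funext => x; rewrite addr0.
by apply: derives_eq d _ => x; rewrite addr0.
Qed.

(** Differentiation under the integral sign. *)
Lemma ct_derives u : rschwartz u ->
  derives (ct u) (fun xi => - (2 * pi) * st (fun x => x * u x) xi).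
Proof.
move=> su; have sxu := rschwartz_mulx su.
have d : derives (ct u) (fun xi => intR (fun x => - (2 * pi) * ((x * u x) * sin (2 * pi * x * xi)))).
  apply: (@derives_intR R (fun xi x => u x * cos (2 * pi * x * xi)) _ (fun x => 2 * pi * `|x * u x|)).
  - by move=> xi; apply: integ_cos; exact: rschwartz_integ.
  - move=> x; apply: derives_eq; first by apply: derivesZ; exact: derives_cos.
    by move=> xi /=; ring.
  - move=> xi x; rewrite !normrM normrN !normrM.
    rewrite [`|2|]ger0_norm// [`|pi|]ger0_norm ?pi_ge0// ler_wpM2l ?mulr_ge0 ?pi_ge0//.
    by rewrite ler_piMr ?mulr_ge0// sin_max.
  - by apply: integZ; apply: integ_norm; exact: rschwartz_integ.
apply: derives_eq d _ => xi; rewrite intRZ//.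
by apply: integ_sin; exact: rschwartz_integ.
Qed.

Lemma st_derives u : rschwartz u ->
  derives (st u) (fun xi => 2 * pi * ct (fun x => x * u x) xi).
Proof.
move=> su; have sxu := rschwartz_mulx su.
have d : derives (st u) (fun xi => intR (fun x => 2 * pi * ((x * u x) * cos (2 * pi * x * xi)))).
  apply: (@derives_intR R (fun xi x => u x * sin (2 * pi * x * xi)) _ (fun x => 2 * pi * `|x * u x|)).
  - by move=> xi; apply: integ_sin; exact: rschwartz_integ.
  - move=> x; apply: derives_eq; first by apply: derivesZ; exact: derives_sin.
    by move=> xi /=; ring.
  - move=> xi x; rewrite !normrM.
    rewrite [`|2|]ger0_norm// [`|pi|]ger0_norm ?pi_ge0// ler_wpM2l ?mulr_ge0 ?pi_ge0//.
    by rewrite ler_piMr ?mulr_ge0// cos_max.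
  - by apply: integZ; apply: integ_norm; exact: rschwartz_integ.
apply: derives_eq d _ => xi; rewrite intRZ//.
by apply: integ_cos; exact: rschwartz_integ.
Qed.

Lemma intR_derive_rschwartzM u g g' N N' : rschwartz u -> derives g g' -> continuous g' ->
  (forall x, `|g x| <= N) -> (forall x, `|g' x| <= N') ->
  intR (fun x => derive1 u x * g x) = - intR (fun x => u x * g' x).
Proof.
move=> su dg cg' hN hN'.
have du := smoothR_is_derive (rschwartz_smooth su).
have cg := derives_continuous dg.
have I1 : integ (fun x => derive1 u x * g x).
  have := integM_bounded (rschwartz_integ (rschwartz_derive su)) (meas_continuous cg) hN.
  by congr integ; apply/funext => x; rewrite mulrC.
have I2 : integ (fun x => u x * g' x).
  have := integM_bounded (rschwartz_integ su) (meas_continuous cg') hN'.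
  by congr integ; apply/funext => x; rewrite mulrC.
apply/eqP; rewrite -addr_eq0 -intRD//; apply/eqP.
have [M M0 hM] := rschwartz_wt su.
apply: (@intR_derives (fun x => u x * g x) _ (M * N)).
- exact: derivesM.
- move=> x; apply: cvgD.
    apply: cvgM; last exact: cg.
    by apply: rschwartz_continuous; exact: rschwartz_derive.
  by apply: cvgM; [exact: rschwartz_continuous|exact: cg'].
- exact: integD.
- by move=> x; rewrite normrM mulrAC ler_pM.
Qed.

(** Integration by parts: the transform of a derivative is the variable times
    the conjugate transform. *)
Lemma ct_derive1 u xi : rschwartz u -> ct (derive1 u) xi = 2 * pi * (xi * st u xi).
Proof.
move=> su.
rewrite /ct (@intR_derive_rschwartzM u (fun x => cos (2 * pi * x * xi))
   (fun x => - (2 * pi * xi * sin (2 * pi * x * xi))) 1 `|2 * pi * xi|) //.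
- have -> : (fun x => u x * - (2 * pi * xi * sin (2 * pi * x * xi))) =
    (fun x => - (2 * pi * xi) * (u x * sin (2 * pi * x * xi))) by apply/funext => x; ring.
  rewrite intRZ -/(st u xi); last by apply: integ_sin; exact: rschwartz_integ.
  by ring.
- have d := @derives_cos (2 * pi * xi).
  have E : (fun x => cos (2 * pi * x * xi)) = (fun x => cos (2 * pi * xi * x)).
    by apply/funext => x; rewrite mulrAC.
  by rewrite E; apply: derives_eq d _ => x; rewrite [2 * pi * x * xi]mulrAC.
- have E : (fun x : R => - (2 * pi * xi * sin (2 * pi * x * xi))) = (fun x => - (2 * pi * xi * sin (2 * pi * xi * x))).
    by apply/funext => x; rewrite [2 * pi * x * xi]mulrAC.
  rewrite E => x; apply: cvgN; apply: cvgMr.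
  exact: (derives_continuous (@derives_sin (2 * pi * xi))).
- by move=> x; exact: cos_max.
- by move=> x; rewrite normrN normrM ler_piMr// sin_max.
Qed.

Lemma st_derive1 u xi : rschwartz u -> st (derive1 u) xi = - (2 * pi) * (xi * ct u xi).
Proof.
move=> su.
rewrite /st (@intR_derive_rschwartzM u (fun x => sin (2 * pi * x * xi))
   (fun x => 2 * pi * xi * cos (2 * pi * x * xi)) 1 `|2 * pi * xi|) //.
- rewrite /ct mulNr; congr (- _); rewrite mulrA -intRZ; last by apply: integ_cos; exact: rschwartz_integ.
  by congr intR; apply/funext => x; ring.
- have d := @derives_sin (2 * pi * xi).
  have E : (fun x => sin (2 * pi * x * xi)) = (fun x => sin (2 * pi * xi * x)).
    by apply/funext => x; rewrite mulrAC.
  by rewrite E; apply: derives_eq d _ => x; rewrite [2 * pi * x * xi]mulrAC.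
- have E : (fun x : R => (2 * pi * xi * cos (2 * pi * x * xi))) = (fun x => (2 * pi * xi * cos (2 * pi * xi * x))).
    by apply/funext => x; rewrite [2 * pi * x * xi]mulrAC.
  rewrite E => x; apply: cvgMr.
  exact: (derives_continuous (@derives_cos (2 * pi * xi))).
- by move=> x; exact: sin_max.
- by move=> x; rewrite normrM ler_piMr// cos_max.
Qed.

Lemma ctZ c u xi : integ u -> ct (fun x => c * u x) xi = c * ct u xi.
Proof.
move=> Iu; rewrite /ct -intRZ; last exact: integ_cos.
by congr intR; apply/funext => x; rewrite mulrA.
Qed.

Lemma stZ c u xi : integ u -> st (fun x => c * u x) xi = c * st u xi.
Proof.
move=> Iu; rewrite /st -intRZ; last exact: integ_sin.
by congr intR; apply/funext => x; rewrite mulrA.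
Qed.

Lemma ct_bnd u xi : integ u -> `|ct u xi| <= intR (fun x => `|u x|).
Proof.
move=> Iu; apply: norm_intR_le; [exact: integ_cos|exact: integ_norm|].
by move=> x; rewrite normrM ler_piMr// cos_max.
Qed.

Lemma st_bnd u xi : integ u -> `|st u xi| <= intR (fun x => `|u x|).
Proof.
move=> Iu; apply: norm_intR_le; [exact: integ_sin|exact: integ_norm|].
by move=> x; rewrite normrM ler_piMr// sin_max.
Qed.

(** The functions [ct u + st v] form a family stable under differentiation (which
    multiplies [u] and [v] by the variable) and under multiplication by the
    variable (which differentiates [u] and [v]). *)
Lemma rschwartz_ct_st u v : rschwartz u -> rschwartz v ->
  rschwartz (fun xi => ct u xi + st v xi).
Proof.
move=> su sv.
apply: (@rschwartz_coind _ (fun w => exists u v, [/\ rschwartz u, rschwartz v &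
   w = (fun xi => ct u xi + st v xi)])); last by exists u, v.
move=> _ [{su}u [{sv}v [su sv ->]]].
have Iu := rschwartz_integ su; have Iv := rschwartz_integ sv; split.
- exists (intR (fun x => `|u x|) + intR (fun x => `|v x|)) => x.
  by rewrite (le_trans (ler_normD _ _))// lerD// ?ct_bnd// st_bnd.
- have sxu := rschwartz_mulx su; have sxv := rschwartz_mulx sv.
  exists (fun xi => - (2 * pi) * st (fun x => x * u x) xi + 2 * pi * ct (fun x => x * v x) xi).
  split; last by apply: derivesD; [exact: ct_derives|exact: st_derives].
  exists (fun x => 2 * pi * (x * v x)), (fun x => - (2 * pi) * (x * u x)); split.
  + exact: rschwartzZ.
  + exact: rschwartzZ.
  + by apply/funext => xi; rewrite ctZ ?stZ 1?addrC//; exact: rschwartz_integ.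
- exists (fun x => (2 * pi)^-1 * derive1 v x), (fun x => - (2 * pi)^-1 * derive1 u x); split.
  + by apply: rschwartzZ; exact: rschwartz_derive.
  + by apply: rschwartzZ; exact: rschwartz_derive.
  + apply/funext => xi; rewrite ctZ ?stZ; last 2 first.
      by apply: rschwartz_integ; exact: rschwartz_derive.
      by apply: rschwartz_integ; exact: rschwartz_derive.
    rewrite ct_derive1// st_derive1//.
    have p0 : (2 * pi : R) != 0 by rewrite mulf_neq0// gt_eqF// pi_gt0.
    by rewrite !mulNr mulrN opprK (mulKf p0) (mulKf p0) mulrDr addrC.
Qed.

Lemma st_cst0 xi : st (fun=> 0) xi = 0.
Proof.
rewrite /st (_ : (fun _ => _) = (fun=> 0)) ?intR_cst0//.
by apply/funext => x; rewrite mul0r.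
Qed.

Lemma ct_cst0 xi : ct (fun=> 0) xi = 0.
Proof.
rewrite /ct (_ : (fun _ => _) = (fun=> 0)) ?intR_cst0//.
by apply/funext => x; rewrite mul0r.
Qed.

Lemma rschwartz_ct u : rschwartz u -> rschwartz (ct u).
Proof.
move=> su; have := rschwartz_ct_st su (rschwartz0 (R := R)); congr rschwartz.
by apply/funext => xi; rewrite st_cst0 addr0.
Qed.

Lemma rschwartz_st u : rschwartz u -> rschwartz (st u).
Proof.
move=> su; have := rschwartz_ct_st (rschwartz0 (R := R)) su; congr rschwartz.
by apply/funext => xi; rewrite ct_cst0 add0r.
Qed.

End TrigTransforms.

(** * The integral of a cosine transform *)

Section Inversion.
Context {R : realType}.
Notation mu := (@lebesgue_measure R).
Implicit Types (f g u v w : R -> R).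

Let halfexp (a x : R) : R := expR (- a * x) * \1_(`[0%R, +oo[%classic) x.

Let meas_halfexp a : meas (halfexp a).
Proof.
apply: measM; last by apply: meas_indic; exact: measurable_itv.
have := meas_comp_affine (- a) 0 (meas_continuous (@continuous_expR R)).
by congr meas; apply/funext => x; rewrite addr0.
Qed.

Let halfexp_bnd a x : 0 < a -> `|halfexp a x| <= (1 + 2 / a ^+ 2) * wt x.
Proof.
move=> a0; rewrite -ler_pdivrMr ?wt_gt0// /wt invrK /halfexp indicE.
case: (boolP (x \in _)) => [|_]; last first.
  by rewrite mulr0 normr0 mul0r addr_ge0// divr_ge0// sqr_ge0.
rewrite mem_setE in_itv/= andbT mulr1 => x0.
rewrite ger0_norm ?expR_ge0// mulNr expRN.
rewrite mulrC ler_pdivrMr ?expR_gt0//.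
have := @expR_ge1Dxn R (a * x) 1 (mulr_ge0 (ltW a0) x0).
rewrite [2`!]/= => h.
have e0 := expR_gt0 (a * x).
have h1 : 1 + (a * x) ^+ 2 / 2 <= expR (a * x) by [].
apply: (@le_trans _ _ ((1 + 2 / a ^+ 2) * (1 + (a * x) ^+ 2 / 2))).
  rewrite mulrDl mul1r !mulrDr mulr1.
  have -> : 2 / a ^+ 2 * ((a * x) ^+ 2 / 2) = x ^+ 2 by field; rewrite ?gt_eqF//.
  rewrite -!addrA lerD2l addrA ler_wpDl// addr_ge0 ?divr_ge0 ?sqr_ge0//.
by rewrite ler_wpM2l// addr_ge0// divr_ge0// sqr_ge0.
Qed.

Let integ_halfexp a : 0 < a -> integ (halfexp a).
Proof.
move=> a0; apply: (integ_dom _ (integZ (1 + 2 / a ^+ 2) (@integ_wt R))); first exact: meas_halfexp.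
by move=> x; exact: halfexp_bnd.
Qed.

Let intR_halfexp_cos a b : 0 < a ->
  intR (fun x => halfexp a x * cos (b * x)) = a / (a ^+ 2 + b ^+ 2).
Proof.
move=> a0.
have p0 : a ^+ 2 + b ^+ 2 != 0 by rewrite gt_eqF// ltr_pwDl ?exprn_gt0// sqr_ge0.
pose V x := expR (- a * x) * (b * sin (b * x) - a * cos (b * x)) / (a ^+ 2 + b ^+ 2).
pose k x := expR (- a * x) * cos (b * x).
have de : derives (fun x => expR (- a * x)) (fun x => - a * expR (- a * x)).
  have d : derives (@expR R) expR by move=> x; exact: is_derive_expR.
  have := is_derive_affine (- a) 0 d; rewrite -[X in X -> _]/(derives _ _) => {}d.
  have -> : (fun x => expR (- a * x)) = (fun x => expR (- a * x + 0)) by apply/funext => x; rewrite addr0.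
  by apply: derives_eq d _ => x; rewrite addr0.
have dV : derives V k.
  have -> : V = (fun x => (a ^+ 2 + b ^+ 2)^-1 * (expR (- a * x) * (b * sin (b * x) + (- a) * cos (b * x)))).
    by apply/funext => x; rewrite /V mulrC; congr (_ * (_ * _)); rewrite mulNr.
  apply: derives_eq.
    apply: derivesZ; apply: derivesM; first exact: de.
    by apply: derivesD; apply: derivesZ; [exact: derives_sin|exact: derives_cos].
  by move=> x; rewrite /k; field.
have ck : continuous k.
  move=> x; apply: cvgM; first exact: (derives_continuous de).
  exact: (derives_continuous (@derives_cos _ b)).
have mcos : meas (fun x => cos (b * x)) by apply: meas_continuous; exact: (derives_continuous (@derives_cos _ b)).
have Ih := integ_halfexp a0.
have [_ c1] : integ (fun x => halfexp a x * cos (b * x)) /\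
    (intR (fun x => k x * \1_(`[0, n.+1%:R]%classic) x) @[n --> \oo] --> intR (fun x => halfexp a x * cos (b * x))).
  apply: (dct_all _ (integ_norm Ih)).
  - by move=> n; apply: measM; [exact: meas_continuous|apply: meas_indic; exact: measurable_itv].
  - move=> x; have [x0|x0] := leP 0 x.
      have -> : halfexp a x = expR (- a * x).
        by rewrite /halfexp indicE mem_set ?mulr1//= in_itv/= x0.
      rewrite -[X in _ --> X]mulr1; apply: cvgMr.
      apply: cvg_near_cst; near=> n; rewrite indicE mem_set//= in_itv/= x0/=.
      rewrite (@le_trans _ _ n%:R)//; last by rewrite ler_nat.
      by rewrite (le_trans (ler_norm _))//; near: n; exact: nbhs_infty_ger.
    rewrite /halfexp indicE memNset/=; last by rewrite in_itv/= andbT leNgt x0.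
    rewrite mulr0 mul0r.
    have -> : (fun n => k x * \1_(`[0, n.+1%:R]%classic) x) = (fun=> 0 : R).
      by apply/funext => n; rewrite indicE memNset ?mulr0//= in_itv/= leNgt x0.
    exact: cvg_cst.
  - move=> n x; rewrite /halfexp indicE.
    case: (boolP (x \in `[0, n.+1%:R]%classic)) => [|_]; last by rewrite mulr0 normr0.
    rewrite mem_setE in_itv/= => /andP[x0 _].
    by rewrite mulr1 indicE mem_set/= ?in_itv/= ?x0// mulr1 normrM ler_piMr// cos_max.
have E n : intR (fun x => k x * \1_(`[0, n.+1%:R]%classic) x) = V n.+1%:R - V 0.
  rewrite -RintegralE; last exact: measurable_itv.
  exact: FTC_derives.
have V0 : V 0 = - (a / (a ^+ 2 + b ^+ 2)).
  by rewrite /V !mulr0 expR0 sin0 cos0 mulr0 sub0r mulr1 mul1r mulNr.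
have c2 : V n.+1%:R @[n --> \oo] --> (0 : R).
  apply: norm_cvg0.
  pose C := (1 + 2 / a ^+ 2) * (`|b| + a) / (a ^+ 2 + b ^+ 2).
  apply: (@squeeze_cvgr _ _ _ _ (cst 0) (fun n => C * wt (n.+1%:R : R))).
  - apply: nearW => n; rewrite normr_ge0/= /V.
    have := @halfexp_bnd a n.+1%:R a0; rewrite /halfexp indicE mem_set/= ?in_itv/= ?ler0n// mulr1 => hb.
    have -> : C * wt (n.+1%:R : R) = ((1 + 2 / a ^+ 2) * wt n.+1%:R) * (`|b| + a) / (a ^+ 2 + b ^+ 2).
      by rewrite /C; ring.
    have p1 : 0 <= (a ^+ 2 + b ^+ 2)^-1 by rewrite invr_ge0 addr_ge0 ?sqr_ge0.
    rewrite normrM [X in _ * X]ger0_norm//; apply: ler_wpM2r => //.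
    rewrite normrM; apply: ler_pM => //.
    rewrite (le_trans (ler_normB _ _))// !normrM [`|a|]gtr0_norm//.
    by rewrite lerD// ler_piMr ?(ltW a0)// ?sin_max ?cos_max.
  - exact: cvg_cst.
  - exact: cvg_harmonic_sqr_wt.
apply: (cvg_unique _ c1); first exact: Rhausdorff.
rewrite (funext E : (fun n => _) = _) V0.
have cq : (fun=> - (a / (a ^+ 2 + b ^+ 2))) @ \oo --> - (a / (a ^+ 2 + b ^+ 2)) by exact: cvg_cst.
have H : (V n.+1%:R - - (a / (a ^+ 2 + b ^+ 2))) @[n --> \oo] --> 0 - - (a / (a ^+ 2 + b ^+ 2)).
  exact: (cvgB c2 cq).
by rewrite [in X in _ --> X]sub0r [in X in _ --> X]opprK in H.
Unshelve. all: by end_near. Qed.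

Let halfexp_le1 a x : 0 <= a -> `|halfexp a x| <= 1.
Proof.
move=> a0; rewrite /halfexp indicE; case: (boolP (x \in _)) => [|_]; last by rewrite mulr0 normr0.
rewrite mem_setE in_itv/= andbT mulr1 => x0.
by rewrite ger0_norm ?expR_ge0// -expR0 ler_expR mulNr oppr_le0 mulr_ge0.
Qed.

Lemma ct_even w xi : ct w (- xi) = ct w xi.
Proof. by rewrite /ct; congr intR; apply/funext => x; rewrite mulrN cosN. Qed.

Lemma st_odd w xi : integ w -> st w (- xi) = - st w xi.
Proof.
move=> Iw; rewrite /st -intRN; last exact: integ_sin.
by congr intR; apply/funext => x; rewrite mulrN sinN mulrN.
Qed.

Lemma intR_st w : rschwartz w -> intR (st w) = 0.
Proof.
move=> sw; apply: intR_odd; first by apply: rschwartz_integ; exact: rschwartz_st.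
by move=> x; apply: st_odd; exact: rschwartz_integ.
Qed.

Let intR_half w : rschwartz w ->
  intR (ct w) = 2 * intR (fun x => ct w x * \1_(`[0%R, +oo[%classic) x).
Proof.
move=> sw; set A := `[0%R, +oo[%classic; set B := (`]0%R, +oo[%classic : set R).
have Ic := rschwartz_integ (rschwartz_ct sw).
have mA : measurable A by exact: measurable_itv.
have mB : measurable B by exact: measurable_itv.
have IA : integ (fun x => ct w x * \1_A x).
  have := integM_bounded Ic (meas_indic mA) (@indic_bnd R A).
  by congr integ; apply/funext => x; rewrite mulrC.
have IB : integ (fun x => ct w x * \1_B x).
  have := integM_bounded Ic (meas_indic mB) (@indic_bnd R B).
  by congr integ; apply/funext => x; rewrite mulrC.
have E : intR (fun x => ct w x * \1_B x) = intR (fun x => ct w x * \1_A x).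
  rewrite -!RintegralE//; apply: Rintegral_itv_obnd_cbnd.
  exact: integrableS Ic.
rewrite mulr_natl mulr2n -[X in _ = X + _]E -intRD//; apply/eqP; rewrite -subr_eq0 -intRB//; last exact: integD.
apply/eqP; apply: intR_odd; first by apply: integB => //; exact: integD.
move=> x; rewrite ct_even -!mulrDr !indicE !mem_setE !in_itv/= !andbT.
rewrite oppr_ge0 oppr_gt0.
case: (ltgtP x 0) => [x0|x0|x0] /=; rewrite ?(addr0, add0r, mulr1, mulr0); ring.
Qed.

Lemma cvg_intR (f_ : nat -> R -> R) f g : (forall n, meas (f_ n)) -> integ g ->
  (forall x, f_ n x @[n --> \oo] --> f x) ->
  (forall n x, `|f_ n x| <= g x) -> intR (f_ n) @[n --> \oo] --> intR f.
Proof. by move=> m I c h; have [] := dct_all m I c h. Qed.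

(** Fourier inversion at the origin.  Insert the factor [expR (- a * xi)] on the
    half line and let [a] tend to 0: by Fubini the integral becomes the average of
    [w] against the Poisson kernel [a / (a ^ 2 + (2 pi x) ^ 2)], and the change of
    variable [x = a y / (2 pi)] lets dominated convergence produce [w 0]. *)
Lemma intR_ct w : rschwartz w -> intR (ct w) = w 0.
Proof.
move=> sw.
have sc := rschwartz_ct sw.
have Ic := rschwartz_integ sc.
have Iw := rschwartz_integ sw.
pose a (n : nat) : R := n.+1%:R^-1.
have a0 n : 0 < a n by rewrite invr_gt0.
have ca : a n @[n --> \oo] --> (0 : R) by exact: cvg_harmonic.
have pp : 0 < pi :> R by exact: pi_gt0.
pose Hv (x : R) : R := \1_(`[0%R, +oo[%classic) x.
have mH : meas Hv by apply: meas_indic; exact: measurable_itv.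
have c1 : intR (fun xi => ct w xi * halfexp (a n) xi) @[n --> \oo] --> intR (fun xi => ct w xi * Hv xi).
  apply: (cvg_intR _ (integ_norm Ic)).
  - by move=> n; apply: measM; [exact: integ_meas|exact: meas_halfexp].
  - move=> x; rewrite /halfexp -/(Hv x); apply: cvgMr.
    rewrite -[X in _ --> X]mul1r; apply: cvgMl.
    rewrite -expR0.
    apply: continuous_cvg; first exact: continuous_expR.
    have : - a n * x @[n --> \oo] --> - 0 * x by apply: cvgMl; apply: cvgN.
    by rewrite oppr0 mul0r.
  - by move=> n x; rewrite normrM ler_piMr// halfexp_le1// ltW.
have fub n : intR (fun xi => ct w xi * halfexp (a n) xi) =
    intR (fun x => w x * (a n / (a n ^+ 2 + (2 * pi * x) ^+ 2))).
  have mF : meas2 (fun xi x => halfexp (a n) xi * (w x * cos (2 * pi * x * xi))).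
    apply: meas2M; first by apply: meas2_1; exact: meas_halfexp.
    apply: meas2M; first by apply: meas2_2; exact: integ_meas.
    apply: (@meas2_comp _ (@cos R)); first exact: (meas_continuous (@continuous_cos R)).
    apply: meas2M; last by apply: (@meas2_1 _ id); exact: measurable_id.
    by apply: (@meas2_2 _ (fun x => 2 * pi * x)); apply: measZ; exact: measurable_id.
  have hF (xi x : R) : `|halfexp (a n) xi * (w x * cos (2 * pi * x * xi))| <= `|halfexp (a n) xi| * `|w x|.
    by rewrite !normrM ler_wpM2l// ler_piMr// cos_max.
  have [_ _ E] := fubini_dom mF (integ_norm (integ_halfexp (a0 n))) (integ_norm Iw) hF.
  transitivity (intR (fun xi => intR (fun x => halfexp (a n) xi * (w x * cos (2 * pi * x * xi))))).
    congr intR; apply/funext => xi; rewrite intRZ; last exact: integ_cos.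
    by rewrite mulrC.
  rewrite E; congr intR; apply/funext => x.
  rewrite -intR_halfexp_cos// -intRZ; last first.
    have := integM_bounded (integ_halfexp (a0 n)) (meas_continuous (derives_continuous (@derives_cos R (2 * pi * x)))) (fun y => cos_max _).
    by congr integ; apply/funext => y; rewrite mulrC.
  by congr intR; apply/funext => xi; rewrite mulrCA.
pose s n := a n / (2 * pi).
have tp : 0 < 2 * pi :> R by rewrite mulr_gt0.
have s0 n : 0 < s n by rewrite divr_gt0.
have [M M0 hM] := rschwartz_wt sw.
have [N hN] := rschwartz_bounded sw.
have mws n : meas (fun y => w (s n * y)).
  have := meas_comp_affine (s n) 0 (rschwartz_meas sw).
  by congr meas; apply/funext => y; rewrite addr0.
have scl n : intR (fun x => w x * (a n / (a n ^+ 2 + (2 * pi * x) ^+ 2))) =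
    (2 * pi)^-1 * intR (fun y => w (s n * y) * wt y).
  have E1 x : a n / (a n ^+ 2 + (2 * pi * x) ^+ 2) = (a n)^-1 * wt ((s n)^-1 * x + 0).
    rewrite addr0 /wt /s; have := a0 n; move: (a n) (pi : R) pp => b P b0 P0.
    have q0 : b ^+ 2 + (2 * P * x) ^+ 2 != 0 by rewrite gt_eqF// ltr_pwDl ?exprn_gt0// sqr_ge0.
    have q1 : 1 + ((b / (2 * P))^-1 * x) ^+ 2 != 0 by rewrite gt_eqF// oneDsqr_gt0'.
    have e : 1 + ((b / (2 * P))^-1 * x) ^+ 2 = (b ^+ 2 + (2 * P * x) ^+ 2) / b ^+ 2.
      by field; rewrite !gt_eqF.
    by rewrite e; field; rewrite ?q0 ?gt_eqF//.
  have sV0 : (s n)^-1 != 0 by rewrite invr_neq0// gt_eqF.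
  have Ig : integ (fun x => w x * (a n / (a n ^+ 2 + (2 * pi * x) ^+ 2))).
    have := @integM_bounded R w (fun x => (a n)^-1 * wt ((s n)^-1 * x + 0)) (a n)^-1 Iw.
    have -> : (fun x => w x * (a n / (a n ^+ 2 + (2 * pi * x) ^+ 2))) =
       (fun x => (a n)^-1 * wt ((s n)^-1 * x + 0) * w x).
      by apply/funext => x; rewrite E1 mulrC.
    apply; first by apply: measZ; apply: meas_comp_affine; exact: meas_wt.
    move=> x; rewrite normrM [`|(a n)^-1|]gtr0_norm ?invr_gt0// ler_piMr//; first by rewrite invr_ge0 ltW.
    by rewrite ger0_norm ?wt_ge0// wt_le1.
  have := @intR_affine R _ (s n) 0 (lt0r_neq0 (s0 n)) Ig.
  rewrite gtr0_norm// => h.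
  rewrite -[LHS](mulVKf (lt0r_neq0 (s0 n))) -h {h}.
  rewrite -!intRZ; first last.
  - by have := integ_affine 0 (lt0r_neq0 (s0 n)) Ig.
  - have := @integM_bounded R wt (fun y => w (s n * y)) N (@integ_wt R) (mws n); apply => y; exact: hN.
  congr intR; apply/funext => y; rewrite addr0 E1 !addr0 (mulKf (lt0r_neq0 (s0 n))).
  have -> : s n = a n * (2 * pi)^-1 by [].
  set r := w _.
  by have := a0 n; move: r (a n) (wt y) (pi : R) pp => r b q P b0 P0; field; rewrite ?gt_eqF//.
have c2 : intR (fun y => w (s n * y) * wt y) @[n --> \oo] --> intR (fun y => w 0 * wt y).
  apply: (cvg_intR _ (integZ N (@integ_wt R))).
  - by move=> n; apply: measM; [exact: mws|exact: meas_wt].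
  - move=> y; apply: cvgMl.
    apply: continuous_cvg; first exact: rschwartz_continuous.
    rewrite -(mul0r y); apply: cvgMl.
    rewrite -(mul0r (2 * pi)^-1); exact: cvgMl.
  - by move=> n y; rewrite normrM [`|wt y|]ger0_norm ?wt_ge0// ler_wpM2r// wt_ge0.
have c3 : intR (fun xi => ct w xi * halfexp (a n) xi) @[n --> \oo] --> (2 * pi)^-1 * (w 0 * pi).
  have -> : (fun n => intR (fun xi => ct w xi * halfexp (a n) xi)) =
      (fun n => (2 * pi)^-1 * intR (fun y => w (s n * y) * wt y)).
    by apply/funext => n; rewrite fub scl.
  by apply: cvgMr; rewrite -(@intR_wt R) -intRZ//; exact: integ_wt.
have := cvg_unique _ c1 c3; rewrite intR_half// => ->; last exact: Rhausdorff.
by move: (pi : R) pp => P P0; field; rewrite gt_eqF.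
Qed.

End Inversion.

(** * Complex integrals and the Fourier transform *)

Section ComplexIntegral.
Context {R : realType}.
Notation mu := (@lebesgue_measure R).
Implicit Types (f g phi psi m : R -> R[i]) (F : R -> R -> R[i]).

Definition cinteg f := integ (reF f) /\ integ (imF f).
Definition cint f : R[i] := cintegral setT f.

(** The l^1 norm of the real and imaginary parts: equivalent to the modulus,
    submultiplicative, and without square roots, so estimates reduce to real
    integrals. *)
Definition n1 (z : R[i]) : R := `|complex.Re z| + `|complex.Im z|.

Lemma cintE f : cint f = intR (reF f) +i* intR (imF f). Proof. by []. Qed.

Lemma cReM (a b : R[i]) : complex.Re (a * b) = complex.Re a * complex.Re b - complex.Im a * complex.Im b.
Proof. by case: a b => [? ?] [? ?]. Qed.
Lemma cImM (a b : R[i]) : complex.Im (a * b) = complex.Re a * complex.Im b + complex.Im a * complex.Re b.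
Proof. by case: a b => [? ?] [? ?]. Qed.
Lemma cReD (a b : R[i]) : complex.Re (a + b) = complex.Re a + complex.Re b.
Proof. by case: a b => [? ?] [? ?]. Qed.
Lemma cImD (a b : R[i]) : complex.Im (a + b) = complex.Im a + complex.Im b.
Proof. by case: a b => [? ?] [? ?]. Qed.
Lemma cReN (a : R[i]) : complex.Re (- a) = - complex.Re a.
Proof. by case: a. Qed.
Lemma cImN (a : R[i]) : complex.Im (- a) = - complex.Im a.
Proof. by case: a. Qed.
Lemma cReB (a b : R[i]) : complex.Re (a - b) = complex.Re a - complex.Re b.
Proof. by case: a b => [? ?] [? ?]. Qed.
Lemma cImB (a b : R[i]) : complex.Im (a - b) = complex.Im a - complex.Im b.
Proof. by case: a b => [? ?] [? ?]. Qed.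
Lemma ceq_reim (a b : R[i]) : complex.Re a = complex.Re b -> complex.Im a = complex.Im b -> a = b.
Proof. by case: a b => [? ?] [? ?] /= -> ->. Qed.

Lemma n1_ge0 z : 0 <= n1 z. Proof. by rewrite addr_ge0. Qed.
Lemma n1D (a b : R[i]) : n1 (a + b) <= n1 a + n1 b.
Proof. by rewrite /n1 cReD cImD addrACA lerD// ler_normD. Qed.
Lemma n1N (a : R[i]) : n1 (- a) = n1 a.
Proof. by rewrite /n1 cReN cImN !normrN. Qed.
Lemma n1B (a b : R[i]) : n1 (a - b) <= n1 a + n1 b.
Proof. by rewrite -(n1N b) n1D. Qed.
Lemma n1M (a b : R[i]) : n1 (a * b) <= n1 a * n1 b.
Proof.
rewrite /n1 cReM cImM.
apply: (@le_trans _ _ ((`|complex.Re a * complex.Re b| + `|complex.Im a * complex.Im b|) +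
   (`|complex.Re a * complex.Im b| + `|complex.Im a * complex.Re b|))).
  by rewrite lerD// ?ler_normB// ler_normD.
by rewrite !normrM; move: (`|_|) (`|_|) (`|_|) (`|_|) => p q r s; nra.
Qed.
Lemma cmod_n1 z : cmod z <= n1 z. Proof. exact: cmod_le. Qed.
Lemma n1_cmod z : n1 z <= 2 * cmod z.
Proof. by rewrite mulr_natl mulr2n lerD// ?Re_le_cmod// Im_le_cmod. Qed.
Lemma Re_n1 z : `|complex.Re z| <= n1 z. Proof. by rewrite lerDl. Qed.
Lemma Im_n1 z : `|complex.Im z| <= n1 z. Proof. by rewrite lerDr. Qed.
Lemma cmod_ge0 (z : R[i]) : 0 <= cmod z.
Proof. exact: le_trans (Re_le_cmod z). Qed.
Lemma cmodM (a b : R[i]) : cmod (a * b) = cmod a * cmod b.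
Proof. exact: Normc.normcM. Qed.

Lemma cexpiD (a b : R) : cexpi (a + b) = cexpi a * cexpi b.
Proof.
apply: ceq_reim; rewrite /cexpi ?cReM ?cImM /= ?cosD ?sinD; first by [].
by rewrite addrC.
Qed.

Lemma n1_cexpi (a : R) : n1 (cexpi a) <= 2.
Proof.
by rewrite /n1/= -[2]/(1 + 1 : R) lerD ?cos_max ?sin_max.
Qed.

Lemma integ_n1 f : cinteg f -> integ (fun x => n1 (f x)).
Proof. by move=> [I1 I2]; apply: integD; exact: integ_norm. Qed.

Lemma n1_cint f : cinteg f -> n1 (cint f) <= intR (fun x => n1 (f x)).
Proof.
move=> [I1 I2]; rewrite intRD; try exact: integ_norm.
by rewrite lerD// le_norm_intR.
Qed.

Lemma cintegD f g : cinteg f -> cinteg g -> cinteg (fun x => f x + g x).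
Proof.
move=> [f1 f2] [g1 g2]; split.
  by have := integD f1 g1; congr integ; apply/funext => x; rewrite /reF cReD.
by have := integD f2 g2; congr integ; apply/funext => x; rewrite /imF cImD.
Qed.

Lemma cintD f g : cinteg f -> cinteg g -> cint (fun x => f x + g x) = cint f + cint g.
Proof.
move=> [f1 f2] [g1 g2]; apply: ceq_reim; rewrite ?cReD ?cImD/= -!/(intR _) -intRD//; congr intR;
  by apply/funext => x; rewrite /reF /imF ?cReD ?cImD.
Qed.

Lemma cintegZ c f : cinteg f -> cinteg (fun x => c * f x).
Proof.
move=> [f1 f2]; split.
  have := integB (integZ (complex.Re c) f1) (integZ (complex.Im c) f2); congr integ.
  by apply/funext => x; rewrite /reF cReM.
have := integD (integZ (complex.Re c) f2) (integZ (complex.Im c) f1); congr integ.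
by apply/funext => x; rewrite /imF cImM.
Qed.

Lemma cintZ c f : cinteg f -> cint (fun x => c * f x) = c * cint f.
Proof.
move=> [f1 f2]; apply: ceq_reim; rewrite ?cReM ?cImM/= -!/(intR _) -!intRZ//.
  rewrite -intRB; [|exact: integZ|exact: integZ].
  by congr intR; apply/funext => x; rewrite /reF cReM.
rewrite -intRD; [|exact: integZ|exact: integZ].
by congr intR; apply/funext => x; rewrite /imF cImM.
Qed.

Lemma cintegB f g : cinteg f -> cinteg g -> cinteg (fun x => f x - g x).
Proof.
move=> cf cg; have := cintegD cf (cintegZ (-1) cg); congr cinteg.
by apply/funext => x; rewrite mulN1r.
Qed.

Lemma cintB f g : cinteg f -> cinteg g -> cint (fun x => f x - g x) = cint f - cint g.
Proof.
move=> cf cg; have := cintD cf (cintegZ (-1) cg); rewrite cintZ// mulN1r => <-.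
by congr cint; apply/funext => x; rewrite mulN1r.
Qed.

Lemma cint_affine f (a b : R) : a != 0 -> cinteg f ->
  cint (fun x => f (a * x + b)) = (`|a|^-1)%:C * cint f.
Proof.
move=> a0 [f1 f2]; apply: ceq_reim; rewrite ?cReM ?cImM/= -!/(intR _) mul0r ?subr0 ?addr0.
  by rewrite -(intR_affine b a0 f1).
by rewrite -(intR_affine b a0 f2).
Qed.

Lemma cint_shift f b : cinteg f -> cint (fun x => f (x + b)) = cint f.
Proof.
move=> [f1 f2]; apply: ceq_reim => /=; rewrite -!/(intR _).
  by rewrite -[RHS](intR_shift b f1).
by rewrite -[RHS](intR_shift b f2).
Qed.

Definition cmeas2 F := meas2 (fun x y => complex.Re (F x y)) /\ meas2 (fun x y => complex.Im (F x y)).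

Lemma cmeas2M F G : cmeas2 F -> cmeas2 G -> cmeas2 (fun x y => F x y * G x y).
Proof.
move=> [F1 F2] [G1 G2]; split.
  have := meas2D (meas2M F1 G1) (meas2N (meas2M F2 G2)); congr meas2.
  by apply/funext => x; apply/funext => y; rewrite cReM.
have := meas2D (meas2M F1 G2) (meas2M F2 G1); congr meas2.
by apply/funext => x; apply/funext => y; rewrite cImM.
Qed.

Lemma cmeas2_1 f : meas (reF f) -> meas (imF f) -> cmeas2 (fun x _ => f x).
Proof. by move=> m1 m2; split; [exact: meas2_1 m1|exact: meas2_1 m2]. Qed.

Lemma cmeas2_2 f : meas (reF f) -> meas (imF f) -> cmeas2 (fun _ y => f y).
Proof. by move=> m1 m2; split; [exact: meas2_2 m1|exact: meas2_2 m2]. Qed.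

Lemma cmeas2_cexpi (F : R -> R -> R) : meas2 F -> cmeas2 (fun x y => cexpi (F x y)).
Proof.
move=> mF; split.
  by apply: meas2_comp mF; apply: meas_continuous; exact: continuous_cos.
by apply: meas2_comp mF; apply: meas_continuous; exact: continuous_sin.
Qed.

Lemma cfubini F (u v : R -> R) : cmeas2 F -> integ u -> integ v ->
  (forall x y, n1 (F x y) <= u x * v y) ->
  cint (fun x => cint (F x)) = cint (fun y => cint (fun x => F x y)).
Proof.
move=> [m1 m2] Iu Iv h.
have [_ _ E1] := fubini_dom m1 Iu Iv (fun x y => le_trans (Re_n1 _) (h x y)).
have [_ _ E2] := fubini_dom m2 Iu Iv (fun x y => le_trans (Im_n1 _) (h x y)).
by apply: ceq_reim; [exact: E1|exact: E2].
Qed.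

End ComplexIntegral.

Section ComplexFourier.
Context {R : realType}.
Notation mu := (@lebesgue_measure R).
Implicit Types (f g phi psi m : R -> R[i]).

Lemma schwartz_re phi : schwartz phi -> rschwartz (reF phi).
Proof. by move=> /schwartzP[]. Qed.
Lemma schwartz_im phi : schwartz phi -> rschwartz (imF phi).
Proof. by move=> /schwartzP[]. Qed.

Lemma schwartz_cinteg phi : schwartz phi -> cinteg phi.
Proof. by move=> /schwartzP[? ?]; split; exact: rschwartz_integ. Qed.

Lemma schwartz_eq phi psi : phi =1 psi -> schwartz phi -> schwartz psi.
Proof. by move=> /funext ->. Qed.

Lemma schwartzD phi psi : schwartz phi -> schwartz psi -> schwartz (fun x => phi x + psi x).
Proof.
move=> /schwartzP[a b] /schwartzP[c d]; apply/schwartzP; split.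
  by have := rschwartzD a c; congr rschwartz; apply/funext => x; rewrite /reF cReD.
by have := rschwartzD b d; congr rschwartz; apply/funext => x; rewrite /imF cImD.
Qed.

Lemma schwartzM phi psi : schwartz phi -> schwartz psi -> schwartz (fun x => phi x * psi x).
Proof.
move=> /schwartzP[a b] /schwartzP[c d]; apply/schwartzP; split.
  have := rschwartzB (rschwartzM a c) (rschwartzM b d); congr rschwartz.
  by apply/funext => x; rewrite /reF cReM.
have := rschwartzD (rschwartzM a d) (rschwartzM b c); congr rschwartz.
by apply/funext => x; rewrite /imF cImM.
Qed.

Lemma schwartzZ c phi : schwartz phi -> schwartz (fun x => c * phi x).
Proof.
move=> /schwartzP[a b]; apply/schwartzP; split.
  have := rschwartzB (rschwartzZ (complex.Re c) a) (rschwartzZ (complex.Im c) b); congr rschwartz.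
  by apply/funext => x; rewrite /reF cReM.
have := rschwartzD (rschwartzZ (complex.Re c) b) (rschwartzZ (complex.Im c) a); congr rschwartz.
by apply/funext => x; rewrite /imF cImM.
Qed.

Lemma schwartzB phi psi : schwartz phi -> schwartz psi -> schwartz (fun x => phi x - psi x).
Proof.
move=> a b; have := schwartzD a (schwartzZ (-1) b); congr schwartz.
by apply/funext => x; rewrite mulN1r.
Qed.

Lemma schwartz_affine phi (a b : R) : a != 0 -> schwartz phi -> schwartz (fun x => phi (a * x + b)).
Proof.
move=> a0 /schwartzP[s1 s2]; apply/schwartzP; split.
  exact: (rschwartz_affine b a0 s1).
exact: (rschwartz_affine b a0 s2).
Qed.

Lemma fourierE phi : schwartz phi -> fourier phi =
  (fun xi => (ct (reF phi) xi + st (imF phi) xi) +i* (ct (imF phi) xi - st (reF phi) xi)).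
Proof.
move=> /schwartzP[s1 s2]; apply/funext => xi.
have I1 := rschwartz_integ s1; have I2 := rschwartz_integ s2.
apply: ceq_reim => /=; rewrite -!/(intR _).
  rewrite -intRD; [|exact: integ_cos|exact: integ_sin].
  by congr intR; apply/funext => x; rewrite /reF cReM/= cosN sinN mulrN opprK.
rewrite -intRB; [|exact: integ_cos|exact: integ_sin].
by congr intR; apply/funext => x; rewrite /imF cImM/= cosN sinN mulrN addrC.
Qed.

Lemma ifourierE phi : schwartz phi -> ifourier phi =
  (fun xi => (ct (reF phi) xi - st (imF phi) xi) +i* (ct (imF phi) xi + st (reF phi) xi)).
Proof.
move=> /schwartzP[s1 s2]; apply/funext => xi.
have I1 := rschwartz_integ s1; have I2 := rschwartz_integ s2.
have mE (x : R) : 2 * pi * xi * x = 2 * pi * x * xi by rewrite mulrAC.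
apply: ceq_reim => /=; rewrite -!/(intR _).
  rewrite -intRB; [|exact: integ_cos|exact: integ_sin].
  by congr intR; apply/funext => x; rewrite /reF cReM/= mE.
rewrite -intRD; [|exact: integ_cos|exact: integ_sin].
by congr intR; apply/funext => x; rewrite /imF cImM/= mE addrC.
Qed.

Lemma schwartz_fourier phi : schwartz phi -> schwartz (fourier phi).
Proof.
move=> sp; have /schwartzP[s1 s2] := sp; rewrite fourierE//; apply/schwartzP; split.
  exact: rschwartz_ct_st.
by apply: rschwartzB; [exact: rschwartz_ct|exact: rschwartz_st].
Qed.

Lemma schwartz_ifourier phi : schwartz phi -> schwartz (ifourier phi).
Proof.
move=> sp; have /schwartzP[s1 s2] := sp; rewrite ifourierE//; apply/schwartzP; split.
  by apply: rschwartzB; [exact: rschwartz_ct|exact: rschwartz_st].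
exact: rschwartz_ct_st.
Qed.

(** The sine part is odd and integrates to 0; the cosine part is [intR_ct]. *)
Lemma cint_fourier phi : schwartz phi -> cint (fourier phi) = phi 0.
Proof.
move=> sp; have /schwartzP[s1 s2] := sp; rewrite fourierE//.
have c1 := rschwartz_integ (rschwartz_ct s1); have c2 := rschwartz_integ (rschwartz_ct s2).
have t1 := rschwartz_integ (rschwartz_st s1); have t2 := rschwartz_integ (rschwartz_st s2).
apply: ceq_reim.
  transitivity (intR (fun xi => ct (reF phi) xi + st (imF phi) xi)); first by [].
  by rewrite (intRD c1 t2) intR_ct// intR_st// addr0.
transitivity (intR (fun xi => ct (imF phi) xi - st (reF phi) xi)); first by [].
by rewrite (intRB c2 t1) intR_ct// intR_st// subr0.
Qed.

Lemma cint_ifourier phi : schwartz phi -> cint (ifourier phi) = phi 0.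
Proof.
move=> sp; have /schwartzP[s1 s2] := sp; rewrite ifourierE//.
have c1 := rschwartz_integ (rschwartz_ct s1); have c2 := rschwartz_integ (rschwartz_ct s2).
have t1 := rschwartz_integ (rschwartz_st s1); have t2 := rschwartz_integ (rschwartz_st s2).
apply: ceq_reim.
  transitivity (intR (fun xi => ct (reF phi) xi - st (imF phi) xi)); first by [].
  by rewrite (intRB c1 t2) intR_ct// intR_st// subr0.
transitivity (intR (fun xi => ct (imF phi) xi + st (reF phi) xi)); first by [].
by rewrite (intRD c2 t1) intR_ct// intR_st// addr0.
Qed.

Lemma meas_reim_cexpi (a b : R) : meas (reF (fun x => cexpi (a * x + b))) /\ meas (imF (fun x => cexpi (a * x + b))).
Proof.
split.
  exact: (meas_comp_affine a b (meas_continuous (@continuous_cos R))).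
exact: (meas_comp_affine a b (meas_continuous (@continuous_sin R))).
Qed.

Lemma cinteg_cexpi f (a b : R) : cinteg f -> cinteg (fun x => f x * cexpi (a * x + b)).
Proof.
move=> cf; have [m1 m2] := cf; have [e1 e2] := meas_reim_cexpi a b.
move/integ_meas in m1; move/integ_meas in m2.
have I2 := integZ 2 (integ_n1 cf).
split; apply: (integ_dom _ I2).
- have := measB (measM m1 e1) (measM m2 e2); congr meas.
  by apply/funext => x; rewrite /reF cReM.
- move=> x; apply: le_trans (Re_n1 _) _; apply: le_trans (n1M _ _) _.
  by rewrite mulrC ler_wpM2r ?n1_ge0// n1_cexpi.
- have := measD (measM m1 e2) (measM m2 e1); congr meas.
  by apply/funext => x; rewrite /imF cImM.
- move=> x; apply: le_trans (Im_n1 _) _; apply: le_trans (n1M _ _) _.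
  by rewrite mulrC ler_wpM2r ?n1_ge0// n1_cexpi.
Qed.

(** Inversion at [x] is inversion at the origin for the translate of [phi]. *)
Lemma fourierK phi : schwartz phi -> ifourier (fourier phi) = phi.
Proof.
move=> sp; apply/funext => x.
have sx : schwartz (fun y => phi (y + x)).
  by have := schwartz_affine x (oner_neq0 _) sp; apply: schwartz_eq => y; rewrite mul1r.
have := cint_fourier sx; rewrite add0r => <-.
rewrite /ifourier -/(cint _); congr cint; apply/funext => xi.
rewrite {1}/fourier -/(cint _) mulrC -cintZ; last first.
  have := @cinteg_cexpi phi (- (2 * pi * xi)) 0 (schwartz_cinteg sp).
  by congr cinteg; apply/funext => y; rewrite addr0 mulNr [2 * pi * xi * y]mulrAC.
have Iy : cinteg (fun y => cexpi (2 * pi * x * xi) * (phi y * cexpi (- (2 * pi * y * xi)))).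
  apply: cintegZ.
  have := @cinteg_cexpi phi (- (2 * pi * xi)) 0 (schwartz_cinteg sp).
  by congr cinteg; apply/funext => y; rewrite addr0 mulNr [2 * pi * xi * y]mulrAC.
rewrite -(cint_shift x Iy) /fourier -/(cint _); congr cint; apply/funext => y.
rewrite mulrCA -cexpiD; congr (_ * cexpi _); ring.
Qed.

(** Fubini: a multiplier on the Fourier side is an average over translates. *)
Lemma fourier_mul_ifourier m phi : schwartz m -> schwartz phi ->
  forall x, fourier (fun xi => m xi * ifourier phi xi) x =
  cint (fun z => phi (x + z) * ifourier m z).
Proof.
move=> sm sp x.
have [sm1 sm2] := (schwartzP _).1 sm; have [sp1 sp2] := (schwartzP _).1 sp.
pose F xi y := m xi * (phi y * cexpi (2 * pi * xi * (y - x))).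
have mF : cmeas2 F.
  apply: cmeas2M; first by apply: cmeas2_1; exact: rschwartz_meas.
  apply: cmeas2M; first by apply: cmeas2_2; exact: rschwartz_meas.
  apply: cmeas2_cexpi; apply: meas2M.
    by apply: (@meas2_1 _ (fun x => 2 * pi * x)); apply: measZ; exact: measurable_id.
  apply: (@meas2_2 _ (fun y => y - x)).
  by have := @meas_affine R 1 (- x); congr meas; apply/funext => y; rewrite mul1r.
have Im := integ_n1 (schwartz_cinteg sm); have Ip := integ_n1 (schwartz_cinteg sp).
have hF xi y : n1 (F xi y) <= n1 (m xi) * (2 * n1 (phi y)).
  apply: le_trans (n1M _ _) _; rewrite ler_wpM2l ?n1_ge0//.
  apply: le_trans (n1M _ _) _; rewrite mulrC ler_wpM2r ?n1_ge0//.
  exact: n1_cexpi.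
have E := cfubini mF Im (integZ 2 Ip) hF.
transitivity (cint (fun xi => cint (F xi))).
  rewrite /fourier -/(cint _); congr cint; apply/funext => xi.
  have Iy : cinteg (fun y => phi y * cexpi (2 * pi * xi * y)).
    have := @cinteg_cexpi phi (2 * pi * xi) 0 (schwartz_cinteg sp).
    by congr cinteg; apply/funext => y; rewrite addr0.
  have -> : F xi = (fun y => (m xi * cexpi (- (2 * pi * xi * x))) * (phi y * cexpi (2 * pi * xi * y))).
    apply/funext => y; rewrite /F -[RHS]mulrA [X in _ = _ * X]mulrCA -cexpiD.
    by congr (_ * (_ * cexpi _)); ring.
  rewrite (cintZ _ Iy) mulrAC /ifourier -/(cint _); reflexivity.
rewrite E.
have Iw : cinteg (fun y => phi y * ifourier m (y - x)).
  have sm' : schwartz (fun y => ifourier m (y - x)).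
    have := schwartz_affine (- x) (oner_neq0 _) (schwartz_ifourier sm).
    by apply: schwartz_eq => y; rewrite mul1r.
  exact: (schwartz_cinteg (schwartzM sp sm')).
transitivity (cint (fun y => phi y * ifourier m (y - x))); last first.
  by rewrite -(cint_shift x Iw); congr cint; apply/funext => z; rewrite addrK addrC.
congr cint; apply/funext => y.
rewrite /ifourier -/(cint _) -cintZ; last first.
  have := @cinteg_cexpi m (2 * pi * (y - x)) 0 (schwartz_cinteg sm).
  by congr cinteg; apply/funext => z; rewrite addr0.
congr cint; apply/funext => z; rewrite /F mulrCA; congr (_ * (_ * cexpi _)); ring.
Qed.

(** The multiplier [xi |-> eta (t * xi)] keeps frequencies below [1 / t]. *)
Definition lowpass (eta : R -> R[i]) (t : R) phi : R -> R[i] :=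
  fourier (fun xi => eta (t * xi) * ifourier phi xi).

Lemma schwartz_lowpass eta t phi : schwartz eta -> t != 0 -> schwartz phi ->
  schwartz (lowpass eta t phi).
Proof.
move=> se t0 sp; apply: schwartz_fourier; apply: schwartzM; last exact: schwartz_ifourier.
by have := schwartz_affine 0 t0 se; apply: schwartz_eq => x; rewrite addr0.
Qed.

(** The kernel of the filter is the dilate by [t] of a fixed Schwartz function. *)
Lemma lowpassE eta t phi : schwartz eta -> 0 < t -> schwartz phi ->
  forall x, lowpass eta t phi x = cint (fun z => phi (x + t * z) * ifourier eta z).
Proof.
move=> se t0 sp x.
have tn0 : t != 0 by rewrite gt_eqF.
have st : schwartz (fun xi => eta (t * xi)).
  by have := schwartz_affine 0 tn0 se; apply: schwartz_eq => y; rewrite addr0.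
rewrite /lowpass (fourier_mul_ifourier st sp).
have Iz : cinteg (fun z => phi (x + z) * ifourier (fun xi => eta (t * xi)) z).
  have sx : schwartz (fun z => phi (x + z)).
    have := schwartz_affine x (oner_neq0 _) sp.
    by apply: schwartz_eq => y; rewrite mul1r addrC.
  exact: (schwartz_cinteg (schwartzM sx (schwartz_ifourier st))).
have := cint_affine 0 tn0 Iz; rewrite (gtr0_norm t0) => h.
have {h} -> : cint (fun z => phi (x + z) * ifourier (fun xi => eta (t * xi)) z) =
  t%:C * cint (fun z => phi (x + (t * z + 0)) * ifourier (fun xi => eta (t * xi)) (t * z + 0)).
  by rewrite h mulrA -rmorphM mulfV; [rewrite rmorph1 mul1r|exact: tn0].
rewrite -cintZ; last first.
  have sx : schwartz (fun z => phi (x + (t * z + 0))).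
    have := schwartz_affine x tn0 sp.
    by apply: schwartz_eq => y; rewrite addr0 addrC.
  exact: (schwartz_cinteg (schwartzM sx (schwartz_affine 0 tn0 (schwartz_ifourier st)))).
congr cint; apply/funext => z; rewrite addr0 mulrCA; congr (_ * _).
rewrite /ifourier -/(cint _).
have Iw : cinteg (fun w => eta w * cexpi (2 * pi * z * w)).
  have := @cinteg_cexpi eta (2 * pi * z) 0 (schwartz_cinteg se).
  by congr cinteg; apply/funext => w; rewrite addr0.
have := cint_affine 0 tn0 Iw; rewrite (gtr0_norm t0) => h.
have e1 : t%:C * (t^-1)%:C = 1 by rewrite -rmorphM mulfV; [exact: rmorph1|exact: tn0].
transitivity (t%:C * ((t^-1)%:C * cint (fun w => eta w * cexpi (2 * pi * z * w)))); last first.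
  by rewrite mulrA e1 mul1r.
rewrite -h; congr (_ * cint _); apply/funext => w; rewrite addr0.
by congr (_ * cexpi _); ring.
Qed.

End ComplexFourier.

(** * Low-pass filters *)

Section Translation.
Context {R : realType}.
Notation mu := (@lebesgue_measure R).
Implicit Types (u v : R -> R).

Lemma derives_ext u v u2 v2 : u =1 u2 -> v =1 v2 -> derives u v -> derives u2 v2.
Proof. by move=> /funext <- /funext <-. Qed.

Lemma derives_comp_line u u' (x h : R) : derives u u' ->
  derives (fun s => u (x + s * h)) (fun s => h * u' (x + s * h)).
Proof.
move=> du; have := is_derive_affine h x du; rewrite -[X in X -> _]/(derives _ _).
have -> : (fun s => u (h * s + x)) = (fun s => u (x + s * h)).
  by apply/funext => s; rewrite addrC mulrC.
by move=> d; apply: derives_eq d _ => s; rewrite addrC [h * s]mulrC.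
Qed.

Lemma increment_integral u h x : rschwartz u ->
  `|u (x + h) - u x| <= `|h| * intR (fun s => `|derive1 u (x + s * h)| * \1_(`[0%R, 1%R]%classic) s).
Proof.
move=> su.
have du := smoothR_is_derive (rschwartz_smooth su).
have su' := rschwartz_derive su.
have d := derives_comp_line x h du.
have c : continuous (fun s : R => h * derive1 u (x + s * h)).
  move=> s; apply: cvgMr.
  exact: (derives_continuous (derives_comp_line x h (smoothR_is_derive (rschwartz_smooth su')))).
have mI : meas (\1_(`[0%R, 1%R]%classic) : R -> R) by apply: meas_indic; exact: measurable_itv.
have [M hM] := rschwartz_bounded su'.
have mu' : meas (fun s => derive1 u (x + s * h)).
  apply: meas_continuous.
  exact: (derives_continuous (derives_comp_line x h (smoothR_is_derive (rschwartz_smooth su')))).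
have I1 : integ (\1_(`[0%R, 1%R]%classic) : R -> R).
  have L1 : Lw (fun=> 1 : R) by apply: (@Lw_bounded _ _ 1); [exact: meas_cst|move=> y; rewrite normr1].
  have := @Lw_itv _ _ `[0%R, 1%R] 1 L1; rewrite /=.
  have h1 : forall y : R, y \in `[0%R, 1%R] -> `|y| <= 1.
    by move=> y; rewrite in_itv/= => /andP[y0 y1]; rewrite ger0_norm.
  by move=> /(_ h1); congr integ; apply/funext => y; rewrite mul1r.
have := FTC_derives ltr01 d c.
rewrite mul1r mul0r addr0 => <-.
rewrite RintegralE; last exact: measurable_itv.
have I2 : integ (fun s => `|derive1 u (x + s * h)| * \1_(`[0%R, 1%R]%classic) s).
  apply: (@integM_bounded _ _ _ M) => //; first exact: meas_norm.
  by move=> s; rewrite normr_id.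
rewrite -intRZ//; apply: norm_intR_le; last first.
- by move=> s; rewrite !normrM mulrA [`|\1__ _|]ger0_norm// indicE.
- exact: integZ.
apply: (@integM_bounded _ _ _ (`|h| * M)) => //; first exact: measZ.
by move=> s; rewrite normrM ler_wpM2l.
Qed.

Lemma intR_indic (A : set R) : measurable A -> intR (\1_A) = fine (mu A).
Proof. by move=> mA; rewrite /intR /Rintegral integral_indic// setIT. Qed.

(** Minkowski form of the fundamental theorem: average the derivative over the
    segment and exchange the integrals. *)
Lemma L1_increment u h : rschwartz u ->
  intR (fun x => `|u (x + h) - u x|) <= `|h| * intR (fun x => `|derive1 u x|).
Proof.
move=> su; have su' := rschwartz_derive su.
pose F x s : R := `|derive1 u (x + s * h)| * \1_(`[0%R, 1%R]%classic) s.
have mI : meas (\1_(`[0%R, 1%R]%classic) : R -> R) by apply: meas_indic; exact: measurable_itv.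
have [M hM] := rschwartz_bounded su'.
have I1 : integ (\1_(`[0%R, 1%R]%classic) : R -> R).
  have L1 : Lw (fun=> 1 : R) by apply: (@Lw_bounded _ _ 1); [exact: meas_cst|move=> y; rewrite normr1].
  have := @Lw_itv _ _ `[0%R, 1%R] 1 L1; rewrite /=.
  have h1 : forall y : R, y \in `[0%R, 1%R] -> `|y| <= 1.
    by move=> y; rewrite in_itv/= => /andP[y0 y1]; rewrite ger0_norm.
  by move=> /(_ h1); congr integ; apply/funext => y; rewrite mul1r.
have mF : meas2 F.
  apply: meas2M; last exact: meas2_2.
  apply: (@meas2_comp _ (fun y => `|derive1 u y|)); first by apply: meas_norm; exact: rschwartz_meas.
  apply: meas2D; first by apply: (@meas2_1 _ id); exact: measurable_id.
  by apply: (@meas2_2 _ (fun s => s * h)); apply: measM; [exact: measurable_id|exact: meas_cst].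
have N1 := integ_norm (rschwartz_integ su').
have F1 x : integ (F x).
  have m1 : meas (fun s => `|derive1 u (x + s * h)|).
    apply: meas_norm; apply: meas_continuous.
    exact: (derives_continuous (derives_comp_line x h (smoothR_is_derive (rschwartz_smooth su')))).
  by apply: (@integM_bounded _ _ _ M I1 m1) => s; rewrite normr_id.
have F2 s : integ (fun x => F x s).
  have := integZ (\1_(`[0%R, 1%R]%classic) s) (integ_shift (s * h) N1).
  by congr integ; apply/funext => x; rewrite mulrC.
pose c (s : R) := intR (fun x => `|derive1 u x|) * \1_(`[0%R, 1%R]%classic) s.
have E2 s : intR (fun x => F x s) = c s.
  rewrite /c -(intR_shift (s * h) N1) mulrC -intRZ; last exact: (integ_shift (s * h) N1).
  by congr intR; apply/funext => x; rewrite mulrC.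
have F0 x s : 0 <= F x s by rewrite mulr_ge0// indicE.
have hc s : intR (fun x => `|F x s|) <= c s.
  by rewrite -E2; apply: le_intR => // [|x]; [exact: integ_norm|rewrite ger0_norm].
have [J1 J2 E] := fubini mF F1 F2 (integZ (intR (fun x => `|derive1 u x|)) I1) hc.
apply: (@le_trans _ _ (intR (fun x => `|h| * intR (F x)))).
  apply: le_intR; last by move=> x; exact: increment_integral.
    exact: (integ_norm (integB (integ_shift h (rschwartz_integ su)) (rschwartz_integ su))).
  exact: integZ.
have -> := intRZ `|h| J1; apply: ler_wpM2l; first by [].
have {E} -> := E.
rewrite (_ : (fun y => intR (fun x => F x y)) = c); last exact: funext.
rewrite /c (intRZ _ I1) -[leRHS]mulr1 ler_wpM2l//; first exact: intR_ge0.
by rewrite intR_indic ?lebesgue_measure_itv/= ?lte_fin ?ltr01 ?sube0//; exact: measurable_itv.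
Qed.

(** The mean value theorem, with the weight moved from the intermediate point to
    [x] at the cost of powers of the increment. *)
Lemma pointwise_increment u a : rschwartz u ->
  exists2 C, 0 <= C & forall x h, `|x| ^+ a * `|u (x + h) - u x| <= C * (`|h| * (1 + `|h| ^+ a)).
Proof.
move=> su; have su' := rschwartz_derive su.
have [M hM] := rschwartz_bnd a su'; have [N hN] := rschwartz_bounded su'.
have M0 : 0 <= M by apply: le_trans (hM 0); rewrite mulr_ge0// exprn_ge0.
have N0 : 0 <= N by exact: le_trans (hN 0).
exists (2 ^+ a * (M + N)); first by rewrite mulr_ge0 ?exprn_ge0// addr_ge0.
move=> x h.
have du := smoothR_is_derive (rschwartz_smooth su).
have d := derives_comp_line x h du.
have [c /andP[c0 c1] E] : exists2 c, 0 <= c <= 1 & u (x + h) - u x = h * derive1 u (x + c * h).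
  have [|c] := @MVT_segment _ (fun s => u (x + s * h)) (fun s => h * derive1 u (x + s * h)) 0 1 ler01 (fun s _ => d s).
    by apply: continuous_subspaceT; exact: (derives_continuous d).
  rewrite in_itv/= subr0 mulr1 mul1r mul0r addr0 => c01 E.
  by exists c.
rewrite E normrM mulrCA [leRHS]mulrCA ler_wpM2l//.
have hx : `|x| <= `|x + c * h| + `|h|.
  rewrite -[in leLHS](addrK (c * h) x) (le_trans (ler_normB _ _))// lerD2l normrM ger0_norm//.
  by rewrite ler_piMl.
have hxa : `|x| ^+ a <= 2 ^+ a * (`|x + c * h| ^+ a + `|h| ^+ a).
  apply: (@le_trans _ _ ((2 * Num.max `|x + c * h| `|h|) ^+ a)).
    rewrite lerXn2r ?nnegrE ?mulr_ge0 ?le_max ?normr_ge0//.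
    apply: le_trans hx _; rewrite mulr_natl mulr2n lerD// le_max lexx// orbT//.
  rewrite exprMn ler_wpM2l ?exprn_ge0//.
  by case: (leP `|x + c * h| `|h|) => _; rewrite ?lerDr ?lerDl exprn_ge0.
apply: (@le_trans _ _ (2 ^+ a * (`|x + c * h| ^+ a + `|h| ^+ a) * `|derive1 u (x + c * h)|)).
  by rewrite ler_wpM2r.
rewrite -!mulrA ler_wpM2l ?exprn_ge0// mulrDl mulrDr mulr1.
have h1 := hM (x + c * h); have h2 := hN (x + c * h).
have h3 : `|h| ^+ a * `|derive1 u (x + c * h)| <= `|h| ^+ a * N by rewrite ler_wpM2l// exprn_ge0.
have h4 : 0 <= M * `|h| ^+ a by rewrite mulr_ge0// exprn_ge0.
have : `|x + c * h| ^+ a * `|derive1 u (x + c * h)| + `|h| ^+ a * `|derive1 u (x + c * h)| <= M + `|h| ^+ a * N.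
  exact: lerD.
by move=> /le_trans; apply; rewrite mulrDl; lra.
Qed.

End Translation.

Section Lowpass.
Context {R : realType}.
Notation mu := (@lebesgue_measure R).
Variable eta : R -> R[i].
Hypothesis se : schwartz eta.
Hypothesis eta0 : eta 0 = 1.
Implicit Types (phi psi : R -> R[i]).
Let K := ifourier eta.
Let sK : schwartz K. Proof. exact: schwartz_ifourier. Qed.

Let cinteg_shiftK phi x (t : R) : schwartz phi -> t != 0 -> cinteg (fun z => phi (x + t * z) * K z).
Proof.
move=> sp t0; have sx : schwartz (fun z => phi (x + t * z)).
  by have := schwartz_affine x t0 sp; apply: schwartz_eq => z; rewrite addrC.
exact: (schwartz_cinteg (schwartzM sx sK)).
Qed.

Lemma lowpass_subE phi t x : schwartz phi -> 0 < t ->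
  lowpass eta t phi x - phi x = cint (fun z => (phi (x + t * z) - phi x) * K z).
Proof.
move=> sp t0.
rewrite lowpassE// -[X in _ - X]mulr1 -eta0 -(cint_ifourier se) -/K.
rewrite -cintZ; last exact: schwartz_cinteg.
rewrite -cintB; [|by apply: cinteg_shiftK; rewrite ?gt_eqF|by apply: cintegZ; exact: schwartz_cinteg].
by congr cint; apply/funext => z; rewrite mulrBl.
Qed.

Let cinteg_incr phi x (t : R) : schwartz phi -> t != 0 -> cinteg (fun z => (phi (x + t * z) - phi x) * K z).
Proof.
move=> sp t0; have := cintegB (cinteg_shiftK x sp t0) (cintegZ (phi x) (schwartz_cinteg sK)).
by congr cinteg; apply/funext => z; rewrite mulrBl.
Qed.

(** The total variation of [phi], up to the choice of norm on the plane. *)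
Definition bvnorm phi : R := intR (fun x => `|derive1 (reF phi) x|) + intR (fun x => `|derive1 (imF phi) x|).

Lemma L1_increment_n1 phi h : schwartz phi ->
  intR (fun x => n1 (phi (x + h) - phi x)) <= `|h| * bvnorm phi.
Proof.
move=> /schwartzP[s1 s2].
have -> : (fun x => n1 (phi (x + h) - phi x)) =
  (fun x => `|reF phi (x + h) - reF phi x| + `|imF phi (x + h) - imF phi x|).
  by apply/funext => x; rewrite /n1 cReB cImB.
have I1 : integ (fun x => `|reF phi (x + h) - reF phi x|).
  exact: (integ_norm (integB (integ_shift h (rschwartz_integ s1)) (rschwartz_integ s1))).
have I2 : integ (fun x => `|imF phi (x + h) - imF phi x|).
  exact: (integ_norm (integB (integ_shift h (rschwartz_integ s2)) (rschwartz_integ s2))).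
by rewrite intRD// mulrDr lerD// L1_increment.
Qed.

Lemma integ_n1_schwartz phi : schwartz phi -> integ (fun x => n1 (phi x)).
Proof. by move=> sp; apply: integ_n1; exact: schwartz_cinteg. Qed.

Lemma Re_scale (r : R) (z : R[i]) : complex.Re (r%:C * z) = r * complex.Re z.
Proof. by rewrite cReM/= mul0r subr0. Qed.
Lemma Im_scale (r : R) (z : R[i]) : complex.Im (r%:C * z) = r * complex.Im z.
Proof. by rewrite cImM/= mul0r addr0. Qed.

Lemma integ_moment a phi : schwartz phi -> integ (fun z => `|z| ^+ a * n1 (phi z)).
Proof.
move=> sp.
have h : schwartz (fun z => (z ^+ a)%:C * phi z).
  elim: a => [|a IH]; first by apply: schwartz_eq sp => z; rewrite expr0 mul1r.
  have /schwartzP[s1 s2] := IH; apply/schwartzP; split.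
    have := rschwartz_mulx s1; congr rschwartz; apply/funext => z.
    by rewrite /reF !Re_scale exprS mulrA.
  have := rschwartz_mulx s2; congr rschwartz; apply/funext => z.
  by rewrite /imF !Im_scale exprS mulrA.
have := integ_n1_schwartz h; congr integ; apply/funext => z.
by rewrite /n1 Re_scale Im_scale !normrM normrX mulrDr.
Qed.

Definition momentK a : R := intR (fun z => `|z| ^+ a * n1 (K z)).

Lemma momentK_ge0 a : 0 <= momentK a.
Proof. by apply: intR_ge0 => z; rewrite mulr_ge0 ?exprn_ge0 ?n1_ge0. Qed.

(** Since the kernel has integral [eta 0 = 1], the error is an average of
    increments, each of which costs its length times the total variation. *)
Lemma lowpass_L1 phi t : schwartz phi -> 0 < t ->
  intR (fun x => n1 (lowpass eta t phi x - phi x)) <= t * (momentK 1 * bvnorm phi).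
Proof.
move=> sp t0; have tn0 : t != 0 by rewrite gt_eqF.
have [sp1 sp2] := (schwartzP _).1 sp; have [sk1 sk2] := (schwartzP _).1 sK.
pose F x z : R := n1 (phi (x + t * z) - phi x) * n1 (K z).
have F0 x z : 0 <= F x z by rewrite mulr_ge0// n1_ge0.
have mS (f : R -> R) : meas f -> meas2 (fun x z : R => f (x + t * z)).
  move=> mf; apply: meas2_comp => //; apply: meas2D.
    by apply: (@meas2_1 _ id); exact: measurable_id.
  by apply: (@meas2_2 _ (fun s => t * s)); apply: measZ; exact: measurable_id.
have mD (f : R -> R) : meas f -> meas2 (fun x z : R => `|f (x + t * z) - f x|).
  move=> mf; apply: (@meas2_comp _ (fun x => `|x|)); first exact: normr_measurable.
  by apply: meas2D; [exact: mS|apply: meas2N; exact: meas2_1].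
have mF : meas2 F.
  apply: meas2M.
    have := meas2D (mD _ (rschwartz_meas sp1)) (mD _ (rschwartz_meas sp2)).
    by congr meas2; apply/funext => x; apply/funext => z; rewrite /n1 cReB cImB.
  apply: (@meas2_2 _ (fun z => n1 (K z))).
  by apply: measD; apply: meas_norm; exact: rschwartz_meas.
have F1 x : integ (F x).
  have [M hM] := rschwartz_bounded sp1; have [N hN] := rschwartz_bounded sp2.
  apply: (integ_dom _ (integZ (2 * (M + N)) (integ_n1_schwartz sK))); first exact: meas2_section.
  move=> z; rewrite ger0_norm// /F ler_wpM2r ?n1_ge0//.
  apply: le_trans (n1B _ _) _; rewrite mulr_natl mulr2n /n1.
  by apply: lerD; apply: lerD; [exact: hM|exact: hN|exact: hM|exact: hN].
have F2 z : integ (fun x => F x z).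
  have := integZ (n1 (K z)) (integ_n1 (cintegB (schwartz_cinteg (schwartz_affine (t * z) (oner_neq0 _) sp)) (schwartz_cinteg sp))).
  by congr integ; apply/funext => x; rewrite /F mul1r mulrC.
pose c z := t * bvnorm phi * (`|z| ^+ 1 * n1 (K z)).
have hc z : intR (fun x => `|F x z|) <= c z.
  have -> : (fun x => `|F x z|) = (fun x => n1 (K z) * n1 (phi (x + t * z) - phi x)).
    by apply/funext => x; rewrite ger0_norm// /F mulrC.
  rewrite intRZ; last first.
    have := integ_n1 (cintegB (schwartz_cinteg (schwartz_affine (t * z) (oner_neq0 _) sp)) (schwartz_cinteg sp)).
    by congr integ; apply/funext => x; rewrite mul1r.
  have -> : c z = n1 (K z) * (`|t * z| * bvnorm phi).
    by rewrite /c normrM gtr0_norm// expr1; ring.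
  by rewrite ler_wpM2l ?n1_ge0// L1_increment_n1.
have [J1 J2 E] := fubini mF F1 F2 (integZ _ (integ_moment 1 sK)) hc.
apply: (@le_trans _ _ (intR (fun x => intR (F x)))).
  apply: le_intR; [exact: (integ_n1_schwartz (schwartzB (schwartz_lowpass se tn0 sp) sp))|exact: J1|].
  move=> x; rewrite (lowpass_subE x sp t0).
  have ci := cinteg_incr x sp tn0.
  apply: le_trans (n1_cint ci) _; apply: le_intR; [exact: integ_n1|exact: F1|].
  by move=> z; exact: n1M.
have {E} -> := E.
apply: (@le_trans _ _ (intR c)).
  apply: le_intR; [exact: J2|exact: (integZ _ (integ_moment 1 sK))|].
  move=> z; apply: le_trans (hc z); apply: le_intR; [exact: (F2 z)|exact: (integ_norm (F2 z))|].
  by move=> x; rewrite ler_norm.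
rewrite /c (intRZ _ (integ_moment 1 sK)).
by rewrite /momentK; lra.
Qed.

Lemma schwartz_cderiv n phi : schwartz phi -> schwartz (cderiv n phi).
Proof.
move=> sp; suff : forall u : R -> R, rschwartz u -> rschwartz (derive1n n u).
  by move=> h; have /schwartzP[s1 s2] := sp; apply/schwartzP; split; exact: h.
move=> u su; elim: n => [|n IH]; first by rewrite derive1n0.
by rewrite derive1nS; exact: rschwartz_derive.
Qed.

Lemma cderivS n phi : cderiv n.+1 phi = cderiv 1 (cderiv n phi).
Proof.
by apply/funext => x; rewrite /cderiv !derive1nS !derive1n0.
Qed.

Lemma cderiv0 phi : cderiv 0 phi = phi.
Proof. by apply/funext => x; rewrite /cderiv !derive1n0; apply: ceq_reim. Qed.

Lemma cderiv1_lowpass phi t : schwartz phi -> 0 < t ->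
  cderiv 1 (lowpass eta t phi) = lowpass eta t (cderiv 1 phi).
Proof.
move=> sp t0; have tn0 : t != 0 by rewrite gt_eqF.
have sp' := schwartz_cderiv 1 sp.
have [p1 p2] := (schwartzP _).1 sp; have [q1 q2] := (schwartzP _).1 sp'.
have [M hM] := rschwartz_bounded q1; have [N hN] := rschwartz_bounded q2.
have d1 : derives (reF phi) (reF (cderiv 1 phi)).
  by apply: derives_eq (smoothR_is_derive (rschwartz_smooth p1)) _ => x; rewrite -derive1n1.
have d2 : derives (imF phi) (imF (cderiv 1 phi)).
  by apply: derives_eq (smoothR_is_derive (rschwartz_smooth p2)) _ => x; rewrite -derive1n1.
have ds u v z : derives u v -> derives (fun x : R => u (x + t * z)) (fun x => v (x + t * z)).
  move=> d; have := is_derive_affine 1 (t * z) d; rewrite -[X in X -> _]/(derives _ _).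
  have -> : (fun x => u (1 * x + t * z)) = (fun x : R => u (x + t * z)) by apply/funext => x; rewrite mul1r.
  by move=> e; apply: derives_eq e _ => x; rewrite !mul1r.
have bnd x z : n1 (cderiv 1 phi (x + t * z) * K z) <= (M + N) * n1 (K z).
  apply: le_trans (n1M _ _) _; rewrite ler_wpM2r ?n1_ge0// /n1 lerD//.
    exact: hM.
  exact: hN.
have IG := integZ (M + N) (integ_n1_schwartz sK).
have l1 : derives (reF (lowpass eta t phi)) (reF (lowpass eta t (cderiv 1 phi))).
  apply: (@derives_ext _ (fun x => intR (fun z => complex.Re (phi (x + t * z) * K z)))
    (fun x => intR (fun z => complex.Re (cderiv 1 phi (x + t * z) * K z)))).
  - by move=> x; rewrite /reF (lowpassE se t0 sp).
  - by move=> x; rewrite /reF (lowpassE se t0 sp').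
  apply: (derives_intR _ _ _ IG).
  - by move=> x; have [] := cinteg_shiftK x sp tn0.
  - move=> z.
    have -> : (fun x => complex.Re (phi (x + t * z) * K z)) =
      (fun x => complex.Re (K z) * reF phi (x + t * z) + - complex.Im (K z) * imF phi (x + t * z)).
      by apply/funext => x; rewrite cReM /reF /imF; ring.
    apply: derives_eq; first by apply: derivesD; apply: derivesZ; apply: ds; [exact: d1|exact: d2].
    by move=> x; rewrite cReM /reF /imF; ring.
  - by move=> x z; apply: le_trans (Re_n1 _) (bnd x z).
have l2 : derives (imF (lowpass eta t phi)) (imF (lowpass eta t (cderiv 1 phi))).
  apply: (@derives_ext _ (fun x => intR (fun z => complex.Im (phi (x + t * z) * K z)))
    (fun x => intR (fun z => complex.Im (cderiv 1 phi (x + t * z) * K z)))).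
  - by move=> x; rewrite /imF (lowpassE se t0 sp).
  - by move=> x; rewrite /imF (lowpassE se t0 sp').
  apply: (derives_intR _ _ _ IG).
  - by move=> x; have [] := cinteg_shiftK x sp tn0.
  - move=> z.
    have -> : (fun x => complex.Im (phi (x + t * z) * K z)) =
      (fun x => complex.Im (K z) * reF phi (x + t * z) + complex.Re (K z) * imF phi (x + t * z)).
      by apply/funext => x; rewrite cImM /reF /imF; ring.
    apply: derives_eq; first by apply: derivesD; apply: derivesZ; apply: ds; [exact: d1|exact: d2].
    by move=> x; rewrite cImM /reF /imF; ring.
  - by move=> x z; apply: le_trans (Im_n1 _) (bnd x z).
apply/funext => x; apply: ceq_reim.
  by rewrite {1}/cderiv !derive1n1 (is_derive_derive1 l1).
by rewrite {1}/cderiv !derive1n1 (is_derive_derive1 l2).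
Qed.

Lemma cderiv_lowpass n phi t : schwartz phi -> 0 < t ->
  cderiv n (lowpass eta t phi) = lowpass eta t (cderiv n phi).
Proof.
move=> sp t0; elim: n => [|n IH]; first by rewrite !cderiv0.
by rewrite cderivS IH (cderiv1_lowpass (schwartz_cderiv n sp) t0) -cderivS.
Qed.

(** All Schwartz seminorms of the error are [O(t)], because the moments of the
    kernel are finite. *)
Lemma lowpass_weighted a phi : schwartz phi -> exists2 C, 0 <= C &
  forall t x, 0 < t <= 1 -> `|x| ^+ a * n1 (lowpass eta t phi x - phi x) <= C * t.
Proof.
move=> sp; have [p1 p2] := (schwartzP _).1 sp.
have [C C0 hC] := pointwise_increment a p1; have [D D0 hD] := pointwise_increment a p2.
exists ((C + D) * (momentK 1 + momentK a.+1)).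
  by rewrite mulr_ge0 ?addr_ge0 ?momentK_ge0.
move=> t x /andP[t0 t1]; have tn0 : t != 0 by rewrite gt_eqF.
rewrite (lowpass_subE x sp t0); have ci := cinteg_incr x sp tn0.
apply: (@le_trans _ _ (`|x| ^+ a * intR (fun z => n1 ((phi (x + t * z) - phi x) * K z)))).
  by rewrite ler_wpM2l ?exprn_ge0// n1_cint.
rewrite -(intRZ _ (integ_n1 ci)).
have IG := integD (integ_moment 1 sK) (integ_moment a.+1 sK).
rewrite mulrAC /momentK -(intRD (integ_moment 1 sK) (integ_moment a.+1 sK)).
rewrite -(intRZ _ IG); apply: le_intR; [exact: (integZ _ (integ_n1 ci))|exact: (integZ _ IG)|].
move=> z; apply: (@le_trans _ _ (`|x| ^+ a * (n1 (phi (x + t * z) - phi x) * n1 (K z)))).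
  by rewrite ler_wpM2l ?exprn_ge0// n1M.
rewrite mulrA -[X in _ <= _ * X]mulrDl [leRHS]mulrA ler_wpM2r ?n1_ge0//.
rewrite /n1 cReB cImB mulrDr.
apply: le_trans (lerD (hC x (t * z)) (hD x (t * z))) _.
rewrite -mulrDl -mulrA ler_wpM2l ?addr_ge0//.
rewrite normrM gtr0_norm// -mulrA ler_wpM2l ?(ltW t0)//.
rewrite mulrDr mulr1 expr1 exprS lerD2l ler_wpM2l// exprMn ler_piMl ?exprn_ge0//.
by rewrite exprn_ile1// ltW.
Qed.

Lemma cderivB n phi psi : schwartz phi -> schwartz psi ->
  cderiv n (fun x => phi x - psi x) = (fun x => cderiv n phi x - cderiv n psi x).
Proof.
move=> /schwartzP[a1 a2] /schwartzP[b1 b2].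
have h (u v : R -> R) : rschwartz u -> rschwartz v ->
    derive1n n (fun x => u x - v x) = (fun x => derive1n n u x - derive1n n v x).
  move=> su sv; elim: n => [|n IH]; first by rewrite !derive1n0.
  rewrite derive1nS IH; apply: is_derive_derive1.
  have d1 := derives_derive1n n (rschwartz_smooth su).
  have d2 := derives_derive1n n (rschwartz_smooth sv).
  move=> x; exact: is_deriveB.
apply/funext => x; apply: ceq_reim.
  rewrite cReB /cderiv/= -[RHS]/((fun x => derive1n n (reF phi) x - derive1n n (reF psi) x) x) -h//.
  by congr (derive1n n _ x); apply/funext => y; rewrite /reF cReB.
rewrite cImB /cderiv/= -[RHS]/((fun x => derive1n n (imF phi) x - derive1n n (imF psi) x) x) -h//.
by congr (derive1n n _ x); apply/funext => y; rewrite /imF cImB.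
Qed.

Lemma tempered_small (T : functional R) (P : R -> R -> R[i]) : tempered T ->
  (forall t, 0 < t <= 1 -> schwartz (P t)) ->
  (forall a b, exists C, forall t x, 0 < t <= 1 -> `|x| ^+ a * cmod (cderiv b (P t) x) <= C * t) ->
  exists C, forall t, 0 < t <= 1 -> cmod (T (P t)) <= C * t.
Proof.
move=> [_ _ [M [N hT]]] sP hP.
have /choice[C hC] : forall ab : nat * nat, exists C, forall t x, 0 < t <= 1 ->
   `|x| ^+ ab.1 * cmod (cderiv ab.2 (P t) x) <= C * t by move=> [a b]; exact: hP.
exists (`|M| * \sum_(a < N) \sum_(b < N) C (val a, val b)) => t t01.
rewrite -lee_fin; apply: le_trans (hT _ (sP t t01)) _.
have S0 : (0 <= \sum_(a < N) \sum_(b < N) schwartz_seminorm a b (P t))%E.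
  apply: sume_ge0 => a _; apply: sume_ge0 => b _.
  apply: le_trans (ereal_sup_ubound _); last by exists 0.
  by rewrite lee_fin mulr_ge0 ?exprn_ge0// cmod_ge0.
apply: (@le_trans _ _ (`|M|%:E * \sum_(a < N) \sum_(b < N) schwartz_seminorm a b (P t))%E).
  by apply: lee_wpmul2r => //; rewrite lee_fin ler_norm.
rewrite -mulrA EFinM; apply: lee_wpmul2l; first by rewrite lee_fin.
rewrite mulr_suml -sumEFin; apply: lee_sum => a _.
rewrite mulr_suml -sumEFin; apply: lee_sum => b _.
by apply: ge_ereal_sup => _ [x _ <-]; rewrite lee_fin; exact: (hC (val a, val b)).
Qed.

Lemma temperedB (T : functional R) phi psi : tempered T -> schwartz phi -> schwartz psi ->
  T (fun x => phi x - psi x) = T phi - T psi.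
Proof.
move=> [_ hT _] s1 s2; have := hT (-1) psi phi s2 s1.
by rewrite mulN1r addrC => <-; congr T; apply/funext => x; rewrite mulN1r addrC.
Qed.

(** The convergence of the filtered test functions in the Schwartz topology, with
    a rate; continuity of [T] does the rest. *)
Lemma tempered_lowpass (T : functional R) phi : tempered T -> schwartz phi ->
  exists C, forall t, 0 < t <= 1 -> cmod (T (lowpass eta t phi) - T phi) <= C * t.
Proof.
move=> tT sp.
have sl t : 0 < t <= 1 -> schwartz (lowpass eta t phi).
  by move=> /andP[t0 _]; apply: schwartz_lowpass => //; rewrite gt_eqF.
have [|a b|C hC] := tempered_small (P := fun t x => lowpass eta t phi x - phi x) tT.
- by move=> t t01; exact: (schwartzB (sl t t01) sp).
- have sb := schwartz_cderiv b sp.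
  have [C C0 hC] := lowpass_weighted a sb; exists C => t x t01.
  have t0 : 0 < t by case/andP: t01.
  rewrite (cderivB b (sl t t01) sp) (cderiv_lowpass b sp t0).
  by apply: le_trans (hC t x t01); rewrite ler_wpM2l ?exprn_ge0// cmod_n1.
exists C => t t01; rewrite -(temperedB tT (sl t t01) sp).
exact: hC.
Qed.

End Lowpass.

(** * Smoothed indicator functions *)

Section Cutoff.
Context {R : realType}.
Variable eta : R -> R[i].
Hypothesis heta : lp_cutoff eta.

Lemma lp_cutoff_out x : 3 / 4 <= `|x| -> eta x = 0.
Proof.
move=> hx; have [_ h _] := heta; apply/eqP; apply: contraT => ne.
have : closure [set xi | eta xi != 0] x by exact: subset_closure.
by move=> /h /=; rewrite ltNge hx.
Qed.

Lemma lp_cutoff0 : eta 0 = 1.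
Proof. by have [_ _ ->//] := heta; rewrite normr0 divr_ge0. Qed.

Lemma lp_cutoff_schwartz : schwartz eta.
Proof.
have [sm _ _] := heta; apply/schwartzP; split; apply: (@smooth_supp_rschwartz _ _ (3 / 4)).
- by move=> n x; have [] := sm n x.
- by move=> x /ltW /lp_cutoff_out; rewrite /reF => ->.
- by move=> n x; have [] := sm n x.
- by move=> x /ltW /lp_cutoff_out; rewrite /imF => ->.
Qed.

End Cutoff.

Section Bump.
Context {R : realType}.
Notation mu := (@lebesgue_measure R).
Variable eta : R -> R[i].
Hypothesis heta : lp_cutoff eta.

Let bump0 (x : R) : R := reF eta x * reF eta x.

Let rschwartz_bump0 : rschwartz bump0.
Proof. by apply: rschwartzM; exact: schwartz_re (lp_cutoff_schwartz heta). Qed.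

Let bump0_int : 1 <= intR bump0.
Proof.
have <- : intR (\1_(`[- 2^-1, 2^-1]%classic) : R -> R) = 1.
  rewrite intR_indic; last exact: measurable_itv.
  rewrite lebesgue_measure_itv/= lte_fin gtrN// -EFinD/=; lra.
have Lf : Lw (fun=> 1 : R) by apply: (@Lw_bounded _ _ 1); [exact: meas_cst|move=> y; rewrite normr1].
apply: le_intR; last 2 first.
- exact: rschwartz_integ.
- move=> x; rewrite indicE mem_setE; case: (boolP (x \in _)) => [xI|_]; last first.
    by rewrite /bump0 -expr2 sqr_ge0.
  have [_ _ h] := heta; rewrite /bump0 /reF h ?mulr1//=.
  by move: xI; rewrite in_itv/= -ler_norml div1r.
have := @Lw_itv _ _ `[- 2^-1, 2^-1] 1 Lf.
have h1 : forall y : R, y \in `[- 2^-1, 2^-1] -> `|y| <= 1.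
  by move=> y; rewrite in_itv/= -ler_norml => /le_trans; apply; lra.
by move=> /(_ h1); congr integ; apply/funext => y; rewrite mul1r.
Qed.

(** The square of the real part of the cutoff, normalised: a smooth nonnegative
    bump supported in [[-1, 1]].  Its integral is positive because the cutoff is 1 near 0. *)
Definition rho (x : R) : R := (intR bump0)^-1 * bump0 x.

Lemma rschwartz_rho : rschwartz rho. Proof. exact: rschwartzZ. Qed.

Lemma rho_ge0 x : 0 <= rho x.
Proof.
apply: mulr_ge0; first by rewrite invr_ge0; exact: le_trans ler01 bump0_int.
by rewrite /bump0 -expr2 sqr_ge0.
Qed.

Lemma rho_out x : 1 <= `|x| -> rho x = 0.
Proof.
move=> hx; rewrite /rho /bump0 /reF (lp_cutoff_out heta)/= ?mulr0//.
by apply: le_trans hx; lra.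
Qed.

Lemma intR_rho : intR rho = 1.
Proof.
rewrite (intRZ _ (rschwartz_integ rschwartz_bump0)) mulVf// gt_eqF//.
exact: lt_le_trans ltr01 bump0_int.
Qed.

Lemma integ_rho : integ rho. Proof. exact: rschwartz_integ rschwartz_rho. Qed.

Definition rstep (x : R) : R := Rintegral mu `]-oo, x]%classic rho.

Lemma rstepE x : rstep x = intR (fun y => rho y * \1_(`]-oo, x]%classic) y).
Proof. by apply: RintegralE; exact: measurable_itv. Qed.

Lemma derives_rstep : derives rstep rho.
Proof.
move=> x.
have xx1 : x < x + 1 by rewrite ltrDl.
have Ir : mu.-integrable `]-oo, x + 1] (EFin \o rho) by exact: integrableS integ_rho.
have cr : {for x, continuous rho} by exact: (rschwartz_continuous rschwartz_rho).
have [d e] := @continuous_FTC1 R rho -oo%O x (x + 1) xx1 Ir (ltNyr x) cr.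
by apply: DeriveDef; [exact: d|rewrite -derive1E e].
Qed.

Let integ_rstep x : integ (fun y => rho y * \1_(`]-oo, x]%classic) y).
Proof.
have := integM_bounded integ_rho (meas_indic (measurable_itv `]-oo, x])) (@indic_bnd R _).
by congr integ; apply/funext => y; rewrite mulrC.
Qed.

Lemma rstep_ge0 x : 0 <= rstep x.
Proof. by rewrite rstepE; apply: intR_ge0 => y; rewrite mulr_ge0 ?rho_ge0// indicE. Qed.

Lemma rstep_le1 x : rstep x <= 1.
Proof.
rewrite rstepE -intR_rho; apply: le_intR => //; first exact: integ_rho.
by move=> y; rewrite ler_piMr ?rho_ge0// indicE; case: (_ \in _).
Qed.

Lemma rstep_left x : x <= -1 -> rstep x = 0.
Proof.
move=> hx; rewrite rstepE -[RHS](@intR_cst0 R); congr intR; apply/funext => y.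
rewrite indicE mem_setE in_itv/=; case: (leP y x) => [yx|_]; last by rewrite mulr0.
by rewrite rho_out ?mul0r// ler_normr; apply/orP; right; lra.
Qed.

Lemma rstep_right x : 1 <= x -> rstep x = 1.
Proof.
move=> hx; rewrite rstepE -[RHS]intR_rho; congr intR; apply/funext => y.
rewrite indicE mem_setE in_itv/=; case: (leP y x) => [_|xy]; first by rewrite mulr1.
by rewrite rho_out ?mul0r// ler_normr; apply/orP; left; lra.
Qed.

Lemma smoothR_derives (u v : R -> R) : derives u v -> smoothR v -> smoothR u.
Proof.
move=> duv sv; case=> [|n] x.
  by rewrite derive1n0; exact: (@ex_derive _ _ _ _ _ _ _ (duv x)).
by rewrite derive1Sn (is_derive_derive1 duv); exact: sv.
Qed.

(** The rescaled bump, of mass 1 and concentrated at distance [1 / (n + 1)] from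
    [a]. *)
Definition moll (n : nat) (a x : R) : R := n.+1%:R * rho (n.+1%:R * x + - (n.+1%:R * a)).

(** A smoothed indicator function of [[a, b[], written as a difference of two
    smoothed steps so that it is additive in the interval for every fixed [n]. *)
Definition sindr (a b : R) (n : nat) (x : R) : R :=
  rstep (n.+1%:R * x + - (n.+1%:R * a)) - rstep (n.+1%:R * x + - (n.+1%:R * b)).

Let nS0 n : n.+1%:R != 0 :> R. Proof. by rewrite pnatr_eq0. Qed.

Lemma rschwartz_moll n a : rschwartz (moll n a).
Proof. by apply: rschwartzZ; exact: rschwartz_affine (nS0 n) rschwartz_rho. Qed.

Lemma intR_moll n a : intR (moll n a) = 1.
Proof.
rewrite /moll intRZ; last exact: integ_affine (nS0 n) integ_rho.
by rewrite (intR_affine _ (nS0 n) integ_rho) intR_rho mulr1 ger0_norm// mulfV.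
Qed.

Lemma moll_ge0 n a x : 0 <= moll n a x.
Proof. by rewrite mulr_ge0// rho_ge0. Qed.

Lemma moll_out n a x : n.+1%:R^-1 <= `|x - a| -> moll n a x = 0.
Proof.
move=> h; rewrite /moll rho_out ?mulr0// -mulrBr normrM [`|n.+1%:R|]ger0_norm//.
by rewrite -ler_pdivrMl ?ltr0n// mulr1.
Qed.

Lemma derives_sindr a b n : derives (sindr a b n) (fun x => moll n a x - moll n b x).
Proof.
have h c : derives (fun x => rstep (n.+1%:R * x + - (n.+1%:R * c))) (moll n c).
  exact: (is_derive_affine _ _ derives_rstep).
by move=> x; apply: is_deriveB; exact: h.
Qed.

Lemma sindrD a b c n x : sindr a b n x + sindr b c n x = sindr a c n x.
Proof. by rewrite /sindr addrA subrK. Qed.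

Lemma sindr_bnd a b n x : `|sindr a b n x| <= 2.
Proof.
rewrite (le_trans (ler_normB _ _))// -[2]/(1 + 1 : R) lerD// ger0_norm ?rstep_ge0 ?rstep_le1//.
Qed.

Lemma sindr_out a b n x : `|a| + `|b| + 1 < `|x| -> sindr a b n x = 0.
Proof.
move=> hx; rewrite /sindr.
have n1 : 1 <= n.+1%:R :> R by rewrite ler1n.
have a1 := ler_norm a; have a2 := ler_norm (- a); have b1 := ler_norm b; have b2 := ler_norm (- b).
rewrite !normrN in a2 b2.
have a0 := normr_ge0 a; have b0 := normr_ge0 b.
case: (lerP 0 x) => x0.
  rewrite (ger0_norm x0) in hx.
  rewrite !rstep_right ?subrr// -mulrBr.
    have : 1 <= x - b by lra.
    by move=> h; nra.
  have : 1 <= x - a by lra.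
  by move=> h; nra.
rewrite (ltr0_norm x0) in hx.
have hN (y : R) : y <= -1 -> n.+1%:R * y <= -1.
  move=> y1; have : 0 <= (n.+1%:R - 1) * (- y - 1) by rewrite mulr_ge0//; lra.
  by lra.
rewrite !rstep_left ?subrr// -mulrBr.
  have : x - b <= -1 by lra.
  exact: hN.
have : x - a <= -1 by lra.
exact: hN.
Qed.

Lemma rschwartz_sindr a b n : rschwartz (sindr a b n).
Proof.
apply: (@smooth_supp_rschwartz _ _ (`|a| + `|b| + 1)); last by move=> x; exact: sindr_out.
apply: smoothR_derives (derives_sindr a b n) _; apply: rschwartz_smooth.
by apply: rschwartzB; exact: rschwartz_moll.
Qed.

(** The derivative is a difference of two bumps of mass 1.  Uniformity in [n] is
    what makes the domination in [pair_indic_cvg] possible. *)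
Lemma sindr_bv a b n : intR (fun x => `|derive1 (sindr a b n) x|) <= 2.
Proof.
rewrite (is_derive_derive1 (derives_sindr a b n)).
have Ia := rschwartz_integ (rschwartz_moll n a); have Ib := rschwartz_integ (rschwartz_moll n b).
have -> : 2 = intR (fun x => moll n a x + moll n b x).
  by rewrite intRD// !intR_moll.
apply: le_intR; [exact: integ_norm (integB Ia Ib)|exact: integD|].
move=> x; apply: le_trans (ler_normB _ _) _.
by rewrite !ger0_norm ?moll_ge0.
Qed.

Lemma near_large (c : R) : 0 < c -> \forall n \near \oo, 1 <= n.+1%:R * c.
Proof.
move=> c0; near=> n; rewrite -ler_pdivrMr// (@le_trans _ _ n%:R)//; last by rewrite ler_nat.
by rewrite (le_trans (ler_norm _))//; near: n; exact: nbhs_infty_ger.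
Unshelve. all: by end_near. Qed.

Lemma rstep_cvg1 x a : a < x -> rstep (n.+1%:R * x + - (n.+1%:R * a)) @[n --> \oo] --> (1 : R).
Proof.
move=> ax; apply: cvg_near_cst; have xa : 0 < x - a by rewrite subr_gt0.
by move: (near_large xa); apply: filterS => n h; rewrite rstep_right// -mulrBr.
Qed.

Lemma rstep_cvg0 x a : x < a -> rstep (n.+1%:R * x + - (n.+1%:R * a)) @[n --> \oo] --> (0 : R).
Proof.
move=> ax; apply: cvg_near_cst; have xa : 0 < a - x by rewrite subr_gt0.
move: (near_large xa); apply: filterS => n h; rewrite rstep_left//.
by rewrite -mulrBr -[x - a]opprB mulrN lerN2.
Qed.

Lemma sindr_cvg a b x : a <= b -> x != a -> x != b ->
  sindr a b n x @[n --> \oo] --> (\1_(`[a, b[%classic) x : R).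
Proof.
move=> ab xa xb; rewrite indicE mem_setE in_itv/=.
case: (ltgtP a x) xa => [ax _|ax _|//].
- case: (ltgtP x b) xb => [xb _|xb _|//].
    by rewrite -[X in _ --> X]subr0; apply: cvgB; [exact: rstep_cvg1|exact: rstep_cvg0].
  by rewrite -[X in _ --> X](subrr 1); apply: cvgB; exact: rstep_cvg1.
- rewrite /= -[X in _ --> X](subrr 0); apply: cvgB; first exact: rstep_cvg0.
  by apply: rstep_cvg0; exact: lt_le_trans ab.
Qed.

Lemma ae_neq (a : R) : {ae mu, forall x, x != a}.
Proof.
exists [set a]; split; [exact: measurable_set1|exact: lebesgue_measure_set1|].
by move=> x /= /negP; rewrite negbK => /eqP.
Qed.

Lemma intR_sindr_cvg f a b : a <= b -> Lw f ->
  intR (fun x => f x * sindr a b n x) @[n --> \oo] --> intR (fun x => f x * \1_(`[a, b[%classic) x).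
Proof.
move=> ab Lf; set A := `|a| + `|b| + 1.
have IG : integ (fun x => 2 * (`|f x| * \1_(`[- A, A]%classic) x)).
  apply: integZ; apply: (@Lw_itv _ _ `[- A, A] A (Lw_norm Lf)).
  by move=> x; rewrite in_itv/= -ler_norml.
have [||||_ h] := @dct R (fun n x => f x * sindr a b n x) (fun x => f x * \1_(`[a, b[%classic) x) _ _ _ IG; last exact: h.
- by move=> n; apply: measM; [exact: Lf.1|exact: rschwartz_meas (rschwartz_sindr a b n)].
- by apply: measM; [exact: Lf.1|apply: meas_indic; exact: measurable_itv].
- apply: aeS (aeI (ae_neq a) (ae_neq b)) => x [xa xb].
  by apply: cvgMr; exact: sindr_cvg.
- move=> n x; rewrite normrM; have [Ax|xA] := ltP A `|x|.
    by rewrite sindr_out// normr0 mulr0 mulr_ge0// mulr_ge0// indicE.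
  rewrite indicE mem_set/=; last by rewrite in_itv/= -ler_norml.
  by rewrite mulr1 mulrC ler_wpM2r// sindr_bnd.
Qed.

(** The bump is bounded by a multiple of the normalised indicator function of a ball
    around [x], so the error is at most a multiple of the average oscillation of [f] there. *)
Lemma moll_cvg f x : Lw f -> lebesgue_pt f x ->
  intR (fun y => f y * moll n x y) @[n --> \oo] --> f x.
Proof.
move=> Lf hx.
have [M hM] := rschwartz_bounded rschwartz_rho.
have M0 : 0 <= M by exact: le_trans (hM 0).
pose r (n : nat) : R := n.+1%:R^-1.
have r0 n : 0 < r n by rewrite invr_gt0.
have Lc : Lw (fun y => f y - f x).
  have := LwD Lf (@Lw_bounded _ (fun=> - f x) `|f x| (@meas_cst _ _) _); apply.
  by move=> y; rewrite normrN.
have Ln := Lw_norm Lc.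
have Iball n : integ (fun y => `|f y - f x| * \1_(ball x (r n)) y).
  apply: (@Lw_mul_supp _ _ _ (`|x| + r n) 1) => //.
  - by apply: meas_indic; exact: measurable_ball.
  - by move=> y; exact: indic_bnd.
  - move=> y hy; rewrite indicE memNset//= /ball/= => h.
    have := ler_normB x (x - y); rewrite subKr => h2.
    have := lt_le_trans hy h2; rewrite ltrD2l => /lt_trans /(_ h).
    by rewrite ltxx.
pose D n := fine (davg f x (r n)).
have DE n : intR (fun y => `|f y - f x| * \1_(ball x (r n)) y) = 2 * r n * D n.
  rewrite -RintegralE; last exact: measurable_ball.
  rewrite /D /davg /iavg /Rintegral.
  rewrite (lebesgue_measure_ball _ (ltW (r0 n))).
  set I := (\int[_]_(y in _) _)%E.
  have fI : I \is a fin_num.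
    apply: integrable_fin_num; first exact: measurable_ball.
    apply/integrable_mkcond; first exact: measurable_ball.
    have := Iball n; rewrite /integ; congr (integrable _ _ _).
    apply/funext => y; rewrite /= patchE indicE; case: (y \in _) => /=; rewrite ?mulr1 ?mulr0//.
  have -> : (r n *+ 2)%:E^-1%E = ((r n *+ 2)^-1)%:E by rewrite inver mulrn_eq0/= gt_eqF.
  by rewrite fineM// /= -[r n *+ 2]mulr_natl mulVKf// mulf_neq0// gt_eqF.
have cD : D n @[n --> \oo] --> (0 : R).
  apply: fine_cvg.
  have cr : r n @[n --> \oo] --> (0 : R)^'+.
    have h0 : r n @[n --> \oo] --> (0 : R) by exact: cvg_harmonic.
    move=> U hU; have hn : \forall n \near \oo, 0 < r n -> U (r n) := h0 _ hU.
    suff : \forall n \near \oo, U (r n) by [].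
    by move: hn; apply: filterS => n h; exact: (h (r0 n)).
  exact: (cvg_comp _ _ cr hx).
have If n : integ (fun y => f y * moll n x y) by exact: Lw_rschwartz Lf (rschwartz_moll n x).
have Ifx n : integ (fun y => f x * moll n x y) by exact: integZ (rschwartz_integ (rschwartz_moll n x)).
have E n : intR (fun y => f y * moll n x y) - f x = intR (fun y => (f y - f x) * moll n x y).
  rewrite -{1}[f x]mulr1 -(intR_moll n x) -intRZ; last exact: rschwartz_integ (rschwartz_moll n x).
  rewrite -intRB//; congr intR; apply/funext => y; by rewrite mulrBl.
apply: cvg_zero.
rewrite (_ : _ - _ = (fun n => intR (fun y => (f y - f x) * moll n x y))); last first.
  by apply/funext => n; exact: E.
apply: norm_cvg0.
apply: (@squeeze_cvgr _ _ _ _ (cst 0) (fun n => 2 * M * D n)).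
- apply: nearW => n; rewrite normr_ge0/=.
  have -> : 2 * M * D n = n.+1%:R * M * intR (fun y => `|f y - f x| * \1_(ball x (r n)) y).
    by rewrite DE /r; move: (D n) (nS0 n); move: (n.+1%:R : R) => N d N0; field.
  rewrite -intRZ//; apply: norm_intR_le; [exact: Lw_rschwartz Lc (rschwartz_moll n x)|exact: integZ|].
  move=> y; rewrite normrM mulrCA ler_wpM2l//.
  rewrite indicE; case: (boolP (y \in _)) => [_|].
    rewrite mulr1 /moll normrM ger0_norm// ler_wpM2l//.
  rewrite notin_setE /ball/= => /negP; rewrite -leNgt distrC => hy.
  by rewrite moll_out// normr0 mulr0.
- exact: cvg_cst.
- by rewrite -[X in _ --> X](mulr0 (2 * M)); apply: cvgMr.
Qed.

End Bump.

(** * Littlewood-Paley blocks *)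

Section AlmostEverywhere.
Context {R : realType}.
Notation mu := (@lebesgue_measure R).
Implicit Types (f g : R -> R[i]).

Lemma intR_ae (u v : R -> R) : meas u -> meas v -> {ae mu, forall x, u x = v x} -> intR u = intR v.
Proof.
move=> mu_ mv uv; rewrite /intR /Rintegral; congr fine.
apply: ae_eq_integral => //.
- by apply/measurable_EFinP; exact: mu_.
- by apply/measurable_EFinP; exact: mv.
- by apply: aeS uv => x -> _.
Qed.

Lemma integ_ae (u v : R -> R) : meas u -> integ v -> {ae mu, forall x, u x = v x} -> integ u.
Proof.
move=> mu_ Iv uv; apply: integP => //; apply: le_lt_trans (integ_lty Iv).
rewrite (@ae_eq_integral _ _ _ mu setT (fun x => `|v x|%:E) (fun x => `|u x|%:E))//.
- by apply/measurable_EFinP; exact: meas_norm.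
- by apply/measurable_EFinP; exact: meas_norm (integ_meas Iv).
- by apply: aeS uv => x -> _.
Qed.

Lemma ae_forall (P : nat -> R -> Prop) : (forall n, {ae mu, forall x, P n x}) ->
  {ae mu, forall x, forall n, P n x}.
Proof. by move=> h; apply: ae_foralln. Qed.

Lemma cmeasM f g : cmeasurable f -> cmeasurable g -> cmeasurable (fun x => f x * g x).
Proof.
move=> [f1 f2] [g1 g2]; split.
  have := measB (measM f1 g1) (measM f2 g2); congr measurable_fun.
  by apply/funext => x; rewrite /reF cReM.
have := measD (measM f1 g2) (measM f2 g1); congr measurable_fun.
by apply/funext => x; rewrite /imF cImM.
Qed.

Lemma cmeasD f g : cmeasurable f -> cmeasurable g -> cmeasurable (fun x => f x + g x).
Proof.
move=> [f1 f2] [g1 g2]; split.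
  by have := measD f1 g1; congr measurable_fun; apply/funext => x; rewrite /reF cReD.
by have := measD f2 g2; congr measurable_fun; apply/funext => x; rewrite /imF cImD.
Qed.

Lemma cmeas_cst (c : R[i]) : cmeasurable (fun=> c).
Proof. by split; exact: meas_cst. Qed.

Lemma cmeasB f g : cmeasurable f -> cmeasurable g -> cmeasurable (fun x => f x - g x).
Proof.
move=> mf mg; have := cmeasD mf (cmeasM (cmeas_cst (-1)) mg); congr cmeasurable.
by apply/funext => x; rewrite mulN1r.
Qed.

Lemma cmeas_schwartz f : schwartz f -> cmeasurable f.
Proof. by move=> /schwartzP[? ?]; split; exact: rschwartz_meas. Qed.

Lemma meas_cmod f : cmeasurable f -> meas (fun x => cmod (f x)).
Proof.
move=> [m1 m2]; have m3 := measD (measM m1 m1) (measM m2 m2).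
have := measurableT_comp (meas_continuous (@sqrt_continuous R)) m3.
congr measurable_fun; apply/funext => x /=; rewrite /cmod -!expr2.
by rewrite /reF /imF; case: (f x).
Qed.

Lemma cint_ae f g : cmeasurable f -> cmeasurable g -> {ae mu, forall x, f x = g x} ->
  cint f = cint g.
Proof.
move=> [f1 f2] [g1 g2] fg; rewrite /cint /cintegral.
congr (_ +i* _); apply: intR_ae => //; apply: aeS fg => x e.
  by rewrite /reF e.
by rewrite /imF e.
Qed.

Lemma dist_of_fun_ae f g : cmeasurable f -> cmeasurable g -> {ae mu, forall x, f x = g x} ->
  dist_of_fun f = dist_of_fun g.
Proof.
move=> mf mg fg; apply/funext => phi; rewrite /dist_of_fun /on_schwartz.
case: asboolP => // sp; have mp := cmeas_schwartz sp.
by apply: cint_ae; [exact: cmeasM|exact: cmeasM|apply: aeS fg => x ->].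
Qed.

Lemma mu_setT_gt0 : (0 < mu setT)%E.
Proof.
have : (mu `[0%R, 1%R] <= mu setT)%E.
  by apply: le_measure => //; rewrite inE//; exact: measurable_itv.
apply: lt_le_trans.
by rewrite lebesgue_measure_itv/= lte_fin ltr01 sube0 lte_fin.
Qed.

Lemma Lpnorm_ooP f (B : R) : cmeasurable f -> (Lpnorm +oo f <= B%:E)%E <->
  {ae mu, forall x, cmod (f x) <= B}.
Proof.
move=> mf; rewrite /Lpnorm unlock.
rewrite mu_setT_gt0.
split=> [/ess_supP|] h; last apply/ess_supP; apply: aeS h => x /=;
  by rewrite lee_fin ger0_norm// cmod_ge0.
Qed.

(** Truncating [f] to 0 off the set where the bound holds. *)
Lemma ae_bounded_version f B : 0 <= B -> cmeasurable f -> {ae mu, forall x, cmod (f x) <= B} ->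
  exists g, [/\ cmeasurable g, forall x, cmod (g x) <= B & {ae mu, forall x, f x = g x}].
Proof.
move=> B0 mf hB; pose A := [set x | cmod (f x) <= B].
have mA : measurable A.
  rewrite (_ : A = (fun x => cmod (f x)) @^-1` `]-oo, B]%classic).
    by rewrite -[X in measurable X]setTI; apply: (meas_cmod mf) => //; exact: measurable_itv.
  by apply/seteqP; split=> x; rewrite /A /= in_itv.
exists (fun x => (\1_A x)%:C * f x); split.
- by apply: cmeasM => //; split; [exact: meas_indic|exact: meas_cst].
- move=> x; rewrite indicE; case: (boolP (x \in A)) => [/set_mem//|_].
    by rewrite mul1r.
  by rewrite mul0r /cmod/= expr0n/= addr0 sqrtr0.
- by apply: aeS hB => x hx; rewrite indicE mem_set// mul1r.
Qed.

Lemma Lpnorm_ge0 p f : (0 <= Lpnorm p f)%E. Proof. exact: Lnorm_ge0. Qed.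

Lemma dist_Lpnorm_ge0 p (T : functional R) : (0 <= dist_Lpnorm p T)%E.
Proof. by apply: le_ereal_inf_tmp => _ [g _ <-]; exact: Lpnorm_ge0. Qed.

Lemma dist_Lpnorm_le p g : cmeasurable g -> (dist_Lpnorm p (dist_of_fun g) <= Lpnorm p g)%E.
Proof. by move=> mg; apply: ereal_inf_lbound; exists g. Qed.

Lemma on_schwartzE (T : functional R) phi : schwartz phi -> on_schwartz T phi = T phi.
Proof. by move=> sp; rewrite /on_schwartz asboolT. Qed.

Lemma dist_of_funE g phi : schwartz phi -> dist_of_fun g phi = cint (fun x => g x * phi x).
Proof. by move=> sp; rewrite /dist_of_fun (on_schwartzE _ sp). Qed.

Lemma n1_cint_bounded g psi B : cmeasurable g -> schwartz psi -> 0 <= B ->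
  {ae mu, forall x, cmod (g x) <= B} ->
  n1 (cint (fun x => g x * psi x)) <= 2 * B * intR (fun x => n1 (psi x)).
Proof.
move=> mg sp B0 hB; have [g' [mg' hB' gg']] := ae_bounded_version B0 mg hB.
have mp := cmeas_schwartz sp; have Ip := integ_n1_schwartz sp.
have m1 := cmeasM mg mp; have m2 := cmeasM mg' mp.
have ag : {ae mu, forall x, g x * psi x = g' x * psi x} by apply: aeS gg' => x ->.
have -> := cint_ae m1 m2 ag.
have bnd x : n1 (g' x * psi x) <= 2 * B * n1 (psi x).
  apply: le_trans (n1M _ _) _; rewrite ler_wpM2r ?n1_ge0//.
  by apply: le_trans (n1_cmod _) _; rewrite ler_wpM2l.
have IG := integZ (2 * B) Ip.
have ci : cinteg (fun x => g' x * psi x).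
  split.
    by apply: (integ_dom m2.1 IG) => x; exact: le_trans (Re_n1 _) (bnd x).
  by apply: (integ_dom m2.2 IG) => x; exact: le_trans (Im_n1 _) (bnd x).
apply: le_trans (n1_cint ci) _; rewrite -(intRZ _ Ip).
by apply: le_intR; [exact: integ_n1 ci|exact: IG|].
Qed.

Lemma dist_Lpnorm_pair (T : functional R) phi : schwartz phi ->
  (dist_Lpnorm +oo T < +oo)%E ->
  n1 (T phi) <= 2 * fine (dist_Lpnorm +oo T) * intR (fun x => n1 (phi x)).
Proof.
move=> sp hT; set b := fine _; set I := intR _.
have I0 : 0 <= I by apply: intR_ge0 => x; exact: n1_ge0.
have bE : dist_Lpnorm +oo T = b%:E by rewrite fineK// ge0_fin_numE// dist_Lpnorm_ge0.
have b0 : 0 <= b by apply: fine_ge0; exact: dist_Lpnorm_ge0.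
apply/ler_addgt0Pr => e e0.
have e'0 : 0 < e / (2 * I + 1) by rewrite divr_gt0// ltr_wpDl// mulr_ge0.
have fb : dist_Lpnorm +oo T \is a fin_num by rewrite bE.
have [_ [g [mg TE] <-] hg] := lb_ereal_inf_adherent e'0 fb.
rewrite -/(dist_Lpnorm +oo T) bE -EFinD in hg.
have hB := (Lpnorm_ooP (b + e / (2 * I + 1)) mg).1 (ltW hg).
rewrite TE (dist_of_funE _ sp).
apply: le_trans (n1_cint_bounded mg sp _ hB) _.
  by rewrite addr_ge0// ltW.
rewrite -/I mulrDr mulrDl lerD2l.
have -> : 2 * (e / (2 * I + 1)) * I = e * (2 * I / (2 * I + 1)) by ring.
rewrite ler_piMr ?(ltW e0)// ler_pdivrMr ?mul1r ?lerDl//.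
by rewrite ltr_wpDl// mulr_ge0.
Qed.

Lemma series_norm_cvg (a c : nat -> R) : (forall k, `|a k| <= c k) -> cvgn (series c) -> cvgn (series a).
Proof.
move=> h cc; apply: normed_cvg; apply: series_le_cvg cc => n.
- exact: normr_ge0.
- exact: le_trans (h n).
- exact: h.
Qed.

Lemma tail_small (c : nat -> R) : (forall k, 0 <= c k) -> cvgn (series c) ->
  forall e, 0 < e -> exists N, forall a : nat -> R, (forall k, `|a k| <= c k) ->
  forall m, (N <= m)%N -> `|series a m - series a N| <= e.
Proof.
move=> c0 cc e e0.
have /cvgrPdist_le /(_ _ e0) [N _ hN] := cc.
exists N => a h m Nm.
rewrite sub_series_geq//.
apply: le_trans (ler_norm_sum _ _ _) _.
apply: (@le_trans _ _ (\sum_(N <= k < m) c k)); first by apply: ler_sum.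
rewrite -sub_series_geq//.
have le1 : series c m <= limn (series c).
  apply: nondecreasing_cvgn_le => //.
  by apply: nondecreasing_series => k _ _; exact: c0.
have := hN N (leqnn N); rewrite /= => /(le_trans (ler_norm _)).
by apply: le_trans; rewrite lerD2r.
Qed.

(** Dominated convergence for series whose partial sums converge for each [n]:
    the domination makes the tails small uniformly in [n], and finitely many terms
    converge separately. *)
Lemma tannery (a_ : nat -> nat -> R) (a c : nat -> R) (S : nat -> R) :
  (forall k, 0 <= c k) -> cvgn (series c) -> (forall n k, `|a_ n k| <= c k) ->
  (forall k, a_ n k @[n --> \oo] --> a k) ->
  (forall n, series (a_ n) @ \oo --> S n) ->
  cvgn (series a) /\ (S n @[n --> \oo] --> limn (series a)).
Proof.
move=> c0 cc h ha hS.
have hac k : `|a k| <= c k.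
  apply: (cvgr_to_le (cvg_norm (ha k))).
  by apply: nearW => n; exact: h.
have ca := series_norm_cvg hac cc.
split=> //.
apply/cvgrPdist_le => e e0.
have e3 : 0 < e / 3 by rewrite divr_gt0.
have [N hN] := tail_small c0 cc e3.
have fin : series (a_ n) N @[n --> \oo] --> series a N.
  rewrite /series/=; by apply: cvg_big => //; move=> x; exact: add_continuous.
have /cvgrPdist_le /(_ _ e3) fe := fin.
apply: filterS fe => n t3.
have t1 : `|limn (series a) - series a N| <= e / 3.
  have cN : (fun=> series a N) @ \oo --> series a N by exact: cvg_cst.
  have cs : (fun m => `|series a m - series a N|) @ \oo --> `|limn (series a) - series a N|.
    exact: (cvg_norm (cvgB ca cN)).
  apply: (cvgr_to_le cs).
  by exists N => // m /= Nm; exact: hN.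
have t2 : `|S n - series (a_ n) N| <= e / 3.
  have cs : (fun m => `|series (a_ n) m - series (a_ n) N|) @ \oo --> `|S n - series (a_ n) N|.
    have cN : (fun=> series (a_ n) N) @ \oo --> series (a_ n) N by exact: cvg_cst.
    exact: (cvg_norm (cvgB (hS n) cN)).
  apply: (cvgr_to_le cs).
  by exists N => // m /= Nm; exact: (hN (a_ n)).
have -> : limn (series a) - S n = (limn (series a) - series a N) + (series a N - series (a_ n) N)
  - (S n - series (a_ n) N) by ring.
apply: le_trans (ler_normB _ _) _; apply: le_trans (lerD (ler_normD _ _) (lexx _)) _.
by rewrite (_ : e = e / 3 + e / 3 + e / 3); [rewrite !lerD|field].
Qed.

End AlmostEverywhere.

Section Blocks.
Context {R : realType}.
Notation mu := (@lebesgue_measure R).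
Variable eta : R -> R[i].
Hypothesis heta : lp_cutoff eta.
Implicit Types (F : functional R) (phi psi m : R -> R[i]).
Let se := lp_cutoff_schwartz heta.
Let e0 := lp_cutoff0 heta.

Definition scale (k : nat) : R := 2 ^- k.
Lemma scale_gt0 k : 0 < scale k. Proof. by rewrite /scale invr_gt0 exprn_gt0. Qed.
Lemma scale_neq0 k : scale k != 0. Proof. by rewrite gt_eqF// scale_gt0. Qed.
Lemma scaleS k : scale k.+1 = scale k / 2. Proof. by rewrite /scale exprSr invfM. Qed.
Lemma scale_le1 k : scale k <= 1.
Proof. by rewrite /scale invf_le1 ?exprn_gt0// exprn_ege1// ler1n. Qed.

Lemma schwartz_dilate (t : R) phi : t != 0 -> schwartz phi -> schwartz (fun x => phi (t * x)).
Proof. by move=> t0 sp; have := schwartz_affine 0 t0 sp; apply: schwartz_eq => x; rewrite addr0. Qed.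

Lemma schwartz_multiplier k : schwartz (lp_multiplier eta k).
Proof.
case: k => [|k]; first exact: se.
exact: (schwartzB (schwartz_dilate (scale_neq0 k.+1) se) (schwartz_dilate (scale_neq0 k) se)).
Qed.

Lemma blockE F k phi : schwartz phi ->
  lp_block eta k F phi = F (fourier (fun xi => lp_multiplier eta k xi * ifourier phi xi)).
Proof.
move=> sp; have si := schwartz_ifourier sp.
rewrite /lp_block /dist_ifourier (on_schwartzE _ sp) /dist_mul (on_schwartzE _ si).
by rewrite /dist_fourier (on_schwartzE _ (schwartzM (schwartz_multiplier k) si)).
Qed.

Lemma cinteg_fourier m (x : R) : schwartz m -> cinteg (fun xi => m xi * cexpi (- (2 * pi * xi * x))).
Proof.
move=> sm; have := @cinteg_cexpi _ m (- (2 * pi * x)) 0 (schwartz_cinteg sm).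
by congr cinteg; apply/funext => y; rewrite addr0 mulNr [2 * pi * x * y]mulrAC.
Qed.

Lemma fourierB (m1 m2 : R -> R[i]) : schwartz m1 -> schwartz m2 ->
  fourier (fun xi => m1 xi - m2 xi) = (fun x => fourier m1 x - fourier m2 x).
Proof.
move=> s1 s2; apply/funext => x; rewrite /fourier -!/(cint _).
rewrite -(cintB (cinteg_fourier x s1) (cinteg_fourier x s2)).
by congr cint; apply/funext => xi; rewrite mulrBl.
Qed.

Lemma fourier0 : fourier (fun _ : R => 0 : R[i]) = (fun=> 0).
Proof.
have := fourierB se se.
have -> : (fun xi => eta xi - eta xi) = (fun=> 0) by apply/funext => x; rewrite subrr.
by move=> ->; apply/funext => x; rewrite subrr.
Qed.

Lemma tempered0 F : tempered F -> F (fun=> 0) = 0.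
Proof.
move=> tF; have := temperedB tF se se.
by rewrite subrr => h; rewrite -[RHS]h; congr F; apply/funext => x; rewrite subrr.
Qed.

Lemma block0 F phi : schwartz phi -> lp_block eta 0 F phi = F (lowpass eta (scale 0) phi).
Proof.
move=> sp; rewrite (blockE _ _ sp) /lowpass; congr (F (fourier _)).
by apply/funext => xi; rewrite /scale expr0 invr1 mul1r.
Qed.

Lemma blockS F k phi : tempered F -> schwartz phi ->
  lp_block eta k.+1 F phi = F (lowpass eta (scale k.+1) phi) - F (lowpass eta (scale k) phi).
Proof.
move=> tF sp; rewrite (blockE _ _ sp) /lowpass.
have si := schwartz_ifourier sp.
have s1 := schwartzM (schwartz_dilate (scale_neq0 k.+1) se) si.
have s2 := schwartzM (schwartz_dilate (scale_neq0 k) se) si.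
rewrite -(temperedB tF (schwartz_fourier s1) (schwartz_fourier s2)) -(fourierB s1 s2).
by congr (F (fourier _)); apply/funext => xi; rewrite /= -mulrBl.
Qed.

(** The multipliers telescope, so partial sums of blocks are low-pass filters. *)
Lemma block_sum F n phi : tempered F -> schwartz phi ->
  \sum_(0 <= k < n.+1) lp_block eta k F phi = F (lowpass eta (scale n) phi).
Proof.
move=> tF sp; elim: n => [|n IH]; first by rewrite big_nat1 block0.
by rewrite big_nat_recr//= IH (blockS _ tF sp) addrC subrK.
Qed.

(** The multiplier of the block vanishes for frequencies up to [2 ^ k / 2], where
    both cutoffs are 1, while the filter at scale [2 * 2 ^ -k] vanishes beyond
    [3 / 8 * 2 ^ k]. *)
Lemma block_highpass F k phi : tempered F -> schwartz phi ->
  lp_block eta k.+1 F (lowpass eta (2 * scale k) phi) = 0.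
Proof.
move=> tF sp.
have t0 : 2 * scale k != 0 :> R by rewrite mulf_neq0// scale_neq0.
rewrite (blockE _ _ (schwartz_lowpass se t0 sp)) /lowpass.
have sm := schwartzM (schwartz_dilate t0 se) (schwartz_ifourier sp).
rewrite (fourierK sm).
have -> : (fun xi => lp_multiplier eta k.+1 xi * (eta (2 * scale k * xi) * ifourier phi xi)) = (fun=> 0).
  apply/funext => xi; rewrite mulrA.
  have -> : lp_multiplier eta k.+1 xi * eta (2 * scale k * xi) = 0; last by rewrite mul0r.
  have [_ _ h1] := heta.
  rewrite /lp_multiplier -/(scale k.+1) -/(scale k) scaleS.
  set s := scale k * xi.
  have -> : scale k / 2 * xi = s / 2 by rewrite /s mulrAC.
  have -> : 2 * scale k * xi = 2 * s by rewrite /s mulrA.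
  (* Either the filter vanishes, or both cutoffs in the multiplier are 1. *)
  have [hs|hs] := lerP (3 / 4) `|2 * s|; first by rewrite (lp_cutoff_out heta hs) mulr0.
  rewrite normrM ger0_norm// in hs.
  have hs1 : `|s| <= 1 / 2 by move: (`|s|) hs => q hq; lra.
  have hs2 : `|s / 2| <= 1 / 2.
    by rewrite normrM [`|2^-1|]ger0_norm//; move: (`|s|) (normr_ge0 s) hs1 => q q0 hq; lra.
  by rewrite (h1 _ hs1) (h1 _ hs2) subrr mul0r.
by rewrite fourier0 tempered0.
Qed.

Definition moment1 : R := momentK eta 1.

Let subr4 (p q r s : R[i]) : (p - q) - (r - s) = (p - r) - (q - s).
Proof. by ring. Qed.

(** Subtracting from [phi] its low-frequency part does not change the value of the
    block, and the difference has L^1 norm at most [2 ^ -k] times the variation of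
    [phi].  This gain pays for the weight [2 ^ -k] in the reference norm. *)
Lemma block_bv F k phi : tempered F -> schwartz phi ->
  (dist_Lpnorm +oo (lp_block eta k.+1 F) < +oo)%E ->
  n1 (lp_block eta k.+1 F phi) <=
  8 * moment1 * bvnorm phi * (scale k.+1 * fine (dist_Lpnorm +oo (lp_block eta k.+1 F))).
Proof.
move=> tF sp hT; set T := lp_block eta k.+1 F in hT *; set b := fine _.
have b0 : 0 <= b by apply: fine_ge0; exact: dist_Lpnorm_ge0.
have t0 : 0 < 2 * scale k :> R by rewrite mulr_gt0// scale_gt0.
have tn0 : 2 * scale k != 0 :> R by rewrite gt_eqF.
have sl := schwartz_lowpass se tn0 sp.
have sd := schwartzB sl sp.
have E : T phi = - T (fun x => lowpass eta (2 * scale k) phi x - phi x).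
  have TB : T (fun x => lowpass eta (2 * scale k) phi x - phi x) = T (lowpass eta (2 * scale k) phi) - T phi.
    have lB t : t != 0 -> F (lowpass eta t (fun x => lowpass eta (2 * scale k) phi x - phi x)) =
      F (lowpass eta t (lowpass eta (2 * scale k) phi)) - F (lowpass eta t phi).
      move=> t1; rewrite -(temperedB tF (schwartz_lowpass se t1 sl) (schwartz_lowpass se t1 sp)); congr F.
      rewrite {1}/lowpass.
      have s1 := schwartzM (schwartz_dilate t1 se) (schwartz_ifourier sl).
      have s2 := schwartzM (schwartz_dilate t1 se) (schwartz_ifourier sp).
      rewrite /lowpass -[X in _ = X](fourierB s1 s2); congr fourier; apply/funext => xi.
      rewrite -mulrBr; congr (_ * _).
      rewrite /ifourier -!/(cint _).
      have ci m : schwartz m -> cinteg (fun y => m y * cexpi (2 * pi * xi * y)).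
        move=> sm; have := @cinteg_cexpi _ m (2 * pi * xi) 0 (schwartz_cinteg sm).
        by congr cinteg; apply/funext => y; rewrite addr0.
      rewrite -(cintB (ci _ sl) (ci _ sp)).
      by congr cint; apply/funext => y; rewrite mulrBl.
    rewrite /T (blockS _ tF sl) (blockS _ tF sp).
    apply: (etrans (blockS k tF sd)).
    apply: (etrans (congr2 (fun p q => p - q) (lB _ (scale_neq0 k.+1)) (lB _ (scale_neq0 k)))).
    exact: subr4.
  by rewrite TB /T (block_highpass _ tF sp) sub0r opprK.
rewrite E n1N; apply: le_trans (dist_Lpnorm_pair sd hT) _; rewrite -/b.
apply: (@le_trans _ _ (2 * b * (2 * scale k * (momentK eta 1 * bvnorm phi)))).
  by apply: ler_wpM2l; [rewrite mulr_ge0|exact: (lowpass_L1 se e0 sp t0)].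
rewrite scaleS /moment1; move: (bvnorm phi) (momentK eta 1) (scale k) => p q r.
by have -> : 2 * b * (2 * r * (q * p)) = 8 * q * p * (r / 2 * b) by field.
Qed.

End Blocks.

(** * Primitives and integration by parts *)

Section Primitive.
Context {R : realType}.
Notation mu := (@lebesgue_measure R).
Implicit Types (g u : R -> R).

(** The oriented indicator function of the segment from 0 to [x]; its integral against [g]
    is the primitive of [g] vanishing at 0 for both signs of [x]. *)
Definition between (x y : R) : R := \1_(`[0, x[%classic) y - \1_(`[x, 0[%classic) y.

Definition prim g x := intR (fun y => g y * between x y).

Lemma betweenE x y : between x y = ((0 <= y) && (y < x))%R%:R - ((x <= y) && (y < 0))%R%:R.
Proof. by rewrite /between !indicE !mem_setE !in_itv/=. Qed.

Lemma between_bnd x y : `|between x y| <= (1 + x ^+ 2) * wt y.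
Proof.
rewrite betweenE -ler_pdivrMr ?wt_gt0// /wt invrK.
have hb : (1 + y ^+ 2) * (`|y| <= `|x|)%R%:R <= 1 + x ^+ 2.
  case: (boolP (`|y| <= `|x|)) => h; last by rewrite mulr0 ltW// oneDsqr_gt0'.
  by rewrite mulr1 lerD2l -(real_normK (num_real y)) -(real_normK (num_real x)) lerXn2r// nnegrE.
apply: le_trans hb; rewrite mulrC ler_wpM2l ?(ltW (oneDsqr_gt0' _))//.
case: (boolP ((0 <= y) && (y < x))) => [/andP[y0 yx]|_].
  have -> : (x <= y) && (y < 0) = false by rewrite leNgt yx.
  rewrite subr0 normr1 (_ : `|y| <= `|x|)// !ger0_norm// ?ltW//.
  exact: le_lt_trans yx.
case: (boolP ((x <= y) && (y < 0))) => [/andP[xy y0]|_]; last by rewrite subr0 normr0.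
rewrite sub0r normrN normr1 (_ : `|y| <= `|x|)// !ltr0_norm// ?lerN2//.
exact: le_lt_trans y0.
Qed.

Lemma meas2_le (f g : R -> R -> R) : meas2 f -> meas2 g -> meas2 (fun x y => (f x y <= g x y)%R%:R : R).
Proof.
move=> mf mg; rewrite /meas2.
have mb := measurable_fun_ler mf mg.
have -> : (fun z : R * R => (f z.1 z.2 <= g z.1 z.2)%R%:R : R) =
   (fun b : bool => b%:R : R) \o (fun z : R * R => f z.1 z.2 <= g z.1 z.2) by [].
by apply: (measurableT_comp _ mb).
Qed.

Lemma meas2_between : meas2 between.
Proof.
have m0 : meas2 (fun _ _ : R => 0 : R) by exact: measurable_cst.
have m1 : meas2 (fun _ _ : R => 1 : R) by exact: measurable_cst.
have mx : meas2 (fun x _ : R => x) by apply: (@meas2_1 _ id); exact: measurable_id.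
have my : meas2 (fun _ y : R => y) by apply: (@meas2_2 _ id); exact: measurable_id.
have lt_ (f g : R -> R -> R) : meas2 f -> meas2 g -> meas2 (fun x y => (f x y < g x y)%R%:R : R).
  move=> mf mg; have := meas2D m1 (meas2N (meas2_le mg mf)); congr meas2.
  by apply/funext => x; apply/funext => y; rewrite ltNge; case: (_ <= _); rewrite ?subrr ?subr0.
have := meas2D (meas2M (meas2_le m0 my) (lt_ _ _ my mx)) (meas2N (meas2M (meas2_le mx my) (lt_ _ _ my m0))).
congr meas2; apply/funext => x; apply/funext => y; rewrite betweenE.
by case: (0 <= y); case: (y < x); case: (x <= y); case: (y < 0); rewrite ?mulr1 ?mulr0.
Qed.

Lemma integ_between g x : Lw g -> integ (fun y => g y * between x y).
Proof.
move=> Lg; apply: (Lw_mul_dom Lg (meas2_section x meas2_between)).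
by move=> y; exact: between_bnd.
Qed.

Lemma prim_bnd g x : Lw g -> `|prim g x| <= intR (fun y => `|wt y * g y|) * (1 + x ^+ 2).
Proof.
move=> Lg; rewrite mulrC -(intRZ _ (integ_norm Lg.2)).
apply: norm_intR_le; [exact: integ_between|exact: integZ _ (integ_norm Lg.2)|].
move=> y; rewrite normrM (normrM (wt y)) [`|wt y|]ger0_norm ?wt_ge0//.
by rewrite mulrA mulrC ler_wpM2r// between_bnd.
Qed.

Lemma prim_ge0 g x : 0 <= x -> prim g x = intR (fun y => g y * \1_(`[0, x[%classic) y).
Proof.
move=> x0; rewrite /prim; congr intR; apply/funext => y; rewrite betweenE indicE mem_setE in_itv/=.
have -> : (x <= y) && (y < 0) = false by apply/negP => /andP[xy]; rewrite ltNge (le_trans x0 xy).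
by rewrite subr0.
Qed.

Lemma prim_lt0 g x : x < 0 -> Lw g -> prim g x = - intR (fun y => g y * \1_(`[x, 0[%classic) y).
Proof.
move=> x0 Lg; rewrite /prim -intRN; last first.
  apply: (@Lw_itv _ _ `[x, 0[ `|x| Lg) => y; rewrite in_itv/= => /andP[xy y0].
  by rewrite (ltr0_norm x0) (ltr0_norm y0) lerN2.
congr intR; apply/funext => y; rewrite betweenE indicE mem_setE in_itv/=.
have -> : (0 <= y) && (y < x) = false.
  by apply/negP => /andP[y0 yx]; have := lt_trans (le_lt_trans y0 yx) x0; rewrite ltxx.
by rewrite sub0r mulrN.
Qed.

Lemma intR_derive_right u y : rschwartz u ->
  intR (fun x => derive1 u x * \1_(`]y, +oo[%classic) x) = - u y.
Proof.
move=> su; have su' := rschwartz_derive su; have Iu' := rschwartz_integ su'.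
have du := smoothR_is_derive (rschwartz_smooth su).
have [M M0 hM] := rschwartz_wt su.
have c1 : intR (fun x => derive1 u x * \1_(`]y, y + n.+1%:R]%classic) x) @[n --> \oo] -->
   intR (fun x => derive1 u x * \1_(`]y, +oo[%classic) x).
  apply: (cvg_intR _ (integ_norm Iu')).
  - by move=> n; apply: measM; [exact: integ_meas|apply: meas_indic; exact: measurable_itv].
  - move=> x; apply: cvgMr; rewrite !indicE mem_setE in_itv/= andbT.
    case: (ltP y x) => yx; last first.
      rewrite (_ : (fun n => _) = (fun=> 0)); first exact: cvg_cst.
      by apply/funext => n; rewrite indicE mem_setE in_itv/= ltNge yx.
    have xy0 : 0 < (x - y) + 1 by rewrite ltr_wpDl// subr_ge0 ltW.
    apply: cvg_near_cst; near=> n; rewrite indicE mem_setE in_itv/= yx/= -lerBlDl.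
    rewrite (@le_trans _ _ n%:R)//; last by rewrite ler_nat.
    by rewrite (le_trans (ler_norm _))//; near: n; exact: nbhs_infty_ger.
  - by move=> n x; rewrite normrM ler_piMr// indic_bnd.
have E n : intR (fun x => derive1 u x * \1_(`]y, y + n.+1%:R]%classic) x) = u (y + n.+1%:R) - u y.
  rewrite -RintegralE; last exact: measurable_itv.
  rewrite Rintegral_itv_obnd_cbnd; last exact: integrableS Iu'.
  by apply: (FTC_derives _ du); [rewrite ltrDl|exact: rschwartz_continuous].
have c2 : u (y + n.+1%:R) @[n --> \oo] --> (0 : R).
  have := @cvg_intR R (fun n x => 0) (fun=> 0).
  move=> _; apply: norm_cvg0.
  apply: (@squeeze_cvgr _ _ _ _ (cst 0) (fun n => M * (2 * (1 + y ^+ 2)) * wt (n.+1%:R : R))).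
  - apply: nearW => n; rewrite normr_ge0/=; apply: le_trans (hM _) _.
    rewrite -mulrA; apply: ler_wpM2l => //.
    move: (n.+1%:R : R) => N; rewrite /wt ler_pdivlMr ?oneDsqr_gt0'// mulrC.
    rewrite ler_pdivrMr ?oneDsqr_gt0'//.
    have h1 : 0 <= (y + (y + N)) ^+ 2 by rewrite sqr_ge0.
    have h2 : 0 <= y ^+ 2 * (y + N) ^+ 2 by rewrite mulr_ge0// sqr_ge0.
    have h3 : 0 <= y ^+ 2 by rewrite sqr_ge0.
    have h4 : 0 <= (y + N) ^+ 2 by rewrite sqr_ge0.
    by nra.
  - exact: cvg_cst.
  - exact: cvg_harmonic_sqr_wt.
apply: (cvg_unique _ c1); first exact: Rhausdorff.
rewrite (funext E : (fun n => _) = _).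
have cu : (fun=> u y) @ \oo --> u y by exact: cvg_cst.
by have := cvgB c2 cu; rewrite sub0r; apply.
Unshelve. all: by end_near. Qed.

Lemma intR_derive0 u : rschwartz u -> intR (derive1 u) = 0.
Proof.
move=> su; have [M M0 hM] := rschwartz_wt su.
apply: (intR_derives (smoothR_is_derive (rschwartz_smooth su)) _ _ hM).
  exact: rschwartz_continuous (rschwartz_derive su).
exact: rschwartz_integ (rschwartz_derive su).
Qed.

Lemma intR_between_derive u y : rschwartz u ->
  intR (fun x => between x y * derive1 u x) = - u y.
Proof.
move=> su; have su' := rschwartz_derive su; have Iu' := rschwartz_integ su'.
have Ir : integ (fun x => derive1 u x * \1_(`]y, +oo[%classic) x).
  have := integM_bounded Iu' (meas_indic (measurable_itv `]y, +oo[)) (@indic_bnd R _).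
  by congr integ; apply/funext => x; rewrite mulrC.
rewrite -(intR_derive_right y su).
case: (lerP 0 y) => y0.
  congr intR; apply/funext => x; rewrite betweenE indicE mem_setE in_itv/= andbT mulrC y0/=.
  by rewrite [in (y < 0)]ltNge y0/= andbF subr0.
rewrite -[RHS]subr0 -(intR_derive0 su) -(intRB Ir Iu').
congr intR; apply/funext => x; rewrite betweenE indicE mem_setE in_itv/= andbT leNgt y0/= andbT sub0r.
by rewrite leNgt; case: (y < x) => /=; rewrite ?mulr1 ?mulr0 ?subrr ?oppr0 ?mul0r// sub0r mulN1r.
Qed.

(** Fubini for [g y * between x y * u' x]: for fixed [y] the inner integral of
    [u'] over the half line beyond [y] is [- u y]. *)
Lemma integration_by_parts_prim g u : Lw g -> rschwartz u ->
  intR (fun x => g x * u x) = - intR (fun x => prim g x * derive1 u x).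
Proof.
move=> Lg su; have su' := rschwartz_derive su.
pose F x y := (g y * between x y) * derive1 u x.
have mF : meas2 F.
  apply: meas2M; last by apply: (@meas2_1 _ (derive1 u)); exact: rschwartz_meas.
  by apply: meas2M; [apply: (@meas2_2 _ g); exact: Lg.1|exact: meas2_between].
have I2 : integ (fun x => `|derive1 u x| * (1 + x ^+ 2)).
  have := integ_norm (rschwartz_integ (rschwartzD su' (rschwartz_mulx (rschwartz_mulx su')))).
  congr integ; apply/funext => x.
  have -> : derive1 u x + x * (x * derive1 u x) = derive1 u x * (1 + x ^+ 2) by ring.
  by rewrite normrM [`|1 + _|]ger0_norm// ltW// oneDsqr_gt0'.
have hF x y : `|F x y| <= (`|derive1 u x| * (1 + x ^+ 2)) * `|wt y * g y|.
  rewrite /F !normrM [`|wt y|]ger0_norm ?wt_ge0//.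
  have h := between_bnd x y.
  have -> : `|derive1 u x| * (1 + x ^+ 2) * (wt y * `|g y|) = `|g y| * ((1 + x ^+ 2) * wt y) * `|derive1 u x| by ring.
  by rewrite ler_wpM2r// ler_wpM2l.
have [J1 J2 E] := fubini_dom mF I2 (integ_norm Lg.2) hF.
have E1 : (fun x => intR (F x)) = (fun x => prim g x * derive1 u x).
  apply/funext => x; rewrite /prim mulrC -(intRZ _ (integ_between x Lg)); congr intR.
  by apply/funext => y; rewrite /F mulrC.
have E2 : (fun y => intR (fun x => F x y)) = (fun y => - (g y * u y)).
  apply/funext => y; rewrite -mulrN -(intR_between_derive y su) -intRZ; last first.
    have := integM_bounded (rschwartz_integ su') (meas2_section y (meas2_swap meas2_between)) (fun x => _ : `|between x y| <= 1).
    apply=> x; rewrite betweenE.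
    by case: (_ && _); case: (_ && _); rewrite ?subrr ?subr0 ?sub0r ?normrN ?normr0 ?normr1.
  by congr intR; apply/funext => x; rewrite /F mulrA.
move: E; rewrite E1 E2 => ->; rewrite -intRN ?opprK.
  by congr intR; apply/funext => x; rewrite opprK.
by rewrite -E2.
Qed.

End Primitive.

(** * Pairing with indicator functions *)

Section ReferenceBesov.
Context {R : realType}.
Notation mu := (@lebesgue_measure R).
Variable eta : R -> R[i].
Hypothesis heta : lp_cutoff eta.
Let se := lp_cutoff_schwartz heta.
Let e0 := lp_cutoff0 heta.

Definition sind (a b : R) (n : nat) : R -> R[i] := fun x => (sindr eta a b n x)%:C.

Lemma schwartz_real (u : R -> R) : rschwartz u -> schwartz (fun x => (u x)%:C).
Proof. by move=> su; apply/schwartzP; split; [exact: su|exact: rschwartz0]. Qed.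

Lemma schwartz_sind a b n : schwartz (sind a b n).
Proof. exact: schwartz_real (rschwartz_sindr heta a b n). Qed.

Lemma n1_real (r : R) : n1 r%:C = `|r|. Proof. by rewrite /n1/= normr0 addr0. Qed.

Lemma bvnorm_sind a b n : bvnorm (sind a b n) <= 2.
Proof.
rewrite /bvnorm.
have -> : derive1 (imF (sind a b n)) = (fun=> 0).
  by apply: is_derive_derive1; exact: derives_cst.
rewrite (_ : intR (fun x => `|0 : R|) = 0); last by rewrite normr0 intR_cst0.
by rewrite addr0; exact: (sindr_bv heta a b n).
Qed.

Lemma intR_sind a b n : intR (fun x => n1 (sind a b n x)) <= 4 * (`|a| + `|b| + 1).
Proof.
set A := `|a| + `|b| + 1.
have A0 : 0 <= A by rewrite !addr_ge0.
have -> : 4 * A = intR (fun x => 2 * \1_(`[- A, A]%classic) x).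
  have I1 : integ (\1_(`[- A, A]%classic) : R -> R).
    have L1 : Lw (fun=> 1 : R) by apply: (@Lw_bounded _ _ 1); [exact: meas_cst|move=> y; rewrite normr1].
    have h1 : forall y : R, y \in `[- A, A] -> `|y| <= A by move=> y; rewrite in_itv/= -ler_norml.
    by have := Lw_itv L1 h1; congr integ; apply/funext => y; rewrite mul1r.
  rewrite (intRZ _ I1) intR_indic; last exact: measurable_itv.
  rewrite lebesgue_measure_itv/= lte_fin; case: ltP => h; first by rewrite -EFinD/=; ring.
  have -> : A = 0 by apply/eqP; rewrite eq_le A0 andbT; lra.
  by rewrite !mulr0.
have I1 : integ (fun x => 2 * \1_(`[- A, A]%classic) x : R).
  apply: integZ.
  have L1 : Lw (fun=> 1 : R) by apply: (@Lw_bounded _ _ 1); [exact: meas_cst|move=> y; rewrite normr1].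
  have h1 : forall y : R, y \in `[- A, A] -> `|y| <= A by move=> y; rewrite in_itv/= -ler_norml.
  by have := Lw_itv L1 h1; congr integ; apply/funext => y; rewrite mul1r.
apply: le_intR; [exact: (integ_n1_schwartz (schwartz_sind a b n))|exact: I1|].
move=> x; rewrite /sind n1_real.
have [xA|Ax] := ltP A `|x|; first by rewrite (sindr_out heta _ xA) normr0 mulr_ge0// indicE.
rewrite indicE mem_set/= ?in_itv/= -?ler_norml// mulr1.
exact: (sindr_bnd heta a b n x).
Qed.

Lemma scale_cvg0 : (fun n => scale n : R) @ \oo --> (0 : R).
Proof.
have h : `|2^-1 : R| < 1 by rewrite ger0_norm//; lra.
rewrite (_ : (fun n => scale n : R) = GRing.exp 2^-1); first exact: cvg_expr.
by apply/funext => n; rewrite /scale exprVn.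
Qed.

Lemma Lw_ae_bounded (g : R -> R[i]) B : cmeasurable g -> {ae mu, forall x, cmod (g x) <= B} ->
  Lw (reF g) /\ Lw (imF g).
Proof.
move=> mg hB.
have hB' : {ae mu, forall x, cmod (g x) <= Num.max B 0} by apply: aeS hB => x h; rewrite le_max h.
have M0 : 0 <= Num.max B 0 by rewrite le_max lexx orbT.
have [g' [mg' hg' gg']] := ae_bounded_version M0 mg hB'.
have L1 : Lw (reF g') by apply: (Lw_bounded mg'.1) => x; exact: le_trans (Re_le_cmod _) (hg' x).
have L2 : Lw (imF g') by apply: (Lw_bounded mg'.2) => x; exact: le_trans (Im_le_cmod _) (hg' x).
split; (split; [by case: mg|]).
  apply: (integ_ae _ L1.2); first by apply: measM; [exact: meas_wt|exact: mg.1].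
  by apply: aeS gg' => x e; rewrite /reF e.
apply: (integ_ae _ L2.2); first by apply: measM; [exact: meas_wt|exact: mg.2].
by apply: aeS gg' => x e; rewrite /imF e.
Qed.

Variable F : functional R.
Hypothesis hF : refB eta F.
Let tF : tempered F. Proof. by case: hF. Qed.

Definition beta k : R := fine (dist_Lpnorm +oo (lp_block eta k F)).

Let bnn k : (0 <= (2 ^- k)%:E * dist_Lpnorm +oo (lp_block eta k F))%E.
Proof. by rewrite mule_ge0 ?dist_Lpnorm_ge0// lee_fin invr_ge0 exprn_ge0. Qed.

Lemma refB_block_lty k : (dist_Lpnorm +oo (lp_block eta k F) < +oo)%E.
Proof.
have [_ h] := hF.
have h1 : ((2 ^- k)%:E * dist_Lpnorm +oo (lp_block eta k F) < +oo)%E.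
  apply: le_lt_trans h.
  apply: le_trans (nneseries_lim_ge (P := xpredT) k.+1 (fun n _ _ => bnn n)).
  by rewrite big_nat_recr//= leeDr// sume_ge0.
by rewrite ltey; apply/negP => /eqP e; move: h1; rewrite e gt0_muley ?ltxx// lte_fin invr_gt0 exprn_gt0.
Qed.

Let betaE k : dist_Lpnorm +oo (lp_block eta k F) = (beta k)%:E.
Proof. by rewrite /beta fineK// ge0_fin_numE ?refB_block_lty// dist_Lpnorm_ge0. Qed.

Lemma beta_ge0 k : 0 <= beta k. Proof. by apply: fine_ge0; exact: dist_Lpnorm_ge0. Qed.

Let sb_ge0 k : 0 <= scale k * beta k.
Proof. by rewrite mulr_ge0 ?beta_ge0// ltW// scale_gt0. Qed.

Lemma refB_summable : cvgn (series (fun k => scale k * beta k)).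
Proof.
apply: nondecreasing_is_cvgn.
  by apply: nondecreasing_series => k _ _; exact: sb_ge0.
have [_ h] := hF.
have fh : refBnorm eta F \is a fin_num.
  by rewrite ge0_fin_numE ?h//; apply: nneseries_ge0 => k _ _; exact: bnn.
exists (fine (refBnorm eta F)) => _ [n _ <-].
rewrite -lee_fin fineK// /series/= -sumEFin.
apply: le_trans (nneseries_lim_ge (P := xpredT) n (fun n _ _ => bnn n)).
rewrite le_eqVlt; apply/orP; left; apply/eqP; apply: eq_bigr => k _.
by rewrite EFinM -betaE.
Qed.

Definition dens k : R -> R[i] := bounded_density (lp_block eta k F).

Lemma densP k : [/\ cmeasurable (dens k), (Lpnorm +oo (dens k) < +oo)%E &
  lp_block eta k F = dist_of_fun (dens k)].
Proof.
rewrite /dens /bounded_density.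
apply: (@xgetPex _ (fun=> 0) [set g | [/\ cmeasurable g, (Lpnorm +oo g < +oo)%E & lp_block eta k F = dist_of_fun g]]).
have [_ [g [mg gE] <-] hg] := ereal_inf_lt (refB_block_lty k).
by exists g.
Qed.

Lemma Lw_dens k : Lw (reF (dens k)) /\ Lw (imF (dens k)).
Proof.
have [mg h _] := densP k.
have fh : Lpnorm +oo (dens k) \is a fin_num by rewrite ge0_fin_numE// Lpnorm_ge0.
apply: (@Lw_ae_bounded _ (fine (Lpnorm +oo (dens k)))) => //.
by apply/(Lpnorm_ooP _ mg); rewrite fineK.
Qed.

Variable P : R[i] -> R.
Hypothesis PB : forall a b, P (a - b) = P a - P b.
Hypothesis PD : forall a b, P (a + b) = P a + P b.
Hypothesis P0 : P 0 = 0.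
Hypothesis Pr : forall (r : R) z, P (z * r%:C) = P z * r.
Hypothesis Pn : forall z, `|P z| <= n1 z.
Hypothesis Pc : forall D (f : R -> R[i]), P (cintegral D f) = Rintegral mu D (fun x => P (f x)).
Hypothesis Ps : forall u, P (cseries_sum u) = limn (series (fun k => P (u k))).
Hypothesis PL : forall k, Lw (fun x => P (dens k x)).

Lemma P_block k (u : R -> R) : rschwartz u ->
  P (lp_block eta k F (fun x => (u x)%:C)) = intR (fun x => P (dens k x) * u x).
Proof.
move=> su; have [_ _ ->] := densP k; rewrite (dist_of_funE _ (schwartz_real su)).
by rewrite /cint Pc /intR; congr (Rintegral mu _ _); apply/funext => x; rewrite Pr.
Qed.

(** The contribution of the block [k] to the pairing with [[a, b[]. *)
Definition piece k a b : R := P (cintegral `[a, b[%classic (dens k)).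

Lemma pieceE k a b : piece k a b = intR (fun x => P (dens k x) * \1_(`[a, b[%classic) x).
Proof. by rewrite /piece Pc RintegralE//; exact: measurable_itv. Qed.

Lemma piece_cvg k a b : a <= b -> P (lp_block eta k F (sind a b n)) @[n --> \oo] --> piece k a b.
Proof.
move=> ab; rewrite pieceE.
rewrite (_ : (fun n => _) = (fun n => intR (fun x => P (dens k x) * sindr eta a b n x))); last first.
  by apply/funext => n; rewrite /sind (P_block k (rschwartz_sindr heta a b n)).
exact: (intR_sindr_cvg heta ab (PL k)).
Qed.

Lemma series_blocks phi : schwartz phi -> series (fun k => P (lp_block eta k F phi)) @ \oo --> P (F phi).
Proof.
move=> sp.
have [C hC] := tempered_lowpass se e0 tF sp.
have Psum n : series (fun k => P (lp_block eta k F phi)) n = P (\sum_(0 <= k < n) lp_block eta k F phi).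
  rewrite /series/=; elim: n => [|n IH]; first by rewrite !big_geq.
  by rewrite !big_nat_recr//= IH PD.
have key : (fun n => P (F (lowpass eta (scale n) phi))) @ \oo --> P (F phi).
  apply: cvg_zero; apply: norm_cvg0.
  apply: (@squeeze_cvgr _ _ _ _ (cst 0) (fun n => 2 * C * scale n)).
  - apply: nearW => n; rewrite normr_ge0/=.
    change (`|P (F (lowpass eta (scale n) phi)) - P (F phi)| <= 2 * C * scale n); rewrite -PB.
    apply: le_trans (Pn _) _; apply: le_trans (n1_cmod _) _.
    rewrite -mulrA ler_wpM2l//; apply: hC; rewrite scale_gt0; exact: scale_le1.
  - exact: cvg_cst.
  - by rewrite -[X in _ --> X](mulr0 (2 * C)); apply: cvgMr; exact: scale_cvg0.
have E : (fun n => P (F (lowpass eta (scale n) phi))) =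
    [sequence series (fun k => P (lp_block eta k F phi)) n.+1]_n.
  by apply/funext => n; rewrite /= Psum (block_sum heta n tF sp).
by rewrite -cvg_shiftS -E.
Qed.

Definition Kc : R := 16 * moment1 eta.
Lemma Kc_ge0 : 0 <= Kc. Proof. by rewrite mulr_ge0// momentK_ge0. Qed.

Definition dom (D : R) (k : nat) : R := if k is 0%N then D else Kc * (scale k * beta k).

Lemma dom_ge0 D k : 0 <= D -> 0 <= dom D k.
Proof. by case: k => [|k]//= _; rewrite mulr_ge0// Kc_ge0. Qed.

Lemma dom_cvg D : 0 <= D -> cvgn (series (dom D)).
Proof.
move=> D0.
have c1 : cvgn (series (geometric D 2^-1)).
  by apply: is_cvg_geometric_series; rewrite ger0_norm//; lra.
have c2 := @is_cvg_seriesZ R _ Kc refB_summable.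
have c3 : cvgn (series (fun k => geometric D 2^-1 k + Kc * (scale k * beta k))).
  exact: is_cvg_seriesD c1 c2.
apply: (series_le_cvg _ _ _ c3) => k.
- exact: dom_ge0.
- by rewrite addr_ge0//; [rewrite /geometric/= mulr_ge0// exprn_ge0|rewrite mulr_ge0// Kc_ge0].
- case: k => [|k]; first by rewrite /geometric/= expr0 mulr1 lerDl mulr_ge0 ?Kc_ge0.
  by rewrite /geometric/= lerDr mulr_ge0// exprn_ge0.
Qed.

(** The bound by the variation does not depend on the length of the interval or on
    the smoothing. *)
Lemma block_sind_bnd k a b n : `|P (lp_block eta k.+1 F (sind a b n))| <= Kc * (scale k.+1 * beta k.+1).
Proof.
apply: le_trans (Pn _) _.
apply: le_trans (block_bv heta tF (schwartz_sind a b n) (refB_block_lty k.+1)) _.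
rewrite -/(beta k.+1) ler_wpM2r//.
have -> : Kc = 8 * moment1 eta * 2 by rewrite /Kc; ring.
by rewrite ler_wpM2l ?mulr_ge0 ?momentK_ge0// bvnorm_sind.
Qed.

Lemma piece_bnd k a b : a <= b -> `|piece k.+1 a b| <= Kc * (scale k.+1 * beta k.+1).
Proof.
move=> ab; have c : `|P (lp_block eta k.+1 F (sind a b n))| @[n --> \oo] --> `|piece k.+1 a b|.
  by apply: cvg_norm; exact: piece_cvg.
by apply: (cvgr_to_le c); apply: nearW => n; exact: block_sind_bnd.
Qed.

(** Expand [F (sind a b n)] into its blocks.  Each block converges to the integral
    of its density by dominated convergence; the block 0 is dominated by its sup
    norm, the others by [block_sind_bnd]. *)
Lemma pair_indic_cvg a b : a <= b ->
  series (fun k => piece k a b) @ \oo --> P (pair_indic eta F `[a, b[%classic) /\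
  (P (F (sind a b n)) @[n --> \oo] --> P (pair_indic eta F `[a, b[%classic)).
Proof.
move=> ab; set A := `|a| + `|b| + 1.
have A0 : 0 <= A by rewrite !addr_ge0.
pose D := 2 * beta 0 * (4 * A).
have D0 : 0 <= D by rewrite !mulr_ge0 ?beta_ge0.
have bnd n k : `|P (lp_block eta k F (sind a b n))| <= dom D k.
  case: k => [|k]; last exact: block_sind_bnd.
  apply: le_trans (Pn _) _.
  apply: le_trans (dist_Lpnorm_pair (schwartz_sind a b n) (refB_block_lty 0)) _.
  by apply: ler_wpM2l; [rewrite mulr_ge0 ?beta_ge0|exact: intR_sind].
have domD k : 0 <= dom D k by exact: dom_ge0.
have [c1 c2] := @tannery R (fun n k => P (lp_block eta k F (sind a b n))) (fun k => piece k a b)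
  (dom D) (fun n => P (F (sind a b n))) domD (dom_cvg D0) bnd
  (fun k => @piece_cvg k a b ab) (fun n => series_blocks (schwartz_sind a b n)).
by rewrite /pair_indic Ps.
Qed.

Definition pr a b : R := P (pair_indic eta F `[a, b[%classic).

Lemma prD a b c : a <= b -> b <= c -> pr a c = pr a b + pr b c.
Proof.
move=> ab bc; have [_ c1] := pair_indic_cvg ab; have [_ c2] := pair_indic_cvg bc.
have [_ c3] := pair_indic_cvg (le_trans ab bc).
apply: (cvg_unique _ c3); first exact: Rhausdorff.
have -> : (fun n => P (F (sind a c n))) = (fun n => P (F (sind a b n)) + P (F (sind b c n))).
  apply/funext => n; rewrite -PD; congr P.
  have [_ lin _] := tF.
  have := lin 1 _ _ (schwartz_sind a b n) (schwartz_sind b c n).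
  rewrite mul1r => <-; congr F; apply/funext => x; rewrite mul1r /sind -(sindrD eta a b c n x).
  by rewrite rmorphD.
exact: cvgD c1 c2.
Qed.

Lemma pr_refl a : pr a a = 0.
Proof. by have := prD (lexx a) (lexx a); lra. Qed.

Hypothesis hz : forall j m : int, -1 <= j -> P (haar_coef eta F j m) = 0.

Definition dy (J : nat) (m : int) : R := 2 ^ (- (J%:Z)) * m%:~R.

Lemma dyD1 J m : dy J (m + 1) = 2 ^ (- (J%:Z)) * (m%:~R + 1).
Proof. by rewrite /dy intrD. Qed.

Lemma dyadic_intervalE J m : dyadic_interval J%:Z m = `[dy J m, dy J (m + 1)[%classic.
Proof. by rewrite /dyadic_interval dyD1. Qed.

Lemma dy_le J m n : (m <= n) -> dy J m <= dy J n.
Proof. by move=> mn; rewrite /dy ler_wpM2l ?exprz_ge0// ler_int. Qed.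

Lemma dy_half J m : dy J.+1 (2 * m) = dy J m.
Proof.
rewrite /dy intrM mulrA; congr (_ * _).
rewrite -[X in _ * X]expr1z -expfzDr ?pnatr_eq0//; congr (_ ^ _).
by rewrite -[J.+1]addn1 PoszD opprD addrK.
Qed.

Lemma half_zero (x y : R) : x = y -> 0 = x + y -> x = 0 /\ y = 0.
Proof. by move=> -> h; split; lra. Qed.

(** Induction on the level: the two halves of a dyadic interval have equal pairings
    by the vanishing of the Haar coefficient, and their sum is the pairing with the
    interval itself. *)
Lemma pr_dy J m : pr (dy J m) (dy J (m + 1)) = 0.
Proof.
elim: J m => [|J IH] m.
  have := @hz (-1) m (lexx _); rewrite /haar_coef /= /dyadic_interval /=.
  by rewrite /pr dyD1 /dy oppr0 expr0z !mul1r.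
have key k : pr (dy J.+1 (2 * k)) (dy J.+1 (2 * k + 1)) = 0 /\
             pr (dy J.+1 (2 * k + 1)) (dy J.+1 (2 * k + 1 + 1)) = 0.
  have e1 : (J%:Z + 1) = J.+1%:Z by rewrite -[J.+1]addn1 PoszD.
  have h1 : pr (dy J.+1 (2 * k)) (dy J.+1 (2 * k + 1)) =
      pr (dy J.+1 (2 * k + 1)) (dy J.+1 (2 * k + 1 + 1)).
    have h1 := @hz J%:Z k (le_trans (lerN10 _) (le0z_nat J)).
    rewrite /haar_coef/= PB e1 in h1.
    apply: subr0_eq; rewrite -[RHS]h1; congr (_ - _); rewrite /pr; congr (P (pair_indic _ _ _));
      by rewrite dyadic_intervalE.
  have h2 := IH k.
  have le1 : 2 * k <= 2 * k + 1 by rewrite lerDl.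
  have le2 : 2 * k + 1 <= 2 * k + 1 + 1 by rewrite lerDl.
  have e2 : dy J.+1 (2 * k + 1 + 1) = dy J (k + 1).
    by rewrite -[RHS]dy_half; congr (dy _ _); ring.
  have h3 : pr (dy J k) (dy J (k + 1)) = pr (dy J.+1 (2 * k)) (dy J.+1 (2 * k + 1)) +
      pr (dy J.+1 (2 * k + 1)) (dy J.+1 (2 * k + 1 + 1)).
    rewrite -[in LHS]e2 -[in LHS](dy_half J k).
    exact: (prD (dy_le J.+1 le1) (dy_le J.+1 le2)).
  rewrite [LHS]h2 in h3; exact: (half_zero h1 h3).
have [k [->|->]] : exists k, m = 2 * k \/ m = 2 * k + 1.
  exists (m %/ 2)%Z; have e := divz_eq m 2.
  have h0 : (0 <= (m %% 2)%Z) by rewrite modz_ge0.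
  have h1 : ((m %% 2)%Z < 2) by rewrite ltz_pmod.
  have [h|h] : (m %% 2)%Z = 0 \/ (m %% 2)%Z = 1.
    by case: (m %% 2)%Z h0 h1 => [[|[|n]]|n]// _ _; [left|right].
    by left; rewrite {1}e h addr0 mulrC.
  by right; rewrite {1}e h mulrC.
- exact: (key k).1.
- exact: (key k).2.
Qed.

Lemma pr_dyn J m (n : nat) : pr (dy J m) (dy J (m + n%:Z)) = 0.
Proof.
elim: n => [|n IH]; first by rewrite addr0 pr_refl.
have e : m + n.+1%:Z = m + n%:Z + 1 by rewrite -addn1 PoszD addrA.
rewrite e (@prD _ (dy J (m + n%:Z))); last 2 first.
  by apply: dy_le; rewrite lerDl.
  by apply: dy_le; rewrite lerDl.
by rewrite IH pr_dy addr0.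
Qed.

Lemma pr_dy0 J m n : m <= n -> pr (dy J m) (dy J n) = 0.
Proof.
move=> mn; have <- : m + (`|n - m|%N)%:Z = n.
  by rewrite gez0_abs ?subr_ge0//; ring.
exact: pr_dyn.
Qed.

Definition dfl (x : R) (J : nat) : R := dy J (Num.floor (2 ^+ J * x)).

Lemma dfl_le x J : dfl x J <= x.
Proof.
rewrite /dfl /dy -exprnN -exprVn exprVn ler_pdivrMl ?exprn_gt0//.
exact: Num.Theory.floor_le.
Qed.

Lemma dfl_gt x J : x - scale J < dfl x J.
Proof.
rewrite /dfl /dy -exprnN /scale ltrBlDr -[X in _ < _ + X]mulr1 -mulrDr.
rewrite ltr_pdivlMl ?exprn_gt0//.
have := Num.Theory.floorD1_gt (2 ^+ J * x).
by rewrite intrD.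
Qed.

(** Continuity of the pairing in the end point, by domination over the blocks. *)
Lemma pr_dfl x : pr (dfl x J) x @[J --> \oo] --> (0 : R).
Proof.
set A := `|x| + 1.
pose D := intR (fun y => `|P (dens 0 y) * \1_(`[- A, A]%classic) y|).
have D0 : 0 <= D by apply: intR_ge0.
have xA J y : y \in `[dfl x J, x[ -> `|y| <= A.
  rewrite in_itv/= => /andP[h1 h2]; have := dfl_gt x J => h3.
  have s1 := @scale_le1 R J; have n1 := ler_norm x; have n2 := ler_norm (- x).
  rewrite normrN in n2; rewrite ler_norml /A; apply/andP; split; lra.
have IA k : integ (fun y => P (dens k y) * \1_(`[- A, A]%classic) y).
  by apply: (@Lw_itv _ _ `[- A, A] A (PL k)) => y; rewrite in_itv/= -ler_norml.
have IJ k J : integ (fun y => P (dens k y) * \1_(`[dfl x J, x[%classic) y).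
  by apply: (@Lw_itv _ _ `[dfl x J, x[ A (PL k)) => y; exact: xA.
have dm k J y : `|P (dens k y) * \1_(`[dfl x J, x[%classic) y| <= `|P (dens k y) * \1_(`[- A, A]%classic) y|.
  rewrite !normrM ler_wpM2l// indicE mem_setE; case: (boolP (y \in _)) => [yI|_]; last by rewrite normr0.
  by rewrite [X in _ <= `|X|]indicE mem_set//= in_itv/= -ler_norml; exact: xA yI.
have domD k : 0 <= dom D k by exact: dom_ge0.
have bnd J k : `|piece k (dfl x J) x| <= dom D k.
  case: k => [|k]; last by apply: piece_bnd; exact: dfl_le.
  rewrite pieceE; apply: norm_intR_le; [exact: (IJ 0%N J)|exact: integ_norm (IA 0%N)|exact: dm].
have lim0 k : piece k (dfl x J) x @[J --> \oo] --> (0 : R).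
  rewrite (_ : (fun J => _) = (fun J => intR (fun y => P (dens k y) * \1_(`[dfl x J, x[%classic) y))); last first.
    by apply/funext => J; exact: pieceE.
  rewrite -(@intR_cst0 R); apply: (cvg_intR _ (integ_norm (IA k))).
  + by move=> J; exact: integ_meas (IJ k J).
  + move=> y; rewrite -[X in _ --> X](mulr0 (P (dens k y))); apply: cvgMr.
    have [xy|yx] := leP x y.
      rewrite (_ : (fun J => _) = (fun=> 0)); first exact: cvg_cst.
      by apply/funext => J; rewrite indicE mem_setE in_itv/= ltNge xy andbF.
    have xy0 : 0 < x - y by rewrite subr_gt0.
    apply: cvg_near_cst.
    have hn : \forall J \near \oo, scale J < x - y := cvgr_lt 0 scale_cvg0 _ xy0.
    case: hn => N _ hN; exists N => // J NJ; have hJ := hN J NJ; rewrite /=.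
    rewrite indicE mem_setE in_itv/= yx andbT leNgt.
    have hy : y < dfl x J by apply: (lt_trans _ (dfl_gt x J)); rewrite ltrBrDl -ltrBrDr.
    by rewrite hy.
  + by move=> J y; exact: dm.
have [_] := @tannery R (fun J k => piece k (dfl x J) x) (fun=> 0) (dom D) (fun J => pr (dfl x J) x)
  domD (dom_cvg D0) bnd lim0 (fun J => (pair_indic_cvg (dfl_le x J)).1).
have -> : series (fun=> 0 : R) = (fun=> 0).
  by apply/funext => n; rewrite /series/= big1.
by rewrite lim_cst.
Qed.

(** The dyadic points are dense and the pairing vanishes on intervals between them. *)
Lemma pr0x x : 0 <= x -> pr 0 x = 0.
Proof.
move=> x0.
have h J : pr (dfl x J) x = pr 0 x.
  have f0 : 0 <= Num.floor (2 ^+ J * x) by rewrite Num.Theory.floor_ge_int mulr_ge0// exprn_ge0.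
  have d0 : dy J 0 = 0 by rewrite /dy mulr0.
  have := pr_dy0 J f0; rewrite d0 => e.
  have dl : 0 <= dfl x J by have := dy_le J f0; rewrite d0.
  by rewrite (prD dl (dfl_le x J)) -/(dfl x J) e add0r.
have := pr_dfl x; rewrite (funext h : (fun J => _) = _) => c.
have c' : (fun=> pr 0 x) @ \oo --> pr 0 x by exact: cvg_cst.
by apply: (cvg_unique _ c' c); exact: Rhausdorff.
Qed.

Lemma prx0 x : x < 0 -> pr x 0 = 0.
Proof.
move=> x0.
have h J : pr (dfl x J) x = - pr x 0.
  have f0 : Num.floor (2 ^+ J * x) <= 0.
    rewrite -ltzD1 -(ltr_int R) intrD /=; apply: le_lt_trans (Num.Theory.floor_le _) _.
    by rewrite add0r (lt_trans _ ltr01)// nmulr_llt0// exprn_gt0.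
  have d0 : dy J 0 = 0 by rewrite /dy mulr0.
  have := pr_dy0 J f0; rewrite d0 -/(dfl x J) (prD (dfl_le x J) (ltW x0)) => e.
  by apply/eqP; rewrite -addr_eq0 e.
have := pr_dfl x; rewrite (funext h : (fun J => _) = _) => c.
have c' : (fun=> - pr x 0) @ \oo --> - pr x 0 by exact: cvg_cst.
have e : - pr x 0 = 0 by apply: (cvg_unique _ c' c); exact: Rhausdorff.
by rewrite -[LHS]opprK e oppr0.
Qed.

(** Expand [F u] into blocks and integrate each by parts: the primitives of the
    densities of the blocks are summable uniformly for positive levels, they grow at
    most quadratically at level 0, and their sum at [x] is the pairing with the segment
    from 0 to [x], which vanishes. *)
Lemma P_F0 (u : R -> R) : rschwartz u -> P (F (fun x => (u x)%:C)) = 0.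
Proof.
move=> su; have su' := rschwartz_derive su.
(* The primitives of the densities of the blocks, vanishing at 0. *)
pose Phi k x := prim (fun y => P (dens k y)) x.
have PhiE k x : Phi k x = if 0 <= x then piece k 0 x else - piece k x 0.
  rewrite /Phi; case: lerP => x0; first by rewrite (prim_ge0 _ x0) pieceE.
  by rewrite (prim_lt0 x0 (PL k)) pieceE.
have Phi_bnd k x : `|Phi k.+1 x| <= Kc * (scale k.+1 * beta k.+1).
  rewrite PhiE; case: (leP 0 x) => x0; first by apply: piece_bnd.
  by rewrite normrN; apply: piece_bnd; exact: ltW.
have serPhi x : series (Phi ^~ x) @ \oo --> (0 : R).
  case: (lerP 0 x) => x0.
    have -> : Phi ^~ x = (fun k => piece k 0 x) by apply/funext => k; rewrite PhiE x0.
    by have [+ _] := pair_indic_cvg x0; rewrite -/(pr 0 x) (pr0x x0).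
  have -> : Phi ^~ x = (fun k => - piece k x 0) by apply/funext => k; rewrite PhiE leNgt x0.
  have [+ _] := pair_indic_cvg (ltW x0); rewrite -/(pr x 0) (prx0 x0) => c.
  have -> : series (fun k => - piece k x 0) = (fun n => - series (fun k => piece k x 0) n).
    by apply/funext => n; rewrite /series/= sumrN.
  by rewrite -[X in _ --> X]oppr0; exact: cvgN.
pose D := intR (fun y => `|wt y * P (dens 0 y)|).
have D0 : 0 <= D by apply: intR_ge0.
pose L := limn (series (dom 0)).
(* A quadratic bound uniform in n, integrable against the derivative of u. *)
have serb n x : `|series (Phi ^~ x) n| <= (D + L) * (1 + x ^+ 2).
  have hx1 : 1 <= 1 + x ^+ 2 := oneDsqr_ge1' x.
  have L0 : 0 <= L.
    apply: limr_ge; first exact: dom_cvg.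
    by apply: nearW => m; apply: sumr_ge0 => k _; exact: dom_ge0.
  have h2 : series (dom 0) n <= L.
    apply: nondecreasing_cvgn_le; last exact: dom_cvg.
    by apply: nondecreasing_series => k _ _; exact: dom_ge0.
  apply: (@le_trans _ _ (D * (1 + x ^+ 2) + series (dom 0) n)); last first.
    by rewrite mulrDl lerD2l (le_trans h2)// ler_peMr.
  rewrite /series/=; case: n h2 => [|n] h2.
    by rewrite !big_geq// normr0 addr0 mulr_ge0// (le_trans ler01).
  rewrite !big_nat_recl//= add0r; apply: le_trans (ler_normD _ _) _; apply: lerD.
    exact: prim_bnd.
  by apply: le_trans (ler_norm_sum _ _ _) _; apply: ler_sum => k _; exact: Phi_bnd.
have Iu2 : integ (fun x => `|derive1 u x| * (1 + x ^+ 2)).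
  have := integ_norm (rschwartz_integ (rschwartzD su' (rschwartz_mulx (rschwartz_mulx su')))).
  congr integ; apply/funext => x.
  have -> : derive1 u x + x * (x * derive1 u x) = derive1 u x * (1 + x ^+ 2) by ring.
  by rewrite normrM [`|1 + _|]ger0_norm// ltW// oneDsqr_gt0'.
(* Measurability by Fubini, after making the integrand integrable on the
   plane with a weight that is divided out at the end. *)
have mPhi k : meas (Phi k).
  have mF : meas2 (fun y x => P (dens k y) * between x y).
    by apply: meas2M; [apply: (@meas2_1 _ (fun y => P (dens k y))); exact: (PL k).1|exact: (meas2_swap meas2_between)].
  have h x y : `|wt x ^+ 2 * (P (dens k y) * between x y)| <= wt x * `|wt y * P (dens k y)|.
    rewrite normrM (normrM (P _)) (normrM (wt y)) [`|wt y|]ger0_norm ?wt_ge0// ger0_norm ?sqr_ge0//.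
    have hb := between_bnd x y.
    apply: (@le_trans _ _ (wt x ^+ 2 * (`|P (dens k y)| * ((1 + x ^+ 2) * wt y)))).
      by rewrite ler_wpM2l ?sqr_ge0// ler_wpM2l.
    have -> : wt x ^+ 2 * (`|P (dens k y)| * ((1 + x ^+ 2) * wt y)) =
      (wt x * (1 + x ^+ 2)) * (wt x * (wt y * `|P (dens k y)|)) by ring.
    by rewrite /wt mulVf ?mul1r// gt_eqF// oneDsqr_gt0'.
  have mF2 : meas2 (fun x y => wt x ^+ 2 * (P (dens k y) * between x y)).
    apply: meas2M; last exact: (meas2_swap mF).
    by apply: (@meas2_1 _ (fun x => wt x ^+ 2)); apply: measM; exact: meas_wt.
  have [J1 _ _] := fubini_dom mF2 (@integ_wt R) (integ_norm (PL k).2) h.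
  have m1 := integ_meas J1.
  have mq : meas (fun x : R => (1 + x ^+ 2) ^+ 2).
    have m1' : meas (fun x : R => 1 + x ^+ 2).
      by apply: measD; [exact: meas_cst|exact: measM (@measurable_id _ _ setT) (@measurable_id _ _ setT)].
    rewrite (_ : (fun x : R => _) = (fun x : R => (1 + x ^+ 2) * (1 + x ^+ 2))); last by apply/funext => x; rewrite expr2.
    exact: (measM m1' m1').
  have := measM mq m1; congr meas; apply/funext => x.
  rewrite (intRZ _ (integ_between x (PL k))) -/(Phi k x) /wt exprVn mulrA divff ?mul1r//.
  by rewrite expf_neq0// gt_eqF// oneDsqr_gt0'.
have mS n : meas (fun x => series (Phi ^~ x) n).
  rewrite /series/=; elim: n => [|n IH].
    by have := meas_cst (0 : R); congr meas; apply/funext => x; rewrite big_geq.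
  have := measD IH (mPhi n); congr meas; apply/funext => x.
  by rewrite big_nat_recr.
have Isd n : integ (fun x => series (Phi ^~ x) n * derive1 u x).
  apply: (integ_dom _ (integZ (D + L) Iu2)).
    by apply: measM; [exact: mS|exact: rschwartz_meas].
  move=> x; rewrite normrM (mulrC `|derive1 u x|) mulrA ler_wpM2r//.
have Ipd k : integ (fun x => Phi k x * derive1 u x).
  apply: (integ_dom _ (integZ (intR (fun y => `|wt y * P (dens k y)|)) Iu2)).
    by apply: measM; [exact: mPhi|exact: rschwartz_meas].
  move=> x; rewrite normrM (mulrC `|derive1 u x|) mulrA ler_wpM2r//.
  exact: prim_bnd.
have E n : series (fun k => P (lp_block eta k F (fun x => (u x)%:C))) n =
    - intR (fun x => series (Phi ^~ x) n * derive1 u x).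
  elim: n => [|n IH].
    rewrite /series/= big_geq// (_ : (fun x => _) = (fun=> 0)) ?intR_cst0 ?oppr0//.
    by apply/funext => x; rewrite big_geq// mul0r.
  rewrite /series/= big_nat_recr//=.
  rewrite -[X in X + _]/(series (fun k => P (lp_block eta k F (fun x => (u x)%:C))) n) IH.
  rewrite (P_block n su) (integration_by_parts_prim (PL n) su) -opprD -(intRD (Isd n) (Ipd n)).
  congr (- intR _); apply/funext => x; rewrite [in RHS]big_nat_recr//= mulrDl//.
have c1 := series_blocks (schwartz_real su).
have c2 : series (fun k => P (lp_block eta k F (fun x => (u x)%:C))) @ \oo --> (0 : R).
  rewrite (funext E : series _ = _) -[X in _ --> X]oppr0; apply: cvgN.
  rewrite -(@intR_cst0 R); apply: (cvg_intR _ (integZ (D + L) Iu2)).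
  - by move=> n; exact: integ_meas (Isd n).
  - by move=> x; rewrite -[X in _ --> X](mul0r (derive1 u x)); apply: cvgMl; exact: serPhi.
  - move=> n x; rewrite normrM (mulrC `|derive1 u x|) mulrA ler_wpM2r//.
by apply: (cvg_unique _ c1 c2); exact: Rhausdorff.
Qed.

End ReferenceBesov.

(** * The strong maximal inequality *)

Lemma le_int {R : realType} (f g : R -> \bar R) : (forall x, 0 <= f x)%E -> (forall x, f x <= g x)%E ->
  (\int[@lebesgue_measure R]_x f x <= \int[@lebesgue_measure R]_x g x)%E.
Proof.
move=> f0 fg; rewrite !ge0_integralTE//; last by move=> x; exact: le_trans (fg x).
apply: le_ereal_sup => _ [h hf <-]; exists h => // x; exact: le_trans (hf x) (fg x).
Qed.

Lemma int_indic {R : realType} (A : set R) : measurable A ->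
 (\int[@lebesgue_measure R]_x (\1_A x)%:E = @lebesgue_measure R A)%E.
Proof. by move=> mA; rewrite integral_indic// setIT. Qed.

Section StrongMaximal.
Context {R : realType}.
Notation mu := (@lebesgue_measure R).
Variable r : R.
Hypothesis r1 : 1 < r.
Let q := r - 1.
Let q0 : 0 < q. Proof. by rewrite subr_gt0. Qed.
Let r0 : 0 < r. Proof. by rewrite (lt_trans ltr01). Qed.
Let rho : R := 2 `^ q.
Let rho1 : 1 < rho.
Proof. have h : 1 `^ q < 2 `^ q :> R by apply: gt0_ltr_powR => //; rewrite ?nnegrE// ltr1n.
by rewrite powR1 in h. Qed.
Let rho10 : 0 < rho - 1. Proof. by rewrite subr_gt0 rho1. Qed.

Lemma geometric_powR (s : R) N : 0 < s ->
  \sum_(n < N) (s * 2 ^+ n) `^ q <= (s * 2 ^+ N) `^ q / (rho - 1).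
Proof.
move=> s0; elim: N => [|N IH]; first by rewrite big_ord0 divr_ge0 ?powR_ge0 ?(ltW rho10).
rewrite big_ord_recr/=; apply: le_trans (lerD IH (lexx _)) _.
have -> : s * 2 ^+ N.+1 = 2 * (s * 2 ^+ N) by rewrite exprS; ring.
have s2 : 0 <= s * 2 ^+ N by rewrite mulr_ge0 ?exprn_ge0// ltW.
rewrite (powRM _ (ler0n _ 2) s2) -/rho; set y := (_ `^ q).
by rewrite le_eqVlt; apply/orP; left; apply/eqP; field; rewrite gt_eqF.
Qed.

(** Only the levels below [a] contribute, and a geometric sum is at most a multiple
    of its largest term. *)
Lemma geometric_powR_cut (s a : R) N : 0 < s -> 0 <= a ->
  \sum_(n < N) (s * 2 ^+ n) `^ q * (s * 2 ^+ n < a)%R%:R <= a `^ q * (rho / (rho - 1)).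
Proof.
move=> s0 a0; have C0 : 0 <= a `^ q * (rho / (rho - 1)).
  by rewrite mulr_ge0 ?powR_ge0 ?divr_ge0 ?powR_ge0 ?(ltW rho10).
elim: N => [|N IH]; first by rewrite big_ord0.
rewrite big_ord_recr/=; have [sa|_] := ltP (s * 2 ^+ N) a; last by rewrite mulr0 addr0.
have s2 : 0 <= s * 2 ^+ N by rewrite mulr_ge0 ?exprn_ge0// ltW.
rewrite mulr1.
apply: (@le_trans _ _ (\sum_(n < N.+1) (s * 2 ^+ n) `^ q)).
  rewrite big_ord_recr/= lerD2r; apply: ler_sum => n _.
  by rewrite ler_piMr ?powR_ge0//; case: (_ < a).
apply: le_trans (geometric_powR N.+1 s0) _.
have -> : s * 2 ^+ N.+1 = 2 * (s * 2 ^+ N) by rewrite exprS; ring.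
rewrite (powRM _ (ler0n _ 2) s2) -/rho mulrA [a `^ q * _]mulrC.
rewrite ler_pM2r ?invr_gt0// ler_pM2l ?(lt_trans ltr01 rho1)//.
by apply: ge0_ler_powR; rewrite ?nnegrE// ltW.
Qed.

Local Open Scope ereal_scope.

Definition lcut (y : \bar R) (s : R) (K : nat) : \bar R :=
  if s%:E < y then (mine y (s * 2 ^+ K)%:E) `^ r else 0.

Lemma lcut_ge0 y s K : 0 <= lcut y s K.
Proof. by rewrite /lcut; case: ifP => // _; exact: poweR_ge0. Qed.

Lemma poweR_le (x y : \bar R) : 0 <= x -> x <= y -> x `^ r <= y `^ r.
Proof.
move=> x0 xy; apply: (gt0_ler_poweR (ltW r0)) => //; rewrite ?in_itv/= ?leey ?andbT//.
exact: le_trans xy.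
Qed.

(** Layer cake on the levels [s * 2 ^ n] instead of an integral over all levels.
    The function is cut below [s] and above the last level so that all sums are
    finite; the cuts are removed by monotone convergence. *)
Lemma ladder (y : \bar R) (s : R) K : (0 < s)%R -> 0 <= y ->
  lcut y s K.+1 <=
  \sum_(n < K.+1) ((s * 2 ^+ n.+1) `^ r)%:E * ((s * 2 ^+ n)%:E < y)%E%:R%:E.
Proof.
move=> s0 y0; elim: K => [|K IH].
  rewrite big_ord_recr big_ord0/= add0e expr0 mulr1 /lcut; case: ifP => sy; last by rewrite mule0.
  rewrite mule1 -poweR_EFin; apply: poweR_le; last by rewrite ge_min lexx orbT.
  by rewrite le_min y0 lee_fin mulr_ge0 ?exprn_ge0// ltW.
rewrite big_ord_recr/=.
have s2 n : (0 <= s * 2 ^+ n)%R by rewrite mulr_ge0 ?exprn_ge0// ltW.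
have [h|h] := ltP (s * 2 ^+ K.+1)%:E y.
  rewrite mule1 /lcut; case: ifP => sy; last first.
    rewrite adde_ge0 ?lee_fin ?powR_ge0//; apply: sume_ge0 => n _.
    by rewrite mule_ge0// lee_fin ?powR_ge0// ler0n.
  rewrite -[X in X <= _]add0e; apply: leeD.
    apply: sume_ge0 => n _.
    by rewrite mule_ge0// lee_fin ?powR_ge0// ler0n.
  rewrite -poweR_EFin; apply: poweR_le; last by rewrite ge_min lexx orbT.
  by rewrite le_min y0 lee_fin s2.
rewrite mule0 adde0; apply: le_trans IH; rewrite /lcut.
case: ifP => // sy; rewrite (min_idPl _) ?(min_idPl h)//.
apply: le_trans h _; rewrite lee_fin ler_pM2l// ler_weXn2l// ler1n //.
Qed.

Variable g : R -> R.
Hypothesis Lg : Lw g.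
Let mg : measurable_fun setT g := Lg.1.

Lemma locally_integrable_le (h : R -> R) : measurable_fun setT h ->
  (forall x, (`|h x| <= `|g x|)%R) -> locally_integrable setT h.
Proof. by move=> mh hg; apply: Lw_locally_integrable; apply: (Lw_dom mh (Lw_norm Lg)). Qed.

Let LIg : locally_integrable setT g := Lw_locally_integrable Lg.

Definition bigp (c x : R) : R := (g x * (c < `|g x|)%R%:R)%R.

Lemma meas_bigp c : measurable_fun setT (bigp c).
Proof.
apply: measurable_funM => //.
pose A := [set x | (c < `|g x|)%R].
have mA : measurable A.
  rewrite (_ : A = setT `&` (fun x => `|g x|%R) @^-1` `]c, +oo[%classic); last first.
    by apply/seteqP; split=> x /=; rewrite in_itv/= andbT => // -[].
  by apply: (meas_norm mg) => //; exact: measurable_itv.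
rewrite (_ : (fun x => _) = \1_A); first exact: meas_indic.
apply/funext => x; rewrite indicE; congr (_%:R)%R; congr nat_of_bool.
by apply/idP/idP; rewrite inE.
Qed.

Lemma bigp_le c x : (`|bigp c x| <= `|g x|)%R.
Proof. by rewrite /bigp normrM ler_piMr//; case: (_ < _)%R; rewrite ?normr1 ?normr0. Qed.

(** The part of [g] below [c] adds at most [c] to every average. *)
Lemma HL_bigp c x : (0 < c)%R -> HL_maximal g x <= c%:E + HL_maximal (bigp c) x.
Proof.
move=> c0; apply: ge_ereal_sup => _ [d /= d0 <-].
rewrite in_itv/= andbT in d0.
(* The truncated part, at most c in modulus. *)
pose sm := fun y => (g y - bigp c y)%R.
have msm : measurable_fun setT sm by apply: measurable_funB => //; exact: meas_bigp.
have mB : measurable (ball x d) by exact: measurable_ball.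
have muB : mu (ball x d) = (d *+ 2)%:E by rewrite lebesgue_measure_ball// ltW.
have -> : g = (sm \+ bigp c)%R by apply/funext => y; rewrite /sm/= subrK.
apply: (le_trans (iavgD mB _ _ _)).
- by rewrite muB ltry.
- exact: measurable_funTS.
- by apply: measurable_funTS; exact: meas_bigp.
apply: leeD; last first.
  by apply: ereal_sup_ubound; exists d => //=; rewrite in_itv/= andbT.
rewrite /iavg muB.
have d2 : (0 < d *+ 2)%R by rewrite pmulrn_rgt0.
rewrite inver gt_eqF// lee_pdivrMl//.
apply: (@le_trans _ _ (\int[mu]_(y in ball x d) (cst c%:E y))).
  apply: ge0_le_integral => //.
  - by apply: measurable_funTS; apply/measurable_EFinP; apply: measurableT_comp.
  - move=> y _; rewrite lee_fin /sm /bigp; case: (ltP c (`|g y|)%R) => h.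
      by rewrite mulr1 subrr normr0 ltW.
    by rewrite mulr0 subr0.
rewrite integral_cst// le_eqVlt; apply/orP; left; apply/eqP; rewrite muleC; congr (_ * _); exact: muB.
Qed.

(** The standard improvement of the weak type inequality: only the part of [g] above
    half the level matters. *)
Lemma weak_type (l : R) : (0 < l)%R ->
  mu [set x | l%:E < HL_maximal g x] <= (6 / l)%:E * \int[mu]_x `|(bigp (l / 2) x)%:E|.
Proof.
move=> l0; have l2 : (0 < l / 2)%R by rewrite divr_gt0.
have lb : locally_integrable setT (bigp (l / 2)).
  by apply: locally_integrable_le; [exact: meas_bigp|exact: bigp_le].
have -> : (6 / l = 3 / (l / 2))%R by field; rewrite gt_eqF.
apply: le_trans (maximal_inequality lb l2).
apply: le_measure; rewrite ?inE.
- rewrite -[X in measurable X]setTI; apply: emeasurable_fun_o_infty => //.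
  exact: measurable_HL_maximal.
- rewrite -[X in measurable X]setTI; apply: emeasurable_fun_o_infty => //.
  exact: measurable_HL_maximal.
move=> x /= lx; have := lt_le_trans lx (HL_bigp x l2).
have {1}-> : (l = l / 2 + l / 2)%R by rewrite -splitr.
by rewrite EFinD lteD2lE.
Qed.

Definition Kmax : R := (6 * 2 `^ r * (2 `^ q * (rho / (rho - 1))))%R.

Lemma Kmax_ge0 : (0 <= Kmax)%R.
Proof. by rewrite /Kmax !mulr_ge0 ?powR_ge0 ?invr_ge0 ?(ltW rho10). Qed.

Let HL0 x : 0 <= HL_maximal g x.
Proof. exact: HL_maximalT_ge0. Qed.

(** Sum the weak type inequality over the levels of the ladder and exchange the sum
    with the integral; the exponent [r - 1 > 0] makes the inner sum geometric. *)
Lemma lcut_int (s : R) K : (0 < s)%R ->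
  \int[mu]_x lcut (HL_maximal g x) s K.+1 <= Kmax%:E * \int[mu]_x ((`|g x| `^ r)%:E).
Proof.
move=> s0.
pose l n : R := (s * 2 ^+ n)%R.
have l0 n : (0 < l n)%R by rewrite mulr_gt0// exprn_gt0.
pose A n := [set x | (l n)%:E < HL_maximal g x].
have mA n : measurable (A n).
  rewrite -[X in measurable X]setTI; apply: emeasurable_fun_o_infty => //.
  exact: measurable_HL_maximal.
have mgr : measurable_fun setT (fun x => (`|g x| `^ r)%:E).
  by apply/measurable_EFinP; apply: (measurableT_comp (measurable_powR r)); exact: measurableT_comp.
have mHL := measurable_HL_maximal LIg.
apply: (@le_trans _ _ (\int[mu]_x \sum_(n < K.+1) ((l n.+1) `^ r)%:E * (\1_(A n) x)%:E)).
  apply: ge0_le_integral => //.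
  - by move=> x _; exact: lcut_ge0.
  - rewrite /lcut; apply: measurable_fun_ifT => //.
    + exact: measurable_fun_lte.
    + apply: (measurableT_comp (measurable_poweR r)); exact: measurable_mine.
  - apply: emeasurable_sum => n; apply: measurable_funeM; apply/measurable_EFinP; exact: (meas_indic (mA n)).
  - move=> x _; apply: le_trans (ladder K s0 (HL0 x)) _.
    apply: lee_sum => n _; rewrite indicE; have -> // : x \in A n = ((l n)%:E < HL_maximal g x).
    by apply/idP/idP; rewrite inE.
rewrite ge0_integral_sum//; last 2 first.
  by move=> n; apply: measurable_funeM; apply/measurable_EFinP; exact: (meas_indic (mA n)).
  by move=> n x _; rewrite mule_ge0// lee_fin ?powR_ge0.
apply: (@le_trans _ _ (\sum_(n < K.+1) \int[mu]_x (((l n.+1) `^ r * (6 / l n) * `|bigp (l n / 2) x|)%:E))).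
  apply: lee_sum => n _.
  rewrite ge0_integralZl_EFin//; last 2 first.
    by apply/measurable_EFinP; exact: (meas_indic (mA n)).
    exact: powR_ge0.
  rewrite [X in _ * X](_ : _ = mu (A n)); last exact: int_indic (mA n).
  under eq_integral do rewrite -mulrA EFinM.
  rewrite ge0_integralZl_EFin//; last 3 first.
  - by move=> x _; rewrite lee_fin mulr_ge0 ?divr_ge0 ?(ltW (l0 n)).
  - apply/measurable_EFinP; apply: measurable_funM => //; apply: measurableT_comp => //; exact: meas_bigp.
  - exact: powR_ge0.
  rewrite lee_wpmul2l// ?lee_fin ?powR_ge0//.
  under eq_integral do rewrite EFinM.
  rewrite ge0_integralZl_EFin//; last 2 first.
  - by apply/measurable_EFinP; apply: measurableT_comp => //; exact: meas_bigp.
  - by rewrite divr_ge0// ltW.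
  exact: weak_type.
rewrite -ge0_integral_sum//; last 2 first.
  move=> n; apply/measurable_EFinP; apply: measurable_funM => //; apply: measurableT_comp => //; exact: meas_bigp.
  by move=> n x _; rewrite lee_fin !mulr_ge0 ?powR_ge0 ?invr_ge0 ?(ltW (l0 _)).
rewrite -ge0_integralZl_EFin//; last first.
  exact: Kmax_ge0.
apply: ge0_le_integral => //.
- by move=> x _; apply: sume_ge0 => n _; rewrite lee_fin !mulr_ge0 ?powR_ge0 ?invr_ge0 ?(ltW (l0 _)).
- apply: emeasurable_sum => n; apply/measurable_EFinP; apply: measurable_funM => //; apply: measurableT_comp => //; exact: meas_bigp.
- by apply: measurable_funeM.
move=> x _; rewrite sumEFin lee_fin.
set a := `|g x|%R.
have E n : ((l n.+1) `^ r * (6 / l n) * `|bigp (l n / 2) x| =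
   6 * 2 `^ r * a * ((s * 2 ^+ n) `^ q * (s * 2 ^+ n < 2 * a)%R%:R))%R.
  have -> : (l n.+1 = 2 * l n)%R by rewrite /l exprS; ring.
  rewrite (powRM _ (ler0n _ 2) (ltW (l0 n))) -(mulr_powRB1 (ltW (l0 n)) r0) -/q -/(l n).
  have -> : (`|bigp (l n / 2) x| = a * (l n < 2 * a)%R%:R)%R.
    rewrite /bigp normrM -/a ltr_pdivrMr// [(a * 2)%R]mulrC.
    by case: (_ < _)%R; rewrite ?normr1 ?normr0.
  by field; rewrite gt_eqF.
under eq_bigr do rewrite E.
rewrite -mulr_sumr.
have a0 : (0 <= a)%R by exact: normr_ge0.
have := geometric_powR_cut K.+1 s0 (mulr_ge0 (ler0n R 2) a0) => h.
apply: le_trans (ler_wpM2l _ h) _; first by rewrite !mulr_ge0 ?powR_ge0.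
rewrite (powRM _ (ler0n _ 2) a0) -(mulr_powRB1 a0 r0) -/q /Kmax.
by rewrite le_eqVlt; apply/orP; left; apply/eqP; ring.
Qed.

(** The bound of [lcut_int] is uniform in the cuts, so it passes to the limit. *)
Theorem strong_maximal :
  \int[mu]_x ((HL_maximal g x) `^ r) <= Kmax%:E * \int[mu]_x ((`|g x| `^ r)%:E).
Proof.
have mHL := measurable_HL_maximal LIg.
(* The cuts from 2 ^ -n up to 2 ^ n.+1 increase to the full power. *)
pose psi n x := lcut (HL_maximal g x) (scale n) n.*2.+1.
have E2 n : (scale n * 2 ^+ n.*2.+1 = 2 ^+ n.+1 :> R)%R.
  by rewrite /scale -addnn -addnS exprD mulrA mulVf ?mul1r// expf_neq0.
have mpsi n : measurable_fun setT (psi n).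
  rewrite /psi /lcut; apply: measurable_fun_ifT => //.
  + exact: measurable_fun_lte.
  + apply: (measurableT_comp (measurable_poweR r)); exact: measurable_mine.
have psi0 n x : 0 <= psi n x by exact: lcut_ge0.
have ndpsi x : nondecreasing_seq (psi^~ x).
  apply/nondecreasing_seqP => n; rewrite /psi /lcut !E2.
  case: ifP => sy; last by case: ifP => // _; exact: poweR_ge0.
  have -> : (scale n.+1)%:E < HL_maximal g x.
    apply: le_lt_trans sy; rewrite lee_fin /scale lef_pV2 ?posrE ?exprn_gt0//.
    by rewrite ler_weXn2l// ler1n.
  apply: poweR_le; first by rewrite le_min HL0 lee_fin exprn_ge0.
  rewrite le_min ge_min lexx/=; apply: (@le_trans _ _ (2 ^+ n.+1)%:E); first by rewrite ge_min lexx orbT.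
  by rewrite lee_fin ler_weXn2l// ler1n.
have limpsi x : (HL_maximal g x) `^ r <= limn (psi^~ x).
  have cv := ereal_nondecreasing_is_cvgn (ndpsi x).
  have ge n : psi n x <= limn (psi^~ x).
    apply: lime_ge => //; exists n => // m /= nm; exact: ndpsi.
  have := HL0 x; case E : (HL_maximal g x) => [y||]//.
    rewrite lee_fin le_eqVlt => /orP[/eqP <-|y0].
      rewrite poweR_EFin powR0 ?gt_eqF//; exact: le_trans (ge 0%N).
    have [n1 h1] : exists n, (scale n < y)%R.
      have := cvgr_lt 0%R scale_cvg0 _ y0; case=> N _ hN; exists N; exact: hN (leqnn N).
    have [n2 h2] : exists n : nat, (y <= n%:R)%R.
      by exists (Num.Def.archi_bound y); rewrite ltW// archi_boundP// ltW.
    pose n := maxn n1 n2.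
    apply: le_trans (ge n); rewrite /psi /lcut E E2.
    have -> : ((scale n)%:E < y%:E)%E.
      rewrite lte_fin; apply: le_lt_trans h1; rewrite /scale lef_pV2 ?posrE ?exprn_gt0//.
      by rewrite ler_weXn2l ?ler1n// leq_maxl.
    rewrite (min_idPl _)// lee_fin; apply: le_trans h2 _.
    rewrite -natrX ler_nat; apply: leq_trans (leq_maxr n1 n2) _; apply: leq_trans (leqnSn _) _.
    by rewrite ltnW// ltn_expl.
  move=> _; rewrite poweRyr ?gt_eqF//.
  suff -> : limn (psi^~ x) = +oo by [].
  apply/eqyP => A A0; apply: (@le_trans _ _ (psi (Num.Def.archi_bound A) x)); last exact: ge.
  rewrite /psi /lcut E ltry E2 min_r ?leey// lee_fin.
  set n := Num.Def.archi_bound A.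
  have hA : (A < n%:R)%R by apply: archi_boundP; exact: ltW.
  have h2 : (n%:R <= 2 ^+ n.+1 :> R)%R.
    by rewrite -natrX ler_nat; apply: leq_trans (leqnSn _) _; rewrite ltnW// ltn_expl.
  apply: le_trans (ltW hA) _; apply: le_trans h2 _; apply: le1r_powR; last exact: ltW.
  by rewrite exprn_ege1// ler1n.
apply: (@le_trans _ _ (\int[mu]_x limn (psi^~ x))).
  apply: ge0_le_integral => //.
  - by move=> x _; exact: poweR_ge0.
  - exact: (measurableT_comp (measurable_poweR r)).
  - apply: (emeasurable_fun_cvg psi) => // x _; exact: ereal_nondecreasing_is_cvgn (ndpsi x).
rewrite monotone_convergence//.
apply: lime_le.
  apply: ereal_nondecreasing_is_cvgn => m n mn; apply: le_int => [x|x]; [exact: psi0|exact: ndpsi].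
apply: nearW => n; rewrite /psi; exact: lcut_int (scale_gt0 n).
Qed.

End StrongMaximal.

(** * Lebesgue norms of real functions *)

Section RealNorm.
Context {R : realType}.
Notation mu := (@lebesgue_measure R).
Variable p : \bar R.
Hypothesis p1 : (1 < p)%E.

Definition nrm (h : R -> R) : \bar R := Lnorm mu p (fun x => (h x)%:E).

Lemma exponentP : (p = +oo)%E \/ exists2 r : R, 1 < r & p = r%:E.
Proof.
move: p1; case: (p) => [r| |]; [|by left|by []].
by rewrite lte_fin; right; exists r.
Qed.

Lemma nrm_ge0 h : (0 <= nrm h)%E. Proof. exact: Lnorm_ge0. Qed.

Lemma nrm_norm h : nrm (fun x => `|h x|) = nrm h.
Proof. by rewrite /nrm -[RHS]Lnorm_abse. Qed.

Lemma cmod_real (x : R) : cmod x%:C = `|x|.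
Proof. by rewrite /cmod/= expr0n/= addr0 sqrtr_sqr. Qed.

Lemma meas_real (h : R -> R) : meas h -> cmeasurable (fun x => (h x)%:C).
Proof. by move=> mh; split => //; exact: meas_cst. Qed.

Lemma nrm_oo_le h (B : R) : p = +oo%E -> meas h ->
  (nrm h <= B%:E)%E <-> {ae mu, forall x, `|h x| <= B}.
Proof.
move=> pE mh; have := Lpnorm_ooP B (meas_real mh).
rewrite -nrm_norm /nrm pE /Lpnorm.
have -> : (fun x => (cmod (h x)%:C)%:E) = (fun x => `|h x|%:E) by apply/funext => x; rewrite cmod_real.
move=> e; split => [/e|h1]; first by apply: aeS => x; rewrite cmod_real.
by apply/e; apply: aeS h1 => x; rewrite cmod_real.
Qed.

Lemma nrm_fin h (r : R) : p = r%:E -> nrm h = ((\int[mu]_x (`|h x| `^ r)%:E) `^ r^-1)%E.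
Proof. by move=> pE; rewrite /nrm pE unlock. Qed.

Lemma meas_powR h (r : R) : meas h -> measurable_fun setT (fun x => (`|h x| `^ r)%:E).
Proof.
move=> mh; apply/measurable_EFinP; apply: (measurableT_comp (measurable_powR r)).
exact: meas_norm.
Qed.

Lemma le_nrm h k : meas h -> meas k -> {ae mu, forall x, `|h x| <= `|k x|} -> (nrm h <= nrm k)%E.
Proof.
move=> mh mk hk; have [pE|[r r1 pE]] := exponentP.
  have := nrm_ge0 k; case E : (nrm k) => [B| |]// _; last by rewrite leey.
  have /(nrm_oo_le B pE mk) kB : (nrm k <= B%:E)%E by rewrite E.
  by apply/(nrm_oo_le _ pE mh); apply: aeS (aeI hk kB) => x [h1 h2]; exact: le_trans h1 h2.
have r0 : 0 < r by rewrite (lt_trans ltr01).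
rewrite !(nrm_fin _ pE); apply: gt0_ler_poweR.
- by rewrite invr_ge0 ltW.
- by rewrite in_itv/= leey andbT; apply: integral_ge0 => x _; rewrite lee_fin powR_ge0.
- by rewrite in_itv/= leey andbT; apply: integral_ge0 => x _; rewrite lee_fin powR_ge0.
apply: ae_ge0_le_integral; [exact: measurableT|by move=> x _; rewrite lee_fin powR_ge0|exact: meas_powR
  |by move=> x _; rewrite lee_fin powR_ge0|exact: meas_powR|].
- apply: aeS hk => x hx _; rewrite lee_fin; apply: ge0_ler_powR => //; exact: ltW.
Qed.

Lemma le_nrm_all h k : meas h -> meas k -> (forall x, `|h x| <= `|k x|) -> (nrm h <= nrm k)%E.
Proof. by move=> mh mk hk; apply: le_nrm => //; apply: aeW. Qed.

Lemma nrmD h k : meas h -> meas k -> (nrm (fun x => h x + k x)%R <= nrm h + nrm k)%E.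
Proof.
move=> mh mk.
have := @eminkowski _ _ _ mu h k p.
rewrite /nrm => H; apply: le_trans (H _ _ (ltW p1)).
- by rewrite le_eqVlt; apply/orP; left; apply/eqP; congr Lnorm; apply/funext => x.
- exact: mh.
- exact: mk.
Qed.

Lemma nrmZ c h : meas h -> (nrm h < +oo)%E -> (nrm (fun x => c * h x)%R <= `|c|%:E * nrm h)%E.
Proof.
move=> mh hoo.
have [pE|[r r1 pE]] := exponentP.
  have fh : nrm h \is a fin_num by rewrite ge0_fin_numE ?nrm_ge0.
  have /(nrm_oo_le (fine (nrm h)) pE mh) hB : (nrm h <= (fine (nrm h))%:E)%E by rewrite fineK.
  rewrite -(fineK fh) -EFinM; apply/(nrm_oo_le _ pE); first exact: measZ.
  by apply: aeS hB => x hx; rewrite normrM ler_wpM2l.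
have r0 : 0 < r by rewrite (lt_trans ltr01).
have c0 : (0 <= `|c|%:E)%E by rewrite lee_fin.
rewrite !(nrm_fin _ pE).
have -> : (fun x => (`|c * h x| `^ r)%:E) = (fun x => ((`|c| `^ r)%:E * (`|h x| `^ r)%:E)%E).
  by apply/funext => x; rewrite normrM powRM// EFinM.
rewrite ge0_integralZl_EFin//; try exact: meas_powR; try exact: powR_ge0.
rewrite poweRM ?lee_fin ?powR_ge0//; last by apply: integral_ge0 => x _; rewrite lee_fin powR_ge0.
by rewrite poweR_EFin -powRrM mulfV ?gt_eqF// powRr1.
Qed.

Lemma integ_powR h (r : R) : p = r%:E -> 1 < r -> meas h -> (nrm h < +oo)%E -> integ (fun x => `|h x| `^ r).
Proof.
move=> pE r1 mh; have r0 : 0 < r by rewrite (lt_trans ltr01).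
rewrite (nrm_fin _ pE) => hoo; apply: integP.
  by apply: (measurableT_comp (measurable_powR r)); exact: meas_norm.
have rn0 : r^-1 != 0 by rewrite invr_neq0// gt_eqF.
have := lty_poweRy rn0 hoo; apply: le_lt_trans.
by apply: le_int => x; rewrite ?lee_fin// ger0_norm ?powR_ge0.
Qed.

Lemma le1D_powR (r t : R) : 1 < r -> 0 <= t -> t <= 1 + t `^ r.
Proof.
move=> r1 t0; have [t1|t1] := leP t 1; first by rewrite (le_trans t1)// lerDl powR_ge0.
apply: (@le_trans _ _ (t `^ r)); last by rewrite lerDr.
by apply: le1r_powR; exact: ltW.
Qed.

(** By [t <= 1 + t ^ r] the weight absorbs the constant and the norm the power. *)
Lemma nrm_Lw h : meas h -> (nrm h < +oo)%E -> Lw h.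
Proof.
move=> mh hoo.
have [pE|[r r1 pE]] := exponentP.
  have fh : nrm h \is a fin_num by rewrite ge0_fin_numE ?nrm_ge0.
  have /(nrm_oo_le (fine (nrm h)) pE mh) hB : (nrm h <= (fine (nrm h))%:E)%E by rewrite fineK.
  have hB' : {ae mu, forall x, cmod (h x)%:C <= fine (nrm h)} by apply: aeS hB => x; rewrite cmod_real.
  by have [] := Lw_ae_bounded (meas_real mh) hB'.
(* The weight is bounded by 1, so it may be dropped in front of the power. *)
have I1 := integ_powR pE r1 mh hoo.
split => //; apply: (integ_dom _ (integD (@integ_wt R) I1)).
  by apply: measM => //; exact: meas_wt.
move=> x; rewrite normrM ger0_norm ?wt_ge0//.
apply: (@le_trans _ _ (wt x * (1 + `|h x| `^ r))); first by rewrite ler_wpM2l ?wt_ge0// le1D_powR.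
by rewrite mulrDr mulr1 lerD2l ler_piMl ?powR_ge0// wt_le1.
Qed.

Lemma Re_nrm (g : R -> R[i]) : cmeasurable g -> (nrm (reF g) <= Lpnorm p g)%E.
Proof.
move=> mg; have h := @le_nrm_all (reF g) (fun x => cmod (g x)); apply: h; [exact: mg.1|exact: meas_cmod|].
by move=> x; rewrite [X in _ <= X]ger0_norm ?cmod_ge0//; exact: Re_le_cmod.
Qed.

Lemma Im_nrm (g : R -> R[i]) : cmeasurable g -> (nrm (imF g) <= Lpnorm p g)%E.
Proof.
move=> mg; have h := @le_nrm_all (imF g) (fun x => cmod (g x)); apply: h; [exact: mg.2|exact: meas_cmod|].
by move=> x; rewrite [X in _ <= X]ger0_norm ?cmod_ge0//; exact: Im_le_cmod.
Qed.

Lemma Lpnorm_reim (g : R -> R[i]) : cmeasurable g -> (Lpnorm p g <= nrm (reF g) + nrm (imF g))%E.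
Proof.
move=> mg; rewrite -(nrm_norm (reF g)) -(nrm_norm (imF g)).
apply: le_trans (nrmD (meas_norm mg.1) (meas_norm mg.2)).
have h := @le_nrm_all (fun x => cmod (g x)) (fun x => `|reF g x| + `|imF g x|).
apply: h; [exact: meas_cmod|by apply: measD; apply: meas_norm; [exact: mg.1|exact: mg.2]|].
move=> x; rewrite ger0_norm ?cmod_ge0// ger0_norm ?addr_ge0//; exact: cmod_n1.
Qed.

Lemma Lpnorm_ae f g : cmeasurable f -> cmeasurable g -> {ae mu, forall x, f x = g x} -> Lpnorm p f = Lpnorm p g.
Proof.
move=> mf mg fg; apply/eqP; rewrite eq_le; apply/andP; split.
  have h := @le_nrm (fun x => cmod (f x)) (fun x => cmod (g x)); apply: h; [exact: meas_cmod|exact: meas_cmod|].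
  by apply: aeS fg => x ->.
have h := @le_nrm (fun x => cmod (g x)) (fun x => cmod (f x)); apply: h; [exact: meas_cmod|exact: meas_cmod|].
by apply: aeS fg => x ->.
Qed.

Lemma normc_triangle (a b : R[i]) : cmod (a + b) <= cmod a + cmod b.
Proof. by have := ler_normD a b; rewrite -rmorphD lecR. Qed.

Lemma LpnormD f g : cmeasurable f -> cmeasurable g ->
  (Lpnorm p (fun x => f x + g x)%R <= Lpnorm p f + Lpnorm p g)%E.
Proof.
move=> mf mg; apply: le_trans (nrmD (meas_cmod mf) (meas_cmod mg)).
have h := @le_nrm_all (fun x => cmod (f x + g x)) (fun x => cmod (f x) + cmod (g x)).
apply: h; [by apply: meas_cmod; exact: cmeasD|by apply: measD; exact: meas_cmod|].
move=> x; rewrite ger0_norm ?cmod_ge0// ger0_norm ?addr_ge0 ?cmod_ge0//.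
exact: normc_triangle.
Qed.

Lemma LpnormZ (c : R[i]) f : cmeasurable f -> (Lpnorm p f < +oo)%E ->
  (Lpnorm p (fun x => c * f x)%R <= (cmod c)%:E * Lpnorm p f)%E.
Proof.
move=> mf foo; have := nrmZ (cmod c) (meas_cmod mf) foo.
rewrite [`|cmod c|]ger0_norm ?cmod_ge0//; apply: le_trans.
rewrite /Lpnorm /nrm le_eqVlt; apply/orP; left; apply/eqP; congr Lnorm.
by apply/funext => x; rewrite cmodM.
Qed.

End RealNorm.

(** * Regular distributions and uniqueness of Haar coefficients *)

Section RegularDistributions.
Context {R : realType}.
Notation mu := (@lebesgue_measure R).

Definition cLw (f : R -> R[i]) := Lw (reF f) /\ Lw (imF f).

Lemma cLw_meas f : cLw f -> cmeasurable f. Proof. by move=> [[? _] [? _]]. Qed.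

Lemma cLw_bounded (f : R -> R[i]) M : cmeasurable f -> (forall x, cmod (f x) <= M) -> cLw f.
Proof.
move=> mf hM; split.
  by apply: (Lw_bounded mf.1) => x; exact: le_trans (Re_le_cmod _) (hM x).
by apply: (Lw_bounded mf.2) => x; exact: le_trans (Im_le_cmod _) (hM x).
Qed.

Lemma cLw_schwartz f phi : cLw f -> schwartz phi -> cinteg (fun x => f x * phi x).
Proof.
move=> [f1 f2] sp; have r1 := schwartz_re sp; have r2 := schwartz_im sp; split.
  have := integB (Lw_rschwartz f1 r1) (Lw_rschwartz f2 r2); congr integ.
  by apply/funext => x; rewrite /reF cReM.
have := integD (Lw_rschwartz f1 r2) (Lw_rschwartz f2 r1); congr integ.
by apply/funext => x; rewrite /imF cImM.
Qed.

Lemma on_schwartzK (T : functional R) : on_schwartz (on_schwartz T) = on_schwartz T.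
Proof. by apply/funext => phi; rewrite /on_schwartz; case: asboolP. Qed.

Lemma on_schwartz_eq (T S : functional R) : (forall phi, schwartz phi -> T phi = S phi) ->
  on_schwartz T = on_schwartz S.
Proof. by move=> h; apply/funext => phi; rewrite /on_schwartz; case: asboolP => // /h. Qed.

Lemma seminorm_ge0 a b (phi : R -> R[i]) : (0 <= schwartz_seminorm a b phi)%E.
Proof.
apply: (@le_trans _ _ (`|0 : R| ^+ a * cmod (cderiv b phi 0))%:E).
  by rewrite lee_fin mulr_ge0 ?exprn_ge0 ?cmod_ge0.
by apply: ereal_sup_ubound; exists 0.
Qed.

Lemma seminorm_le a b (phi : R -> R[i]) x :
  ((`|x| ^+ a * cmod (cderiv b phi x))%:E <= schwartz_seminorm a b phi)%E.
Proof. by apply: ereal_sup_ubound; exists x. Qed.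

Lemma sum33 (s : nat -> nat -> \bar R) : (forall a b, 0 <= s a b)%E ->
  (s 0%N 0%N + s 2%N 0%N <= \sum_(a < 3) \sum_(b < 3) s a b)%E.
Proof.
move=> s0.
have row a : (s a 0%N <= \sum_(b < 3) s a b)%E.
  by rewrite big_ord_recl leeDl// sume_ge0.
rewrite big_ord_recl leeD ?row// 2!big_ord_recl big_ord0 adde0.
by rewrite (le_trans (row 2%N))// leeDr// sume_ge0.
Qed.

Lemma cLw_tempered f : cLw f -> tempered (dist_of_fun f).
Proof.
move=> Lf; split.
- exact: on_schwartzK.
- move=> a phi psi sp ss.
  have s1 := schwartzD (schwartzZ a sp) ss.
  rewrite (dist_of_funE _ s1) (dist_of_funE _ sp) (dist_of_funE _ ss).
  rewrite -(cintZ a (cLw_schwartz Lf sp)) -(cintD (cintegZ a (cLw_schwartz Lf sp)) (cLw_schwartz Lf ss)).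
  by congr cint; apply/funext => x; ring.
pose I1 := intR (fun x => wt x * n1 (f x)).
have Ln : integ (fun x => wt x * n1 (f x)).
  exact: (LwD (Lw_norm Lf.1) (Lw_norm Lf.2)).2.
have I10 : 0 <= I1 by apply: intR_ge0 => x; rewrite mulr_ge0 ?wt_ge0 ?n1_ge0.
exists (2 * I1), 3%N => phi sp.
have fin a b : schwartz_seminorm a b phi \is a fin_num.
  by rewrite ge0_fin_numE ?seminorm_ge0//; case: sp.
pose s0 := fine (schwartz_seminorm 0 0 phi); pose s2 := fine (schwartz_seminorm 2 0 phi).
have h0 x : cmod (phi x) <= s0.
  rewrite -lee_fin /s0 fineK//; apply: le_trans (seminorm_le 0 0 phi x).
  by rewrite expr0 mul1r cderiv0.
have h2 x : x ^+ 2 * cmod (phi x) <= s2.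
  rewrite -lee_fin /s2 fineK//; apply: le_trans (seminorm_le 2 0 phi x).
  by rewrite cderiv0 real_normK// num_real.
have hb x : n1 (phi x) <= 2 * (s0 + s2) * wt x.
  rewrite /wt ler_pdivlMr ?oneDsqr_gt0'//.
  apply: le_trans (ler_wpM2r (ltW (oneDsqr_gt0' x)) (n1_cmod (phi x))) _.
  by have := h0 x; have := h2 x; nra.
have key : cmod (dist_of_fun f phi) <= 2 * I1 * (s0 + s2).
  rewrite (dist_of_funE _ sp); apply: le_trans (cmod_n1 _) _.
  apply: le_trans (n1_cint (cLw_schwartz Lf sp)) _.
  have -> : 2 * I1 * (s0 + s2) = intR (fun x => (2 * (s0 + s2)) * (wt x * n1 (f x))).
    by rewrite (intRZ _ Ln) -/I1; ring.
  apply: le_intR; [exact: integ_n1 (cLw_schwartz Lf sp)|exact: integZ Ln|].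
  move=> x; apply: le_trans (n1M _ _) _.
  have := ler_wpM2l (n1_ge0 (f x)) (hb x); lra.
apply: (@le_trans _ _ (2 * I1 * (s0 + s2))%:E); first by rewrite lee_fin.
rewrite EFinM lee_wpmul2l//; first by rewrite lee_fin mulr_ge0.
by rewrite EFinD /s0 /s2 !fineK//; exact: sum33 (fun a b => seminorm_ge0 a b phi).
Qed.

End RegularDistributions.

Section ReImParts.
Context {R : realType}.
Notation mu := (@lebesgue_measure R).
Variable eta : R -> R[i].
Hypothesis heta : lp_cutoff eta.

Lemma ReMreal (r : R) (z : R[i]) : complex.Re (z * r%:C) = complex.Re z * r.
Proof. by rewrite cReM/= mulr0 subr0. Qed.
Lemma ImMreal (r : R) (z : R[i]) : complex.Im (z * r%:C) = complex.Im z * r.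
Proof. by rewrite cImM/= mulr0 add0r. Qed.

Lemma tempered_reim (F : functional R) phi : tempered F -> schwartz phi ->
  F phi = 'i * F (fun x => (imF phi x)%:C) + F (fun x => (reF phi x)%:C).
Proof.
move=> [_ lin _] sp.
rewrite -(lin 'i _ _ (schwartz_real (schwartz_im sp)) (schwartz_real (schwartz_re sp))).
by congr F; apply/funext => x; rewrite addrC; exact: complexE.
Qed.

Section OneDist.
Variable F : functional R.
Hypothesis hF : refB eta F.

Let LR k : Lw (fun x => complex.Re (dens eta F k x)). Proof. by have [] := Lw_dens hF k. Qed.
Let LI k : Lw (fun x => complex.Im (dens eta F k x)). Proof. by have [] := Lw_dens hF k. Qed.

Lemma Re_pair_indic a b : a <= b ->
  complex.Re (F (sind eta a b n)) @[n --> \oo] --> complex.Re (pair_indic eta F `[a, b[%classic).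
Proof.
move=> ab.
by have [] := @pair_indic_cvg R eta heta F hF (fun z => complex.Re z) cReB cReD erefl ReMreal (@Re_n1 R)
  (fun _ _ => erefl) (fun _ => erefl) LR a b ab.
Qed.

Lemma Im_pair_indic a b : a <= b ->
  complex.Im (F (sind eta a b n)) @[n --> \oo] --> complex.Im (pair_indic eta F `[a, b[%classic).
Proof.
move=> ab.
by have [] := @pair_indic_cvg R eta heta F hF (fun z => complex.Im z) cImB cImD erefl ImMreal (@Im_n1 R)
  (fun _ _ => erefl) (fun _ => erefl) LI a b ab.
Qed.

(** Both the real and the imaginary part of [F] vanish on real test functions. *)
Lemma haar_unique : (forall j m : int, -1 <= j -> haar_coef eta F j m = 0) -> F = (fun=> 0).
Proof.
move=> hz.
have h1 u : rschwartz u -> complex.Re (F (fun x => (u x)%:C)) = 0.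
  apply: (@P_F0 R eta heta F hF (fun z => complex.Re z) cReB cReD erefl ReMreal (@Re_n1 R)
  (fun _ _ => erefl) (fun _ => erefl) LR) => j m j1; by rewrite hz.
have h2 u : rschwartz u -> complex.Im (F (fun x => (u x)%:C)) = 0.
  apply: (@P_F0 R eta heta F hF (fun z => complex.Im z) cImB cImD erefl ImMreal (@Im_n1 R)
  (fun _ _ => erefl) (fun _ => erefl) LI) => j m j1; by rewrite hz.
have h3 u : rschwartz u -> F (fun x => (u x)%:C) = 0.
  by move=> su; apply: ceq_reim; [exact: h1|exact: h2].
have tF : tempered F by case: hF.
have [ons _ _] := tF; apply/funext => phi; rewrite -ons /on_schwartz.
case: asboolP => // sp.
by rewrite (tempered_reim tF sp) (h3 _ (schwartz_re sp)) (h3 _ (schwartz_im sp)) mulr0 addr0.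
Qed.

End OneDist.

Lemma cvgR_unique (u : nat -> R) (a b : R) : u @ \oo --> a -> u @ \oo --> b -> a = b.
Proof. by move=> ha hb; apply: (cvg_unique _ ha hb); exact: Rhausdorff. Qed.

Lemma pair_indicB (F G H : functional R) a b : refB eta F -> refB eta G -> refB eta H ->
  (forall phi, schwartz phi -> H phi = F phi - G phi) -> a <= b ->
  pair_indic eta H `[a, b[%classic = pair_indic eta F `[a, b[%classic - pair_indic eta G `[a, b[%classic.
Proof.
move=> hF hG hH e ab; apply: ceq_reim.
  rewrite cReB; apply: (cvgR_unique (Re_pair_indic hH ab)).
  rewrite (_ : (fun n => _) = (fun n => complex.Re (F (sind eta a b n)) - complex.Re (G (sind eta a b n)))).
    by apply: cvgB; exact: Re_pair_indic.
  by apply/funext => n; rewrite (e _ (schwartz_sind heta a b n)) cReB.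
rewrite cImB; apply: (cvgR_unique (Im_pair_indic hH ab)).
rewrite (_ : (fun n => _) = (fun n => complex.Im (F (sind eta a b n)) - complex.Im (G (sind eta a b n)))).
  by apply: cvgB; exact: Im_pair_indic.
by apply/funext => n; rewrite (e _ (schwartz_sind heta a b n)) cImB.
Qed.

Lemma dyadic_half_open (j m : int) : exists a b : R, a <= b /\ dyadic_interval j m = `[a, b[%classic.
Proof.
rewrite /dyadic_interval; case: ifP => _.
  eexists; eexists; split; last reflexivity.
  by rewrite ler_wpM2l ?exprz_ge0// lerDl.
by eexists; eexists; split; last reflexivity; rewrite lerDl.
Qed.

Lemma subr_interchange (a b c d : R[i]) : (a - b) - (c - d) = (a - c) - (b - d).
Proof. by ring. Qed.

Lemma haar_coefB (F G H : functional R) j m : refB eta F -> refB eta G -> refB eta H ->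
  (forall phi, schwartz phi -> H phi = F phi - G phi) ->
  haar_coef eta H j m = haar_coef eta F j m - haar_coef eta G j m.
Proof.
move=> hF hG hH e.
have key i n : pair_indic eta H (dyadic_interval i n) =
    pair_indic eta F (dyadic_interval i n) - pair_indic eta G (dyadic_interval i n).
  by have [a [b [ab ->]]] := dyadic_half_open i n; exact: pair_indicB.
by rewrite /haar_coef !key; case: ifP => _; [exact: subr_interchange|].
Qed.

Lemma pair_indic_fun f a b : cLw f -> refB eta (dist_of_fun f) -> a <= b ->
  pair_indic eta (dist_of_fun f) `[a, b[%classic =
  intR (fun x => reF f x * \1_(`[a, b[%classic) x) +i* intR (fun x => imF f x * \1_(`[a, b[%classic) x).
Proof.
move=> Lf hF ab.
have E n : dist_of_fun f (sind eta a b n) = intR (fun x => reF f x * sindr eta a b n x) +i*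
    intR (fun x => imF f x * sindr eta a b n x).
  rewrite (dist_of_funE _ (schwartz_sind heta a b n)) cintE; congr (_ +i* _); congr intR; apply/funext => x.
    by rewrite /reF /sind ReMreal.
  by rewrite /imF /sind ImMreal.
apply: ceq_reim => /=.
  apply: (cvgR_unique (Re_pair_indic hF ab)).
  rewrite (_ : (fun n => _) = (fun n => intR (fun x => reF f x * sindr eta a b n x))).
    exact: (intR_sindr_cvg heta ab Lf.1).
  by apply/funext => n; rewrite E.
apply: (cvgR_unique (Im_pair_indic hF ab)).
rewrite (_ : (fun n => _) = (fun n => intR (fun x => imF f x * sindr eta a b n x))).
  exact: (intR_sindr_cvg heta ab Lf.2).
by apply/funext => n; rewrite E.
Qed.

(** Testing with bumps recovers both functions at common Lebesgue points. *)
Lemma reps_ae_eq f g : cLw f -> cLw g -> dist_of_fun f = dist_of_fun g -> {ae mu, forall x, f x = g x}.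
Proof.
move=> Lf Lg fg.
have key (P : R[i] -> R) : (forall (h : R -> R[i]) (u : R -> R), rschwartz u ->
    P (dist_of_fun h (fun x => (u x)%:C)) = intR (fun x => P (h x) * u x)) ->
    Lw (fun x => P (f x)) -> Lw (fun x => P (g x)) -> {ae mu, forall x, P (f x) = P (g x)}.
  move=> hP Pf Pg.
  have l1 := lebesgue_differentiation (Lw_locally_integrable Pf).
  have l2 := lebesgue_differentiation (Lw_locally_integrable Pg).
  apply: aeS (aeI l1 l2) => x [p1 p2].
  apply: (cvgR_unique (moll_cvg heta Pf p1)).
  rewrite (_ : (fun n => _) = (fun n => intR (fun y => P (g y) * moll eta n x y))).
    exact: (moll_cvg heta Pg p2).
  by apply/funext => n; rewrite -!(hP _ _ (rschwartz_moll heta n x)) fg.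
have h1 := key (fun z => complex.Re z); have h2 := key (fun z => complex.Im z).
have e1 : forall (h : R -> R[i]) (u : R -> R), rschwartz u ->
    complex.Re (dist_of_fun h (fun x => (u x)%:C)) = intR (fun x => complex.Re (h x) * u x).
  move=> h u su; rewrite (dist_of_funE _ (schwartz_real su)) cintE/=; congr intR; apply/funext => x.
  by rewrite /reF ReMreal.
have e2 : forall (h : R -> R[i]) (u : R -> R), rschwartz u ->
    complex.Im (dist_of_fun h (fun x => (u x)%:C)) = intR (fun x => complex.Im (h x) * u x).
  move=> h u su; rewrite (dist_of_funE _ (schwartz_real su)) cintE/=; congr intR; apply/funext => x.
  by rewrite /imF ImMreal.
apply: aeS (aeI (h1 e1 Lf.1 Lg.1) (h2 e2 Lf.2 Lg.2)) => x [a b].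
exact: ceq_reim.
Qed.

End ReImParts.

(** * Bounded functions in the reference space *)

Section BoundedFunctions.
Context {R : realType}.
Notation mu := (@lebesgue_measure R).

Lemma meas_onePsqr : meas (fun x : R => 1 + x ^+ 2).
Proof. by apply: measD; [exact: meas_cst|exact: measM (@measurable_id _ _ setT) (@measurable_id _ _ setT)]. Qed.

(** Multiplying by the weight makes the function integrable on the plane, where
    Fubini gives measurability; then the weight is divided out. *)
Lemma meas_intR2 (F : R -> R -> R) (A : R) (v : R -> R) : meas2 F -> integ v ->
  (forall x y, `|F x y| <= A * v y) -> meas (fun x => intR (F x)).
Proof.
move=> mF Iv h.
have mG : meas2 (fun x y => wt x * F x y) by apply: meas2M => //; exact: (meas2_1 meas_wt).
have hG x y : `|wt x * F x y| <= wt x * (A * v y).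
  by rewrite normrM ger0_norm ?wt_ge0// ler_wpM2l ?wt_ge0.
have [J1 _ _] := fubini_dom mG integ_wt (integZ A Iv) hG.
have IF x : integ (F x) by apply: (integ_dom _ (integZ A Iv)); [exact: meas2_section mF|exact: h].
have := measM meas_onePsqr (integ_meas J1); congr meas; apply/funext => x.
by rewrite (intRZ _ (IF x)) /wt mulrA divff ?mul1r// gt_eqF// oneDsqr_gt0'.
Qed.

Lemma wt_peetre (x h : R) : wt (x + h) <= 2 * wt x * (1 + h ^+ 2).
Proof.
rewrite /wt; set y := x + h.
have E : (1 + y ^+ 2) != 0 by rewrite gt_eqF// oneDsqr_gt0'.
have py := oneDsqr_gt0' y; have px := oneDsqr_gt0' x.
rewrite -[X in X <= _]mul1r ler_pdivrMr//.
have -> : 2 * (1 + x ^+ 2)^-1 * (1 + h ^+ 2) * (1 + y ^+ 2) = (2 * (1 + h ^+ 2) * (1 + y ^+ 2)) / (1 + x ^+ 2) by ring.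
rewrite ler_pdivlMr// mul1r.
have -> : x = y - h by rewrite /y addrK.
have := sqr_ge0 (y + h); have := sqr_ge0 (y * h); nra.
Qed.

Lemma schwartz_wt (phi : R -> R[i]) : schwartz phi -> exists2 C, 0 <= C & forall x, n1 (phi x) <= C * wt x.
Proof.
move=> sp; have [A A0 hA] := rschwartz_wt (schwartz_re sp).
have [B B0 hB] := rschwartz_wt (schwartz_im sp).
exists (A + B); first exact: addr_ge0.
by move=> x; rewrite /n1 mulrDl; apply: lerD; [exact: hA|exact: hB].
Qed.

Variable eta : R -> R[i].
Hypothesis heta : lp_cutoff eta.
Let se := lp_cutoff_schwartz heta.
Let e0 := lp_cutoff0 heta.
Let K := ifourier eta.
Let sK : schwartz K := schwartz_ifourier se.

Section Fun.
Variable f : R -> R[i].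
Variable M : R.
Hypothesis mf : cmeasurable f.
Hypothesis M0 : 0 <= M.
Hypothesis fM : forall x, n1 (f x) <= M.

(** The transpose of the filter, acting on the function instead of the test
    function. *)
Definition blur (t y : R) : R[i] := cint (fun z => f (- t * z + y) * K z).

Let k0 := intR (fun z => n1 (K z)).
Let IK : integ (fun z => n1 (K z)) := integ_n1_schwartz sK.

Lemma cLw_boundedn1 : cLw f.
Proof. by apply: (@cLw_bounded _ f M mf) => x; exact: le_trans (cmod_n1 _) (fM x). Qed.

Lemma meas2_shift (t : R) : meas2 (fun x z : R => - t * z + x).
Proof.
apply: meas2D; last exact: (meas2_1 (@measurable_id _ _ setT)).
by apply: (@meas2_2 _ (fun z => - t * z)); apply: measZ; exact: measurable_id.
Qed.

Lemma cmeas2_shift (t : R) : cmeas2 (fun x z : R => f (- t * z + x)).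
Proof.
split; [exact: (meas2_comp mf.1 (meas2_shift t))|exact: (meas2_comp mf.2 (meas2_shift t))].
Qed.

Let cinteg_blur t y : cinteg (fun z => f (- t * z + y) * K z).
Proof.
have [m1 m2] := mf.
apply: (cLw_schwartz _ sK); apply: (@cLw_bounded _ _ M).
  by split; [exact: (meas_comp_affine (- t) y m1)|exact: (meas_comp_affine (- t) y m2)].
by move=> z; exact: le_trans (cmod_n1 _) (fM _).
Qed.

Let blur_dom t y z : n1 (f (- t * z + y) * K z) <= M * n1 (K z).
Proof. by apply: le_trans (n1M _ _) _; rewrite ler_wpM2r ?n1_ge0. Qed.

Lemma blur_bnd t y : n1 (blur t y) <= M * k0.
Proof.
apply: le_trans (n1_cint (cinteg_blur t y)) _.
rewrite -(intRZ _ IK); apply: le_intR; [exact: integ_n1 (cinteg_blur t y)|exact: integZ|].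
by move=> z; exact: blur_dom.
Qed.

Lemma cmeas_blur t : cmeasurable (blur t).
Proof.
have mK : cmeas2 (fun _ z : R => K z) by apply: cmeas2_2; [exact: (cmeas_schwartz sK).1|exact: (cmeas_schwartz sK).2].
have [m1 m2] := cmeas2M (cmeas2_shift t) mK.
split.
  apply: (meas_intR2 m1 IK) => x z; exact: le_trans (Re_n1 _) (blur_dom t x z).
apply: (meas_intR2 m2 IK) => x z; exact: le_trans (Im_n1 _) (blur_dom t x z).
Qed.

Lemma lowpass_pair t phi : 0 < t -> schwartz phi ->
  dist_of_fun f (lowpass eta t phi) = cint (fun y => blur t y * phi y).
Proof.
move=> t0 sp; have tn0 : t != 0 by rewrite gt_eqF.
rewrite (dist_of_funE _ (schwartz_lowpass se tn0 sp)).
have [C C0 hC] := schwartz_wt sp.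
have ssh x : schwartz (fun z => phi (t * z + x) * K z) by exact: (schwartzM (schwartz_affine x tn0 sp) sK).
have ssh2 z : schwartz (fun x => phi (1 * x + t * z) * K z).
  have h := schwartzZ (K z) (schwartz_affine (t * z) (oner_neq0 R) sp).
  by apply: schwartz_eq h => x; rewrite mulrC.
have S1 : (fun x => f x * lowpass eta t phi x) = (fun x => cint (fun z => f x * (phi (t * z + x) * K z))).
  apply/funext => x; rewrite (lowpassE se t0 sp) (cintZ _ (schwartz_cinteg (ssh x))); congr (_ * _).
  by congr cint; apply/funext => z; rewrite [x + _]addrC.
rewrite S1.
have cK2 : cmeas2 (fun _ z : R => K z) by apply: cmeas2_2; [exact: (cmeas_schwartz sK).1|exact: (cmeas_schwartz sK).2].
have cK1 : cmeas2 (fun z _ : R => K z) by apply: cmeas2_1; [exact: (cmeas_schwartz sK).1|exact: (cmeas_schwartz sK).2].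
have cf1 : cmeas2 (fun x _ : R => f x) by apply: cmeas2_1; [exact: mf.1|exact: mf.2].
have cp2 : cmeas2 (fun _ x : R => phi x) by apply: cmeas2_2; [exact: (cmeas_schwartz sp).1|exact: (cmeas_schwartz sp).2].
have cps : cmeas2 (fun x z : R => phi (t * z + x)).
  have m2 := meas2_shift (- t); rewrite opprK in m2.
  by split; [exact: (meas2_comp (cmeas_schwartz sp).1 m2)|exact: (meas2_comp (cmeas_schwartz sp).2 m2)].
have Iv : integ (fun z => (1 + (t * z) ^+ 2) * n1 (K z)).
  have h := integD IK (integZ (t ^+ 2) (integ_moment 2 sK)).
  move: h; congr integ; apply/funext => z.
  by rewrite real_normK ?num_real// exprMn; ring.
rewrite (@cfubini _ (fun x z => f x * (phi (t * z + x) * K z)) (fun x => (2 * M * C) * wt x)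
   (fun z => (1 + (t * z) ^+ 2) * n1 (K z))); last 4 first.
- by apply: cmeas2M => //; exact: cmeas2M.
- exact: integZ (@integ_wt R).
- exact: Iv.
- move=> x z; apply: le_trans (n1M _ _) _.
  have h1 := ler_wpM2l (n1_ge0 (f x)) (n1M (phi (t * z + x)) (K z)).
  apply: le_trans h1 _.
  have h2 : n1 (phi (t * z + x)) <= C * (2 * wt x * (1 + (t * z) ^+ 2)).
    by apply: le_trans (hC _) _; rewrite ler_wpM2l// addrC; exact: wt_peetre.
  have -> : 2 * M * C * wt x * ((1 + (t * z) ^+ 2) * n1 (K z)) =
     M * (C * (2 * wt x * (1 + (t * z) ^+ 2)) * n1 (K z)) by ring.
  apply: ler_pM; [exact: n1_ge0|by rewrite mulr_ge0 ?n1_ge0|exact: fM|].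
  by rewrite ler_wpM2r ?n1_ge0.
have S2 : (fun z => cint (fun x => f x * (phi (t * z + x) * K z))) =
    (fun z => cint (fun x => (f (- t * z + x) * K z) * phi x)).
  apply/funext => z.
  have I1 : cinteg (fun x => f x * (phi (t * z + x) * K z)).
    have := cLw_schwartz cLw_boundedn1 (ssh2 z); congr cinteg; apply/funext => x.
    by rewrite mul1r [x + _]addrC.
  rewrite -(cint_shift (- t * z) I1); congr cint; apply/funext => x.
  have -> : t * z + (x + - t * z) = x by ring.
  by rewrite [x + _]addrC -mulrA; congr (_ * _); rewrite mulrC.
rewrite S2 (@cfubini _ (fun z x => f (- t * z + x) * K z * phi x) (fun z => M * n1 (K z)) (fun x => n1 (phi x))); last 4 first.
- apply: cmeas2M => //; apply: cmeas2M => //.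
  by have [m1 m2] := cmeas2_shift t; split; [exact: meas2_swap m1|exact: meas2_swap m2].
- exact: integZ.
- exact: integ_n1_schwartz.
- by move=> z x; apply: le_trans (n1M _ _) _; rewrite ler_wpM2r ?n1_ge0.
congr cint; apply/funext => x.
rewrite mulrC -(cintZ _ (cinteg_blur t x)); congr cint; apply/funext => z.
by rewrite mulrC.
Qed.

Let F := dist_of_fun f.
Let tF : tempered F := cLw_tempered cLw_boundedn1.

Lemma lp_block_off k (G : functional R) phi : ~ schwartz phi -> lp_block eta k G phi = 0.
Proof. by move=> ns; rewrite /lp_block /dist_ifourier /on_schwartz asboolF. Qed.

Lemma dist_of_fun_off g (phi : R -> R[i]) : ~ schwartz phi -> dist_of_fun g phi = 0.
Proof. by move=> ns; rewrite /dist_of_fun /on_schwartz asboolF. Qed.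

Lemma cLw_blur t : cLw (blur t).
Proof.
by apply: (@cLw_bounded _ _ (M * k0) (cmeas_blur t)) => x; exact: le_trans (cmod_n1 _) (blur_bnd t x).
Qed.

Lemma block0_fun : lp_block eta 0 F = dist_of_fun (blur (scale 0)).
Proof.
apply/funext => phi; have [sp|ns] := pselect (schwartz phi); last first.
  by rewrite lp_block_off// dist_of_fun_off.
rewrite (block0 heta F sp) /F (lowpass_pair (scale_gt0 0) sp).
exact: esym (dist_of_funE _ sp).
Qed.

Lemma blockS_fun k : lp_block eta k.+1 F = dist_of_fun (fun x => blur (scale k.+1) x - blur (scale k) x).
Proof.
apply/funext => phi; have [sp|ns] := pselect (schwartz phi); last first.
  by rewrite lp_block_off// dist_of_fun_off.
rewrite (blockS heta k tF sp) /F (lowpass_pair (scale_gt0 k) sp) (lowpass_pair (scale_gt0 k.+1) sp).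
rewrite (dist_of_funE _ sp).
rewrite -(cintB (cLw_schwartz (cLw_blur _) sp) (cLw_schwartz (cLw_blur _) sp)).
by congr cint; apply/funext => x; rewrite mulrBl.
Qed.

Lemma block_fun_le k : (dist_Lpnorm +oo (lp_block eta k F) <= (2 * (M * k0))%:E)%E.
Proof.
have Mk : 0 <= M * k0 by apply: le_trans (blur_bnd 0 0); exact: n1_ge0.
case: k => [|k].
  rewrite block0_fun; apply: le_trans (dist_Lpnorm_le _ (cmeas_blur _)) _.
  apply/(Lpnorm_ooP _ (cmeas_blur _)); apply: aeW => x.
  by apply: le_trans (cmod_n1 _) _; apply: le_trans (blur_bnd _ _) _; lra.
have mb := cmeasB (cmeas_blur (scale k.+1)) (cmeas_blur (scale k)).
rewrite blockS_fun; apply: le_trans (dist_Lpnorm_le _ mb) _.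
apply/(Lpnorm_ooP _ mb); apply: aeW => x.
apply: le_trans (cmod_n1 _) _; apply: le_trans (n1B _ _) _.
by have := blur_bnd (scale k.+1) x; have := blur_bnd (scale k) x; lra.
Qed.

Lemma refB_fun_n1 : refB eta F.
Proof.
split; first exact: tF.
have Mk : 0 <= M * k0 by apply: le_trans (blur_bnd 0 0); exact: n1_ge0.
apply: (@le_lt_trans _ _ (4 * (M * k0))%:E); last exact: ltry.
have nn k : (0 <= (2 ^- k)%:E * dist_Lpnorm +oo (lp_block eta k F))%E.
  by rewrite mule_ge0 ?dist_Lpnorm_ge0// lee_fin invr_ge0 exprn_ge0.
apply: lime_le; first by apply: is_cvg_nneseries => k _ _; exact: nn.
apply: nearW => n.
apply: (@le_trans _ _ (4 * (M * k0) * (1 - scale n))%:E); last first.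
  have h4 : 0 <= 4 * (M * k0) by apply: mulr_ge0.
  by rewrite lee_fin (ler_piMr h4)// lerBlDr lerDl ltW// scale_gt0.
elim: n => [|n IH].
  by rewrite big_geq// lee_fin /scale expr0 invr1 subrr mulr0.
rewrite big_nat_recr//=.
apply: (@le_trans _ _ ((4 * (M * k0) * (1 - scale n))%:E + (2 ^- n)%:E * (2 * (M * k0))%:E)%E).
  by apply: leeD => //; rewrite lee_wpmul2l ?lee_fin ?invr_ge0 ?exprn_ge0//; exact: block_fun_le.
rewrite -EFinM -EFinD lee_fin -/(scale n) scaleS le_eqVlt; apply/orP; left; apply/eqP.
by field.
Qed.

End Fun.

(** The blocks of a bounded function are uniformly bounded, since they are averages
    of it against integrable kernels; so the weights [2 ^ -k] make the reference
    norm finite. *)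
Lemma refB_fun f M : cmeasurable f -> {ae mu, forall x, cmod (f x) <= M} -> refB eta (dist_of_fun f).
Proof.
move=> mf hM; pose M' := Num.max M 0.
have M'0 : 0 <= M' by rewrite le_max lexx orbT.
have hM' : {ae mu, forall x, cmod (f x) <= M'} by apply: aeS hM => x h; rewrite le_max h.
have [g [mg gM fg]] := ae_bounded_version M'0 mf hM'.
rewrite (dist_of_fun_ae mf mg fg).
apply: (@refB_fun_n1 g (2 * M') mg).
by move=> x; apply: le_trans (n1_cmod _) _; rewrite ler_wpM2l.
Qed.

Section LinearCombinations.
Variable p : \bar R.
Hypothesis p1 : (1 < p)%E.

Lemma Lpnorm_cLw g : cmeasurable g -> (Lpnorm p g < +oo)%E -> cLw g.
Proof.
move=> mg h; split; apply: (nrm_Lw p1).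
- exact: mg.1.
- exact: le_lt_trans (Re_nrm p1 mg) h.
- exact: mg.2.
- exact: le_lt_trans (Im_nrm p1 mg) h.
Qed.

(** All representing functions agree almost everywhere, so the infimum is attained. *)
Lemma dist_Lpnorm_fun g : cmeasurable g -> (Lpnorm p g < +oo)%E ->
  dist_Lpnorm p (dist_of_fun g) = Lpnorm p g.
Proof.
move=> mg h; apply/eqP; rewrite eq_le dist_Lpnorm_le//=.
apply: le_ereal_inf_tmp => _ [g' [mg' e] <-].
have [h'|h'] := ltP (Lpnorm p g') +oo%E; last by apply: le_trans (leey _) h'.
rewrite (@Lpnorm_ae _ p p1 g g')//.
exact: (reps_ae_eq heta (Lpnorm_cLw mg h) (Lpnorm_cLw mg' h') e).
Qed.

Lemma dist_Lpnorm_rep (T : functional R) : (dist_Lpnorm p T < +oo)%E ->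
  exists g, [/\ cmeasurable g, cLw g, T = dist_of_fun g, Lpnorm p g = dist_Lpnorm p T & (Lpnorm p g < +oo)%E].
Proof.
move=> h; have [_ [g [mg e] <-] hg] := ereal_inf_lt h.
by exists g; split => //; [exact: Lpnorm_cLw|rewrite e dist_Lpnorm_fun].
Qed.

Lemma dist_of_fun_lin (a : R[i]) f g : cLw f -> cLw g ->
  (fun phi => a * dist_of_fun f phi + dist_of_fun g phi) = dist_of_fun (fun x => a * f x + g x).
Proof.
move=> Lf Lg; apply/funext => phi; have [sp|ns] := pselect (schwartz phi); last first.
  by rewrite !dist_of_fun_off// mulr0 addr0.
rewrite !(dist_of_funE _ sp).
rewrite -(cintZ _ (cLw_schwartz Lf sp)) -(cintD (cintegZ _ (cLw_schwartz Lf sp)) (cLw_schwartz Lg sp)).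
by congr cint; apply/funext => x; ring.
Qed.

Lemma cmeasZ (a : R[i]) f : cmeasurable f -> cmeasurable (fun x : R => a * f x).
Proof. by move=> mf; apply: cmeasM => //; exact: cmeas_cst. Qed.

Lemma dist_Lpnorm_lin (a : R[i]) (T S : functional R) :
  (dist_Lpnorm p T < +oo)%E -> (dist_Lpnorm p S < +oo)%E ->
  (dist_Lpnorm p (fun phi => a * T phi + S phi)%R <= (cmod a)%:E * dist_Lpnorm p T + dist_Lpnorm p S)%E.
Proof.
move=> hT hS; have [f [mf Lf -> ef ff]] := dist_Lpnorm_rep hT.
have [g [mg Lg -> eg fg]] := dist_Lpnorm_rep hS.
rewrite (dist_of_fun_lin a Lf Lg) -ef -eg.
apply: le_trans (dist_Lpnorm_le _ (cmeasD (cmeasZ a mf) mg)) _.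
apply: le_trans (LpnormD p1 (cmeasZ a mf) mg) _.
by rewrite leeD2r//; exact: LpnormZ.
Qed.

End LinearCombinations.

Lemma lee_sum_ord (s : nat -> \bar R) (m n : nat) : (forall i, 0 <= s i)%E ->
  (\sum_(i < m) s i <= \sum_(i < m + n) s i)%E.
Proof.
by move=> s0; rewrite big_split_ord/= leeDl// sume_ge0.
Qed.

Lemma tempered_lin (a : R[i]) (F G : functional R) : tempered F -> tempered G ->
  tempered (fun phi => a * F phi + G phi).
Proof.
move=> [oF lF [M1 [N1 b1]]] [oG lG [M2 [N2 b2]]]; split.
- apply/funext => phi; rewrite /on_schwartz; case: asboolP => // ns.
  by rewrite -oF -oG /on_schwartz asboolF// mulr0 addr0.
- by move=> c phi psi sp ss; rewrite lF// lG//; ring.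
exists (cmod a * `|M1| + `|M2|), (N1 + N2)%N => phi sp.
set S := (X in (_ <= _ * X)%E).
pose s N : \bar R := (\sum_(i < N) \sum_(j < N) schwartz_seminorm i j phi)%E.
have sn i j := seminorm_ge0 i j phi.
have mono m n : (s m <= s (m + n)%N)%E.
  apply: (@le_trans _ _ (\sum_(i < m) \sum_(j < m + n) schwartz_seminorm i j phi)%E).
    by apply: lee_sum => i _; exact: (@lee_sum_ord (fun j => schwartz_seminorm i j phi) m n (sn i)).
  apply: (@lee_sum_ord (fun i => \sum_(j < m + n) schwartz_seminorm i j phi)%E m n) => i; exact: sume_ge0.
have s0 m : (0 <= s m)%E by apply: sume_ge0 => i _; exact: sume_ge0.
have S0 : (0 <= S)%E by exact: s0.
have aux (M : R) N T : (T <= M%:E * s N)%E -> (s N <= S)%E -> (T <= `|M|%:E * S)%E.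
  move=> h1 h2; apply: le_trans h1 _.
  apply: (@le_trans _ _ (`|M|%:E * s N)%E); first by rewrite lee_wpmul2r// lee_fin ler_norm.
  by rewrite lee_wpmul2l// lee_fin.
have h1 := aux _ _ _ (b1 _ sp) (mono N1 N2).
have h2 : ((cmod (G phi))%:E <= `|M2|%:E * S)%E.
  by apply: (aux _ _ _ (b2 _ sp)); rewrite /S addnC; exact: mono.
apply: (@le_trans _ _ ((cmod a)%:E * (cmod (F phi))%:E + (cmod (G phi))%:E)%E).
  rewrite -EFinM -EFinD lee_fin -cmodM; exact: normc_triangle.
rewrite EFinD EFinM ge0_muleDl// ?mule_ge0 ?lee_fin ?cmod_ge0//.
by apply: leeD => //; rewrite -muleA lee_wpmul2l// lee_fin cmod_ge0.
Qed.

Lemma lp_block_lin k (a : R[i]) (F G : functional R) :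
  lp_block eta k (fun phi => a * F phi + G phi) = (fun phi => a * lp_block eta k F phi + lp_block eta k G phi).
Proof.
apply/funext => phi; have [sp|ns] := pselect (schwartz phi); last first.
  by rewrite !lp_block_off// mulr0 addr0.
by rewrite !(blockE heta _ _ sp).
Qed.

Lemma refB_lin (a : R[i]) (F G : functional R) : refB eta F -> refB eta G ->
  refB eta (fun phi => a * F phi + G phi).
Proof.
move=> hF hG; split; first by apply: tempered_lin; [case: hF|case: hG].
have o1 : (1 < +oo :> \bar R)%E by exact: ltry.
have nn (H : functional R) k : (0 <= (2 ^- k)%:E * dist_Lpnorm +oo (lp_block eta k H))%E.
  by rewrite mule_ge0 ?dist_Lpnorm_ge0// lee_fin invr_ge0 exprn_ge0.
have a0 : (0 <= (cmod a)%:E)%E by rewrite lee_fin cmod_ge0.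
apply: (@le_lt_trans _ _ ((cmod a)%:E * refBnorm eta F + refBnorm eta G)%E); last first.
  have [_ fF] := hF; have [_ fG] := hG; apply: lte_add_pinfty => //.
  by apply: lte_mul_pinfty.
rewrite /refBnorm -nneseriesZl//.
rewrite -nneseriesD//; last by move=> k _ _; rewrite mule_ge0.
apply: lee_nneseries; first by move=> *; exact: nn.
move=> k *.
rewrite lp_block_lin muleCA -ge0_muleDr ?mule_ge0 ?dist_Lpnorm_ge0//.
rewrite lee_wpmul2l ?lee_fin ?invr_ge0 ?exprn_ge0//.
by apply: dist_Lpnorm_lin => //; exact: refB_block_lty.
Qed.

Lemma refB_sub (F G : functional R) : refB eta F -> refB eta G -> refB eta (fun phi => F phi - G phi).
Proof.
move=> hF hG; have := refB_lin (- 1) hG hF; congr refB; apply/funext => phi.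
by rewrite mulN1r addrC.
Qed.

End BoundedFunctions.

(** * Absolutely continuous representatives *)

Section AbsolutelyContinuous.
Context {R : realType}.
Notation mu := (@lebesgue_measure R).
Implicit Types (u g : R -> R).

Definition iI g (a b : R) : R := intR (fun x => g x * \1_(`[a, b[%classic) x).

Lemma integ_iI g a b : Lw g -> integ (fun x => g x * \1_(`[a, b[%classic) x).
Proof.
move=> Lg; apply: (@Lw_itv _ g `[a, b[ (`|a| + `|b|) Lg) => x; rewrite in_itv/= => /andP[h1 h2].
have n1 := ler_norm a; have n2 := ler_norm b; have n3 := ler_norm (- a); have n4 := normr_ge0 b.
have n5 := normr_ge0 a.
by rewrite normrN in n3; rewrite ler_norml; apply/andP; split; lra.
Qed.

Lemma indic_itv (a b x : R) : \1_(`[a, b[%classic) x = ((a <= x) && (x < b))%R%:R :> R.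
Proof. by rewrite indicE mem_setE in_itv. Qed.

Lemma iI_split g a b c : Lw g -> a <= b -> b <= c -> iI g a c = iI g a b + iI g b c.
Proof.
move=> Lg ab bc; rewrite /iI -(intRD (integ_iI a b Lg) (integ_iI b c Lg)); congr intR.
apply/funext => x; rewrite !indic_itv -mulrDr; congr (_ * _).
have [xb|bx] := ltP x b.
  by rewrite (lt_le_trans xb bc) !andbT addr0.
by rewrite (le_trans ab bx)/= add0r.
Qed.

Lemma norm_iI g a b : Lw g -> `|iI g a b| <= iI (fun x => `|g x|) a b.
Proof.
move=> Lg; apply: norm_intR_le; [exact: integ_iI|exact: integ_iI (Lw_norm Lg)|].
by move=> x; rewrite normrM [X in _ * X]ger0_norm// indic_itv.
Qed.

Lemma iI_ge0 g a b : (forall x, 0 <= g x) -> 0 <= iI g a b.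
Proof. by move=> g0; apply: intR_ge0 => x; rewrite mulr_ge0// indic_itv. Qed.

Lemma iI_sub g a b c d : Lw g -> (forall x, 0 <= g x) -> c <= a -> b <= d -> iI g a b <= iI g c d.
Proof.
move=> Lg g0 ca bd; apply: le_intR; [exact: integ_iI|exact: integ_iI|].
move=> x; rewrite ler_wpM2l// !indic_itv.
case: (boolP ((a <= x) && (x < b))) => [/andP[h1 h2]|_] //.
by rewrite (le_trans ca h1) (lt_le_trans h2 bd).
Qed.

Lemma le_iI g h a b : Lw g -> Lw h -> (forall x, g x <= h x) -> iI g a b <= iI h a b.
Proof.
move=> Lg Lh gh; apply: le_intR; [exact: integ_iI|exact: integ_iI|].
by move=> x; rewrite ler_wpM2r// indic_itv.
Qed.

Lemma Lw_cst (c : R) : Lw (fun=> c : R).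
Proof. by apply: (@Lw_bounded _ _ `|c|); [exact: meas_cst|]. Qed.

Lemma iI_cst (c a b : R) : a <= b -> iI (fun=> c) a b = c * (b - a).
Proof.
move=> ab; have I1 : integ (\1_(`[a, b[%classic) : R -> R).
  by have := integ_iI a b (Lw_cst 1); congr integ; apply/funext => x; rewrite mul1r.
rewrite /iI (intRZ _ I1) intR_indic; last exact: measurable_itv.
rewrite lebesgue_measure_itv/= lte_fin; case: ltP => h; first by rewrite -EFinD.
have -> : b = a by apply/eqP; rewrite eq_le h ab.
by rewrite subrr.
Qed.

Lemma iID g h a b : Lw g -> Lw h -> iI (fun x => g x + h x) a b = iI g a b + iI h a b.
Proof.
move=> Lg Lh; rewrite /iI -(intRD (integ_iI a b Lg) (integ_iI a b Lh)); congr intR.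
by apply/funext => x; rewrite mulrDl.
Qed.

Lemma iIB g h a b : Lw g -> Lw h -> iI (fun x => g x - h x) a b = iI g a b - iI h a b.
Proof.
move=> Lg Lh; rewrite /iI -(intRB (integ_iI a b Lg) (integ_iI a b Lh)); congr intR.
by apply/funext => x; rewrite mulrBl.
Qed.

Lemma meas_prim g : Lw g -> meas (prim g).
Proof.
move=> Lg.
have mF : meas2 (fun x y => wt x * (g y * between x y)).
  apply: meas2M; first exact: (meas2_1 meas_wt).
  by apply: meas2M; [exact: (meas2_2 Lg.1)|exact: meas2_between].
have h x y : `|wt x * (g y * between x y)| <= 1 * (wt y * `|g y|).
  rewrite normrM normrM ger0_norm ?wt_ge0// mul1r.
  apply: (@le_trans _ _ (wt x * (`|g y| * ((1 + x ^+ 2) * wt y)))).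
    by rewrite ler_wpM2l ?wt_ge0// ler_wpM2l// between_bnd.
  have -> : wt x * (`|g y| * ((1 + x ^+ 2) * wt y)) = (wt x * (1 + x ^+ 2)) * (wt y * `|g y|) by ring.
  by rewrite /wt mulVf ?mul1r// gt_eqF// oneDsqr_gt0'.
have := measM meas_onePsqr (meas_intR2 mF (Lw_norm Lg).2 h); congr meas; apply/funext => x.
rewrite (intRZ _ (integ_between x Lg)) /wt mulrA divff ?mul1r//.
by rewrite gt_eqF// oneDsqr_gt0'.
Qed.

Lemma primB g a b : Lw g -> a <= b -> prim g b - prim g a = iI g a b.
Proof.
move=> Lg ab.
have [a0|a0] := leP 0 a.
  have b0 := le_trans a0 ab.
  rewrite !prim_ge0// -!/(iI _ _ _) (iI_split Lg a0 ab); ring.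
have [b0|b0] := leP 0 b.
  rewrite prim_ge0// prim_lt0// -!/(iI _ _ _) (iI_split Lg (ltW a0) b0); ring.
rewrite !prim_lt0// -!/(iI _ _ _) (iI_split Lg ab (ltW b0)); ring.
Qed.

Definition abscont u g := [/\ Lw u, Lw g & forall a b, a <= b -> u b - u a = iI g a b].

Lemma ae_ex (P : R -> Prop) : {ae mu, forall x, P x} -> exists x, P x.
Proof.
move=> h; apply: contrapT => hn.
have : mu.-negligible (setT : set R).
  by move: h; congr (_.-negligible _); apply/seteqP; split => // x _ /= px; apply: hn; exists x.
move/(negligibleP _ measurableT) => e.
by have := @mu_setT_gt0 R; rewrite e ltxx.
Qed.

Variable eta : R -> R[i].
Hypothesis heta : lp_cutoff eta.

(** Test the weak derivative with smoothed indicator functions of [[a, b[]: in the limit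
    this gives [u b - u a = int_a^b g] whenever [a] and [b] are Lebesgue points of
    [u], which determines a continuous representative. *)
Lemma du_Bois_Reymond u g : Lw u -> Lw g ->
  (forall w, rschwartz w -> intR (fun x => u x * derive1 w x) = - intR (fun x => g x * w x)) ->
  exists u', abscont u' g /\ {ae mu, forall x, u x = u' x}.
Proof.
move=> Lu Lg hw.
have LP := lebesgue_differentiation (Lw_locally_integrable Lu).
have key a b : lebesgue_pt u a -> lebesgue_pt u b -> a <= b -> u b - u a = iI g a b.
  move=> pa pb ab.
  have c1 := intR_sindr_cvg heta ab Lg.
  have c2 : intR (fun x => u x * moll eta n b x) - intR (fun x => u x * moll eta n a x) @[n --> \oo] --> u b - u a.
    by apply: cvgB; [exact: moll_cvg pb|exact: moll_cvg pa].
  apply: (cvgR_unique c2).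
  rewrite (_ : (fun n => _) = (fun n => intR (fun x => g x * sindr eta a b n x)))//.
  apply/funext => n.
  have := hw _ (rschwartz_sindr heta a b n).
  rewrite (is_derive_derive1 (derives_sindr heta a b n)) => /eqP; rewrite -eqr_oppLR => /eqP <-.
  rewrite -(intRB (Lw_rschwartz Lu (rschwartz_moll heta n b)) (Lw_rschwartz Lu (rschwartz_moll heta n a))).
  rewrite -(intRN (Lw_rschwartz Lu (rschwartzB (rschwartz_moll heta n a) (rschwartz_moll heta n b)))).
  by congr intR; apply/funext => x; ring.
(* One Lebesgue point fixes the constant of integration. *)
have [x0 p0] := ae_ex LP.
pose u' x := (u x0 - prim g x0) + prim g x.
have uu' : {ae mu, forall x, u x = u' x}.
  apply: aeS LP => x px; rewrite /u'; have [h|h] := leP x0 x.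
    by have := key _ _ p0 px h; rewrite -(primB Lg h); lra.
  by have := key _ _ px p0 (ltW h); rewrite -(primB Lg (ltW h)); lra.
have mu' : meas u' by apply: measD; [exact: meas_cst|exact: meas_prim].
exists u'; split => //; split => //.
- split => //; apply: (integ_ae _ Lu.2); first by apply: measM; [exact: meas_wt|].
  by apply: aeS uu' => x ->.
- by move=> a b ab; rewrite -(primB Lg ab) /u'; ring.
Qed.

(** On a unit interval, [u x] differs from the mean of [u] by at most the integral
    of [|g|], and both are controlled by the p-th powers.  Boundedness places the function in the
    reference space. *)
Lemma abscont_bounded u g (r : R) : 1 < r -> abscont u g ->
  integ (fun x => `|u x| `^ r) -> integ (fun x => `|g x| `^ r) ->
  exists M, forall x, `|u x| <= M.
Proof.
move=> r1 [Lu Lg hu] Iu Ig.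
have loc h x : Lw h -> integ (fun x => `|h x| `^ r) -> iI (fun y => `|h y|) x (x + 1) <= 1 + intR (fun x => `|h x| `^ r).
  move=> Lh Ih.
  have x1 : x <= x + 1 by rewrite lerDl.
  have e1 : iI (fun=> 1) x (x + 1) = 1 by rewrite iI_cst//; ring.
  apply: (@le_trans _ _ (iI (fun=> 1) x (x + 1) + intR (fun x => `|h x| `^ r))); last by rewrite e1.
  rewrite /iI -(intRD (integ_iI x (x + 1) (Lw_cst 1)) Ih).
  apply: le_intR; [exact: integ_iI (Lw_norm Lh)|exact: integD (integ_iI x (x + 1) (Lw_cst 1)) Ih|].
  move=> y; rewrite indic_itv; case: (_ && _); last by rewrite !mulr0 add0r powR_ge0.
  by rewrite !mulr1; exact: le1D_powR.
(* The bound by one integral over the whole line does not depend on x. *)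
exists (1 + intR (fun x => `|u x| `^ r) + (1 + intR (fun x => `|g x| `^ r))) => x.
apply: le_trans (lerD (loc u x Lu Iu) (loc g x Lg Ig)).
have x1 : x <= x + 1 by rewrite lerDl.
have e1 (c : R) : iI (fun=> c) x (x + 1) = c by rewrite iI_cst//; ring.
set G1 := iI (fun y => `|g y|) x (x + 1).
have key : iI (fun=> `|u x|) x (x + 1) <= iI (fun y => `|u y| + G1) x (x + 1).
  apply: le_intR; [exact: integ_iI (Lw_cst _)|exact: integ_iI (LwD (Lw_norm Lu) (Lw_cst _))|].
  move=> y; rewrite indic_itv; case: (boolP (_ && _)) => [/andP[xy yx]|_]; last by rewrite !mulr0.
  rewrite !mulr1; have -> : u x = u y - iI g x y by rewrite -hu//; ring.
  apply: le_trans (ler_normB _ _) _; rewrite lerD2l; apply: le_trans (norm_iI _ _ Lg) _.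
  by apply: iI_sub => //; [exact: Lw_norm|exact: ltW].
by rewrite (iID _ _ (Lw_norm Lu) (Lw_cst _)) !e1 in key.
Qed.

End AbsolutelyContinuous.

Section SobolevRepresentative.
Context {R : realType}.
Notation mu := (@lebesgue_measure R).
Variable eta : R -> R[i].
Hypothesis heta : lp_cutoff eta.
Variable p : \bar R.
Hypothesis p1 : (1 < p)%E.

(** A choice of the representative that is absolutely continuous, so that it can be
    evaluated at points. *)
Record W1rep (F : functional R) (U G : R -> R[i]) : Prop := W1Rep {
  W1rep_U : cLw U;
  W1rep_G : cLw G;
  W1rep_FU : F = dist_of_fun U;
  W1rep_FG : dist_deriv F = dist_of_fun G;
  W1rep_re : abscont (reF U) (reF G);
  W1rep_im : abscont (imF U) (imF G);
  W1rep_NU : Lpnorm p U = dist_Lpnorm p F;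
  W1rep_NG : Lpnorm p G = dist_Lpnorm p (dist_deriv F);
  W1rep_finU : (Lpnorm p U < +oo)%E;
  W1rep_finG : (Lpnorm p G < +oo)%E }.

Lemma cderiv1_real (w : R -> R) : cderiv 1 (fun x => (w x)%:C) = (fun x => (derive1 w x)%:C).
Proof.
apply/funext => x; rewrite /cderiv /=; apply: ceq_reim => //=.
by rewrite (is_derive_derive1 (derives_cst (0 : R))).
Qed.

Lemma W1_rep (F : functional R) : W1 p F -> exists U G, W1rep F U G.
Proof.
move=> [tF [NF NdF]].
have [U0 [mU0 LU0 FU0 eU0 fU0]] := dist_Lpnorm_rep heta p1 NF.
have [G [mG LG FG eG fG]] := dist_Lpnorm_rep heta p1 NdF.
have weak w : rschwartz w -> cint (fun x => U0 x * (derive1 w x)%:C) = - cint (fun x => G x * (w x)%:C).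
  move=> sw; have s1 := schwartz_real sw; have s2 := schwartz_real (rschwartz_derive sw).
  rewrite -(dist_of_funE _ s2) -(dist_of_funE _ s1) -FU0 -FG /dist_deriv (on_schwartzE _ s1).
  by rewrite cderiv1_real opprK.
have [u [ACu uU]] : exists u', abscont u' (reF G) /\ {ae mu, forall x, reF U0 x = u' x}.
  apply: (du_Bois_Reymond heta LU0.1 LG.1) => w sw.
  have := congr1 (fun z => complex.Re z) (weak w sw); rewrite !cintE/= => h.
  rewrite (_ : (fun x => reF U0 x * _) = reF (fun x => U0 x * (derive1 w x)%:C)).
    by rewrite h; congr (- intR _); apply/funext => x; rewrite /reF ReMreal.
  by apply/funext => x; rewrite /reF ReMreal.
have [v [ACv vU]] : exists u', abscont u' (imF G) /\ {ae mu, forall x, imF U0 x = u' x}.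
  apply: (du_Bois_Reymond heta LU0.2 LG.2) => w sw.
  have := congr1 (fun z => complex.Im z) (weak w sw); rewrite !cintE/= => h.
  rewrite (_ : (fun x => imF U0 x * _) = imF (fun x => U0 x * (derive1 w x)%:C)).
    by rewrite h; congr (- intR _); apply/funext => x; rewrite /imF ImMreal.
  by apply/funext => x; rewrite /imF ImMreal.
pose U x := u x +i* v x.
have LU : cLw U by split; [case: ACu|case: ACv].
have UU : {ae mu, forall x, U0 x = U x}.
  by apply: aeS (aeI uU vU) => x [a b]; apply: ceq_reim.
have mU := cLw_meas LU.
exists U, G; split => //.
- by rewrite FU0; exact: dist_of_fun_ae.
- by rewrite -(Lpnorm_ae p1 mU0 mU UU).
- by rewrite -(Lpnorm_ae p1 mU0 mU UU).
Qed.

Lemma W1rep_refB F U G : W1rep F U G -> refB eta F.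
Proof.
move=> w; have mU := cLw_meas (W1rep_U w); have mG := cLw_meas (W1rep_G w).
rewrite (W1rep_FU w).
have [pE|[r r1 pE]] := exponentP p1.
  have fU := W1rep_finU w; rewrite pE in fU.
  have fin : Lpnorm +oo U \is a fin_num by rewrite ge0_fin_numE ?Lpnorm_ge0.
  apply: (@refB_fun _ _ heta _ (fine (Lpnorm +oo U)) mU).
  by apply/(Lpnorm_ooP _ mU); rewrite fineK.
have I1 := integ_powR pE r1 mU.1 (le_lt_trans (Re_nrm p1 mU) (W1rep_finU w)).
have I2 := integ_powR pE r1 mU.2 (le_lt_trans (Im_nrm p1 mU) (W1rep_finU w)).
have I3 := integ_powR pE r1 mG.1 (le_lt_trans (Re_nrm p1 mG) (W1rep_finG w)).
have I4 := integ_powR pE r1 mG.2 (le_lt_trans (Im_nrm p1 mG) (W1rep_finG w)).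
have [A hA] := abscont_bounded r1 (W1rep_re w) I1 I3.
have [B hB] := abscont_bounded r1 (W1rep_im w) I2 I4.
apply: (@refB_fun _ _ heta _ (A + B) mU); apply: aeW => x.
by apply: le_trans (cmod_n1 _) _; apply: lerD; [exact: hA|exact: hB].
Qed.

Lemma W1rep_pair F U G a b : W1rep F U G -> a <= b ->
  pair_indic eta F `[a, b[%classic = iI (reF U) a b +i* iI (imF U) a b.
Proof.
move=> w ab; have hB := W1rep_refB w.
by rewrite (W1rep_FU w) in hB *; exact: pair_indic_fun (W1rep_U w) hB ab.
Qed.

Lemma dist_deriv_lin (a : R[i]) (F G : functional R) : tempered F -> tempered G ->
  dist_deriv (fun phi => a * F phi + G phi) = (fun phi => a * dist_deriv F phi + dist_deriv G phi).
Proof.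
move=> tF tG; apply/funext => phi; rewrite /dist_deriv /on_schwartz; case: asboolP => // _.
  by ring.
by rewrite mulr0 addr0.
Qed.

Lemma dist_of_fun0 : dist_of_fun (fun=> 0) = (fun=> 0) :> functional R.
Proof.
apply/funext => phi; rewrite /dist_of_fun /on_schwartz; case: asboolP => // _.
rewrite (_ : (fun x => 0 * phi x) = (fun=> 0)); last by apply/funext => x; rewrite mul0r.
by have := @cintE R (fun=> 0); rewrite /cint => ->; apply: ceq_reim; exact: intR_cst0.
Qed.

Lemma W1_lin : linear_subspace (W1 p : set (functional R)).
Proof.
have L0 : (dist_Lpnorm p ((fun=> 0%R) : functional R) < +oo)%E.
  rewrite -dist_of_fun0; apply: le_lt_trans (dist_Lpnorm_le _ (cmeas_cst 0)) _.
  rewrite /Lpnorm (_ : (fun x : R => _) = (cst 0%E)); last first.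
    by apply/funext => x; rewrite -[0]/(0%:C) cmod_real normr0.
  by rewrite Lnorm0 ?ltry// gt_eqF// (lt_trans _ p1)// lte_fin.
have dd0 : dist_deriv (fun=> 0) = (fun=> 0) :> functional R.
  by apply/funext => phi; rewrite /dist_deriv /on_schwartz oppr0; case: asboolP.
split.
  split; last by rewrite dd0.
  by rewrite -dist_of_fun0; apply: cLw_tempered; split; exact: Lw_cst.
move=> a F G [tF [n1F n2F]] [tG [n1G n2G]].
split; [exact: tempered_lin|split].
  apply: le_lt_trans (dist_Lpnorm_lin heta p1 a n1F n1G) _.
  by apply: lte_add_pinfty => //; apply: lte_mul_pinfty => //; rewrite lee_fin cmod_ge0.
rewrite dist_deriv_lin//; apply: le_lt_trans (dist_Lpnorm_lin heta p1 a n2F n2G) _.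
by apply: lte_add_pinfty => //; apply: lte_mul_pinfty => //; rewrite lee_fin cmod_ge0.
Qed.

End SobolevRepresentative.

(** * Dyadic step functions *)

Section StepFunctions.
Context {R : realType}.
Notation mu := (@lebesgue_measure R).

Definition fl (J : nat) (x : R) : int := Num.floor (2 ^+ J * x).

Lemma dyE J m : dy J m = scale J * m%:~R :> R.
Proof. by rewrite /dy -exprnN. Qed.

Lemma fl_le J (x : R) : dy J (fl J x) <= x.
Proof. exact: dfl_le. Qed.

Lemma fl_lt J (x : R) : x < dy J (fl J x + 1).
Proof.
rewrite dyE /scale ltr_pdivlMl ?exprn_gt0//.
exact: Num.Theory.floorD1_gt.
Qed.

Lemma flP J (x : R) m : (dy J m <= x < dy J (m + 1)) = (fl J x == m).
Proof.
apply/idP/eqP => [|<-]; last by rewrite fl_le fl_lt.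
rewrite !dyE /scale ler_pdivrMl ?exprn_gt0// ltr_pdivlMl ?exprn_gt0// => h.
exact: Num.Theory.floor_def.
Qed.

Definition cell J m : set R := `[dy J m, dy J (m + 1)[%classic.

Lemma cellP J m x : cell J m x <-> fl J x = m.
Proof. by rewrite /cell/= in_itv/= flP; split => /eqP. Qed.

Lemma measurable_cell J m : measurable (cell J m).
Proof. exact: measurable_itv. Qed.

Lemma dyS J m : dy J (m + 1) = dy J m + scale J :> R.
Proof. by rewrite !dyE intrD mulrDr mulr1. Qed.

Lemma mu_cell J m : mu (cell J m) = (scale J)%:E.
Proof.
rewrite /cell lebesgue_measure_itv/= lte_fin dyS ltrDl scale_gt0 -EFinD; congr (_%:E); ring.
Qed.

Lemma meas_step (a : int -> R) J : meas (fun x => a (fl J x)).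
Proof.
move=> _ Y mY; rewrite setTI.
pose S n := if pickle_inv n is Some m then [set x | cell J m x /\ Y (a m)] else (set0 : set R).
rewrite (_ : _ @^-1` Y = \bigcup_n S n); last first.
  apply/seteqP; split => x /=.
    move=> Yx; exists (pickle (fl J x)); first exact: I.
    by rewrite /S pickleK_inv; split; [exact/cellP|].
  move=> [n _]; rewrite /S; case: pickle_inv => // m [/cellP <-] //.
apply: bigcup_measurable => n _; rewrite /S; case: pickle_inv => // m.
have [Yam|nYam] := pselect (Y (a m)).
  rewrite (_ : [set x | _] = cell J m); first exact: measurable_cell.
  by apply/seteqP; split => x //= [].
by rewrite (_ : [set x | _] = set0)//; apply/seteqP; split => x //= [].
Qed.

(** A family over the integers listed along their enumeration as a countable type. *)
Definition unfold (b : int -> \bar R) (n : nat) : \bar R :=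
  if pickle_inv n is Some m then b m else 0%E.

Lemma esum_int (b : int -> \bar R) : (forall m, 0 <= b m)%E ->
  (\esum_(m in [set: int]) b m = \sum_(0 <= n <oo) unfold b n)%E.
Proof.
move=> b0.
have u0 n : (0 <= unfold b n)%E by rewrite /unfold; case: pickle_inv.
rewrite nneseries_esumT// (_ : unfold b = (fun n => if n \in range (@pickle int) then unfold b n else 0%E)).
  rewrite -esum_mkcond (@reindex_esum _ _ _ [set: int] _ (@pickle int)).
    by apply: eq_esum => m _; rewrite /unfold pickleK_inv.
  split; [by move=> m _; exists m|by move=> x y _ _; exact: (pcan_inj pickleK_inv)|by move=> n [m _ <-]; exists m].
apply/funext => n; case: ifPn => // ; rewrite notin_setE/= => h.
rewrite /unfold; case E : (pickle_inv n) => [m|]//.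
by exfalso; apply: h; exists m => //; have := @pickle_invK int n; rewrite E.
Qed.

Lemma int_step (b : int -> R) J : (forall m, 0 <= b m) ->
  (\int[mu]_x (b (fl J x))%:E = (scale J)%:E * \esum_(m in [set: int]) (b m)%:E)%E.
Proof.
move=> b0.
pose F n := if @pickle_inv int n is Some m then cell J m else (set0 : set R).
have mF n : measurable (F n) by rewrite /F; case: pickle_inv => // m; exact: measurable_cell.
have FT : (setT : set R) = \bigcup_n F n.
  apply/seteqP; split; last by move=> x _; exact: I.
  move=> x _; exists (pickle (fl J x)); first exact: I.
  by rewrite /F pickleK_inv; exact/cellP.
have tF : trivIset setT F.
  move=> n1 n2 _ _ [x []]; rewrite /F.
  have := @pickle_invK int n1; have := @pickle_invK int n2.
  case: (pickle_inv n1) => // m1; case: (pickle_inv n2) => // m2 /= <- <- /cellP <- /cellP <- //.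
rewrite FT ge0_integral_bigcup//; last 2 first.
- rewrite -FT; apply/measurable_EFinP; exact: meas_step.
- by move=> x _; rewrite lee_fin.
rewrite (esum_int (b := fun m => (b m)%:E))//.
rewrite -nneseriesZl; last first.
- by move=> n _; rewrite /unfold; case: pickle_inv => // m; rewrite lee_fin.
apply: eq_eseriesr => n _; rewrite /F /unfold; case: pickle_inv => [m|]; last by rewrite integral_set0 mule0.
rewrite (eq_integral (cst (b m)%:E)); last by move=> x /set_mem /cellP ->.
have e := @integral_cst _ _ R mu (cell J m) (measurable_cell J m) (b m)%:E.
by apply: (etrans e); rewrite muleC; congr (_ * _)%E; exact: mu_cell.
Qed.

Variable p : \bar R.
Hypothesis p1 : (1 < p)%E.

Lemma ellp_ge0 a : (0 <= ellp p a)%E.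
Proof.
have [->|[r r1 ->]] := exponentP p1; last exact: poweR_ge0.
by apply: le_trans (ereal_sup_ubound (imageT _ (0 : int))); rewrite lee_fin.
Qed.

Lemma step_nrm a J : (nrm p (fun x => a (fl J x)) = (scale J `^ (fine p)^-1)%:E * ellp p a)%E.
Proof.
have [pE|[r r1 pE]] := exponentP p1; last first.
  rewrite (nrm_fin _ pE) pE /= (@int_step (fun m => `|a m| `^ r)); last by move=> m; exact: powR_ge0.
  rewrite poweRM ?lee_fin ?(ltW (scale_gt0 J))//.
  by apply: esum_ge0 => m _; rewrite lee_fin powR_ge0.
rewrite pE /= invr0 powRr0 mul1e; apply/eqP; rewrite eq_le; apply/andP; split.
  case E : (ereal_sup _) => [B| |]; last 2 first.
  - exact: leey.
  - have := @ellp_ge0 a; rewrite pE /= E //.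
  apply/(nrm_oo_le _ erefl); first exact: meas_step.
  apply: aeW => x; rewrite -lee_fin -E; apply: ereal_sup_ubound; by exists (fl J x).
apply: ge_ereal_sup => _ [m _ <-].
have := nrm_ge0 p (fun x => a (fl J x)).
rewrite pE; case E : (nrm +oo%E (fun x => a (fl J x))) => [B| |]// _; last exact: leey.
have : (nrm p (fun x => a (fl J x)) <= B%:E)%E by rewrite pE E.
move/(nrm_oo_le _ pE (meas_step a J)) => [N [mN N0 NB]].
rewrite lee_fin leNgt; apply/negP => hB.
have : (mu (cell J m) <= mu N)%E.
  apply: le_measure; rewrite ?inE//; first exact: measurable_cell.
  move=> x /cellP xm; apply: NB => /=; rewrite xm => h; by move: hB; rewrite ltNge h.
by rewrite N0 mu_cell lee_fin leNgt scale_gt0.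
Qed.

End StepFunctions.

Section MaximalBound.
Context {R : realType}.
Notation mu := (@lebesgue_measure R).
Variable p : \bar R.
Hypothesis p1 : (1 < p)%E.

(** The constant of the maximal inequality in terms of norms; for the exponent [oo]
    it is 1. *)
Definition Cmax : R := if p is r%:E then Kmax r `^ r^-1 else 1.

Lemma Cmax_ge0 : 0 <= Cmax. Proof. by rewrite /Cmax; case: p => // r; exact: powR_ge0. Qed.

Lemma maximal_Lnorm (S : R -> \bar R) (c : R) g : 0 < c -> Lw g ->
  (forall x, 0 <= S x)%E -> (forall x, S x <= c%:E * HL_maximal g x)%E ->
  (Lnorm mu p S <= (c * Cmax)%:E * nrm p g)%E.
Proof.
move=> c0 Lg S0 hS.
have absS x : `|S x|%E = S x by rewrite gee0_abs.
have [pE|[r r1 pE]] := exponentP p1; last first.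
  have r0 : 0 < r by rewrite (lt_trans ltr01).
  rewrite (nrm_fin _ pE) /Cmax pE unlock.
  rewrite (_ : (fun x => _) = (fun x => S x `^ r)%E); last by apply/funext => x; rewrite absS.
  have HL0 x : (0 <= HL_maximal g x)%E by apply: HL_maximalT_ge0; exact: Lw_locally_integrable.
  have I0 : (0 <= \int[mu]_x (`|g x| `^ r)%:E)%E by apply: integral_ge0 => x _; rewrite lee_fin powR_ge0.
  apply: (@le_trans _ _ (((c `^ r)%:E * ((Kmax r)%:E * \int[mu]_x (`|g x| `^ r)%:E)) `^ r^-1)%E); last first.
    rewrite poweRM ?mule_ge0 ?lee_fin ?powR_ge0 ?Kmax_ge0//.
    rewrite poweRM ?lee_fin ?Kmax_ge0// !poweR_EFin -powRrM mulfV ?gt_eqF// powRr1 ?(ltW c0)//.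
    by rewrite EFinM muleA.
  apply: gt0_ler_poweR.
  - by rewrite invr_ge0 ltW.
  - by rewrite in_itv/= leey andbT; apply: integral_ge0 => x _; exact: poweR_ge0.
  - by rewrite in_itv/= leey andbT !mule_ge0 ?lee_fin ?powR_ge0 ?Kmax_ge0.
  have cr : (0 <= (c `^ r)%:E)%E by rewrite lee_fin powR_ge0.
  apply: le_trans (lee_wpmul2l cr (strong_maximal r1 Lg)).
  have mHL := measurable_HL_maximal (Lw_locally_integrable Lg).
  rewrite -ge0_integralZl_EFin//; last 2 first.
  - by move=> x _; exact: poweR_ge0.
  - by first [exact: powR_ge0 | exact: (measurableT_comp (measurable_poweR r))].
  apply: le_int => x; first exact: poweR_ge0.
  rewrite -poweR_EFin -poweRM ?lee_fin ?(ltW c0)//.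
  by apply: poweR_le.
have -> : Cmax = 1 by rewrite /Cmax pE.
rewrite mulr1 pE; have := nrm_ge0 p g; rewrite pE.
case E : (nrm +oo%E g) => [B| |]// _; last by rewrite gt0_muley ?lte_fin// leey.
have : (nrm p g <= B%:E)%E by rewrite pE E.
move/(nrm_oo_le _ pE Lg.1) => hB.
have HLB x : (HL_maximal g x <= B%:E)%E.
  apply: ge_ereal_sup => _ [d /= d0 <-]; rewrite in_itv/= andbT in d0.
  have muB : mu (ball x d) = (d *+ 2)%:E by rewrite lebesgue_measure_ball// ltW.
  have d2 : 0 < d *+ 2 by rewrite pmulrn_rgt0.
  rewrite /iavg muB inver gt_eqF// lee_pdivrMl//.
  have mB : measurable (ball x d) by exact: measurable_ball.
  apply: (@le_trans _ _ (\int[mu]_(y in ball x d) (cst B%:E y))%E); last first.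
    by rewrite integral_cst// le_eqVlt; apply/orP; left; apply/eqP; rewrite muleC; congr (_ * _)%E; exact: muB.
  apply: ae_ge0_le_integral => //.
  - by apply: measurable_funTS; apply/measurable_EFinP; apply: meas_norm; case: Lg.
  - move=> y _; rewrite lee_fin; have [z hz] := ae_ex hB; exact: le_trans hz.
  - by apply: aeS hB => y h _; rewrite lee_fin.
rewrite unlock mu_setT_gt0; apply/ess_supP; apply: aeW => x /=.
rewrite absS; apply: le_trans (hS x) _.
by rewrite lee_wpmul2l// lee_fin ltW.
Qed.

End MaximalBound.

Section Fatou.
Context {R : realType}.
Notation mu := (@lebesgue_measure R).
Variable p : \bar R.
Hypothesis p1 : (1 < p)%E.

Lemma nrm_fatou (h_ : nat -> R -> R) h (B : R) : (forall n, meas (h_ n)) -> meas h ->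
  {ae mu, forall x, h_ n x @[n --> \oo] --> h x} ->
  (forall n, nrm p (h_ n) <= B%:E)%E -> (nrm p h <= B%:E)%E.
Proof.
move=> mh_ mh hh hB.
have [pE|[r r1 pE]] := exponentP p1.
  apply/(nrm_oo_le _ pE mh).
  have h1 : {ae mu, forall x, forall n, `|h_ n x| <= B}.
    by apply: ae_forall => n; apply/(nrm_oo_le _ pE (mh_ n)).
  apply: aeS (aeI hh h1) => x [c b].
  have c' : `|h_ n x| @[n --> \oo] --> `|h x| by apply: cvg_norm.
  by apply: (cvgr_to_le c'); apply: nearW.
have r0 : 0 < r by rewrite (lt_trans ltr01).
have B0 : 0 <= B by rewrite -lee_fin (le_trans _ (hB 0%N))// nrm_ge0.
have ib n : (\int[mu]_x (`|h_ n x| `^ r)%:E <= (B `^ r)%:E)%E.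
  have := hB n; rewrite (nrm_fin _ pE) => e.
  have I0 : (0 <= \int[mu]_x (`|h_ n x| `^ r)%:E)%E by apply: integral_ge0 => x _; rewrite lee_fin powR_ge0.
  have -> : (\int[mu]_x (`|h_ n x| `^ r)%:E = ((\int[mu]_x (`|h_ n x| `^ r)%:E) `^ r^-1) `^ r)%E.
    by rewrite -poweRrM mulVf ?gt_eqF// poweRe1.
  by rewrite -poweR_EFin; apply: poweR_le => //; exact: poweR_ge0.
have mp n := @meas_powR R (h_ n) r (mh_ n).
have h0 n x : setT x -> (0 <= (`|h_ n x| `^ r)%:E)%E by move=> _; rewrite lee_fin powR_ge0.
have ft := @fatou _ _ R mu setT measurableT (fun n x => (`|h_ n x| `^ r)%:E) mp h0.
have e1 : (\int[mu]_x (`|h x| `^ r)%:E <= (B `^ r)%:E)%E.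
  apply: (@le_trans _ _ (\int[mu]_x limn_einf (fun n => (`|h_ n x| `^ r)%:E))%E).
    apply: ae_ge0_le_integral; first exact: measurableT.
    - by move=> x _; rewrite lee_fin powR_ge0.
    - exact: meas_powR.
    - move=> x _; rewrite limn_einf_lim; apply: lime_ge; first exact: is_cvg_einfs.
      by apply: nearW => n; apply: le_ereal_inf_tmp => _ [m _ <-]; rewrite lee_fin powR_ge0.
    - rewrite (_ : (fun x => limn_einf _) = (fun x => limn (einfs (fun n => (`|h_ n x| `^ r)%:E)))); last first.
        by apply/funext => x; rewrite limn_einf_lim.
      apply: (emeasurable_fun_cvg (fun n x => einfs (fun n => (`|h_ n x| `^ r)%:E) n)).
        by move=> n; exact: (measurable_fun_einfs (f := fun n x => (`|h_ n x| `^ r)%:E)).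
      by move=> x _; exact: is_cvg_einfs.
    - apply: aeS hh => x c _; have [hx0|hx0] := eqVneq (h x) 0.
        rewrite hx0 normr0 powR0 ?gt_eqF// limn_einf_lim; apply: lime_ge; first exact: is_cvg_einfs.
        by apply: nearW => n; apply: le_ereal_inf_tmp => _ [m _ <-]; rewrite lee_fin powR_ge0.
      have cn : `|h_ n x| @[n --> \oo] --> `|h x| by apply: cvg_norm.
      have cp : {for `|h x|, continuous (fun y : R => y `^ r)}.
        apply: differentiable_continuous; apply/derivable1_diffP; apply: derivable_powR.
        by rewrite in_itv/= andbT normr_gt0.
      have c' : (`|h_ n x| `^ r)%:E @[n --> \oo] --> (`|h x| `^ r)%:E.
        apply: cvg_EFin; first by apply: nearW.
        have c2 := @cvg_comp _ _ _ (fun n => `|h_ n x|) (fun y : R => y `^ r) _ _ _ cn cp.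
        exact: c2.
      by have [-> _] := cvg_limn_einf_sup c'.
  apply: le_trans ft _.
  rewrite limn_einf_lim; apply: lime_le; first exact: is_cvg_einfs.
  apply: nearW => n; apply: le_trans (ib n).
  by apply: ereal_inf_lbound; exists n => /=.
rewrite (nrm_fin _ pE).
have -> : B%:E = ((B `^ r)%:E `^ r^-1)%E by rewrite poweR_EFin -powRrM mulfV ?gt_eqF// powRr1.
apply: gt0_ler_poweR => //.
- by rewrite invr_ge0 ltW.
- by rewrite in_itv/= leey andbT; apply: integral_ge0 => x _; rewrite lee_fin powR_ge0.
- by rewrite in_itv/= leey andbT lee_fin powR_ge0.
Qed.

End Fatou.

(** * Half-interval differences of absolutely continuous functions *)

Section Differences.
Context {R : realType}.
Notation mu := (@lebesgue_measure R).
Implicit Types (u g h : R -> R).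

(** The Haar coefficient of [u] on [[a, a + 2 h[]. *)
Definition Dif u (a h : R) : R := iI u a (a + h) - iI u (a + h) (a + h + h).

Lemma Dif_formula u g (a h L : R) : abscont u g -> 0 <= h ->
  `|Dif u a h + h ^+ 2 * L| <= h * iI (fun t => `|g t - L|) a (a + h + h).
Proof.
move=> [Lu Lg hu] h0.
have ah : a <= a + h by rewrite lerDl.
have LgL : Lw (fun t => g t - L) by have := LwD Lg (Lw_cst (- L)).
set C := iI _ a (a + h + h).
have I1 := integ_iI a (a + h) Lu.
have I2' := integ_shift h (integ_iI (a + h) (a + h + h) Lu).
have I2 : integ (fun x => u (x + h) * \1_(`[a, (a + h)[%classic) x).
  by move: I2'; congr integ; apply/funext => x; rewrite !indic_itv lerD2r ltrD2r.
have I3 := integ_iI a (a + h) (Lw_cst (h * L)).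
have E2 : iI u (a + h) (a + h + h) = intR (fun x => u (x + h) * \1_(`[a, (a + h)[%classic) x).
  rewrite /iI -(intR_shift h (integ_iI (a + h) (a + h + h) Lu)); congr intR.
  by apply/funext => x; rewrite !indic_itv lerD2r ltrD2r.
have E : Dif u a h + h ^+ 2 * L = intR (fun y => (u y * \1_(`[a, (a + h)[%classic) y - u (y + h) * \1_(`[a, (a + h)[%classic) y)
    + h * L * \1_(`[a, (a + h)[%classic) y).
  rewrite (intRD (integB I1 I2) I3) (intRB I1 I2) -/(iI u a (a + h)) -E2 /Dif; congr (_ + _).
  by have := iI_cst (h * L) ah; rewrite /iI => ->; ring.
have -> : h * C = iI (fun=> C) a (a + h) by rewrite iI_cst//; ring.
rewrite E; apply: norm_intR_le; [exact: (integD (integB I1 I2) I3)|exact: integ_iI (Lw_cst _)|].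
move=> y; rewrite -mulrBl -mulrDl normrM [X in _ * X]ger0_norm; last by rewrite indic_itv.
rewrite indic_itv; case: (boolP (_ && _)) => [/andP[ay yh]|_]; last by rewrite !mulr0.
rewrite !mulr1.
have yy : y <= y + h by rewrite lerDl.
have -> : u y - u (y + h) + h * L = - iI (fun t => g t - L) y (y + h).
  rewrite (iIB _ _ Lg (Lw_cst L)) (iI_cst _ yy) -(hu _ _ yy); ring.
rewrite normrN; apply: le_trans (norm_iI _ _ LgL) _.
apply: iI_sub => //; first exact: Lw_norm.
by rewrite lerD2r ltW.
Qed.

(** The Haar coefficient with the factor [4 ^ J] that makes it scale like the
    derivative. *)
Definition Ph u J (m : int) : R := 4 ^+ J * Dif u (dy J m) (scale J.+1).

Lemma scale2 J : scale J = scale J.+1 + scale J.+1 :> R.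
Proof. by rewrite scaleS; field. Qed.

Lemma scaleE J : scale J * 2 ^+ J = 1 :> R.
Proof. by rewrite /scale mulVf// expf_neq0. Qed.

Lemma Ph_formula u g J m (L : R) : abscont u g ->
  `|Ph u J m + L / 4| <= 2 ^+ J / 2 * iI (fun t => `|g t - L|) (dy J m) (dy J (m + 1)).
Proof.
move=> hu; have s0 : (0 : R) <= scale J.+1 by rewrite ltW// scale_gt0.
have := Dif_formula (dy J m) L hu s0.
have -> : dy J m + scale J.+1 + scale J.+1 = dy J (m + 1) :> R by rewrite dyS [in RHS]scale2 addrA.
set D := Dif _ _ _; set I := iI _ _ _ => h.
have p4 : 4 ^+ J = 2 ^+ J * 2 ^+ J :> R by rewrite -exprMn; congr (_ ^+ _); ring.
have sE := scaleE J.
have -> : Ph u J m + L / 4 = 4 ^+ J * (D + scale J.+1 ^+ 2 * L).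
  have X : 4 ^+ J * (scale J.+1 ^+ 2 * L) = L / 4.
    have -> : 4 ^+ J * (scale J.+1 ^+ 2 * L) = (scale J * 2 ^+ J) ^+ 2 * L / 4 by rewrite p4 scaleS; field.
    by rewrite sE expr1n mul1r.
  by rewrite [RHS]mulrDr X.
rewrite normrM ger0_norm ?exprn_ge0//.
apply: le_trans (ler_wpM2l _ h) _; first by rewrite exprn_ge0.
rewrite le_eqVlt; apply/orP; left; apply/eqP.
have -> : 4 ^+ J * (scale J.+1 * I) = (scale J * 2 ^+ J) * (2 ^+ J / 2 * I) by rewrite p4 scaleS; field.
by rewrite sE mul1r.
Qed.

Lemma cell_iavg h J x : Lw h ->
  ((2 ^+ J / 2 * iI (fun t => `|h t|) (dy J (fl J x)) (dy J (fl J x + 1)))%:E <= iavg h (ball x (scale J)))%E.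
Proof.
move=> Lh; have s0 : (0 : R) < scale J := scale_gt0 J.
have muB : mu (ball x (scale J)) = (scale J *+ 2)%:E by rewrite lebesgue_measure_ball// ltW.
have s2 : 0 < scale J *+ 2 :> R by rewrite pmulrn_rgt0.
rewrite /iavg muB inver gt_eqF//.
have -> : (scale J *+ 2)^-1 = 2 ^+ J / 2 :> R.
  have h1 : (scale J *+ 2) * (2 ^+ J / 2) = 1 :> R.
    rewrite mulr2n; have -> : (scale J + scale J) * (2 ^+ J / 2) = scale J * 2 ^+ J :> R by field.
    exact: scaleE.
  have n0 : scale J *+ 2 != 0 :> R by rewrite gt_eqF.
  by apply: (mulfI n0); rewrite h1 (mulfV n0).
have p20 : (0 <= (2 ^+ J / 2 : R)%:E)%E by rewrite lee_fin divr_ge0 ?exprn_ge0.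
rewrite EFinM; apply: (lee_wpmul2l p20).
rewrite -(intRE (integ_iI _ _ (Lw_norm Lh))) [in leRHS]integral_mkcond.
apply: le_int => y; first by rewrite lee_fin mulr_ge0// indic_itv.
rewrite patchE indic_itv.
case: (boolP (_ && _)) => [/andP[h1 h2]|_]; last first.
  by rewrite mulr0; case: ifP => // _; rewrite lee_fin.
rewrite mem_set ?mulr1//=.
have h3 := fl_le J x; have h4 := fl_lt J x; rewrite dyS in h2 h4.
by rewrite /ball/= ltr_norml; apply/andP; split; lra.
Qed.

(** A dyadic interval of length [2 ^ -J] is contained in the ball of that radius
    around each of its points, and the ball is only twice as long. *)
Lemma cell_HL h J x : Lw h ->
  ((2 ^+ J / 2 * iI (fun t => `|h t|) (dy J (fl J x)) (dy J (fl J x + 1)))%:E <= HL_maximal h x)%E.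
Proof.
move=> Lh; apply: le_trans (cell_iavg J x Lh) _.
by apply: ereal_sup_ubound; exists (scale J) => //=; rewrite in_itv/= andbT scale_gt0.
Qed.

Lemma Ph_le u g J m : abscont u g ->
  `|Ph u J m| <= 2 ^+ J / 2 * iI (fun t => `|g t|) (dy J m) (dy J (m + 1)).
Proof.
move=> hu; have := Ph_formula J m 0 hu; rewrite mul0r addr0.
by rewrite (_ : (fun t => `|g t - 0|) = (fun t => `|g t|))//; apply/funext => t; rewrite subr0.
Qed.

(** Apply [Ph_formula] with [L = g x]: the error is at most an average oscillation
    of [g] around [x], over a ball containing the dyadic interval. *)
Lemma Ph_cvg u g x : abscont u g -> lebesgue_pt g x -> Ph u n (fl n x) @[n --> \oo] --> - (g x / 4).
Proof.
move=> hu px; have [Lu Lg _] := hu.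
have LgL : Lw (fun t => g t - g x) by have := LwD Lg (Lw_cst (- g x)).
apply/cvgrPdist_le => e e0.
have := px _ (nbhs_open_ereal_lt (r := 0) (f := fun=> e) e0); case => d /= d0 hd.
have [N _ hN] := cvgr_lt 0 scale_cvg0 _ d0.
exists N => // n /= Nn; have sn := hN n Nn.
have s0 := @scale_gt0 R n.
have hlt : (davg g x (scale n) < e%:E)%E.
  by apply: hd => //=; rewrite sub0r normrN gtr0_norm.
rewrite -lee_fin; apply: ltW; apply: le_lt_trans hlt.
apply: le_trans (cell_iavg n x LgL).
rewrite lee_fin -normrN opprB opprK; exact: Ph_formula.
Qed.

Lemma abscont_mean u g x : abscont u g ->
  `|u x - iI u (dy 0 (fl 0 x)) (dy 0 (fl 0 x + 1))| <= iI (fun t => `|g t|) (dy 0 (fl 0 x)) (dy 0 (fl 0 x + 1)).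
Proof.
move=> [Lu Lg hu]; set a := dy 0 _; set b := dy 0 _; set C := iI (fun t => `|g t|) a b.
have ax : a <= x := fl_le 0 x.
have xb : x < b := fl_lt 0 x.
have ab : a <= b by rewrite (le_trans ax)// ltW.
have ba : b - a = 1 by rewrite /a /b dyS /scale expr0 invr1; ring.
have -> : u x - iI u a b = iI (fun t => u x - u t) a b.
  by rewrite (iIB _ _ (Lw_cst _) Lu) (iI_cst _ ab) ba mulr1.
have -> : C = iI (fun=> C) a b by rewrite iI_cst// ba mulr1.
apply: norm_intR_le; [by apply: integ_iI; have := LwD (Lw_cst (u x)) (LwZ (-1) Lu); congr Lw; apply/funext => t; rewrite mulN1r|exact: integ_iI (Lw_cst _)|].
move=> y; rewrite normrM [X in _ * X]ger0_norm; last by rewrite indic_itv.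
rewrite indic_itv; case: (boolP (_ && _)) => [/andP[ay yb]|_]; last by rewrite !mulr0.
rewrite !mulr1; have [xy|yx] := leP x y.
  rewrite -normrN opprB hu//; apply: le_trans (norm_iI _ _ Lg) _.
  by apply: iI_sub => //; [exact: Lw_norm|exact: ltW].
rewrite hu ?(ltW yx)//; apply: le_trans (norm_iI _ _ Lg) _.
by apply: iI_sub => //; [exact: Lw_norm|exact: ltW].
Qed.

Variable p : \bar R.
Hypothesis p1 : (1 < p)%E.

(** Fatou along the convergence at Lebesgue points. *)
Lemma lower_deriv u g (B : R) : abscont u g ->
  (forall J, nrm p (fun x => Ph u J (fl J x)) <= B%:E)%E -> (nrm p g <= (4 * B)%:E)%E.
Proof.
move=> hu hB; have [Lu Lg _] := hu.
apply: (nrm_fatou p1 (h_ := fun J x => - 4 * Ph u J (fl J x))).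
- by move=> J; apply: measZ; exact: meas_step.
- by case: Lg.
- apply: aeS (lebesgue_differentiation (Lw_locally_integrable Lg)) => x px.
  have -> : g x = - 4 * - (g x / 4) by field.
  by apply: cvgMr; exact: Ph_cvg.
- move=> J; apply: le_trans (nrmZ p1 _ (meas_step _ _) (le_lt_trans (hB J) (ltry B))) _.
  by rewrite normrN [`|4|]ger0_norm// EFinM lee_wpmul2l// lee_fin.
Qed.

(** The function is its mean over the unit interval up to an error bounded by the
    maximal function of the derivative. *)
Lemma lower_fun u g (B0 B1 : R) : abscont u g -> (nrm p g <= B1%:E)%E ->
  (nrm p (fun x => iI u (dy 0 (fl 0 x)) (dy 0 (fl 0 x + 1))) <= B0%:E)%E ->
  (nrm p u <= (B0 + 2 * Cmax p * B1)%:E)%E.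
Proof.
move=> hu hg h0; have [Lu Lg _] := hu.
pose a m := iI u (dy 0 m) (dy 0 (m + 1)); pose b m := iI (fun t => `|g t|) (dy 0 m) (dy 0 (m + 1)).
have b0 m : 0 <= b m by apply: iI_ge0 => x; exact: normr_ge0.
have ma := meas_step a 0; have mb := meas_step b 0.
apply: (@le_trans _ _ (nrm p (fun x => `|a (fl 0 x)| + b (fl 0 x)))).
  apply: (le_nrm_all p1) => [|//|x].
  - by case: Lu.
  - by apply: measD => //; exact: meas_norm.
  rewrite [X in _ <= X]ger0_norm ?addr_ge0//.
  have := abscont_mean x hu; rewrite -/(a _) -/(b _) => h.
  by have := ler_normD (a (fl 0 x)) (u x - a (fl 0 x)); rewrite addrC subrK; lra.
apply: le_trans (nrmD p1 (meas_norm ma) mb) _.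
rewrite nrm_norm EFinD; apply: leeD => //.
rewrite EFinM; apply: le_trans (lee_wpmul2l _ hg); last by rewrite lee_fin mulr_ge0 ?Cmax_ge0.
apply: (@maximal_Lnorm _ p p1 (fun x => (b (fl 0 x))%:E) 2 g) => //.
  by move=> x; rewrite lee_fin.
move=> x; have := cell_HL 0 x Lg; rewrite expr0 mul1r -/(b _) => h.
apply: le_trans (lee_wpmul2l _ h); last by rewrite lee_fin.
by rewrite -EFinM lee_fin mulrA divff ?mul1r.
Qed.

End Differences.

(** * Dyadic norms of Sobolev functions *)

Section HaarNorms.
Context {R : realType}.
Notation mu := (@lebesgue_measure R).
Variable eta : R -> R[i].
Hypothesis heta : lp_cutoff eta.
Variable p : \bar R.
Hypothesis p1 : (1 < p)%E.

(** By convention the coefficients of levels -1 and 0 both live on unit intervals. *)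
Definition lev (j : int) : nat := if 0 <= j then `|j|%N else 0%N.
Definition ix (j : int) (x : R) : int := fl (lev j) x.

Lemma level_cases (j : int) : -1 <= j -> j = -1 \/ exists J : nat, j = J%:Z.
Proof. by case: j => [J _|[|n]]; [right; exists J|left|]. Qed.

Lemma dyadic_interval_cell j m : -1 <= j -> (dyadic_interval j m : set R) = cell (lev j) m.
Proof.
move=> /level_cases[->|[J ->]]; last exact: dyadic_intervalE.
by rewrite /dyadic_interval /cell /lev /= dyS dyE /scale expr0 invr1 mul1r.
Qed.

Lemma mem_dyadic j m x : -1 <= j -> dyadic_interval j m x <-> ix j x = m.
Proof. by move=> j1; rewrite (dyadic_interval_cell _ j1); exact: cellP. Qed.

(** The step function under the supremum in the norm of F. *)
Definition hval (F : functional R) j x : R :=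
  2 ^ j * cmod ((2 ^ j)%:C * haar_coef eta F j (ix j x)).

Lemma hval_ge0 F j x : 0 <= hval F j x.
Proof. by rewrite mulr_ge0 ?exprz_ge0 ?cmod_ge0. Qed.

Lemma haar_sum F j x : -1 <= j ->
  \sum_(m \in [set: int]) (2 ^ j)%:C * haar_coef eta F j m * (\1_(dyadic_interval j m) x)%:C
  = (2 ^ j)%:C * haar_coef eta F j (ix j x).
Proof.
move=> j1; rewrite -(@fsbig_widen _ _ _ _ [set ix j x] setT)//=; last first.
  move=> m [_ /= ne]; rewrite indicE memNset ?mulr0//.
  by move=> /(mem_dyadic _ _ j1) e; apply: ne.
by rewrite fsbig_set1 indicE mem_set ?mulr1//; exact/(mem_dyadic _ _ j1).
Qed.

Lemma Fdyad_normE F : Fdyad_norm eta p F =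
  Lnorm mu p (fun x => ereal_sup [set (hval F j x)%:E | j in [set j : int | -1 <= j]]).
Proof.
rewrite /Fdyad_norm; congr Lnorm; apply/funext => x; congr ereal_sup.
by apply/seteqP; split => _ [j j1 <-]; exists j => //; rewrite haar_sum.
Qed.

Let a F j m : R := cmod ((2 ^ j)%:C * haar_coef eta F j m).

Let aE F j x : hval F j x = 2 ^ j * a F j (fl (lev j) x). Proof. by []. Qed.

Lemma meas_val F j : meas (hval F j).
Proof. exact: measZ (meas_step (a F j) (lev j)). Qed.

Lemma nrmZ_pos (c : R) h : 0 < c -> meas h -> nrm p (fun x => c * h x) = (c%:E * nrm p h)%E.
Proof.
move=> c0 mh; apply/eqP; rewrite eq_le; apply/andP; split.
  have [hoo|hoo] := ltP (nrm p h) +oo%E.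
    by have := nrmZ p1 c mh hoo; rewrite gtr0_norm.
  have -> : nrm p h = +oo%E by apply/eqP; rewrite -leye_eq.
  by rewrite gt0_muley ?lte_fin// leey.
have mch : meas (fun x => c * h x) by exact: measZ.
have [hoo|hoo] := ltP (nrm p (fun x => c * h x)) +oo%E; last exact: le_trans (leey _) hoo.
have := nrmZ p1 c^-1 mch hoo.
rewrite (_ : (fun x => c^-1 * (c * h x)) = h); last by apply/funext => x; rewrite mulKf// gt_eqF.
rewrite gtr0_norm ?invr_gt0// => le.
have c0' : (0 <= c%:E)%E by rewrite lee_fin ltW.
apply: le_trans (lee_wpmul2l c0' le) _.
by rewrite muleA -EFinM divff ?mul1e// gt_eqF.
Qed.

(** The level [j] of the norm of B, with the power of 2 written with a real
    exponent; for [p = oo] the value of [fine] makes the inverse exponent 0. *)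
Definition term F j : \bar R :=
  ((2 `^ (j%:~R * (1 - (fine p)^-1)))%:E * ellp p (a F j))%E.

Lemma inv_p_bounds : 0 <= (fine p)^-1 <= 1.
Proof.
have [->|[r r1 ->]] := exponentP p1; first by rewrite /= invr0 lexx ler01.
have r0 : 0 < r by rewrite (lt_trans ltr01).
by rewrite /= invr_ge0 (ltW r0) invf_le1// ltW.
Qed.

Lemma term_nat F (J : nat) : term F J%:Z = nrm p (hval F J%:Z).
Proof.
rewrite (_ : hval F J%:Z = (fun x => 2 ^+ J * a F J%:Z (fl J x))); last by apply/funext => x.
rewrite nrmZ_pos ?exprn_gt0//; last exact: meas_step.
rewrite (step_nrm p1) muleA -EFinM /term; congr (_%:E * _)%E.
set q := (fine p)^-1.
have -> : scale J = 2 `^ (- J%:R) :> R by rewrite powR_invn.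
rewrite -powR_mulrn// -powRrM -powRD; last by rewrite pnatr_eq0 implybT.
by congr (2 `^ _); rewrite mulrBr mulr1 mulNr.
Qed.

(** At level -1 the intervals have length 1 instead of [2 ^ -j = 2]; this costs a
    factor at most 2 in one direction. *)
Lemma nrm_val_le_term F j : -1 <= j -> (nrm p (hval F j) <= term F j)%E.
Proof.
move=> /level_cases[->|[J ->]]; last by rewrite term_nat.
rewrite (_ : hval F (-1) = (fun x => 2^-1 * a F (-1) (fl 0 x))); last by apply/funext => x.
rewrite nrmZ_pos ?invr_gt0//; last exact: meas_step.
rewrite (step_nrm p1) /scale expr0 invr1 powR1 mul1e /term.
rewrite lee_wpmul2r ?ellp_ge0// lee_fin.
have /andP[q0 q1] := inv_p_bounds; rewrite -[X in X <= _]powR_inv1//.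
by apply: ler_powR; [rewrite ler1n|rewrite mulN1r lerN2 gerBl].
Qed.

Lemma term_le_nrm_val F j : -1 <= j -> (term F j <= 2%:E * nrm p (hval F j))%E.
Proof.
move=> /level_cases[->|[J ->]]; last first.
  by rewrite term_nat -[X in (X <= _)%E]mul1e lee_wpmul2r ?nrm_ge0// lee_fin ler1n.
rewrite (_ : hval F (-1) = (fun x => 2^-1 * a F (-1) (fl 0 x))); last by apply/funext => x.
rewrite nrmZ_pos ?invr_gt0//; last exact: meas_step.
rewrite (step_nrm p1) /scale expr0 invr1 powR1 mul1e /term muleA -EFinM divff//.
rewrite lee_wpmul2r ?ellp_ge0// lee_fin.
have /andP[q0 q1] := inv_p_bounds; rewrite -[X in _ <= X](powRr0 2).
by apply: ler_powR; [rewrite ler1n|rewrite mulN1r oppr_le0 subr_ge0].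
Qed.

Lemma nrm_val_le_B F j : -1 <= j -> (nrm p (hval F j) <= Bdyad_norm eta p F)%E.
Proof.
move=> j1; apply: le_trans (nrm_val_le_term F j1) _.
by apply: ereal_sup_ubound; exists j.
Qed.

Lemma Bdyad_norm_ge0 F : (0 <= Bdyad_norm eta p F)%E.
Proof. exact: le_trans (nrm_ge0 _ _) (nrm_val_le_B F (lexx (-1))). Qed.

Lemma B_le F (M : \bar R) : (forall j : int, -1 <= j -> (nrm p (hval F j) <= M)%E) ->
  (Bdyad_norm eta p F <= 2%:E * M)%E.
Proof.
move=> h; apply: ge_ereal_sup => _ [j /= j1 <-].
apply: le_trans (term_le_nrm_val F j1) _.
by rewrite lee_wpmul2l// ?lee_fin//; exact: h.
Qed.

Lemma le_Lnorm (f g : R -> \bar R) : (p < +oo)%E -> (forall x, 0 <= f x)%E -> (forall x, f x <= g x)%E ->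
  (Lnorm mu p f <= Lnorm mu p g)%E.
Proof.
move=> poo f0 fg; have [pE|[r r1 pE]] := exponentP p1; first by rewrite pE ltxx in poo.
have r0 : 0 < r by rewrite (lt_trans ltr01).
rewrite pE unlock; apply: gt0_ler_poweR.
- by rewrite invr_ge0 ltW.
- by rewrite in_itv/= leey andbT; apply: integral_ge0 => x _; exact: poweR_ge0.
- by rewrite in_itv/= leey andbT; apply: integral_ge0 => x _; exact: poweR_ge0.
apply: le_int => x; first exact: poweR_ge0.
by apply: (poweR_le r1); [exact: abse_ge0|rewrite !gee0_abs// (le_trans (f0 x))].
Qed.

Lemma B_le_F F : (p < +oo)%E -> (Bdyad_norm eta p F <= 2%:E * Fdyad_norm eta p F)%E.
Proof.
move=> poo; apply: B_le => j j1; rewrite Fdyad_normE.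
apply: (le_Lnorm poo) => x; first by rewrite lee_fin hval_ge0.
by apply: ereal_sup_ubound; exists j.
Qed.

Section OneFunction.
Variables (F : functional R) (U G : R -> R[i]).
Hypothesis w : W1rep p F U G.
Let wre := W1rep_re w.
Let wim := W1rep_im w.
Let mU := cLw_meas (W1rep_U w).
Let mG := cLw_meas (W1rep_G w).

Lemma csub_reim (a1 b1 c1 d1 : R) : (a1 +i* b1) - (c1 +i* d1) = (a1 - c1) +i* (b1 - d1).
Proof. by apply: ceq_reim; rewrite ?cReB ?cImB. Qed.

Lemma haar_coef_nat (J : nat) m : haar_coef eta F J%:Z m =
  Dif (reF U) (dy J m) (scale J.+1) +i* Dif (imF U) (dy J m) (scale J.+1).
Proof.
rewrite /haar_coef /=.
have -> : (J%:Z + 1) = J.+1%:Z by rewrite -[J.+1]addn1 PoszD.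
rewrite !dyadic_intervalE !dyS dy_half.
have s0 : (0 : R) <= scale J.+1 by rewrite ltW// scale_gt0.
by rewrite !(W1rep_pair heta p1 w) ?lerDl// csub_reim.
Qed.

Lemma haar_coef_neg m : haar_coef eta F (-1) m =
  iI (reF U) (dy 0 m) (dy 0 (m + 1)) +i* iI (imF U) (dy 0 m) (dy 0 (m + 1)).
Proof.
rewrite /haar_coef /= dyadic_interval_cell// /cell (W1rep_pair heta p1 w)//.
by rewrite dyS lerDl ltW// scale_gt0.
Qed.

Lemma cmod_scale (r : R) (z : R[i]) : 0 <= r -> cmod (r%:C * z) = r * cmod z.
Proof. by move=> r0; rewrite cmodM cmod_real ger0_norm. Qed.

Lemma val_nat (J : nat) x : hval F J%:Z x = 4 ^+ J * cmod (haar_coef eta F J%:Z (fl J x)).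
Proof.
rewrite /hval /ix /lev (cmod_scale _ (exprz_ge0 _ (ler0n R 2))) mulrA; congr (_ * _).
by rewrite -[2 ^ J%:Z]/(2 ^+ J) -exprMn; congr (_ ^+ _); ring.
Qed.

Lemma val_neg x : hval F (-1) x = 4^-1 * cmod (haar_coef eta F (-1) (fl 0 x)).
Proof.
rewrite /hval /ix /lev (cmod_scale _ (exprz_ge0 _ (ler0n R 2))) mulrA; congr (_ * _).
by rewrite (_ : 2 ^ (-1 : int) = 2^-1 :> R)// -invfM; congr (_^-1); ring.
Qed.

(** One function whose maximal function controls the coefficients of all levels,
    those of level -1 through [U] and the others through [G]. *)
Definition total x : R := n1 (U x) + n1 (G x).

Lemma Lw_total : Lw total.
Proof.
have [? ?] := W1rep_U w; have [? ?] := W1rep_G w.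
by apply: LwD; apply: LwD; exact: Lw_norm.
Qed.

Lemma total_ge0 x : 0 <= total x. Proof. by rewrite addr_ge0 ?n1_ge0. Qed.

Lemma iI2_total (f g : R -> R) a1 b1 : Lw f -> Lw g -> (forall x, `|f x| + `|g x| <= total x) ->
  iI (fun t => `|f t|) a1 b1 + iI (fun t => `|g t|) a1 b1 <= iI (fun t => `|total t|) a1 b1.
Proof.
move=> Lf Lg h; rewrite -(iID _ _ (Lw_norm Lf) (Lw_norm Lg)).
apply: le_iI; [exact: LwD (Lw_norm Lf) (Lw_norm Lg)|exact: Lw_norm Lw_total|].
by move=> x; rewrite [X in _ <= X]ger0_norm ?total_ge0//; exact: h.
Qed.

Lemma val_le_HL j x : -1 <= j -> ((hval F j x)%:E <= HL_maximal total x)%E.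
Proof.
have [LU1 LU2] := W1rep_U w; have [LG1 LG2] := W1rep_G w.
have hU y : `|reF U y| + `|imF U y| <= total y by rewrite /total lerDl n1_ge0.
have hG y : `|reF G y| + `|imF G y| <= total y by rewrite /total lerDr n1_ge0.
move=> /level_cases[->|[J ->]].
  apply: le_trans (cell_HL 0 x Lw_total); rewrite lee_fin val_neg haar_coef_neg expr0 mul1r.
  set m := fl 0 x.
  have h := iI2_total (dy 0 m) (dy 0 (m + 1)) LU1 LU2.
  have {}h := h hU.
  set z := (_ +i* _); have hz : cmod z <= `|complex.Re z| + `|complex.Im z| := cmod_n1 z.
  have h1 := norm_iI (dy 0 m) (dy 0 (m + 1)) LU1; have h2 := norm_iI (dy 0 m) (dy 0 (m + 1)) LU2.
  have {}hz : cmod z <= `|iI (reF U) (dy 0 m) (dy 0 (m + 1))| + `|iI (imF U) (dy 0 m) (dy 0 (m + 1))| := hz.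
  have {hz h1 h2}hz := le_trans (le_trans hz (lerD h1 h2)) h.
  have z0 := cmod_ge0 z.
  move: (cmod z) (iI _ _ _) z0 hz => X C X0 hz; lra.
apply: le_trans (cell_HL J x Lw_total); rewrite lee_fin val_nat haar_coef_nat.
set m := fl J x.
have h := iI2_total (dy J m) (dy J (m + 1)) LG1 LG2.
have {}h := h hG.
set z := (_ +i* _); have hz : cmod z <= `|complex.Re z| + `|complex.Im z| := cmod_n1 z.
have p40 : 0 <= 4 ^+ J :> R by rewrite exprn_ge0.
have p20 : 0 <= 2 ^+ J / 2 :> R by rewrite divr_ge0 ?exprn_ge0.
apply: le_trans (ler_wpM2l p40 hz) _; rewrite mulrDr /z /=.
have h1 := Ph_le J m wre; have h2 := Ph_le J m wim.
rewrite /Ph normrM (ger0_norm p40) in h1; rewrite /Ph normrM (ger0_norm p40) in h2.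
apply: le_trans (lerD h1 h2) _; rewrite -mulrDr.
exact: ler_wpM2l.
Qed.

Lemma W1normE : W1norm p F = (Lpnorm p U + Lpnorm p G)%E.
Proof. by rewrite /W1norm -(W1rep_NU w) -(W1rep_NG w). Qed.

Lemma nrm_total : (nrm p total <= 2%:E * W1norm p F)%E.
Proof.
rewrite W1normE.
have m1 := meas_norm mU.1; have m2 := meas_norm mU.2.
have m3 := meas_norm mG.1; have m4 := meas_norm mG.2.
apply: le_trans (nrmD p1 (measD m1 m2) (measD m3 m4)) _.
apply: le_trans (leeD (nrmD p1 m1 m2) (nrmD p1 m3 m4)) _.
rewrite !nrm_norm ge0_muleDr ?Lpnorm_ge0//.
have two (x : \bar R) : (2%:E * x = x + x)%E by rewrite -[2]/(1 + 1) EFinD ge0_muleDl ?lee_fin// !mul1e.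
rewrite !two; apply: leeD; apply: leeD.
- exact: (Re_nrm p1 mU).
- exact: (Im_nrm p1 mU).
- exact: (Re_nrm p1 mG).
- exact: (Im_nrm p1 mG).
Qed.

Lemma F_le_W1 : (Fdyad_norm eta p F <= (2 * Cmax p)%:E * W1norm p F)%E.
Proof.
rewrite Fdyad_normE.
apply: le_trans (@maximal_Lnorm _ p p1 _ 1 total ltr01 Lw_total _ _) _.
- move=> x; apply: (@le_trans _ _ (hval F (-1) x)%:E); first by rewrite lee_fin hval_ge0.
  by apply: ereal_sup_ubound; exists (-1).
- move=> x; rewrite mul1e; apply: ge_ereal_sup => _ [j /= j1 <-]; exact: val_le_HL.
rewrite mul1r mulrC EFinM -muleA lee_wpmul2l ?lee_fin ?Cmax_ge0//; exact: nrm_total.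
Qed.

(** For each level separately, so that [p = oo] is included. *)
Lemma B_le_W1 : (Bdyad_norm eta p F <= (4 * Cmax p)%:E * W1norm p F)%E.
Proof.
have h j : -1 <= j -> (nrm p (hval F j) <= (2 * Cmax p)%:E * W1norm p F)%E.
  move=> j1; apply: le_trans (@maximal_Lnorm _ p p1 (fun x => (hval F j x)%:E) 1 total ltr01 Lw_total _ _) _.
  - by move=> x; rewrite lee_fin hval_ge0.
  - by move=> x; rewrite mul1e; exact: val_le_HL.
  rewrite mul1r mulrC EFinM -muleA lee_wpmul2l ?lee_fin ?Cmax_ge0//; exact: nrm_total.
apply: le_trans (B_le h) _; rewrite muleA -EFinM mulrA.
by rewrite (_ : 2 * 2 = 4 :> R)//; ring.
Qed.

(** The derivative first, then the function: its bound uses that of the derivative.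
    The constant collects a factor 4 from the limit [- g / 4], a factor 2 from the real and
    imaginary parts, and the maximal inequality. *)
Lemma W1_le_B : (W1norm p F <= (16 + 16 * Cmax p)%:E * Bdyad_norm eta p F)%E.
Proof.
have C0 := @Cmax_ge0 R p.
have := Bdyad_norm_ge0 F; case E : (Bdyad_norm eta p F) => [b| |]// b0; last first.
  by rewrite gt0_muley ?leey// lte_fin ltr_pwDl// mulr_ge0.
rewrite lee_fin in b0.
have hv j : -1 <= j -> (nrm p (hval F j) <= b%:E)%E by rewrite -E; exact: nrm_val_le_B.
have [LU1 LU2] := W1rep_U w; have [LG1 LG2] := W1rep_G w.
have der u g : abscont u g -> (forall (J : nat) x, `|Ph u J (fl J x)| <= hval F J%:Z x) ->
    (nrm p g <= (4 * b)%:E)%E.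
  move=> hu hle; apply: (lower_deriv p1 hu) => J; apply: le_trans (hv J%:Z _) => //.
  apply: (le_nrm_all p1); [exact: meas_step|exact: meas_val|].
  by move=> x; rewrite [X in _ <= X]ger0_norm ?hval_ge0.
have fun_ u g : abscont u g -> (nrm p g <= (4 * b)%:E)%E ->
    (forall x, `|iI u (dy 0 (fl 0 x)) (dy 0 (fl 0 x + 1))| <= 4 * hval F (-1) x) ->
    (nrm p u <= (4 * b + 2 * Cmax p * (4 * b))%:E)%E.
  move=> hu hg hle; apply: (lower_fun p1 hu hg).
  apply: (@le_trans _ _ (nrm p (fun x => 4 * hval F (-1) x))).
    apply: (le_nrm_all p1); [exact: (meas_step (fun m => iI u (dy 0 m) (dy 0 (m + 1))))|apply: measZ; exact: meas_val|].
    by move=> x; rewrite [X in _ <= X](ger0_norm (mulr_ge0 (ler0n R 4) (hval_ge0 F (-1) x))).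
  by rewrite nrmZ_pos//; [rewrite EFinM lee_wpmul2l ?lee_fin ?hv//|exact: meas_val].
have v4 x : 4 * hval F (-1) x = cmod (haar_coef eta F (-1) (fl 0 x)).
  by rewrite val_neg mulrA divff// mul1r.
have g1 : (nrm p (reF G) <= (4 * b)%:E)%E.
  apply: (der _ _ wre) => J x; rewrite val_nat haar_coef_nat /Ph normrM ger0_norm ?exprn_ge0//.
  by rewrite ler_wpM2l ?exprn_ge0//; exact: (@Re_le_cmod R (_ +i* _)).
have g2 : (nrm p (imF G) <= (4 * b)%:E)%E.
  apply: (der _ _ wim) => J x; rewrite val_nat haar_coef_nat /Ph normrM ger0_norm ?exprn_ge0//.
  by rewrite ler_wpM2l ?exprn_ge0//; exact: (@Im_le_cmod R (_ +i* _)).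
have u1 := fun_ _ _ wre g1; have u2 := fun_ _ _ wim g2.
have {}u1 : (nrm p (reF U) <= (4 * b + 2 * Cmax p * (4 * b))%:E)%E.
  by apply: u1 => x; rewrite v4 haar_coef_neg; exact: (@Re_le_cmod R (_ +i* _)).
have {}u2 : (nrm p (imF U) <= (4 * b + 2 * Cmax p * (4 * b))%:E)%E.
  by apply: u2 => x; rewrite v4 haar_coef_neg; exact: (@Im_le_cmod R (_ +i* _)).
rewrite W1normE; apply: le_trans (leeD (Lpnorm_reim p1 mU) (Lpnorm_reim p1 mG)) _.
apply: le_trans (leeD (leeD u1 u2) (leeD g1 g2)) _.
rewrite -!EFinD -EFinM lee_fin le_eqVlt; apply/orP; left; apply/eqP; ring.
Qed.

End OneFunction.

End HaarNorms.

(** * Limits of fast Cauchy sequences, and an indicator function *)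

Section Completeness.
Context {R : realType}.
Notation mu := (@lebesgue_measure R).

(** Monotone convergence: an L^1 summable series of nonnegative functions is finite
    almost everywhere, and its sum serves as dominating function.  The set [E] is
    explicit so that the sequence can be cut to 0 off it and converge everywhere. *)
Lemma summable_dominates (d : nat -> R -> R) (C : R) :
  (forall k, Lw (d k)) -> (forall k x, 0 <= d k x) ->
  (forall n, \sum_(0 <= k < n) intR (fun x => wt x * d k x) <= C) ->
  exists Q, exists E : set R, [/\ Lw Q, measurable E, {ae mu, forall x, E x},
    forall x, 0 <= Q x & forall x n, E x -> series (d ^~ x) n <= Q x].
Proof.
move=> Ld d0 hC.
pose T n x := series (fun k => wt x * d k x) n.
have T0 n x : 0 <= T n x by apply: sumr_ge0 => k _; rewrite mulr_ge0 ?wt_ge0.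
have IT n : integ (T n) /\ intR (T n) = \sum_(0 <= k < n) intR (fun x => wt x * d k x).
  elim: n => [|n [I1 I2]].
    rewrite big_geq//; split.
      by have := @integ0 R; congr integ; apply/funext => x; rewrite /T /series/= big_geq.
    by rewrite -[RHS](@intR_cst0 R); congr intR; apply/funext => x; rewrite /T /series/= big_geq.
  have E : T n.+1 = (fun x => T n x + wt x * d n x).
    by apply/funext => x; rewrite /T /series/= big_nat_recr.
  rewrite E; split; first exact: integD I1 (Ld n).2.
  by rewrite (intRD I1 (Ld n).2) I2 big_nat_recr.
pose S x := limn (fun n => (T n x)%:E).
have ndT x : nondecreasing_seq (fun n => (T n x)%:E).
  apply/nondecreasing_seqP => n; rewrite lee_fin /T /series/= big_nat_recr//= lerDl.
  by rewrite mulr_ge0 ?wt_ge0.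
have cT x := ereal_nondecreasing_is_cvgn (ndT x).
have TS n x : ((T n x)%:E <= S x)%E.
  by apply: lime_ge => //; exists n => // m /= nm; exact: ndT.
have mT n : measurable_fun setT (fun x => (T n x)%:E) by apply/measurable_EFinP; exact: integ_meas (IT n).1.
have mS : measurable_fun setT S.
  by apply: (emeasurable_fun_cvg (fun n x => (T n x)%:E)) => // x _; exact: cT.
have S0 x : (0 <= S x)%E by apply: le_trans (TS 0%N x); rewrite lee_fin.
have IS : (\int[mu]_x S x <= C%:E)%E.
  rewrite /S monotone_convergence//.
  - apply: lime_le.
      apply: ereal_nondecreasing_is_cvgn => m n mn; apply: le_int => x; first by rewrite lee_fin.
      exact: ndT.
    by apply: nearW => n; rewrite (intRE (IT n).1) lee_fin (IT n).2.
  - by move=> n x _; rewrite lee_fin.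
have intS : mu.-integrable setT S.
  apply/integrableP; split => //; apply: le_lt_trans (ltry C); apply: le_trans IS.
  by apply: le_int => x; [exact: abse_ge0|rewrite gee0_abs].
pose E := [set x | S x \is a fin_num].
have mE : measurable E.
  rewrite (_ : E = [set x | (S x < +oo)%E]); last by apply/seteqP; split => x /=; rewrite /E/= ge0_fin_numE.
  by rewrite -[X in measurable X]setTI; exact: emeasurable_fun_infty_o.
have aeE : {ae mu, forall x, E x}.
  by have := integrable_ae measurableT intS; apply: aeS => x; apply.
have mfS : meas (fun x => fine (S x)) by exact: (measurableT_comp (fine_measurable measurableT) mS).
have IfS : integ (fun x => fine (S x)).
  apply: integP => //; apply: le_lt_trans (ltry C); apply: le_trans IS.
  apply: le_int => x; first by rewrite lee_fin.
  rewrite ger0_norm ?fine_ge0//; case E' : (S x) (S0 x) => [s| |]//= _; by rewrite ?leey.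
exists (fun x => fine (S x) * (1 + x ^+ 2)), E; split => //.
- split; first by apply: measM => //; exact: meas_onePsqr.
  move: IfS; congr integ; apply/funext => x.
  by rewrite mulrC -mulrA /wt divff ?mulr1// gt_eqF// oneDsqr_gt0'.
- by move=> x; rewrite mulr_ge0 ?fine_ge0// ltW// oneDsqr_gt0'.
- move=> x n Ex; have := TS n x; rewrite -(fineK Ex) lee_fin /T => h.
  rewrite -ler_pdivrMr ?oneDsqr_gt0'//; apply: le_trans h; rewrite le_eqVlt; apply/orP; left; apply/eqP.
  by rewrite mulrC /series/= mulr_sumr.
Qed.

Variable p : \bar R.
Hypothesis p1 : (1 < p)%E.

(** Young's inequality in the form [t <= 1 + t ^ r], rescaled by [s].  The weighted L^1
    norm is thus linear in [s], and the same argument serves all exponents. *)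
Lemma nrm_L1wt (h : R -> R) (s : R) : 0 < s -> meas h -> (nrm p h <= s%:E)%E ->
  intR (fun x => wt x * `|h x|) <= s * (pi + 1).
Proof.
move=> s0 mh hs.
have Lh : Lw h by apply: (nrm_Lw p1) => //; exact: le_lt_trans hs (ltry s).
have Ih := (Lw_norm Lh).2.
have [pE|[r r1 pE]] := exponentP p1.
  have hB := (nrm_oo_le s pE mh).1 hs.
  apply: (@le_trans _ _ (s * pi)); last by rewrite ler_pM2l// lerDl.
  rewrite -(@intR_wt R) -(intRZ _ (@integ_wt R)).
  rewrite -lee_fin -(intRE Ih) -(intRE (integZ s (@integ_wt R))).
  apply: ae_ge0_le_integral; [exact: measurableT|by move=> x _; rewrite lee_fin mulr_ge0 ?wt_ge0|
    apply/measurable_EFinP; exact: integ_meas Ih|by move=> x _; rewrite lee_fin mulr_ge0 ?wt_ge0// ltW|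
    apply/measurable_EFinP; exact: integ_meas (integZ s (@integ_wt R))|].
  by apply: aeS hB => x h1 _; rewrite lee_fin mulrC ler_wpM2r ?wt_ge0.
have r0 : 0 < r by rewrite (lt_trans ltr01).
have Ir := integ_powR pE r1 mh (le_lt_trans hs (ltry s)).
have hr : intR (fun x => `|h x| `^ r) <= s `^ r.
  rewrite -lee_fin -(intRE Ir).
  have I0 : (0 <= \int[mu]_x (`|h x| `^ r)%:E)%E by apply: integral_ge0 => x _; rewrite lee_fin powR_ge0.
  have -> : (\int[mu]_x (`|h x| `^ r)%:E = nrm p h `^ r)%E.
    by rewrite (nrm_fin _ pE) -poweRrM mulVf ?gt_eqF// poweRe1.
  by rewrite -poweR_EFin; apply: poweR_le => //; exact: nrm_ge0.
have sr : 0 < s `^ r by exact: powR_gt0.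
pose c := s * (s `^ r)^-1.
have Ib := integD (integZ s (@integ_wt R)) (integZ c Ir).
apply: (@le_trans _ _ (intR (fun x => s * wt x + c * `|h x| `^ r))).
  apply: le_intR => // x.
  have t0 : 0 <= `|h x| / s by rewrite divr_ge0// ltW.
  have h1 := le1D_powR r1 t0.
  rewrite (powRM _ (normr_ge0 _)) ?invr_ge0 ?(ltW s0)// in h1.
  have e : s^-1 `^ r = (s `^ r)^-1 by rewrite -[s^-1]powR_inv1 ?(ltW s0)// -powRrM mulN1r powRN.
  rewrite e ler_pdivrMr// in h1.
  have w0 := wt_ge0 x; have w1 := wt_le1 x.
  apply: le_trans (ler_wpM2l w0 h1) _.
  have -> : wt x * ((1 + `|h x| `^ r * (s `^ r)^-1) * s) = s * wt x + wt x * (c * `|h x| `^ r) by rewrite /c; ring.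
  by rewrite lerD2l ler_piMl// mulr_ge0 ?powR_ge0// /c divr_ge0 ?powR_ge0// ltW.
rewrite (intRD (integZ s (@integ_wt R)) (integZ c Ir)) (intRZ _ (@integ_wt R)) (intRZ _ Ir) intR_wt (mulrDr s pi 1) mulr1.
rewrite lerD2l /c -mulrA ler_piMr ?(ltW s0)// mulrC ler_pdivrMr ?mul1r//.
Qed.

(** A sequence with increments summable in L^p converges almost everywhere under a
    common majorant integrable against the weight; Fatou gives the norm of the limit, and domination
    the convergence of all the integrals against test functions and intervals. *)
Lemma limit_function (h : nat -> R -> R) (B K : R) : 0 < K ->
  (forall n, meas (h n)) -> (forall n, nrm p (h n) <= B%:E)%E ->
  (forall n, nrm p (fun x => h n.+1 x - h n x)%R <= (K * scale n)%:E)%E ->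
  exists k, [/\ Lw k, (nrm p k <= B%:E)%E,
    (forall w, rschwartz w -> intR (fun x => h n x * w x) @[n --> \oo] --> intR (fun x => k x * w x)) &
    (forall a b, iI (h n) a b @[n --> \oo] --> iI k a b)].
Proof.
move=> K0 mh hB hd.
have Lh n : Lw (h n) by apply: (nrm_Lw p1) => //; exact: le_lt_trans (hB n) (ltry B).
pose d k x := if k is k'.+1 then `|h k'.+1 x - h k' x| else `|h 0%N x|.
have Lhd n : Lw (fun x => h n.+1 x - h n x).
  by have := LwD (Lh n.+1) (LwZ (-1) (Lh n)); congr Lw; apply/funext => x; rewrite mulN1r.
have Ld k : Lw (d k) by case: k => [|k]; [exact: Lw_norm (Lh 0%N)|exact: Lw_norm (Lhd k)].
have d0 k x : 0 <= d k x by case: k => [|k]; exact: normr_ge0.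
pose c0 := intR (fun x => wt x * `|h 0%N x|).
pose A := K * (pi + 1).
have A0 : 0 <= A by rewrite mulr_ge0 ?(ltW K0)// addr_ge0// ltW// pi_gt0.
have bd n : \sum_(0 <= k < n.+1) intR (fun x => wt x * d k x) <= c0 + A * (2 - 2 * scale n).
  elim: n => [|n IH]; first by rewrite big_nat1 /scale expr0 invr1 mulr1 subrr mulr0 addr0.
  rewrite big_nat_recr//=; apply: le_trans (lerD IH (lexx _)) _.
  have s0 : 0 < K * scale n by rewrite mulr_gt0// scale_gt0.
  have := nrm_L1wt s0 (Lhd n).1 (hd n); rewrite scaleS.
  have -> : K * scale n * (pi + 1) = A * scale n by rewrite /A; ring.
  move: (intR _) => X; lra.
have hC n : \sum_(0 <= k < n) intR (fun x => wt x * d k x) <= c0 + A * 2.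
  have c00 : 0 <= c0 by apply: intR_ge0 => x; rewrite mulr_ge0 ?wt_ge0.
  case: n => [|n]; first by rewrite big_geq// addr_ge0// mulr_ge0.
  by apply: le_trans (bd n) _; rewrite lerD2l ler_wpM2l// lerBlDr lerDl mulr_ge0// ltW// scale_gt0.
(* Replacing the functions by 0 off E makes convergence and domination hold
   everywhere without changing the integrals. *)
have [Q [E [LQ mE aeE Q0 hQ]]] := summable_dominates Ld d0 hC.
pose h' n x := h n x * \1_E x.
have ind x : \1_E x = 1 :> R \/ \1_E x = 0 :> R by rewrite indicE; case: (x \in E); [left|right].
have hh' n : {ae mu, forall x, h n x = h' n x}.
  by apply: aeS aeE => x Ex; rewrite /h' indicE mem_set// mulr1.
have mh' n : meas (h' n) by apply: measM => //; exact: meas_indic.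
have hsum x n : `|h n x| <= series (d ^~ x) n.+1.
  elim: n => [|n IH]; first by rewrite /series/= big_nat1.
  rewrite /series/= big_nat_recr//=.
  have e : h n.+1 x = h n x + (h n.+1 x - h n x) by rewrite addrC subrK.
  rewrite {1}e; apply: le_trans (ler_normD _ _) _; apply: lerD; [exact: IH|exact: lexx].
have h'Q n x : `|h' n x| <= Q x.
  rewrite /h' indicE; have [xE|xE] := boolP (x \in E); last by rewrite mulr0 normr0.
  by rewrite mulr1; apply: le_trans (hsum x n) _; apply: hQ; exact: set_mem.
have cvh' x : cvgn (fun n => h' n x).
  rewrite /h' indicE; have [xE|xE] := boolP (x \in E); last first.
    by rewrite (_ : (fun n => _) = (fun=> 0)); [exact: is_cvg_cst|apply/funext => n; rewrite mulr0].
  rewrite (_ : (fun n => _) = (fun n => h 0%N x + series (fun k => h k.+1 x - h k x) n)); last first.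
    apply/funext => n; rewrite mulr1 /series/=; elim: n => [|n IH]; first by rewrite big_geq ?addr0.
    by rewrite big_nat_recr//= addrA -IH addrC subrK.
  apply: is_cvgD; first exact: is_cvg_cst.
  apply: (@series_norm_cvg _ _ (fun k => d k.+1 x)) => [k|]; first by [].
  apply: nondecreasing_is_cvgn; first by apply: nondecreasing_series.
  exists (Q x) => _ [n _ <-]; apply: le_trans (hQ x n.+1 (set_mem xE)).
  by rewrite /series/= [leRHS]big_nat_recl//= lerDr.
pose k x := limn (fun n => h' n x).
have ck x : h' n x @[n --> \oo] --> k x by exact: cvh'.
have mk : meas k by apply: (@measurable_fun_cvg _ _ _ setT h') => // x _; exact: ck.
have kQ x : `|k x| <= Q x.
  have c : `|h' n x| @[n --> \oo] --> `|k x| by apply: cvg_norm; exact: ck.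
  by apply: (cvgr_to_le c); apply: nearW.
have conv (w : R -> R) : meas w -> integ (fun x => Q x * w x) ->
    intR (fun x => h n x * w x) @[n --> \oo] --> intR (fun x => k x * w x).
  move=> mw IQw.
  have E1 n : intR (fun x => h n x * w x) = intR (fun x => h' n x * w x).
    by apply: intR_ae; [exact: measM|exact: measM|apply: aeS (hh' n) => x ->].
  rewrite (funext E1 : (fun n => _) = _).
  apply: (cvg_intR _ (integ_norm IQw)).
  - by move=> n; exact: measM.
  - by move=> x; apply: cvgMl; exact: ck.
  - by move=> n x; rewrite normrM (normrM (Q x)) (ger0_norm (Q0 x)); apply: ler_wpM2r; [exact: normr_ge0|exact: h'Q].
exists k; split.
- exact: (Lw_dom mk LQ kQ).
- apply: (nrm_fatou p1 mh mk _ hB); apply: aeS (aeI aeE (ae_forall hh')) => x [_ e].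
  by rewrite (_ : (fun n => h n x) = (fun n => h' n x)); [exact: ck|apply/funext => n; exact: e].
- move=> w sw; apply: conv; [exact: rschwartz_meas|exact: Lw_rschwartz].
- move=> a b; apply: conv; last exact: integ_iI.
  by apply: meas_indic; exact: measurable_itv.
Qed.

End Completeness.

Section Example.
Context {R : realType}.
Notation mu := (@lebesgue_measure R).
Variable eta : R -> R[i].
Hypothesis heta : lp_cutoff eta.
Variable p : \bar R.
Hypothesis p1 : (1 < p)%E.

Definition ind01 (x : R) : R := \1_(`[0, 1[%classic) x.

Lemma eq_iI (f g : R -> R) a b : (forall x, a <= x < b -> f x = g x) -> iI f a b = iI g a b.
Proof.
move=> h; rewrite /iI; congr intR; apply/funext => x; rewrite indic_itv.
by case: (boolP (_ && _)) => [/h ->|_]; rewrite ?mulr0.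
Qed.

(** The indicator function of the unit interval is constant on every dyadic interval of level at least 0, since
    0 and 1 are end points of such intervals. *)
Lemma ind01_cell J x : ind01 x = ind01 (dy J (fl J x)).
Proof.
rewrite /ind01 !indic_itv; set m := fl J x.
have h1 := fl_le J x; have h2 := fl_lt J x; rewrite -/m in h1 h2.
have s0 := @scale_gt0 R J; have sE := @scaleE R J.
congr (_%:R); congr nat_of_bool; congr (_ && _).
  apply/idP/idP => [x0|]; last by move=> d0; exact: le_trans h1.
  have := le_lt_trans x0 h2; rewrite !dyE pmulr_rgt0// ltr0z ltzD1 => m0.
  by rewrite mulr_ge0 ?(ltW s0)// ler0z.
apply/idP/idP => [x1|]; first exact: le_lt_trans h1 x1.
rewrite dyE => d1; apply: lt_le_trans h2 _; rewrite dyE.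
have e1 : 1 = scale J * ((2 : int) ^+ J)%:~R :> R by rewrite rmorphXn /= sE.
rewrite [X in _ < X]e1 ltr_pM2l// ltr_int in d1.
by rewrite [X in _ <= X]e1 ler_pM2l// ler_int lezD1.
Qed.

Lemma ind01_iI J m a b : dy J m <= a -> a <= b -> b <= dy J (m + 1) ->
  iI ind01 a b = ind01 (dy J m) * (b - a).
Proof.
move=> ma ab bm; rewrite -(iI_cst _ ab); apply: eq_iI => x /andP[ax xb].
rewrite (ind01_cell J x); congr (ind01 (dy J _)); apply/eqP; rewrite -flP.
by rewrite (le_trans ma ax) (lt_le_trans xb bm).
Qed.

Lemma ind01_Dif J m : Dif ind01 (dy J m) (scale J.+1) = 0.
Proof.
have s0 : (0 : R) <= scale J.+1 by rewrite ltW// scale_gt0.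
have e : dy J (m + 1) = dy J m + scale J.+1 + scale J.+1 :> R by rewrite dyS [in LHS]scale2 addrA.
rewrite /Dif !(@ind01_iI J m) ?e ?lerDl ?lexx//; first by ring.
Qed.

Definition F01 : functional R := dist_of_fun (fun x => (ind01 x)%:C).

Lemma meas_ind01 : cmeasurable (fun x => (ind01 x)%:C).
Proof. by apply: meas_real; apply: meas_indic; exact: measurable_itv. Qed.

Lemma ind01_bnd x : cmod (ind01 x)%:C <= 1.
Proof. by rewrite cmod_real; exact: indic_bnd. Qed.

Lemma cLw_ind01 : cLw (fun x => (ind01 x)%:C).
Proof. exact: cLw_bounded meas_ind01 ind01_bnd. Qed.

Lemma refB_F01 : refB eta F01.
Proof. by apply: (@refB_fun _ _ heta _ 1 meas_ind01); apply: aeW; exact: ind01_bnd. Qed.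

Lemma pair_F01 a b : a <= b -> pair_indic eta F01 `[a, b[%classic = (iI ind01 a b)%:C.
Proof.
move=> ab; rewrite (pair_indic_fun heta cLw_ind01 refB_F01 ab); apply: ceq_reim => //=.
by rewrite -(@intR_cst0 R); congr intR; apply/funext => x; rewrite /imF/= mul0r.
Qed.

Lemma haar_F01_nat (J : nat) m : haar_coef eta F01 J%:Z m = 0.
Proof.
rewrite /haar_coef /=.
have -> : (J%:Z + 1) = J.+1%:Z by rewrite -[J.+1]addn1 PoszD.
rewrite !dyadic_intervalE !dyS dy_half.
have s0 : (0 : R) <= scale J.+1 by rewrite ltW// scale_gt0.
rewrite !pair_F01 ?lerDl//; apply: ceq_reim; last by rewrite cImB/= subrr.
by rewrite cReB /= -/(Dif _ _ _) ind01_Dif.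
Qed.

Lemma haar_F01_neg m : haar_coef eta F01 (-1) m = (ind01 (dy 0 m))%:C.
Proof.
rewrite /haar_coef /= dyadic_interval_cell// /cell.
have s0 : (0 : R) < scale 0 := scale_gt0 0.
have ab : dy 0 m <= dy 0 (m + 1) :> R by rewrite dyS lerDl ltW.
rewrite (pair_F01 ab) (@ind01_iI 0 m)//; congr (_%:C).
by rewrite dyS /scale expr0 invr1 (addrC _ 1) addrK mulr1.
Qed.

Lemma F01_Bdyad : Bdyad eta p F01.
Proof.
split; first exact: refB_F01.
have m01 : meas ind01 by apply: meas_indic; exact: measurable_itv.
have n01 : (nrm p ind01 < +oo)%E.
  have [pE|[r r1 pE]] := exponentP p1.
    apply: le_lt_trans (ltry 1); apply/(nrm_oo_le _ pE m01); apply: aeW => x; exact: indic_bnd.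
  have r0 : r != 0 by rewrite gt_eqF// (lt_trans ltr01).
  rewrite (nrm_fin _ pE); apply: poweR_lty.
  rewrite (_ : (fun x => _) = (fun x => (\1_(`[0, 1[%classic) x)%:E)); last first.
    apply/funext => x; rewrite /ind01 indicE; case: (_ \in _); first by rewrite normr1 powR1.
    by rewrite normr0 powR0.
  by rewrite int_indic ?lebesgue_measure_itv/= ?lte01 ?ltry//; case: ifP => // _; rewrite ltry.
have h (j : int) : -1 <= j -> (nrm p (hval eta F01 j) <= nrm p ind01)%E.
  move=> /level_cases[->|[J ->]].
    apply: (le_nrm_all p1); [exact: meas_val|exact: m01|move=> x].
    rewrite ger0_norm ?hval_ge0// /hval haar_F01_neg -[ix (-1) x]/(fl 0 x) -ind01_cell.
    rewrite cmod_scale ?exprz_ge0// cmod_real mulrA (_ : 2 ^ (-1 : int) = 2^-1 :> R)//.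
    by rewrite ler_piMl// -invfM invf_le1 ?mulr_gt0//; lra.
  apply: (le_nrm_all p1); [exact: meas_val|exact: m01|move=> x].
  by rewrite /hval haar_F01_nat mulr0 -[0]/(0%:C) cmod_real normr0 mulr0 normr0.
apply: le_lt_trans (B_le p1 h) _.
by apply: lte_mul_pinfty.
Qed.

(** All coefficients of levels at least 0 vanish, hence so does the derivative of a
    representative, by the convergence at Lebesgue points.  The representative is
    then constant, but the indicator function has different means over [[0, 1[] and [[1, 2[]. *)
Lemma F01_notin : ~ W1 p F01.
Proof.
move=> hW; have [U [G w]] := W1_rep heta p1 hW.
have [Lu Lg hu] := W1rep_re w.
have Ph0 J m : Ph (reF U) J m = 0.
  have := haar_coef_nat heta p1 w J m; rewrite haar_F01_nat => e.
  have := congr1 (fun z => complex.Re z) e; rewrite /= => e'.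
  by rewrite /Ph -e' mulr0.
have g0 : {ae mu, forall x, reF G x = 0}.
  apply: aeS (lebesgue_differentiation (Lw_locally_integrable Lg)) => x px.
  have c := Ph_cvg (W1rep_re w) px.
  have c0 : Ph (reF U) n (fl n x) @[n --> \oo] --> (0 : R).
    by rewrite (_ : (fun n => _) = (fun=> 0)); [exact: cvg_cst|apply/funext => n; exact: Ph0].
  by have := cvgR_unique c c0; lra.
(* The representative is constant, being the integral of a null function. *)
have uc a b : a <= b -> reF U b = reF U a.
  move=> ab; apply/eqP; rewrite -subr_eq0 (hu _ _ ab); apply/eqP.
  rewrite -(@intR_cst0 R); apply: intR_ae; first exact: integ_meas (integ_iI a b Lg).
    exact: meas_cst.
  by apply: aeS g0 => x ->; rewrite mul0r.
have e01 := reps_ae_eq heta cLw_ind01 (W1rep_U w) (W1rep_FU w).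
have val_iI a b : a <= b -> iI ind01 a b = iI (reF U) a b.
  move=> ab; apply: intR_ae; first exact: integ_meas (integ_iI a b cLw_ind01.1).
    exact: integ_meas (integ_iI a b Lu).
  by apply: aeS e01 => x e; rewrite /reF -e.
have uC a b : 0 <= a -> a <= b -> iI (reF U) a b = reF U 0 * (b - a).
  move=> a0 ab; rewrite -(iI_cst _ ab); apply: eq_iI => x /andP[ax _].
  by apply: uc; exact: le_trans ax.
have d0 : dy 0 0 = 0 :> R by rewrite dyE mulr0.
have d1 : dy 0 1 = 1 :> R by rewrite dyE /scale expr0 invr1 mul1r.
have d2 : dy 0 (1 + 1) = 2 :> R by rewrite dyE /scale expr0 invr1 mul1r.
have h1 : iI ind01 0 1 = 1.
  rewrite (@ind01_iI 0 0) ?d0 ?d1// subr0 mulr1 /ind01 indic_itv lexx ltr01 //.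
have h2 : iI ind01 1 2 = 0.
  rewrite (@ind01_iI 0 1) ?d1 ?d2//; last by lra.
  by rewrite /ind01 indic_itv ltxx andbF mul0r.
rewrite val_iI ?uC// in h1; rewrite val_iI ?uC// in h2; [lra|lra|lra].
Qed.

End Example.

(** * Closedness and the norm equivalences *)

Section Closedness.
Context {R : realType}.
Notation mu := (@lebesgue_measure R).
Variable eta : R -> R[i].
Hypothesis heta : lp_cutoff eta.
Variable p : \bar R.
Hypothesis p1 : (1 < p)%E.

Lemma le_ellp (a : int -> R) m : (`|a m|%:E <= ellp p a)%E.
Proof.
have [->|[r r1 ->]] := exponentP p1; first by apply: ereal_sup_ubound; exists m.
have r0 : 0 < r by rewrite (lt_trans ltr01).
have -> : (`|a m|%:E = (`|a m| `^ r)%:E `^ r^-1)%E by rewrite poweR_EFin -powRrM mulfV ?gt_eqF// powRr1.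
apply: gt0_ler_poweR.
- by rewrite invr_ge0 ltW.
- by rewrite in_itv/= leey andbT lee_fin powR_ge0.
- by rewrite in_itv/= leey andbT; apply: esum_ge0 => i _; rewrite lee_fin powR_ge0.
apply: esum_ge; exists [set m]; last by rewrite fsbig_set1.
by split => //; exact: finite_set1.
Qed.

Lemma haar_coef_bound j m : -1 <= j -> exists2 k : R, 0 < k & forall (H : functional R) (s : R),
  (nrm p (hval eta H j) <= s%:E)%E -> k * cmod (haar_coef eta H j m) <= s.
Proof.
move=> j1; have t0 : 0 < 2 ^ j :> R by rewrite exprz_gt0.
have c0 : 0 < scale (lev j) `^ (fine p)^-1 :> R by rewrite powR_gt0// scale_gt0.
exists (2 ^ j * (scale (lev j) `^ (fine p)^-1 * 2 ^ j)); first by rewrite !mulr_gt0.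
move=> H s.
pose a m := cmod ((2 ^ j)%:C * haar_coef eta H j m).
have -> : hval eta H j = (fun x => 2 ^ j * a (fl (lev j) x)) by [].
rewrite (nrmZ_pos p1 t0 (meas_step a (lev j))) (step_nrm p1) => h.
have h2 : ((2 ^ j * (scale (lev j) `^ (fine p)^-1 * a m))%:E <= s%:E)%E.
  apply: le_trans h; rewrite EFinM lee_wpmul2l ?lee_fin ?(ltW t0)//.
  rewrite EFinM lee_wpmul2l ?lee_fin ?(ltW c0)//.
  by have := le_ellp a m; rewrite ger0_norm// cmod_ge0.
by move: h2; rewrite lee_fin /a (cmod_scale _ (ltW t0)) !mulrA.
Qed.

Lemma Re_dist (f : R -> R[i]) phi : cLw f -> schwartz phi ->
  complex.Re (dist_of_fun f phi) = intR (fun x => reF f x * reF phi x) - intR (fun x => imF f x * imF phi x).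
Proof.
move=> [f1 f2] sp; rewrite (dist_of_funE _ sp) cintE /=.
rewrite -(intRB (Lw_rschwartz f1 (schwartz_re sp)) (Lw_rschwartz f2 (schwartz_im sp))).
by congr intR; apply/funext => x; rewrite /reF cReM.
Qed.

Lemma Im_dist (f : R -> R[i]) phi : cLw f -> schwartz phi ->
  complex.Im (dist_of_fun f phi) = intR (fun x => reF f x * imF phi x) + intR (fun x => imF f x * reF phi x).
Proof.
move=> [f1 f2] sp; rewrite (dist_of_funE _ sp) cintE /=.
rewrite -(intRD (Lw_rschwartz f1 (schwartz_im sp)) (Lw_rschwartz f2 (schwartz_re sp))).
by congr intR; apply/funext => x; rewrite /imF cImM.
Qed.

Definition weak_cvg (h : nat -> R -> R) (k : R -> R) := forall w, rschwartz w ->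
  intR (fun x => h n x * w x) @[n --> \oo] --> intR (fun x => k x * w x).

Lemma dist_cvg (f_ : nat -> R -> R[i]) f phi : (forall n, cLw (f_ n)) -> cLw f ->
  weak_cvg (fun n => reF (f_ n)) (reF f) -> weak_cvg (fun n => imF (f_ n)) (imF f) -> schwartz phi ->
  (complex.Re (dist_of_fun (f_ n) phi) @[n --> \oo] --> complex.Re (dist_of_fun f phi)) /\
  (complex.Im (dist_of_fun (f_ n) phi) @[n --> \oo] --> complex.Im (dist_of_fun f phi)).
Proof.
move=> L_ Lf c1 c2 sp; have sr := schwartz_re sp; have si := schwartz_im sp; split.
  rewrite (Re_dist Lf sp) (funext (fun n => Re_dist (L_ n) sp) : (fun n => _) = _).
  by apply: cvgB; [exact: c1|exact: c2].
rewrite (Im_dist Lf sp) (funext (fun n => Im_dist (L_ n) sp) : (fun n => _) = _).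
by apply: cvgD; [exact: c1|exact: c2].
Qed.

Lemma cmodN (z : R[i]) : cmod (- z) = cmod z.
Proof. by case: z => a b; rewrite /cmod/= !sqrrN. Qed.

Lemma hval_tri (F G H : functional R) j x : refB eta F -> refB eta G -> refB eta H ->
  (forall phi, schwartz phi -> H phi = F phi - G phi) -> hval eta H j x <= hval eta F j x + hval eta G j x.
Proof.
move=> hF hG hH e; rewrite /hval (haar_coefB heta j _ hF hG hH e) -mulrDr ler_wpM2l ?exprz_ge0//.
rewrite mulrBr; apply: le_trans (normc_triangle _ _) _.
by rewrite lerD2l cmodN.
Qed.

Lemma nrm_hval_tri (F G H : functional R) j : refB eta F -> refB eta G -> refB eta H ->
  (forall phi, schwartz phi -> H phi = F phi - G phi) ->
  (nrm p (hval eta H j) <= nrm p (hval eta F j) + nrm p (hval eta G j))%E.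
Proof.
move=> hF hG hH e; apply: le_trans (nrmD p1 (meas_val _ _ _) (meas_val _ _ _)).
apply: (le_nrm_all p1); [exact: meas_val|by apply: measD; exact: meas_val|].
by move=> x; rewrite !ger0_norm ?addr_ge0 ?hval_ge0//; exact: hval_tri.
Qed.

Lemma W1_refB (F : functional R) : W1 p F -> refB eta F.
Proof. by move=> hW; have [U [G w]] := W1_rep heta p1 hW; exact: (W1rep_refB heta p1 w). Qed.

Lemma cvg_squeeze0 (u v : nat -> R) : (forall n, `|u n| <= v n) -> v @ \oo --> (0 : R) -> u @ \oo --> (0 : R).
Proof.
move=> uv v0; apply: norm_cvg0; apply: (@squeeze_cvgr _ _ _ _ (cst 0) v) => //; last exact: cvg_cst.
by apply: nearW => n; rewrite normr_ge0 uv.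
Qed.

Lemma reim_cvgB (a b : nat -> R[i]) (x y : R[i]) :
  (complex.Re (a n) @[n --> \oo] --> complex.Re x) /\ (complex.Im (a n) @[n --> \oo] --> complex.Im x) ->
  (complex.Re (b n) @[n --> \oo] --> complex.Re y) /\ (complex.Im (b n) @[n --> \oo] --> complex.Im y) ->
  (complex.Re (a n - b n) @[n --> \oo] --> complex.Re (x - y)) /\
  (complex.Im (a n - b n) @[n --> \oo] --> complex.Im (x - y)).
Proof.
move=> [a1 a2] [b1 b2]; rewrite cReB cImB; split.
  by rewrite (funext (fun n => cReB (a n) (b n)) : (fun n => _) = _); exact: cvgB.
by rewrite (funext (fun n => cImB (a n) (b n)) : (fun n => _) = _); exact: cvgB.
Qed.

(** Choose [g n] in the Sobolev space within [2 ^ -n] of [F].  The lower bound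
    applied to consecutive differences makes the representatives and their
    derivatives converge fast, so limits [U'] and [G'] exist and define an element
    [F'] of the Sobolev space.  The Haar coefficients of [g n] converge to those of
    [F'] by convergence of the integrals, and to those of [F] by convergence in
    norm. *)
Lemma W1_closed : closed_wrt (Bdyad_norm eta p) (Bdyad eta p) (W1 p).
Proof.
move=> F [hF BF] happ.
have [b bE] : exists b : R, Bdyad_norm eta p F = b%:E.
  by exists (fine (Bdyad_norm eta p F)); rewrite fineK// ge0_fin_numE// (Bdyad_norm_ge0 eta p1).
have b0 : 0 <= b by rewrite -lee_fin -bE (Bdyad_norm_ge0 eta p1).
have [g hg] : exists g : nat -> functional R, forall n, W1 p (g n) /\ (Bdyad_norm eta p (g n \- F)%R < (scale n)%:E)%E.
  have h n : exists T, W1 p T /\ (Bdyad_norm eta p (T \- F)%R < (scale n)%:E)%E.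
    by have [T hT bT] := happ _ (@scale_gt0 R n); exists T.
  by have [f hf] := choice h; exists f.
have [UG w] : exists UG : nat -> (R -> R[i]) * (R -> R[i]), forall n, W1rep p (g n) (UG n).1 (UG n).2.
  have h n : exists T : (R -> R[i]) * (R -> R[i]), W1rep p (g n) T.1 T.2.
    by have [U [G wn]] := W1_rep heta p1 (hg n).1; exists (U, G).
  by have [f hf] := choice h; exists f.
have gB n := W1_refB (hg n).1.
have dB n : refB eta (g n \- F)%R by exact: (refB_sub heta (gB n) hF).
have sm n j : -1 <= j -> (nrm p (hval eta (g n \- F)%R j) <= (scale n)%:E)%E.
  by move=> j1; apply: le_trans (nrm_val_le_B eta p1 _ j1) _; exact: ltW (hg n).2.
pose C1 := 16 + 16 * Cmax p.
have C10 : 0 < C1 by rewrite ltr_pwDl// mulr_ge0// Cmax_ge0.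
have gbd n : (W1norm p (g n) <= (C1 * (2 * (1 + b)))%:E)%E.
  apply: le_trans (W1_le_B heta p1 (w n)) _; rewrite EFinM lee_wpmul2l ?lee_fin ?(ltW C10)//.
  rewrite EFinM; apply: (B_le p1) => j j1.
  have mg : (nrm p (hval eta (g n) j) <= nrm p (hval eta (g n \- F)%R j) + nrm p (hval eta F j))%E.
    apply: le_trans (nrmD p1 (meas_val _ _ _) (meas_val _ _ _)).
    apply: (le_nrm_all p1); [exact: meas_val|by apply: measD; exact: meas_val|].
    move=> x; rewrite !ger0_norm ?addr_ge0 ?hval_ge0// /hval.
    rewrite (haar_coefB heta j _ (gB n) hF (dB n) (fun _ _ => erefl)) -mulrDr ler_wpM2l ?exprz_ge0//.
    by apply: le_trans (normc_triangle _ _); rewrite -mulrDr subrK.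
  apply: le_trans mg _; rewrite EFinD; apply: leeD.
    by apply: le_trans (sm n j j1) _; rewrite lee_fin scale_le1.
  by rewrite -bE; exact: nrm_val_le_B.
pose K := C1 * 4.
have K0 : 0 < K by rewrite mulr_gt0.
(* Written as a linear combination, the form in which stability of the
   Sobolev space under differences is available. *)
pose D n : functional R := fun phi => -1 * g n phi + g n.+1 phi.
have DW n : W1 p (D n) by have [_ lin] := W1_lin heta p1; apply: lin; [exact: (hg n).1|exact: (hg n.+1).1].
have Dbd n : (W1norm p (D n) <= (K * scale n)%:E)%E.
  have [U' [G' w']] := W1_rep heta p1 (DW n).
  apply: le_trans (W1_le_B heta p1 w') _; rewrite /K -mulrA EFinM lee_wpmul2l ?lee_fin ?(ltW C10)//.
  (* The factor 2 is the one of B_le. *)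
  rewrite (_ : 4 * scale n = 2 * (scale n + scale n)); last by ring.
  rewrite EFinM; apply: (B_le p1) => j j1.
  apply: le_trans (nrm_hval_tri j (dB n.+1) (dB n) (W1_refB (DW n)) _) _.
    by move=> phi _; rewrite /D /=; ring.
  rewrite EFinD; apply: leeD; last exact: sm.
  by apply: le_trans (sm n.+1 j j1) _; rewrite lee_fin scaleS ler_pdivrMr// ler_peMr ?ler1n// ltW// scale_gt0.
pose U n := (UG n).1; pose G n := (UG n).2.
have LU n : cLw (U n) := W1rep_U (w n).
have LG n : cLw (G n) := W1rep_G (w n).
have diff (f : nat -> R -> R[i]) (T : functional R) n : (forall n, cLw (f n)) -> (forall n, Lpnorm p (f n) < +oo)%E ->
    T = dist_of_fun (fun x => -1 * f n x + f n.+1 x) -> (dist_Lpnorm p T <= (K * scale n)%:E)%E ->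
    (nrm p (fun x => reF (f n.+1) x - reF (f n) x)%R <= (K * scale n)%:E)%E /\
    (nrm p (fun x => imF (f n.+1) x - imF (f n) x)%R <= (K * scale n)%:E)%E.
  move=> Lf ff -> hT.
  have md : cmeasurable (fun x => -1 * f n x + f n.+1 x) by apply: cmeasD; [apply: cmeasZ|]; exact: cLw_meas.
  have fd : (Lpnorm p (fun x => -1 * f n x + f n.+1 x)%R < +oo)%E.
    apply: le_lt_trans (LpnormD p1 (cmeasZ _ (cLw_meas (Lf n))) (cLw_meas (Lf n.+1))) _.
    apply: lte_add_pinfty; last exact: ff.
    apply: le_lt_trans (LpnormZ p1 _ (cLw_meas (Lf n)) (ff n)) _.
    by apply: lte_mul_pinfty; [rewrite lee_fin cmod_ge0|by []|exact: ff].
  rewrite (dist_Lpnorm_fun heta p1 md fd) in hT; split.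
    apply: le_trans hT; apply: le_trans (Re_nrm p1 md); rewrite le_eqVlt; apply/orP; left; apply/eqP.
    by congr (nrm p); apply/funext => x; rewrite /reF mulN1r [- f n x + _]addrC cReB.
  apply: le_trans hT; apply: le_trans (Im_nrm p1 md); rewrite le_eqVlt; apply/orP; left; apply/eqP.
  by congr (nrm p); apply/funext => x; rewrite /imF mulN1r [- f n x + _]addrC cImB.
have DU n : D n = dist_of_fun (fun x => -1 * U n x + U n.+1 x).
  by rewrite -(dist_of_fun_lin _ (LU n) (LU n.+1)) /D (W1rep_FU (w n)) (W1rep_FU (w n.+1)).
have DG n : dist_deriv (D n) = dist_of_fun (fun x => -1 * G n x + G n.+1 x).
  rewrite -(dist_of_fun_lin _ (LG n) (LG n.+1)) -(W1rep_FG (w n)) -(W1rep_FG (w n.+1)).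
  by apply: dist_deriv_lin; [exact: (hg n).1.1|exact: (hg n.+1).1.1].
have dU n : (dist_Lpnorm p (D n) <= (K * scale n)%:E)%E.
  by apply: le_trans (Dbd n); rewrite /W1norm leeDl// dist_Lpnorm_ge0.
have dG n : (dist_Lpnorm p (dist_deriv (D n)) <= (K * scale n)%:E)%E.
  by apply: le_trans (Dbd n); rewrite /W1norm leeDr// dist_Lpnorm_ge0.
have eU n := diff U (D n) n LU (fun n => W1rep_finU (w n)) (DU n) (dU n).
have eG n := diff G (dist_deriv (D n)) n LG (fun n => W1rep_finG (w n)) (DG n) (dG n).
pose B0 := C1 * (2 * (1 + b)).
have bU n : (Lpnorm p (U n) <= B0%:E)%E.
  by apply: le_trans (gbd n); rewrite (W1normE (w n)) leeDl// Lpnorm_ge0.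
have bG n : (Lpnorm p (G n) <= B0%:E)%E.
  by apply: le_trans (gbd n); rewrite (W1normE (w n)) leeDr// Lpnorm_ge0.
have [ur [Lur nur wur iur]] := limit_function p1 K0 (fun n => (LU n).1.1)
  (fun n => le_trans (Re_nrm p1 (cLw_meas (LU n))) (bU n)) (fun n => (eU n).1).
have [ui [Lui nui wui iui]] := limit_function p1 K0 (fun n => (LU n).2.1)
  (fun n => le_trans (Im_nrm p1 (cLw_meas (LU n))) (bU n)) (fun n => (eU n).2).
have [gr [Lgr ngr wgr _]] := limit_function p1 K0 (fun n => (LG n).1.1)
  (fun n => le_trans (Re_nrm p1 (cLw_meas (LG n))) (bG n)) (fun n => (eG n).1).
have [gi [Lgi ngi wgi _]] := limit_function p1 K0 (fun n => (LG n).2.1)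
  (fun n => le_trans (Im_nrm p1 (cLw_meas (LG n))) (bG n)) (fun n => (eG n).2).
pose U' x := ur x +i* ui x; pose G' x := gr x +i* gi x.
have LU' : cLw U' by split.
have LG' : cLw G' by split.
pose F' : functional R := dist_of_fun U'.
have fin (f : R -> R[i]) : cLw f -> (nrm p (reF f) <= B0%:E)%E -> (nrm p (imF f) <= B0%:E)%E ->
    (dist_Lpnorm p (dist_of_fun f) < +oo)%E.
  move=> Lf h1 h2; have mf := cLw_meas Lf.
  apply: le_lt_trans (dist_Lpnorm_le _ mf) _; apply: le_lt_trans (Lpnorm_reim p1 mf) _.
  by apply: le_lt_trans (leeD h1 h2) _; rewrite -EFinD ltry.
have dF' : dist_deriv F' = dist_of_fun G'.
  apply: on_schwartz_eq => phi sp.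
  have sp' := schwartz_cderiv 1 sp.
  have [c1 c2] := dist_cvg LU LU' wur wui sp'.
  have [c3 c4] := dist_cvg LG LG' wgr wgi sp.
  have e n : dist_of_fun (G n) phi = - dist_of_fun (U n) (cderiv 1 phi).
    by rewrite -(W1rep_FG (w n)) -(W1rep_FU (w n)) /dist_deriv (on_schwartzE _ sp).
  rewrite -/(cint _) -(dist_of_funE _ sp).
  apply: ceq_reim.
    rewrite cReN; apply: (cvgR_unique _ c3).
    rewrite (_ : (fun n => _) = (fun n => - complex.Re (dist_of_fun (U n) (cderiv 1 phi)))); first exact: cvgN.
    by apply/funext => n; rewrite e cReN.
  rewrite cImN; apply: (cvgR_unique _ c4).
  rewrite (_ : (fun n => _) = (fun n => - complex.Im (dist_of_fun (U n) (cderiv 1 phi)))); first exact: cvgN.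
  by apply/funext => n; rewrite e cImN.
have W' : W1 p F'.
  split; first exact: cLw_tempered.
  split; first exact: fin.
  by rewrite dF'; exact: fin.
have hF' := W1_refB W'.
(* It remains to compare the Haar coefficients of the two limits. *)
suff -> : F = F' by [].
have hH := refB_sub heta hF hF'.
suff H0 : (fun phi => F phi - F' phi) = (fun=> 0).
  by apply/funext => phi; apply: subr0_eq; have := congr1 (fun T => T phi) H0.
apply: (haar_unique heta hH) => j m j1.
rewrite (haar_coefB heta j m hF hF' hH (fun _ _ => erefl)); apply/eqP; rewrite subr_eq0; apply/eqP.
have pairc i k : (complex.Re (pair_indic eta (g n) (dyadic_interval i k)) @[n --> \oo] -->
      complex.Re (pair_indic eta F' (dyadic_interval i k))) /\
    (complex.Im (pair_indic eta (g n) (dyadic_interval i k)) @[n --> \oo] -->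
      complex.Im (pair_indic eta F' (dyadic_interval i k))).
  have [a1 [b1 [ab ->]]] := @dyadic_half_open R i k.
  rewrite (pair_indic_fun heta LU' hF' ab); split.
    rewrite (_ : (fun n => _) = (fun n => iI (reF (U n)) a1 b1)); first exact: iur.
    by apply/funext => n; rewrite (W1rep_pair heta p1 (w n) ab).
  rewrite (_ : (fun n => _) = (fun n => iI (imF (U n)) a1 b1)); first exact: iui.
  by apply/funext => n; rewrite (W1rep_pair heta p1 (w n) ab).
have haarc : (complex.Re (haar_coef eta (g n) j m) @[n --> \oo] --> complex.Re (haar_coef eta F' j m)) /\
    (complex.Im (haar_coef eta (g n) j m) @[n --> \oo] --> complex.Im (haar_coef eta F' j m)).
  rewrite /haar_coef; case: (0 <= j); last by exact: (pairc j m).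
  exact: (reim_cvgB (pairc _ _) (pairc _ _)).
have [k k0 hk] := haar_coef_bound m j1.
have small n : cmod (haar_coef eta (g n) j m - haar_coef eta F j m) <= k^-1 * scale n.
  rewrite ler_pdivlMl// -(haar_coefB heta j m (gB n) hF (dB n) (fun _ _ => erefl)).
  by apply: hk; exact: sm.
have ks0 : k^-1 * scale n @[n --> \oo] --> (0 : R).
  by rewrite -[X in _ --> X](mulr0 k^-1); apply: cvgMr; exact: scale_cvg0.
apply: ceq_reim.
  apply: (cvgR_unique _ haarc.1); apply/subr_cvg0; apply: (cvg_squeeze0 _ ks0) => n.
  by rewrite -cReB; exact: le_trans (Re_le_cmod _) (small n).
apply: (cvgR_unique _ haarc.2); apply/subr_cvg0; apply: (cvg_squeeze0 _ ks0) => n.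
by rewrite -cImB; exact: le_trans (Im_le_cmod _) (small n).
Qed.

End Closedness.

Theorem theorem1p8 (R : realType) (p : \bar R) (hp : (1 < p)%E) :
  [/\ exists2 C : R, 0 < C &
        forall eta : R -> R[i], lp_cutoff eta ->
        forall f : functional R, W1 p f ->
          (W1norm p f <= C%:E * Bdyad_norm eta p f)%E,
      forall eta : R -> R[i], lp_cutoff eta ->
        proper_closed_subspace (Bdyad_norm eta p) (Bdyad eta p) (W1 p) &
      (p < +oo)%E ->
        exists2 C : R, 0 < C &
          forall eta : R -> R[i], lp_cutoff eta ->
          forall f : functional R, W1 p f ->
            comparable_upto C (W1norm p f) (Bdyad_norm eta p f) /\
            comparable_upto C (Bdyad_norm eta p f) (Fdyad_norm eta p f)].
Proof.
have M0 := @Cmax_ge0 R p.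
pose C1 := 16 + 16 * Cmax p.
have C10 : 0 < C1 by rewrite ltr_pwDl// mulr_ge0.
have W0 (f : functional R) : (0 <= W1norm p f)%E by rewrite adde_ge0 ?dist_Lpnorm_ge0.
have BW eta : lp_cutoff eta -> forall f : functional R, W1 p f -> (Bdyad_norm eta p f <= (4 * Cmax p)%:E * W1norm p f)%E.
  by move=> he f hf; have [U [G w]] := W1_rep he hp hf; exact: (B_le_W1 he hp w).
have WB eta : lp_cutoff eta -> forall f : functional R, W1 p f -> (W1norm p f <= C1%:E * Bdyad_norm eta p f)%E.
  by move=> he f hf; have [U [G w]] := W1_rep he hp hf; exact: (W1_le_B he hp w).
clearbody C1; split.
- by exists C1 => // eta he f hf; exact: WB.
- move=> eta he; split; [exact: (W1_lin he hp)| |exact: (W1_closed he hp)].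
  split; last first.
    by move=> /(_ (F01 : functional R) (F01_Bdyad he hp)); exact: (F01_notin he hp).
  move=> f hf; split; first exact: (W1_refB he hp hf).
  apply: le_lt_trans (BW _ he _ hf) _.
  apply: lte_mul_pinfty; [by rewrite lee_fin mulr_ge0|by []|].
  by case: hf => _ [? ?]; exact: lte_add_pinfty.
- move=> poo; exists (C1 + 4 * Cmax p + 2 + 2 * Cmax p * C1).
    have MC : 0 <= 2 * Cmax p * C1 by rewrite !mulr_ge0// ltW.
    by lra.
  move=> eta he f hf; have [U [G w]] := W1_rep he hp hf.
  have B0 := Bdyad_norm_ge0 eta hp f.
  have F0 : (0 <= Fdyad_norm eta p f)%E by exact: Lnorm_ge0.
  have MC : 0 <= 2 * Cmax p * C1 by rewrite !mulr_ge0// ltW.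
  have up (c C : R) (x y : \bar R) : (0 <= y)%E -> c <= C -> (x <= c%:E * y)%E -> (x <= C%:E * y)%E.
    by move=> y0 cC h; apply: le_trans h _; rewrite lee_wpmul2r// lee_fin.
  split; split.
  + by apply: up B0 _ (WB _ he _ hf); lra.
  + by apply: up (W0 f) _ (BW _ he _ hf); lra.
  + by apply: up F0 _ (B_le_F eta hp _ poo); lra.
  apply: (up (2 * Cmax p * C1) _ _ _ B0); first by lra.
  apply: le_trans (F_le_W1 he hp w) _.
  rewrite [in leRHS]EFinM -muleA; apply: lee_wpmul2l; first by rewrite lee_fin mulr_ge0.
  exact: WB.
Qed.
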